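(* Let $(X,X_* )$ be a dual pairing and let ${\bf T}=(T(t))_{t>0}\subset\mathcal B_w(X)$ be a semigroup which is weakly continuous with respect to $(X,X_* )$. (i) Let $u\in\mathcal I_{\bf T}$. If $\lim_{t\to0^+}\left\|\frac{T(t)u-u}{t}-v\right\|=0$ for some $v\in\mathcal U_{\bf T}$, then $u$ belongs to the domain $\mathcal D_{A_{{\bf T},\mathcal I_{\bf T}}}$ of $A_{{\bf T},\mathcal I_{\bf T}}$, and $A_{{\bf T},\mathcal I_{\bf T}}u=v$. (ii) Let $u\in\mathcal J_{\bf T}$. Then $u$ belongs to the domain $\mathcal D_{A_{{\bf T},\mathcal J_{\bf T}}}$ of $A_{{\bf T},\mathcal J_{\bf T}}$ if, and only if, there exists $v\in\mathcal J_{\bf T}$ such that $\lim_{t\to0^+}\left\|\frac{T(t)u-u}{t}-v\right\|_{\mathcal J_{\bf T}}=0$, and in this situation $A_{{\bf T},\mathcal J_{\bf T}}u=v$.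
   Context: Dual pairing $(X,X_* )$: $X$ is a Banach space, $X_*$ a linear subspace of the dual $X'$ such that (1) $\|x\|=\sup\{|\langle x,l\rangle| : l\in X_*,\|l\|\le1\}$ for all $x\in X$; (2) the $\sigma(X,X_* )$-closed convex hull of every $\sigma(X,X_* )$-compact subset of $X$ is $\sigma(X,X_* )$-compact. $\mathcal B_w(X)$ is the set of $R\in\mathcal B(X)$ with $l\circ R\in X_*$ for all $l\in X_*$. A semigroup ${\bf T}=(T(t))_{t>0}\subset\mathcal B_w(X)$ ($T(s+t)=T(s)T(t)$) is weakly continuous with respect to $(X,X_* )$ if $t\mapsto\langle T(t)x,l\rangle$ is continuous on $(0,+\infty)$ for all $x\in X,l\in X_*$. $\omega_{\bf T}(t)=\|T(t)\|$, $\rho_{\bf T}=\lim_{t\to+\infty}\|T(t)\|^{1/t}$ (with $\log 0=-\infty$). For a lower semicontinuous submultiplicative weight $\omega$ on $(0,+\infty)$, $L^1_\omega$ is the convolution algebra of measurable $f$ on $(0,+\infty)$ with $\int|f|\omega\,dt<+\infty$. For $f\in L^1_{\omega_{\bf T}}$, $\phi_{\bf T}(f)\in\mathcal B(X)$ is determined by $\langle\phi_{\bf T}(f)x,l\rangle=\int_0^{+\infty}f(t)\langle T(t)x,l\rangle dt$. $X_1$ is the norm closure of $\bigcup_{t>0}T(t)(X)$; $\phi_{\bf T}(f)$ is regarded as an element of $\mathcal B(X_1)$. The Arveson ideal $\mathcal I_{\bf T}$ is the closure of $\phi_{\bf T}(L^1_{\omega_{\bf T}})$ in $\mathcal B(X_1)$,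 with the operator norm $\|\cdot\|$; $T(t)$ acts on it by multiplication. For a commutative Banach algebra $\mathcal U$: $\Omega(\mathcal U)=\{u : u\,\mathcal U\text{ dense in }\mathcal U\}$; $\mathcal M(\mathcal U)$ is the multiplier algebra (bounded linear $S$ with $S(uv)=(Su)v$) with operator norm. If $\Omega(\mathcal U)\ne\emptyset$ and $u\,\mathcal U\ne\{0\}$ for $u\ne0$, a quasimultiplier is a partially defined operator $S_{u/v}=u/v$ ($u\in\mathcal U,v\in\Omega(\mathcal U)$) with domain $\{x\in\mathcal U : ux\in v\,\mathcal U\}$, $S_{u/v}x$ being the unique $y\in\mathcal U$ with $ux=vy$. With $T(0)u=u$, fix $\lambda>\log\rho_{\bf T}$; $\mathcal L_{\bf T}=\{u\in\mathcal I_{\bf T} : \limsup_{t\to0^+}\|T(t)u\|<+\infty\}$ is a Banach algebra for $\|u\|_\lambda=\sup_{s\ge0}e^{-\lambda s}\|T(s)u\|$; $\mathcal U_{\bf T}$ is the closure of $\bigcup_{t>0}T(t)\mathcal I_{\bf T}$ in it; the normalized Arveson ideal $\mathcal J_{\bf T}$ is the closure of $\mathcal I_{\bf T}$ (acting by multiplication on $\mathcal U_{\bf T}$) in $\mathcal M(\mathcal U_{\bf T})$, and $\|\cdot\|_{\mathcal J_{\bf T}}$ is that operator norm. Restriction to $\mathcal U_{\bf T}$ identifies $\mathcal M(\mathcal J_{\bf T})$ with $\mathcal M(\mathcal U_{\bf T})$, so $T(t)\in\mathcal M(\mathcal J_{\bf T})$. $\tilde\omega_{\bf T}(t)=\|T(t)\|_{\mathcal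 M(\mathcal J_{\bf T})}$, and for $f\in L^1_{\tilde\omega_{\bf T}}$, $\tilde\phi_{\bf T}(f)u=\int_0^{+\infty}f(t)T(t)u\,dt$ ($u\in\mathcal J_{\bf T}$). Generators: $A_{{\bf T},\mathcal I_{\bf T}}=-\phi_{\bf T}(f_0')/\phi_{\bf T}(f_0)\in\mathcal{QM}(\mathcal I_{\bf T})$ (quasimultipliers on $\mathcal I_{\bf T}$) for any $f_0\in\mathcal C^1([0,+\infty))\cap\Omega(L^1_{\omega_{\bf T}})$ with $f_0(0)=0$, $f_0'\in L^1_{\omega_{\bf T}}$; $A_{{\bf T},\mathcal J_{\bf T}}=-\tilde\phi_{\bf T}(g_0')/\tilde\phi_{\bf T}(g_0)\in\mathcal{QM}(\mathcal J_{\bf T})$ for any $g_0\in\mathcal C^1([0,+\infty))\cap\Omega(L^1_{\tilde\omega_{\bf T}})$ with $g_0(0)=0$, $g_0'\in L^1_{\tilde\omega_{\bf T}}$ (neither depends on the choice). *)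

(* Defs.v *)
From HB Require Import structures.
From mathcomp Require Import all_boot all_order all_algebra.
From mathcomp Require Import all_classical all_reals all_analysis.
From mathcomp Require Import complex.

Set Implicit Arguments.
Unset Strict Implicit.
Unset Printing Implicit Defensive.

Import Order.TTheory GRing.Theory Num.Theory.
Import numFieldNormedType.Exports.

Local Open Scope classical_set_scope.
Local Open Scope complex_scope.
Local Open Scope ring_scope.

(* Banach spaces are complex.  All norms below take values in the realType R,
   whereas the library norm of a normedModType R[i] takes values in R[i]. *)
Definition cabs (R : realType) (z : R[i]) : R := complex.Re `|z|.

(* Normed spaces and algebras are given as a subset [car] of an ambient
   lmodType, with a norm (for L^1: a seminorm) and a product that are only
   meaningful on [car]. *)
Record nspace (R : realType) : Type := NSpace {
  amb : lmodType R[i];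
  car : set amb;
  nrm : amb -> R }.

Record nalg (R : realType) : Type := NAlg {
  sp :> nspace R;
  mul : amb sp -> amb sp -> amb sp }.

Definition subnalg (R : realType) (A : nalg R) (C : set (amb A)) : nalg R :=
  @NAlg R (@NSpace R (amb A) C (@nrm R A)) (@mul R A).

Definition nclosure (R : realType) (E : nspace R) (P : set (amb E)) :
    set (amb E) :=
  [set x | car x /\
    forall e : R, 0 < e -> exists2 a, P a & nrm (x - a) < e].

Definition opnorm (R : realType) (E F : nspace R) (S : amb E -> amb F) : R :=
  sup [set nrm (S x) | x in [set x | car x /\ nrm x <= 1]].

(* An operator on [car] is represented by its extension by 0 to the ambient
   space, so that equality of functions is equality of operators. *)
Definition restr (R : realType) (E : nspace R) (S : amb E -> amb E) :
    amb E -> amb E :=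
  fun x => if `[< car x >] then S x else 0.

Definition bounded_op (R : realType) (E : nspace R) (S : amb E -> amb E) :
    Prop :=
  [/\ forall x, car x -> car (S x),
      forall a x y, car x -> car y -> S (a *: x + y) = a *: S x + S y,
      exists M : R, forall x, car x -> nrm (S x) <= M * nrm x
    & forall x, ~ car x -> S x = 0].

Definition Bop (R : realType) (E : nspace R) : nalg R :=
  @NAlg R (@NSpace R (amb E -> amb E : lmodType R[i])
             [set S | bounded_op S] (@opnorm R E E))
    (fun S1 S2 => S1 \o S2).

Definition Mult (R : realType) (U : nalg R) : nalg R :=
  @subnalg R (Bop U)
    [set S | bounded_op S /\
       forall u v, car u -> car v -> S (mul u v) = mul (S u) v].

Definition lmult (R : realType) (U : nalg R) (u : amb U) : amb U -> amb U :=
  restr (mul u).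

Definition Omega (R : realType) (U : nalg R) : set (amb U) :=
  [set u | car u /\
    forall h, car h -> forall e : R, 0 < e ->
      exists2 w, car w & nrm (h - mul u w) < e].

(* The quasimultiplier u/v, for v in [Omega U]: its domain and its values. *)
Definition qm_dom (R : realType) (U : nalg R) (u v : amb U) : set (amb U) :=
  [set x | car x /\ exists2 y, car y & mul u x = mul v y].

Definition qm_val (R : realType) (U : nalg R) (u v x : amb U) : amb U :=
  xget 0 [set y | car y /\ mul u x = mul v y].

Notation halfline R := (`]0%R, +oo[%classic : set R).

Definition cintegral (R : realType) (D : set R) (f : R -> R[i]) : R[i] :=
  (\int[lebesgue_measure]_(t in D) complex.Re (f t)) +i*
  (\int[lebesgue_measure]_(t in D) complex.Im (f t)).

Definition conv (R : realType) (f g : R -> R[i]) (t : R) : R[i] :=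
  cintegral `]0, t[%classic (fun s => f s * g (t - s)).

(* Functions are not identified when they agree almost everywhere. *)
Definition L1 (R : realType) (w : R -> R) : nalg R :=
  @NAlg R
    (@NSpace R (R -> R[i]^o : lmodType R[i])
      [set f | [/\ measurable_fun (halfline R) (fun t => complex.Re (f t)),
                   measurable_fun (halfline R) (fun t => complex.Im (f t))
                 & (\int[lebesgue_measure]_(t in halfline R)
                      (cabs (f t) * w t)%:E < +oo)%E]]
      (fun f => \int[lebesgue_measure]_(t in halfline R) (cabs (f t) * w t)))
    (@conv R).

Definition C1_halfline (R : realType) (f f' : R -> R[i]^o) : Prop :=
  (forall t : R, 0 <= t ->
     (fun h : R => (h^-1)%:C *: (f (t + h) - f t))
       @ within [set h | 0 <= t + h] 0^' --> f' t) /\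
  {within `[0, +oo[%classic, continuous f'}.

(* The functions f0 with derivative f0' that define the generators. *)
Definition generating (R : realType) (w : R -> R) (f0 f0' : R -> R[i]^o) :
    Prop :=
  [/\ C1_halfline f0 f0', @Omega R (L1 w) f0, f0 0 = 0 & @car R (L1 w) f0'].

(* Simple functions are finite sums of functions c \1_A, encoded as lists of
   pairs (A, c); [is_bochner g y] says that g is Bochner integrable on the
   half-line, with integral y. *)
Definition simple_val (R : realType) (V : lmodType R[i])
    (s : seq (set R * V)) (t : R) : V :=
  \sum_(p <- s | t \in p.1) p.2.

Definition simple_int (R : realType) (V : lmodType R[i])
    (s : seq (set R * V)) : V :=
  \sum_(p <- s) (fine (lebesgue_measure p.1))%:C *: p.2.

Definition is_simple (R : realType) (E : nspace R)
    (s : seq (set R * amb E)) : Prop :=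
  forall i, (i < size s)%N ->
    let p := nth (set0, 0) s i in
    [/\ measurable p.1, p.1 `<=` halfline R,
        (lebesgue_measure p.1 < +oo)%E & car p.2].

Definition is_bochner (R : realType) (E : nspace R) (g : R -> amb E)
    (y : amb E) : Prop :=
  car y /\ exists s : nat -> seq (set R * amb E),
    [/\ forall n, is_simple (s n),
        forall n, measurable_fun (halfline R)
          (fun t => nrm (g t - simple_val (s n) t)),
        (\int[lebesgue_measure]_(t in halfline R)
            (nrm (g t - simple_val (s n) t))%:E)%E @[n --> \oo] --> 0%E
      & nrm (simple_int (s n) - y) @[n --> \oo] --> (0 : R)].

Definition banach (R : realType) (X : completeNormedModType R[i]) : nspace R :=
  @NSpace R X setT (fun x => complex.Re `|x|).

Definition scalars (R : realType) : nspace R :=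
  @NSpace R R[i]^o setT (@cabs R).

Definition sigma_top (R : realType) (X : completeNormedModType R[i])
    (Xs : set (X -> R[i]^o)) : topologicalType :=
  initial_topology (fun x : X =>
    (fun l => sval l x) : prod_topology (fun _ : {l | Xs l} => R[i]^o)).

Definition dual_pairing (R : realType) (X : completeNormedModType R[i])
    (Xs : set (X -> R[i]^o)) : Prop :=
  [/\ forall l, Xs l -> linear l /\ continuous l,
      Xs 0 /\ (forall a l m, Xs l -> Xs m -> Xs (a *: l + m)),
      forall x : X, complex.Re `|x| =
        sup [set cabs (l x) | l in
               [set l | Xs l /\ @opnorm R (banach X) (scalars R) l <= 1]]
    & forall A : set (sigma_top Xs), compact A ->
        compact (smallest
          [set C : set (sigma_top Xs) | closed C /\ @convex_set _ X C] A)].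

Section semigroup.
Context (R : realType) (X : completeNormedModType R[i]).
Context (Xs : set (X -> R[i]^o)).

(* Only the values T t for t > 0 are relevant. *)
Definition weakly_continuous_semigroup (T : R -> X -> X) : Prop :=
  [/\ forall t, 0 < t -> [/\ linear (T t), continuous (T t)
                           & forall l, Xs l -> Xs (l \o T t)],
      forall s t, 0 < s -> 0 < t -> T (s + t) = T s \o T t
    & forall x l, Xs l ->
        {within halfline R, continuous (fun t => l (T t x))}].

Context (T : R -> X -> X).

Definition omegaT (t : R) : R := @opnorm R (banach X) (banach X) (T t).

Definition rhoT : R := lim (omegaT t `^ t^-1 @[t --> +oo]).

Definition phiX (f : R -> R[i]) (x : X) : X :=
  xget 0 [set y | forall l, Xs l ->
    l y = cintegral (halfline R) (fun t => f t * l (T t x))].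

Definition X1 : nspace R :=
  @NSpace R X (closure (\bigcup_(t in halfline R) range (T t)))
    (fun x => complex.Re `|x|).

Definition phiI (f : R -> R[i]) : X -> X := @restr R X1 (phiX f).

Definition Arveson : nalg R :=
  @subnalg R (Bop X1)
    (@nclosure R (Bop X1) [set phiI f | f in @car R (L1 omegaT)]).

Definition actI (t : R) (u : X -> X) : X -> X :=
  if t == 0 then u else T t \o u.

Definition LT (lambda : R) : nalg R :=
  @NAlg R
    (@NSpace R (amb Arveson)
      [set u | @car R Arveson u /\
        (limf_esup (fun t : R => (@nrm R Arveson (actI t u))%:E) 0^'+ < +oo)%E]
      (fun u => sup [set expR (- lambda * s) * @nrm R Arveson (actI s u)
                       | s in [set s | 0 <= s]]))
    (@mul R Arveson).

Definition UT (lambda : R) : nalg R :=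
  @subnalg R (LT lambda)
    (@nclosure R (LT lambda)
      (\bigcup_(t in halfline R) [set actI t u | u in @car R Arveson])).

Definition JT (lambda : R) : nalg R :=
  @subnalg R (Mult (UT lambda))
    (@nclosure R (Mult (UT lambda))
      [set @lmult R (UT lambda) u | u in @car R Arveson]).

(* The action on JT of T t, the multiplier of UT given by w |-> T t \o w. *)
Definition actJ (t : R) (u : (X -> X) -> X -> X) : (X -> X) -> X -> X :=
  fun w => actI t (u w).

Definition omegaJ (lambda t : R) : R :=
  @opnorm R (JT lambda) (JT lambda) (actJ t).

(* The element of JT that acts on JT as u |-> \int_0^oo f(t) T(t) u dt. *)
Definition phiJ (lambda : R) (f : R -> R[i]) : amb (JT lambda) :=
  xget 0 [set j | @car R (JT lambda) j /\
    forall u, @car R (JT lambda) u ->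
      @is_bochner R (JT lambda) (fun t => f t *: actJ t u)
        (@mul R (JT lambda) j u)].

Arguments phiJ : clear implicits.

Definition genI_dom (f0 f0' : R -> R[i]) : set (amb Arveson) :=
  @qm_dom R Arveson (- phiI f0') (phiI f0).

Definition genI_val (f0 f0' : R -> R[i]) (u : amb Arveson) : amb Arveson :=
  @qm_val R Arveson (- phiI f0') (phiI f0) u.

Definition genJ_dom (lambda : R) (g0 g0' : R -> R[i]) :
    set (amb (JT lambda)) :=
  @qm_dom R (JT lambda) (- phiJ lambda g0') (phiJ lambda g0).

Definition genJ_val (lambda : R) (g0 g0' : R -> R[i])
    (u : amb (JT lambda)) : amb (JT lambda) :=
  @qm_val R (JT lambda) (- phiJ lambda g0') (phiJ lambda g0) u.

Definition limI (u v : amb Arveson) : Prop :=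
  @nrm R Arveson ((t^-1)%:C *: (actI t u - u) - v) @[t --> 0^'+] --> (0 : R).

Definition limJ (lambda : R) (u v : amb (JT lambda)) : Prop :=
  @nrm R (JT lambda) ((t^-1)%:C *: (actJ t u - u) - v) @[t --> 0^'+]
    --> (0 : R).

End semigroup.

Arguments phiI {R X} Xs T f.
Arguments phiJ {R X} Xs T lambda f.
Arguments genI_dom {R X} Xs T f0 f0'.
Arguments genI_val {R X} Xs T f0 f0' u.
Arguments genJ_dom {R X} Xs T lambda g0 g0'.
Arguments genJ_val {R X} Xs T lambda g0 g0' u.
Arguments limI {R X} Xs T u v.
Arguments limJ {R X} Xs T lambda u v.

(* Main.v *)
(* An operator phi(f) is tested on the scalar orbits F(t) = <T(t) u x, l>.
   If (T(t)u - u)/t -> v as t -> 0, then F has derivative G(t) = <T(t) v x, l>,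
   and integrating (f0 F)' over the half-line yields phi(f0) v = - phi(f0') u,
   since f0(0) = 0 and F is bounded near 0.  Such a v is unique: if
   phi(f0) y = 0, the density of f0 * L1 in L1 forces all the scalar orbits of
   y to vanish.

   For the converse in (ii), let Q_h be the average of T over ]0, h[.  Then
   Q_h u has derivative (T(h)u - u)/h, so phi(g0) v = - phi(g0') u gives
   phi(g0) ((T(h)u - u)/h) = - Q_h phi(g0') u = phi(g0) (Q_h v), whence
   (T(h)u - u)/h = Q_h v -> v as h -> 0. *)

Require Import Defs.
From mathcomp Require Import all_boot all_order all_algebra.
From mathcomp Require Import all_classical all_reals all_analysis.
From mathcomp Require Import measurable_realfun.
From mathcomp Require Import complex.
From mathcomp Require Import ring lra.

Set Implicit Arguments.
Unset Strict Implicit.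
Unset Printing Implicit Defensive.

Import Order.TTheory GRing.Theory Num.Theory.
Import numFieldNormedType.Exports.

Local Open Scope classical_set_scope.
Local Open Scope complex_scope.
Local Open Scope ring_scope.

(** * The complex modulus *)

(** Orbits t |-> T(t)x are only weakly continuous and may be unbounded near 0, which shapes the
    whole proof. The integral defining phi(f)x is not a norm integral: it comes from compactness of
    closed convex hulls in the weak topology of the pairing, then from truncation and completeness.
    The norm of T(t) is lower semicontinuous, hence a measurable submultiplicative weight; such a
    weight is automatically bounded on compact subsets of ]0, oo[ and, because of the choice of
    lambda, exponentially bounded away from 0. Norm continuity is recovered by density, from
    continuity of translation on a dense part of the weighted L1 space. Statement (ii) is proved for
    an abstract algebra of multipliers with a strongly continuous action, tested against a norming
    family of functionals; the normalized ideal is an instance, with functionals v |-> l(v x). There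
    the integrals are Bochner integrals by definition, but they are first built and estimated weakly
    and only then shown to be Bochner integrals. Identities are checked on real parts, since the
    families of functionals are stable under complex multiples. *)

Section complex_modulus.
Context {R : realType}.
Implicit Types (z w c : R[i]) (a b : R).

Lemma normE_cabs z : `|z| = (cabs z)%:C.
Proof. by case: z => a b; rewrite /cabs normc_def. Qed.

Lemma cabsE z : cabs z = Num.sqrt (complex.Re z ^+ 2 + complex.Im z ^+ 2).
Proof. by case: z => a b; rewrite /cabs normc_def. Qed.

Lemma cabs_ge0 z : 0 <= cabs z.
Proof. by rewrite cabsE sqrtr_ge0. Qed.

Lemma cabsM z w : cabs (z * w) = cabs z * cabs w.
Proof.
have := normrM z w; rewrite !normE_cabs.
by rewrite -rmorphM/= => -[->].
Qed.

Lemma cabsD z w : cabs (z + w) <= cabs z + cabs w.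
Proof.
by have := ler_normD z w; rewrite !normE_cabs -rmorphD/= lecR.
Qed.

Lemma cabsN z : cabs (- z) = cabs z.
Proof. by rewrite /cabs normrN. Qed.

Lemma cabs0 : cabs (0 : R[i]) = 0.
Proof. by rewrite /cabs normr0. Qed.

Lemma cabs0_eq0 z : cabs z = 0 -> z = 0.
Proof. by move=> z0; apply/normr0_eq0; rewrite normE_cabs z0. Qed.

Lemma cabs_real a : cabs a%:C = `|a|.
Proof. by rewrite cabsE/= expr0n addr0 sqrtr_sqr. Qed.

Lemma Re_le_cabs z : `|complex.Re z| <= cabs z.
Proof. by rewrite cabsE -sqrtr_sqr ler_wsqrtr// lerDl sqr_ge0. Qed.

Lemma Im_le_cabs z : `|complex.Im z| <= cabs z.
Proof. by rewrite cabsE -sqrtr_sqr ler_wsqrtr// lerDr sqr_ge0. Qed.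

Lemma cabs_le_ReIm z : cabs z <= `|complex.Re z| + `|complex.Im z|.
Proof.
case: z => a b; rewrite [X in cabs X](_ : _ = a%:C + 'i%C * b%:C); last first.
  by rewrite [LHS]complexE.
rewrite (le_trans (cabsD _ _))// cabsM !cabs_real//=.
by rewrite [cabs 'i%C]cabsE/= expr0n expr1n add0r sqrtr1 mul1r.
Qed.

(** An imaginary part is the real part of a rotated quantity; in this way identities proved for real
    parts against all functionals pass to complex values. *)
Lemma ReMi z : complex.Re (- 'i%C * z) = complex.Im z.
Proof. by case: z => a b /=; simpc. Qed.

Lemma ReM z w : complex.Re (z * w) =
  complex.Re z * complex.Re w - complex.Im z * complex.Im w.
Proof. by case: z w => [a b] [c d]. Qed.

Lemma ImM z w : complex.Im (z * w) =
  complex.Re z * complex.Im w + complex.Im z * complex.Re w.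
Proof. by case: z w => [a b] [c d]. Qed.

Lemma ReD z w : complex.Re (z + w) = complex.Re z + complex.Re w.
Proof. by case: z w => [a b] [c d]. Qed.

Lemma ImD z w : complex.Im (z + w) = complex.Im z + complex.Im w.
Proof. by case: z w => [a b] [c d]. Qed.

Lemma ReN z : complex.Re (- z) = - complex.Re z.
Proof. by case: z => [a b]. Qed.

Lemma ImN z : complex.Im (- z) = - complex.Im z.
Proof. by case: z => [a b]. Qed.

Lemma ReZ a z : complex.Re (a%:C * z) = a * complex.Re z.
Proof. by case: z => b c /=; rewrite mul0r subr0. Qed.

Lemma ImZ a z : complex.Im (a%:C * z) = a * complex.Im z.
Proof. by case: z => b c /=; rewrite mul0r addr0. Qed.

Lemma complex_eqP z w :
  complex.Re z = complex.Re w -> complex.Im z = complex.Im w -> z = w.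
Proof. by case: z w => [a b] [c d] /= -> ->. Qed.

(** The conjugate phase makes z real and nonnegative. A family of functionals stable under
    unimodular factors therefore sees norms through real parts alone. *)
Lemma cabs_rotate z : exists2 c, cabs c = 1 & complex.Re (c * z) = cabs z.
Proof.
have [->|z0] := eqVneq z 0.
  by exists 1; rewrite ?mulr0 ?cabs0// (_ : 1 = 1%:C)// cabs_real normr1.
exists (conjc z / `|z|).
  have cz : cabs z != 0 by apply: contra_neq z0; exact: cabs0_eq0.
  rewrite normE_cabs -fmorphV cabsM cabs_real normfV ger0_norm ?cabs_ge0//.
  by rewrite [cabs z^*]cabsE; case: z z0 cz => a b z0; rewrite cabsE/= sqrrN => cz; rewrite divff.
rewrite mulrAC [z^* * z]mulrC -normCK expr2 mulfK ?normr_eq0//.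
Qed.

End complex_modulus.

(** * Integration on the half-line, convolution *)

Section translation_invariance.
Context {R : realType}.
Local Notation mu := (@lebesgue_measure R).
Local Notation RM := (measurableTypeR R).
Local Open Scope ereal_scope.

Let measurable_addr (s : R) : measurable_fun [set: RM] ((fun x => x + s)%R : RM -> RM).
Proof. exact: measurable_funD. Qed.

(** Uniqueness of the Lebesgue measure: the image measure gives half-open intervals the same
    length. *)
Lemma lebesgue_measure_shift (s : R) (A : set RM) : measurable A ->
  mu A = pushforward mu ((fun x => x + s)%R : RM -> RM) A.
Proof.
have := measurable_addr s => /(isMeasurableFun.Build _ _ RM RM _) mf.
pose F : {mfun RM >-> RM} := MeasurableFun.Pack (MeasurableFun.Class mf).
apply: (@lebesgue_measure_unique R (pushforward mu F)) => //= _ [[a b]] _ <-.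
rewrite /pushforward (_ : _ @^-1` _ = `](a - s)%R, (b - s)%R]%classic).
  rewrite !lebesgue_measure_itv/= !lte_fin ltrD2r; case: ifPn => // _.
  by rewrite -!EFinD; congr EFin; lra.
by apply/seteqP; split => x /=; rewrite !in_itv/=; lra.
Qed.

Lemma ge0_integral_shift (f : RM -> \bar R) (s : R) :
  measurable_fun [set: RM] f -> (forall x, 0 <= f x) ->
  \int[mu]_x f (x + s)%R = \int[mu]_x f x.
Proof.
move=> mf f0.
have := @ge0_integral_pushforward _ _ RM RM R _ (measurable_addr s)
  (@lebesgue_measure R) setT f measurableT.
rewrite preimage_setT => <- //.
by apply: eq_measure_integral => //= A mA _; exact/esym/lebesgue_measure_shift.
Qed.

Lemma integral_shift (f : RM -> \bar R) (s : R) : measurable_fun [set: RM] f ->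
  \int[mu]_x f (x + s)%R = \int[mu]_x f x.
Proof.
move=> mf; rewrite integralE [RHS]integralE; congr (_ - _).
  have E := funepos_comp f (fun x : RM => (x + s)%R : RM).
rewrite [X in \int[_]_x X x = _]E.
  by apply: ge0_integral_shift => //; exact: measurable_funepos.
have E := funeneg_comp f (fun x : RM => (x + s)%R : RM).
rewrite [X in \int[_]_x X x = _]E.
by apply: ge0_integral_shift => //; exact: measurable_funeneg.
Qed.

End translation_invariance.

(** * Fubini's theorem in the sheared coordinates (s, t - s) *)

Section shear.
Context {R : realType}.
Local Notation mu := (@lebesgue_measure R).
Local Notation RM := (measurableTypeR R).
Local Notation iRint Q := (\int[mu]_t \int[mu]_s Q t s).
Context (P : RM -> RM -> R) (a b : RM -> R).
Hypothesis mP : measurable_fun [set: RM * RM] (fun p => P p.1 p.2).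
Hypothesis ia : mu.-integrable [set: RM] (EFin \o a).
Hypothesis ib : mu.-integrable [set: RM] (EFin \o b).
Hypothesis Pab : forall s r, `|P s r| <= a s * b r.

Local Open Scope ereal_scope.

Let ma : measurable_fun [set: RM] a.
Proof. by case/integrableP: ia => /measurable_EFinP. Qed.

Let mb : measurable_fun [set: RM] b.
Proof. by case/integrableP: ib => /measurable_EFinP. Qed.

Let mPs s : measurable_fun [set: RM] (P s).
Proof.
rewrite (_ : P s = (fun p : RM * RM => P p.1 p.2) \o (fun r : RM => (s, r)))//.
by apply: (measurableT_comp mP); exact: measurable_fun_pair.
Qed.

Let int_P_lty : \int[mu]_s \int[mu]_r `|(P s r)%:E| < +oo.
Proof.
apply: (@le_lt_trans _ _ (\int[mu]_s \int[mu]_r (`|a s|%:E * `|b r|%:E))).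
  apply: ge0_le_integral => //.
  - by move=> s _; exact: integral_ge0.
  - apply: (measurable_fun_fubini_tonelli_F (fun p => `|(P p.1 p.2)%:E|)) => //.
    by apply: measurableT_comp => //; exact/measurable_EFinP.
  - apply: (measurable_fun_fubini_tonelli_F (fun p => `|a p.1|%:E * `|b p.2|%:E)); last first.
      by move=> p; rewrite -EFinM lee_fin.
    by apply: emeasurable_funM; apply/measurable_EFinP; apply: measurableT_comp => //;
      apply: measurableT_comp.
  - move=> s _; apply: ge0_le_integral => //.
    + apply: measurableT_comp => //; apply/measurable_EFinP.
      exact: mPs.
    + apply: emeasurable_funM => //; apply/measurable_EFinP; exact: measurableT_comp.
    + move=> r _; rewrite -EFinM lee_fin -normrM.
      by apply: (le_trans (Pab s r)); exact: ler_norm.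
under eq_integral.
  move=> s _; rewrite ge0_integralZl//; last by apply/measurable_EFinP; exact: measurableT_comp.
  over.
rewrite /= ge0_integralZr//; last 2 first.
- by apply/measurable_EFinP; exact: measurableT_comp.
- exact: integral_ge0.
apply: lte_mul_pinfty.
- exact: integral_ge0.
- rewrite ge0_fin_numE; last exact: integral_ge0.
  by case/integrableP : ia.
- by case/integrableP : ib.
Qed.

Let iP : (mu \x mu).-integrable setT (fun p => (P p.1 p.2)%:E).
Proof. apply/integrable12ltyP; last exact: int_P_lty.
by apply/measurable_EFinP; exact: mP. Qed.

Let mQ : measurable_fun [set: RM * RM] (fun p => P p.2 (p.1 - p.2)%R).
Proof.
apply: (@measurableT_comp _ _ _ _ _ _ (fun p : RM * RM => P p.1 p.2) _ (fun p : RM * RM => (p.2, (p.1 - p.2)%R))) => //.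
by apply: measurable_fun_pair => //; exact: measurable_funB.
Qed.

(** For fixed s the variable t - s runs over a translate of the line, so the iterated integral of
    the modulus is that of [P], which is dominated by the product of [a] and [b]. *)
Lemma shear_integrable :
  (mu \x mu).-integrable setT (fun p => (P p.2 (p.1 - p.2)%R)%:E).
Proof.
apply/integrable21ltyP; first exact/measurable_EFinP.
apply: le_lt_trans int_P_lty; rewrite le_eqVlt; apply/predU1P; left.
apply: eq_integral => s _.
rewrite -[RHS](@ge0_integral_shift R (fun r => `|(P s r)%:E|) (- s)%R)//.
apply: measurableT_comp => //; apply/measurable_EFinP.
exact: mPs.
Qed.

(** The real-valued integral replaces an infinite inner integral by 0. Integrability on the product
    makes the inner integrals finite for almost every t, so both readings agree. *)
Lemma Rintegral_iterated (Q : RM -> RM -> R) :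
  (mu \x mu).-integrable setT (fun p => (Q p.1 p.2)%:E) ->
  (\int[mu]_t (\int[mu]_s Q t s))%R = fine (\int[mu]_t \int[mu]_s (Q t s)%:E).
Proof.
move=> iQ; congr fine; have mF := measurable_fubini_F iQ.
apply: ae_eq_integral => //.
  apply/measurable_EFinP; apply: measurableT_comp => //; exact: mF.
have := ae_integrable1 iQ; apply: filterS => t it _ /=.
by rewrite fineK//; exact: integrable_fin_num.
Qed.

Lemma shear_Fubini_l :
  (iRint (fun t s => P s (t - s)) = iRint P)%R.
Proof.
rewrite (Rintegral_iterated iP) (Rintegral_iterated shear_integrable).
congr fine; rewrite (Fubini shear_integrable)/=; apply: eq_integral => s _.
rewrite -[RHS](@integral_shift R (fun r => (P s r)%:E) (- s)%R)//.
apply/measurable_EFinP; exact: mPs.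
Qed.

Lemma shear_Fubini_r :
  (iRint P = iRint (fun r s => P s r))%R.
Proof.
rewrite (Rintegral_iterated iP) Rintegral_iterated; first by congr fine; rewrite (Fubini iP).
apply/integrable21ltyP; last exact: int_P_lty.
apply/measurable_EFinP.
apply: (@measurableT_comp _ _ _ _ _ _ (fun p : RM * RM => P p.1 p.2) _ (fun p : RM * RM => (p.2, p.1))) => //.
by apply: measurable_fun_pair.
Qed.

End shear.

Definition cmeasurable (R : realType) d (T : measurableType d) (A : set T)
    (f : T -> R[i]) :=
  measurable_fun A (fun t => complex.Re (f t)) /\
  measurable_fun A (fun t => complex.Im (f t)).

Lemma cmeasurable_comp (R : realType) d (T : measurableType d) d' (T' : measurableType d')
    (A : set T) (f : T' -> R[i]) (g : T -> T') :
  cmeasurable setT f -> measurable_fun A g -> cmeasurable A (f \o g).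
Proof.
move=> [fr fi] mg; split; [exact: (measurableT_comp fr mg)|exact: (measurableT_comp fi mg)].
Qed.

(** * Extension by zero, weights and measurability on the half-line *)

Section half_line.
Context {R : realType}.
Local Notation mu := (@lebesgue_measure R).
Local Notation RM := (measurableTypeR R).
Local Notation D := (halfline R).

(** Turns integrals over the half-line, and the interval ]0, t[ in [conv], into integrals over the
    whole line, where translation invariance applies. *)
Definition zero_ext (V : nmodType) (f : R -> V) (t : R) : V :=
  if 0 < t then f t else 0.

(** Zeros are allowed: the norm of a nilpotent semigroup vanishes from some time on. Values at t <=
    0 carry no information. *)
Definition weight (w : R -> R) :=
  [/\ measurable_fun D w, forall t, 0 < t -> 0 <= w t
    & forall s t, 0 < s -> 0 < t -> w (s + t) <= w s * w t].

Lemma halflineE t : D t = (0 < t) :> Prop.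
Proof. by rewrite /= in_itv/= andbT. Qed.

Lemma zero_ext_pos (V : nmodType) (f : R -> V) t : 0 < t -> zero_ext f t = f t.
Proof. by rewrite /zero_ext => ->. Qed.

Lemma zero_ext_npos (V : nmodType) (f : R -> V) t : t <= 0 -> zero_ext f t = 0.
Proof. by rewrite /zero_ext leNgt => /negbTE ->. Qed.

Lemma zero_ext_patch (f : R -> R) : zero_ext f = f \_ D.
Proof.
apply/funext => t; rewrite /zero_ext patchE; case: ltP => t0.
  by rewrite mem_set// halflineE.
by rewrite memNset// halflineE; apply/negP; rewrite -leNgt.
Qed.

Lemma measurable_zero_ext (f : R -> R) :
  measurable_fun D f -> measurable_fun [set: RM] (zero_ext f).
Proof. by move=> mf; rewrite zero_ext_patch; apply/(measurable_restrictT _ _).1. Qed.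

Lemma cmeasurable_zero_ext (f : R -> R[i]) :
  cmeasurable D f -> cmeasurable [set: RM] (zero_ext f).
Proof.
move=> [/measurable_zero_ext mr /measurable_zero_ext mi].
by split; [move: mr|move: mi]; congr measurable_fun; apply/funext => t;
  rewrite /zero_ext; case: ifP.
Qed.

Lemma measurable_cabs d (T : measurableType d) (A : set T) (f : T -> R[i]) : cmeasurable A f -> measurable_fun A (fun t => cabs (f t)).
Proof.
move=> [mr mi]; under eq_fun do rewrite cabsE.
apply: (measurableT_comp (f := @Num.sqrt R)).
  by apply: continuous_measurable_fun; exact: sqrt_continuous.
by apply: measurable_funD; exact: measurable_funX.
Qed.

Lemma cmeasurableM d (T : measurableType d) (A : set T) (f g : T -> R[i]) : cmeasurable A f -> cmeasurable A g ->
  cmeasurable A (fun t => f t * g t).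
Proof.
move=> [fr fi] [gr gi]; split.
  under eq_fun do rewrite ReM.
  by apply: measurable_funB; exact: measurable_funM.
under eq_fun do rewrite ImM.
by apply: measurable_funD; exact: measurable_funM.
Qed.

Lemma Rintegral_zero_ext (f : R -> R) :
  \int[mu]_(t in D) f t = \int[mu]_t zero_ext f t.
Proof. by rewrite Rintegral_mkcond zero_ext_patch. Qed.

Lemma L1_integrable w f : weight w -> car (n := L1 w) f ->
  mu.-integrable D (EFin \o (fun t => cabs (f t) * w t)).
Proof.
move=> [mw w0 _] [mr mi foo]; apply/integrableP; split.
  by apply/measurable_EFinP; apply: measurable_funM => //; exact: measurable_cabs.
apply: le_lt_trans foo; rewrite le_eqVlt; apply/predU1P; left.
apply: eq_integral => t; rewrite inE halflineE => t0 /=.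
by rewrite ger0_norm// mulr_ge0 ?cabs_ge0 ?w0.
Qed.

Lemma integrable_zero_ext (f : R -> R) : mu.-integrable D (EFin \o f) ->
  mu.-integrable [set: RM] (EFin \o zero_ext f).
Proof.
move=> fi; rewrite zero_ext_patch -restrict_EFin.
by apply/integrable_restrict => //; rewrite setTI.
Qed.

(** Holds for divergent integrals too, because [fine] sends the infinities to 0. *)
Lemma fine_integral_le (h : RM -> R) (A : set RM) : measurable A -> measurable_fun A h ->
  (`|\int[mu]_(t in A) h t|%:E <= \int[mu]_(t in A) `|(h t)%:E|)%E.
Proof.
move=> mA mh.
have /(le_trans _) := le_abse_integral mu mA (proj2 (measurable_EFinP _ _) mh); apply.
have K (x : \bar R) : (`|fine x|%:E <= `|x|)%E by case: x => [r||]//=; rewrite normr0 leey.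
exact: K.
Qed.

End half_line.

(** * Convolution in a weighted L1 space *)

Section convolution.
Context {R : realType}.
Local Notation mu := (@lebesgue_measure R).
Local Notation RM := (measurableTypeR R).
Local Notation D := (halfline R).
Local Notation conv := Defs.conv.
Context (w : R -> R) (f g : R -> R[i]).
Hypothesis ww : weight w.
Hypothesis fL1 : car (n := L1 w) f.
Hypothesis gL1 : car (n := L1 w) g.

Let f0 := zero_ext f.
Let g0 := zero_ext g.
Let w0 := zero_ext w.
Let a t := cabs (f0 t) * w0 t.
Let b t := cabs (g0 t) * w0 t.
Let h (s t : R) := f0 s * g0 (t - s).

Let mf0 : cmeasurable [set: RM] f0.
Proof. by apply: cmeasurable_zero_ext; case: fL1. Qed.

Let mg0 : cmeasurable [set: RM] g0.
Proof. by apply: cmeasurable_zero_ext; case: gL1. Qed.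

Let mw0 : measurable_fun [set: RM] w0.
Proof. by apply: measurable_zero_ext; case: ww. Qed.

Let w0_ge0 t : 0 <= w0 t.
Proof. by rewrite /w0/zero_ext; case: ifP => // t0; case: ww => _ + _; exact. Qed.

Let aE : a = zero_ext (fun t => cabs (f t) * w t).
Proof. by apply/funext => t; rewrite /a /f0 /w0 /zero_ext; case: ifP; rewrite ?mulr0. Qed.

Let bE : b = zero_ext (fun t => cabs (g t) * w t).
Proof. by apply/funext => t; rewrite /b /g0 /w0 /zero_ext; case: ifP; rewrite ?mulr0. Qed.

Let ia : mu.-integrable [set: RM] (EFin \o a).
Proof. by rewrite aE; apply: integrable_zero_ext; exact: L1_integrable. Qed.

Let ib C : mu.-integrable [set: RM] (EFin \o (fun t => C * b t)).
Proof.
have := integrable_zero_ext (L1_integrable ww gL1); rewrite -bE => ib.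
have := @integrableZl _ _ _ mu [set: RM] measurableT C _ ib.
by apply: eq_integrable.
Qed.


Let mf1 : cmeasurable [set: RM * RM] (fun p : RM * RM => f0 p.1).
Proof. by apply: (cmeasurable_comp mf0); exact: measurable_fst. Qed.

Let mg2 : cmeasurable [set: RM * RM] (fun p : RM * RM => g0 p.2).
Proof. by apply: (cmeasurable_comp mg0); exact: measurable_snd. Qed.

Let mD12 : measurable_fun [set: RM * RM] (fun p : RM * RM => (p.1 + p.2 : RM)).
Proof. exact: measurable_funD. Qed.

Let mfg : cmeasurable [set: RM * RM] (fun p : RM * RM => f0 p.1 * g0 p.2).
Proof. exact: cmeasurableM. Qed.

Let mh : cmeasurable [set: RM * RM] (fun p : RM * RM => h p.2 p.1).
Proof.
have := @cmeasurable_comp R _ _ _ _ [set: RM * RM] _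
  (fun p : RM * RM => (p.2, (p.1 - p.2)%R) : RM * RM) mfg; apply.
by apply: measurable_fun_pair => //; exact: measurable_funB.
Qed.

Let mht t : cmeasurable [set: RM] (h ^~ t).
Proof.
have := @cmeasurable_comp R _ _ _ _ [set: RM] _ (fun s : RM => (t, s) : RM * RM) mh.
by apply; exact: measurable_fun_pair.
Qed.

Let Pk s r := cabs (f0 s * g0 r) * w0 (s + r).

(** Submultiplicativity splits w(s + r) into w(s) w(r), so the kernel is dominated by the product of
    the integrable functions [a] and [b]. *)
Let abs_kernel_integrable :
  (mu \x mu)%E.-integrable [set: RM * RM] (fun p => (Pk p.2 (p.1 - p.2))%:E).
Proof.
have := @shear_integrable R Pk a (fun t => 1 * b t); apply => //.
- apply: measurable_funM; first exact: measurable_cabs.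
  exact: (measurableT_comp mw0 mD12).
- move=> s r; rewrite mul1r ger0_norm ?mulr_ge0 ?cabs_ge0//.
  rewrite /Pk /a /b mulrACA -cabsM.
  have [s0|s0] := ltP 0 s; last by rewrite /f0 zero_ext_npos// !mul0r cabs0 !mul0r.
  have [r0|r0] := ltP 0 r; last by rewrite /g0 (zero_ext_npos _ r0)// !mulr0 cabs0 !mul0r.
  rewrite ler_wpM2l ?cabs_ge0// /w0 !zero_ext_pos ?addr_gt0//.
  by case: ww => _ _; exact.
Qed.

Let conv_Re t : complex.Re (conv f g t) = \int[mu]_s complex.Re (h s t).
Proof.
rewrite /conv /= Rintegral_mkcond; apply: eq_Rintegral => s _.
rewrite patchE /h /f0 /g0 /zero_ext subr_gt0.
case: ifPn; first by rewrite inE/= in_itv/= => /andP[-> ->].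
rewrite notin_setE/= in_itv/=.
by case: ltP => _; case: ltP => _; rewrite ?mulr0 ?mul0r//= => /(_ isT).
Qed.

Let conv_Im t : complex.Im (conv f g t) = \int[mu]_s complex.Im (h s t).
Proof.
rewrite /conv /= Rintegral_mkcond; apply: eq_Rintegral => s _.
rewrite patchE /h /f0 /g0 /zero_ext subr_gt0.
case: ifPn; first by rewrite inE/= in_itv/= => /andP[-> ->].
rewrite notin_setE/= in_itv/=.
by case: ltP => _; case: ltP => _; rewrite ?mulr0 ?mul0r//= => /(_ isT).
Qed.

(** Tonelli's measurability for the positive and negative parts separately; [fine] is measurable, so
    slices with divergent integral do no harm. *)
Let measurable_Rintegral_l (k : RM * RM -> R) : measurable_fun [set: RM * RM] k ->
  measurable_fun [set: RM] (fun t => \int[mu]_s k (t, s)).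
Proof.
move=> mk; apply: (measurableT_comp (f := fine)); first exact: fine_measurable.
under eq_fun do rewrite integralE.
have mk' : measurable_fun [set: RM * RM] (EFin \o k) by exact/measurable_EFinP.
apply: emeasurable_funB.
  rewrite (_ : (fun _ => _) = (fun t : RM => \int[mu]_s (EFin \o k)^\+ (t, s)))%E; last first.
    apply/funext => t; congr (integral mu setT _).
    exact: (funepos_comp (EFin \o k) (fun s : RM => (t, s))).
  apply: (measurable_fun_fubini_tonelli_F (EFin \o k)^\+%E) => //.
  exact: measurable_funepos.
rewrite (_ : (fun _ => _) = (fun t : RM => \int[mu]_s (EFin \o k)^\- (t, s)))%E; last first.
  apply/funext => t; congr (integral mu setT _).
  exact: (funeneg_comp (EFin \o k) (fun s : RM => (t, s))).
apply: (measurable_fun_fubini_tonelli_F (EFin \o k)^\-%E) => //.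
exact: measurable_funeneg.
Qed.

Lemma conv_cmeasurable : cmeasurable [set: RM] (conv f g).
Proof.
have [mr mi] := mh; split.
  by under eq_fun do rewrite conv_Re; exact: (measurable_Rintegral_l mr).
by under eq_fun do rewrite conv_Im; exact: (measurable_Rintegral_l mi).
Qed.

Lemma conv_L1 : car (n := L1 w) (conv f g).
Proof.
have [mr mi] := conv_cmeasurable.
split; [exact: measurable_funTS|exact: measurable_funTS|].
have mcw : measurable_fun D (fun t => (cabs (conv f g t) * w t)%:E).
  apply/measurable_EFinP/measurable_funM; last by case: ww.
  by apply: measurable_cabs; split; exact: measurable_funTS.
have P0 s r : 0 <= Pk s r by rewrite mulr_ge0 ?cabs_ge0.
have mPk : measurable_fun [set: RM * RM] (fun p => (Pk p.2 (p.1 - p.2))%:E).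
  exact: measurable_int abs_kernel_integrable.
pose I t := (\int[mu]_s (Pk s (t - s))%:E)%E.
have mI : measurable_fun [set: RM] I.
  have := measurable_fun_fubini_tonelli_F (m2 := mu) _ mPk; apply => p.
  by rewrite lee_fin.
(* The factor 2 arises because the modulus is bounded by the sum of the moduli of the real and
   imaginary parts, each of which is bounded by the same majorant. *)
apply: (@le_lt_trans _ _ (\int[mu]_(t in D) (2%:E * I t))%E).
  apply: ge0_le_integral => //.
  - move=> t; rewrite halflineE => t0; rewrite lee_fin mulr_ge0 ?cabs_ge0//.
    by case: ww => _ + _; exact.
  - by apply: measurable_funTS; exact: measurable_funeM.
  - move=> t; rewrite halflineE => t0.
    have w_ge0 : 0 <= w t by case: ww => _ + _; exact.
    apply: (@le_trans _ _ ((`|complex.Re (conv f g t)| + `|complex.Im (conv f g t)|) * w t)%:E).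
      by rewrite lee_fin ler_wpM2r// cabs_le_ReIm.
    rewrite mulrDl EFinD (_ : 2%:E = 1 + 1)%E// ge0_muleDl// !mul1e.
    suff K (k : R -> R) : measurable_fun [set: RM] k -> (forall s, `|k s| <= cabs (h s t)) ->
        ((`|\int[mu]_s k s| * w t)%:E <= I t)%E.
      apply: leeD; rewrite ?conv_Re ?conv_Im; apply: K; try by case: (mht t).
        by move=> s; exact: Re_le_cabs.
      by move=> s; exact: Im_le_cabs.
    move=> mk kh; rewrite EFinM.
    apply: (@le_trans _ _ ((\int[mu]_s `|(k s)%:E|) * (w t)%:E)%E).
      by rewrite lee_wpmul2r// fine_integral_le.
    rewrite -ge0_integralZr//; last exact/measurable_EFinP/measurableT_comp.
    apply: ge0_le_integral => //.
    + by move=> s _; rewrite -EFinM lee_fin mulr_ge0.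
    + by apply: emeasurable_funM => //; exact/measurable_EFinP/measurableT_comp.
    + by apply: (measurableT_comp mPk (g := fun s => (t, s))); exact: measurable_fun_pair.
    + move=> s _; rewrite -EFinM lee_fin /Pk subrKC /w0 zero_ext_pos// ler_wpM2r//.
apply: (@le_lt_trans _ _ (\int[mu]_t (2%:E * I t))%E).
  apply: ge0_subset_integral => //; first exact: measurable_funeM.
  by move=> t _; rewrite mule_ge0//; apply: integral_ge0 => s _; rewrite lee_fin.
rewrite ge0_integralZl//; last by move=> t _; apply: integral_ge0 => s _; rewrite lee_fin.
rewrite lte_mul_pinfty//.
have /integrable12ltyP := abs_kernel_integrable.
move=> /(_ mPk); apply: le_lt_trans; rewrite le_eqVlt; apply/predU1P; left.
by apply: eq_integral => t _; apply: eq_integral => s _ /=; rewrite ger0_norm.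
Qed.

Context (F : R -> R[i]) (C : R).
Hypothesis mF : cmeasurable D F.
Hypothesis FC : forall t, 0 < t -> cabs (F t) <= C * w t.

Let F0 := zero_ext F.
Let P s r := complex.Re (f0 s * g0 r * F0 (s + r)).

Let mP : measurable_fun [set: RM * RM] (fun p => P p.1 p.2).
Proof.
have [] // : cmeasurable [set: RM * RM] (fun p : RM * RM => f0 p.1 * g0 p.2 * F0 (p.1 + p.2)).
apply: cmeasurableM => //; apply: (cmeasurable_comp _ mD12); exact: cmeasurable_zero_ext.
Qed.

Let Pab s r : `|P s r| <= a s * (`|C| * b r).
Proof.
apply: le_trans (Re_le_cabs _) _; rewrite !cabsM.
have [s0|s0] := ltP 0 s; last by rewrite /a /f0 (zero_ext_npos _ s0) cabs0 !mul0r.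
have [r0|r0] := ltP 0 r.
  rewrite /a /b /f0 /g0 /w0 /F0 !zero_ext_pos ?addr_gt0//.
  have /le_trans H := FC (addr_gt0 s0 r0).
  rewrite [X in _ <= _ * X]mulrCA mulrACA -mulrA -mulrA !ler_wpM2l ?cabs_ge0//.
  have [_ wg0 wM] := ww.
  apply: H; apply: (@le_trans _ _ (`|C| * w (s + r))).
    by rewrite ler_wpM2r ?ler_norm// wg0// addr_gt0.
  by rewrite mulrCA mulrA -mulrA ler_wpM2l// wM.
by rewrite /b /g0 (zero_ext_npos _ r0) cabs0 !(mulr0, mul0r).
Qed.

(** Where [F0 t] vanishes both sides are 0. Elsewhere the bound by C w forces w t > 0, and dividing
    the integrable kernel [Pk] by w t shows that the integral defining the convolution converges for
    almost every such t. *)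
Let conv_F_ae : ae_eq mu setT
  (fun t => (complex.Re (conv f g t * F0 t))%:E)
  (fun t => (\int[mu]_s P s (t - s))%:E).
Proof.
have := ae_integrable1 abs_kernel_integrable; apply: filterS => t /= it _; congr EFin.
have [Ft0|Ft0] := eqVneq (F0 t) 0.
  rewrite Ft0 mulr0 /=; under eq_Rintegral do rewrite /P subrKC Ft0 mulr0 /=.
  by rewrite Rintegral_cst// mul0r.
have t0 : 0 < t by rewrite ltNge; apply: contra_neqN Ft0 => /zero_ext_npos; exact.
have wt0 : 0 < w t.
  rewrite lt_neqAle; case: (ww) => _ -> // _; rewrite andbT.
  apply: contra_neq Ft0 => wt0; apply: cabs0_eq0; apply/eqP.
  rewrite eq_le cabs_ge0 andbT /F0 zero_ext_pos//.
  by rewrite (le_trans (FC t0))// -wt0 mulr0.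
have ik (k : R -> R) : measurable_fun [set: RM] k -> (forall s, `|k s| <= cabs (h s t)) ->
    mu.-integrable [set: RM] (EFin \o k).
  move=> mk kh.
  have := @integrableZl _ _ _ mu [set: RM] measurableT (w t)^-1 _ it.
  apply: le_integrable => //; first exact/measurable_EFinP.
  move=> s _; rewrite /= lee_fin /Pk subrKC /w0 zero_ext_pos//.
  rewrite (le_trans (kh s))// mulrC mulrK ?unitfE ?gt_eqF//.
  by rewrite ger0_norm ?cabs_ge0.
have [mr mi] := mht t.
have ir := ik _ mr (fun s => Re_le_cabs _); have ii := ik _ mi (fun s => Im_le_cabs _).
rewrite ReM conv_Re conv_Im -!RintegralZr// -RintegralB//; last 2 first.
- exact: (integrableZr measurableT _ ir).
- exact: (integrableZr measurableT _ ii).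
by apply: eq_Rintegral => s _; rewrite /P subrKC ReM.
Qed.

Let P_half s : \int[mu]_r P s r =
  zero_ext (fun s => \int[mu]_(r in D) complex.Re (f s * g r * F (s + r))) s.
Proof.
rewrite /zero_ext; case: ifPn => [s0|]; last first.
  rewrite -leNgt => s0; under eq_Rintegral do rewrite /P /f0 zero_ext_npos// !mul0r /=.
  by rewrite Rintegral_cst// mul0r.
rewrite Rintegral_zero_ext; apply: eq_Rintegral => r _.
rewrite /P /f0 /g0 /zero_ext s0; case: ltP => [r0|]; last by rewrite mulr0 mul0r.
by rewrite /F0 zero_ext_pos// addr_gt0.
Qed.

Lemma conv_integral_l :
  \int[mu]_(t in D) complex.Re (conv f g t * F t) =
  \int[mu]_(s in D) \int[mu]_(r in D) complex.Re (f s * g r * F (s + r)).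
Proof.
transitivity (\int[mu]_s \int[mu]_r P s r); last first.
  by rewrite [RHS]Rintegral_zero_ext; apply: eq_Rintegral => s _; exact: P_half.
rewrite -(shear_Fubini_l mP ia (ib _) Pab) Rintegral_zero_ext.
transitivity (\int[mu]_t complex.Re (conv f g t * F0 t)).
  by apply: eq_Rintegral => t _; rewrite /F0 /zero_ext; case: ifP; rewrite ?mulr0.
congr fine; apply: ae_eq_integral => //.
  apply/measurable_EFinP; have [] // : cmeasurable [set: RM] (fun t => conv f g t * F0 t).
  apply: cmeasurableM; [exact: conv_cmeasurable|exact: cmeasurable_zero_ext].
apply/measurable_EFinP.
have := @measurable_Rintegral_l (fun p => P p.2 (p.1 - p.2)); apply.
apply/(measurable_EFinP [set: RM * RM]); exact: (measurable_int _ (shear_integrable mP ia (ib _) Pab)).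
Qed.

Let P_half_r r : \int[mu]_s P s r =
  zero_ext (fun r => \int[mu]_(s in D) complex.Re (f s * g r * F (s + r))) r.
Proof.
rewrite /zero_ext; case: ifPn => [r0|]; last first.
  rewrite -leNgt => r0; under eq_Rintegral do rewrite /P /g0 (zero_ext_npos _ r0) mulr0 mul0r /=.
  by rewrite Rintegral_cst// mul0r.
rewrite Rintegral_zero_ext; apply: eq_Rintegral => s _.
rewrite /P /f0 /g0 /zero_ext r0; case: ltP => [s0|]; last by rewrite !mul0r.
by rewrite /F0 zero_ext_pos// addr_gt0.
Qed.

(** This order, with [f] integrated first, is the one that lets information on [f] alone annihilate
    the whole integral; it also stands in for the symmetry of the convolution. *)
Lemma conv_integral_r :
  \int[mu]_(t in D) complex.Re (conv f g t * F t) =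
  \int[mu]_(r in D) \int[mu]_(s in D) complex.Re (f s * g r * F (s + r)).
Proof.
rewrite conv_integral_l; transitivity (\int[mu]_s \int[mu]_r P s r).
  by rewrite [LHS]Rintegral_zero_ext; apply: eq_Rintegral => s _; exact/esym/P_half.
rewrite (shear_Fubini_r mP ia (ib _) Pab) [RHS]Rintegral_zero_ext.
by apply: eq_Rintegral => r _; exact: P_half_r.
Qed.

End convolution.

(** * Pairing weighted L1 functions with functions bounded by the weight *)

Section pairing.
Context {R : realType}.
Local Notation mu := (@lebesgue_measure R).
Local Notation RM := (measurableTypeR R).
Local Notation D := (halfline R).
Implicit Types (w : R -> R) (f F : R -> R[i]).

Definition locally_bounded w :=
  forall a b, 0 < a -> exists M, forall t, a <= t <= b -> w t <= M.

(** Dominated convergence in the form that truncation errors satisfy: at each point they are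
    eventually exactly 0. *)
Lemma Rintegral_dominated_cvg0 (k : nat -> RM -> R) (g : RM -> R) :
  (forall n, measurable_fun D (k n)) ->
  (forall n t, 0 < t -> `|k n t| <= g t) ->
  mu.-integrable D (EFin \o g) ->
  (forall t, 0 < t -> exists N, forall n, (N <= n)%N -> k n t = 0) ->
  forall e, 0 < e -> exists N, forall n, (N <= n)%N -> \int[mu]_(t in D) `|k n t| < e.
Proof.
move=> mk kg ig k0 e e0.
have mk' n : measurable_fun (D : set RM) (EFin \o (fun t => `|k n t|)).
  apply/measurable_EFinP.
  exact: (measurableT_comp (@normr_measurable R setT) (mk n)).
have H := @dominated_cvg _ RM R mu D _ (fun n t => `|k n t|%:E) (cst 0%E) (EFin \o g).
have {}H : (\int[mu]_(t in D) `|k n t|%:E @[n --> \oo] --> (0 : \bar R))%E.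
  rewrite -[X in _ --> X](integral0 mu D); apply: H => //.
  - move=> t; rewrite halflineE => t0; have [N HN] := k0 t t0.
    apply: cvg_near_cst; exists N => // n /= Nn.
    by rewrite HN// normr0.
  - by move=> n t; rewrite halflineE => t0 /=; rewrite lee_fin normr_id kg.
have ikn n : mu.-integrable D (EFin \o (fun t => `|k n t|)).
  apply: le_integrable ig => //;   by move=> t; rewrite halflineE => t0 /=; rewrite lee_fin normr_id ler_normr kg.
move/fine_cvgP : H => [_ /cvgrPdist_lt/(_ e e0)[N _ HN]].
exists N => n Nn; have := HN n Nn; rewrite /= sub0r normrN ger0_norm//.
by apply: fine_ge0; apply: integral_ge0 => t _; rewrite lee_fin.
Qed.

Lemma pairing_integrable w f F C : weight w -> car (n := L1 w) f ->
  cmeasurable D F -> (forall t, 0 < t -> cabs (F t) <= C * w t) ->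
  mu.-integrable D (EFin \o (fun t => complex.Re (f t * F t))).
Proof.
move=> ww fL1 mF FC; have [mr mi _] := fL1.
have iC : mu.-integrable D (EFin \o (fun t => C * (cabs (f t) * w t))).
  by apply: (@integrableZl _ _ _ mu D _ C _ (L1_integrable ww fL1)).
apply: le_integrable iC => //.
  apply/measurable_EFinP; have [] // : cmeasurable D (fun t => f t * F t).
  by apply: cmeasurableM.
move=> t; rewrite halflineE => t0 /=; rewrite lee_fin.
rewrite (le_trans (Re_le_cabs _))// cabsM (le_trans _ (ler_norm _))// mulrCA.
by rewrite ler_wpM2l ?cabs_ge0// FC.
Qed.

Lemma pairing_le w f F C : weight w -> car (n := L1 w) f ->
  cmeasurable D F -> (forall t, 0 < t -> cabs (F t) <= C * w t) ->
  \int[mu]_(t in D) complex.Re (f t * F t) <= C * nrm (n := L1 w) f.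
Proof.
move=> ww fL1 mF FC; rewrite -RintegralZl//; last exact: L1_integrable.
apply: le_Rintegral => //.
- exact: pairing_integrable FC.
- apply: (@integrableZl _ _ _ mu D _ C _ (L1_integrable ww fL1)) => //.
- move=> t; rewrite halflineE => t0.
  rewrite (le_trans (ler_norm _))// (le_trans (Re_le_cabs _))// cabsM mulrCA.
  by rewrite ler_wpM2l ?cabs_ge0// FC.
Qed.

Lemma L1B w f g : weight w -> car (n := L1 w) f -> car (n := L1 w) g ->
  car (n := L1 w) (f - g).
Proof.
move=> ww fL gL; have [fr fi foo] := fL; have [gr gi goo] := gL.
have ms : cmeasurable D (f - g).
  split.
    rewrite (_ : (fun t => _) = (fun t => complex.Re (f t) - complex.Re (g t))).
      exact: measurable_funB.
    by apply/funext => t; rewrite -ReN -ReD.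
  rewrite (_ : (fun t => _) = (fun t => complex.Im (f t) - complex.Im (g t))).
    exact: measurable_funB.
  by apply/funext => t; rewrite -ImN -ImD.
have [mr mi] := ms; split => //.
have [mw w0 _] := ww.
apply: (@le_lt_trans _ _ (\int[mu]_(t in D) (cabs (f t) * w t + cabs (g t) * w t)%:E)%E).
  apply: ge0_le_integral => //.
  - by move=> t; rewrite halflineE => t0; rewrite lee_fin mulr_ge0 ?cabs_ge0 ?w0.
  - by apply/measurable_EFinP/measurable_funM => //; exact: measurable_cabs.
  - by apply/measurable_EFinP/measurable_funD; apply/measurable_funM => //; exact: measurable_cabs.
  - move=> t; rewrite halflineE => t0; rewrite lee_fin -mulrDl ler_wpM2r ?w0//.
    by rewrite (le_trans (cabsD _ _))// cabsN.
under eq_integral do rewrite EFinD.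
rewrite integralD//; [exact: lte_add_pinfty| |]; exact: L1_integrable.
Qed.

Lemma L1_bounded w f a b M : weight w -> locally_bounded w -> 0 < a ->
  cmeasurable D f -> (forall t, 0 < t -> cabs (f t) <= M) ->
  (forall t, ~~ (a <= t <= b) -> f t = 0) -> car (n := L1 w) f.
Proof.
move=> [mw w0 _] lw a0 mf fM fab; have [mr mi] := mf; split => //.
have [K wK] := lw a b a0.
have M0 : 0 <= M by apply: le_trans (fM 1 ltr01); exact: cabs_ge0.
apply: (@le_lt_trans _ _ (\int[mu]_(t in D) (M * `|K| * \1_`[a, b]%classic t)%:E)%E).
  apply: ge0_le_integral => //.
  - by move=> t; rewrite halflineE => t0; rewrite lee_fin mulr_ge0 ?cabs_ge0 ?w0.
  - by apply/measurable_EFinP/measurable_funM => //; exact: measurable_cabs.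
  - by apply/measurable_EFinP/measurable_funM => //; exact: measurable_indic.
  - move=> t; rewrite halflineE => t0; rewrite lee_fin indicE.
    have [tab|/negbTE tab] := boolP (a <= t <= b); last first.
      by rewrite fab ?tab// cabs0 mul0r mulr_ge0// mulr_ge0.
    rewrite mem_set/= ?in_itv//= mulr1 ler_pM ?cabs_ge0 ?w0 ?fM//.
    by rewrite (le_trans (wK _ tab))// ler_norm.
under eq_integral do rewrite EFinM.
rewrite ge0_integralZl//; last 2 first.
- exact/measurable_EFinP/measurable_indic.
- by rewrite lee_fin mulr_ge0.
rewrite lte_mul_pinfty ?lee_fin ?mulr_ge0// integral_indic//.
rewrite (@le_lt_trans _ _ (mu `[a, b]))//; last first.
  by rewrite lebesgue_measure_itv/=; case: ifP => _; rewrite -?EFinB ltry.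
by apply: le_measure; rewrite ?inE//; apply: measurableI.
Qed.

(** The indefinite integral of k from t / 2 is identically 0, and its derivative at t is k t. *)
Lemma integral_itv_eq0 (k : R -> R) :
  (forall t, 0 < t -> {for t, continuous k}) ->
  (forall a b, 0 < a -> \int[mu]_(t in `[a, b]) k t = 0) ->
  forall t, 0 < t -> k t = 0.
Proof.
move=> ck k0 t t0.
have t2 : 0 < t / 2 by rewrite divr_gt0.
have tt1 : t < t + 1 by rewrite ltrDl.
have := @continuous_FTC1_closed R k (t / 2) t (t + 1) tt1.
have ik : mu.-integrable `[t / 2, t + 1] (EFin \o k).
  apply: continuous_compact_integrable; first exact: segment_compact.
  apply: continuous_in_subspaceT => x; rewrite inE/= in_itv/= => /andP[x0 _].
  by apply: ck; exact: lt_le_trans x0.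
move=> /(_ ik) /= /(_ _ (ck t t0)) [|_]; first by rewrite ltr_pdivrMr// ltr_pMr// ltr1n.
rewrite derive1E (_ : (fun x : R => _) = cst 0) ?derive_cst// => //.
by apply/funext => x; exact: k0.
Qed.

Definition pos_continuous (F : R -> R[i]) :=
  (forall t, 0 < t -> {for t, continuous (fun t => complex.Re (F t))}) /\
  (forall t, 0 < t -> {for t, continuous (fun t => complex.Im (F t))}).

Lemma pos_continuous_measurable F : pos_continuous F -> cmeasurable D F.
Proof.
move=> [cr ci]; split; apply: open_continuous_measurable_fun.
- exact: interval_open.
- by move=> t; rewrite inE halflineE; exact: cr.
- exact: interval_open.
- by move=> t; rewrite inE halflineE; exact: ci.
Qed.

(** The last hypothesis, with c in the role of u(r), says that the pairing with F kills every
    convolution f * u. Density extends this to all of [L1 w], and multiples of indicators of compact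
    intervals then isolate the values of the continuous F. *)
Lemma Omega_cancel w f F C : weight w -> locally_bounded w ->
  Omega (U := L1 w) f ->
  pos_continuous F -> (forall t, 0 < t -> cabs (F t) <= C * w t) ->
  (forall c r, 0 < r -> \int[mu]_(s in D) complex.Re (f s * c * F (s + r)) = 0) ->
  forall t, 0 < t -> F t = 0.
Proof.
move=> ww lw [fL1 fO] cF FC f0.
have mF := pos_continuous_measurable cF.
(* An upper bound is enough, since it will be used for a constant and for its opposite. *)
have F0 h : car (n := L1 w) h -> \int[mu]_(t in D) complex.Re (h t * F t) <= 0.
  move=> hL1; apply/ler_addgt0Pr => e e0.
  (* Adding 1 keeps the denominator positive even for C = 0; the same device recurs throughout. *)
  have C1 : 0 < `|C| + 1 by rewrite ltr_wpDl.
  have [u uL1 hu] := fO h hL1 (e / (`|C| + 1)) (divr_gt0 e0 C1).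
  have cL1 := conv_L1 ww fL1 uL1.
  have dL1 := L1B ww hL1 cL1.
  have -> : \int[mu]_(t in D) complex.Re (h t * F t) =
      \int[mu]_(t in D) complex.Re ((h - Defs.conv f u) t * F t) +
      \int[mu]_(t in D) complex.Re (Defs.conv f u t * F t).
    rewrite -RintegralD//; [|exact: pairing_integrable dL1 mF FC|exact: pairing_integrable cL1 mF FC].
    by apply: eq_Rintegral => t _; rewrite -ReD -mulrDl/= subrK.
  rewrite (conv_integral_r ww fL1 uL1 mF FC) [X in _ + X](_ : _ = 0); last first.
    rewrite -[RHS](mul0r (fine (mu D))) -Rintegral_cst//; apply: eq_Rintegral => r.
    by rewrite inE halflineE => r0; rewrite f0.
  rewrite addr0 add0r.
  have FC' t : 0 < t -> cabs (F t) <= (`|C| + 1) * w t.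
    move=> t0; rewrite (le_trans (FC t t0))// ler_wpM2r//; first by case: ww => _ + _; exact.
    by rewrite (le_trans (ler_norm _))// lerDl.
  rewrite (le_trans (pairing_le ww dL1 mF FC'))// -ler_pdivlMl// mulrC.
  exact/ltW.
have cFc c t : 0 < t -> {for t, continuous (fun t => complex.Re (c * F t))}.
  move=> t0; have [cr ci] := cF.
  rewrite (_ : (fun t => _) = (fun t => complex.Re c * complex.Re (F t) -
    complex.Im c * complex.Im (F t))); last by apply/funext => s; rewrite ReM.
  by apply: continuousB; apply: continuousM; [exact: cvg_cst|exact: cr|exact: cvg_cst|exact: ci].
have Fc c a b : 0 < a -> \int[mu]_(t in `[a, b]) complex.Re (c * F t) = 0.
  move=> a0; suff Fc_le c' : \int[mu]_(t in `[a, b]) complex.Re (c' * F t) <= 0.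
    apply/eqP; rewrite eq_le Fc_le/= -oppr_le0 -mulN1r -RintegralZl//; last first.
      apply: continuous_compact_integrable; first exact: segment_compact.
      apply: continuous_in_subspaceT => t; rewrite inE/= in_itv/= => /andP[ta _].
      by apply: cFc; exact: lt_le_trans ta.
    have := Fc_le (- c); congr (_ <= _); apply: eq_Rintegral => t _.
    by rewrite mulNr ReN mulN1r.
  pose h t := if a <= t <= b then c' else 0.
  have hL1 : car (n := L1 w) h.
    apply: (@L1_bounded w h a b (cabs c')) => //.
    - split.
        rewrite (_ : (fun t => _) = (fun t => complex.Re c' * \1_`[a, b]%classic t)); last first.
          apply/funext => t; rewrite indicE /h; case: ifPn => tab.
            by rewrite mem_set ?mulr1//= in_itv.
          by rewrite memNset ?mulr0//= in_itv; exact/negP.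
        by apply: measurable_funM => //; exact: measurable_indic.
      rewrite (_ : (fun t => _) = (fun t => complex.Im c' * \1_`[a, b]%classic t)); last first.
        apply/funext => t; rewrite indicE /h; case: ifPn => tab.
          by rewrite mem_set ?mulr1//= in_itv.
        by rewrite memNset ?mulr0//= in_itv; exact/negP.
      by apply: measurable_funM => //; exact: measurable_indic.
    - by move=> t _; rewrite /h; case: ifP => // _; rewrite cabs0 cabs_ge0.
    - by move=> t /negbTE; rewrite /h => ->.
  have := F0 h hL1; congr (_ <= _).
  rewrite (_ : `[a, b]%classic = D `&` `[a, b]); last first.
    apply/seteqP; split => t /=; last by case.
    by rewrite !in_itv/= andbT => /andP[ta tb]; rewrite (lt_le_trans a0 ta) ta.
  rewrite Rintegral_mkcondr; apply: eq_Rintegral => t _.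
  rewrite patchE /h; case: ifPn => tab; first by rewrite mem_set//= in_itv.
  by rewrite memNset ?mul0r//= in_itv; exact/negP.
move=> t t0; apply: complex_eqP.
  have := integral_itv_eq0 (cFc 1) (Fc 1) t0; by rewrite mul1r.
by have := integral_itv_eq0 (cFc (- 'i%C)) (Fc _) t0; rewrite ReMi.
Qed.

End pairing.

(** * Submultiplicative weights *)

Section weights.
Context {R : realType}.
Local Notation mu := (@lebesgue_measure R).
Local Notation RM := (measurableTypeR R).
Local Notation D := (halfline R).
Implicit Types (w : R -> R).

Lemma lebesgue_measure_reflect (t : R) (A : set RM) : measurable A ->
  measurable ((fun s : RM => (t - s : RM)%R) @^-1` A) /\
  mu ((fun s : RM => (t - s : RM)%R) @^-1` A) = mu A.
Proof.
move=> mA.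
have mS : measurable ((fun s : RM => (s + t : RM)%R) @^-1` A).
  have m : measurable_fun [set: RM] (fun s : RM => (s + t : RM)%R) by exact: measurable_funD.
  by rewrite -[_ @^-1` _]setTI; exact: m.
rewrite (_ : (fun s : RM => _) @^-1` A =
  (-%R : RM -> RM) @^-1` ((fun s : RM => (s + t : RM)%R) @^-1` A)); last first.
  by apply/seteqP; split => s /=; rewrite addrC.
split.
  have m : measurable_fun [set: RM] (-%R : RM -> RM) by exact: oppr_measurable.
  by rewrite -[_ @^-1` _]setTI; exact: m.
have := lebesgue_measureN mS; rewrite /pushforward => ->.
by have := lebesgue_measure_shift t mA; rewrite /pushforward => ->.
Qed.

(* If [w t >= n ^ 2] then, for every [s] in [(0, t)], either [w s >= n] or
   [w (t - s) >= n]: the set where [w >= n] fills at least half of [(0, t)]. *)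
Lemma weight_locally_bounded w : weight w -> locally_bounded w.
Proof.
move=> [mw w0 wM] a b a0; apply/not_existsP => nb.
pose A n : set RM := `]0, b]%classic `&` [set s | n%:R <= w s].
have mA n : measurable (A n).
  have -> : A n = `]0, b]%classic `&` w @^-1` `[n%:R, +oo[.
    by apply/seteqP; split => s /= [sb ns]; split => //=; move: ns; rewrite in_itv/= andbT.
  apply: (measurable_funS _ _ mw) => //.
  by move=> s /=; rewrite !in_itv/= andbT => /andP[].
have A0 : \bigcap_n A n = set0.
  apply/seteqP; split => // s /= As.
  have [_ /=] := As (Num.truncn (w s)).+1 I.
  by rewrite leNgt truncnS_gt.
have : mu (A n) @[n --> \oo] --> mu (\bigcap_n A n).
  apply: nonincreasing_cvg_mu => //.
  - apply: (@le_lt_trans _ _ (mu `]0, b])).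
      by apply: le_measure; rewrite ?inE//; apply: subIsetl.
    by rewrite lebesgue_measure_itv/=; case: ifP => _; rewrite -?EFinB ltry.
  - exact: bigcapT_measurable.
  - move=> m n mn; apply/subsetPset => s [sb /= ns]; split => //=.
    by rewrite (le_trans _ ns)// ler_nat.
(* Since w is finite everywhere the sets [A n] shrink to the empty set, so some has measure below a
   / 2. As t >= a, it and its reflection cannot cover ]0, t[. *)
rewrite A0 measure0 => /fine_cvgP[Afin /cvgrPdist_lt/(_ (a / 2))].
move=> /(_ (divr_gt0 a0 (ltr0n _ 2)))[N1 _ HN1].
have [N2 _ HN2] := Afin.
pose n := maxn N1 N2; have {}HN1 := HN1 n (leq_maxl _ _); have {}HN2 := HN2 n (leq_maxr _ _).
have /existsNP[t /not_implyP[/andP[ta tb] /negP]] := nb (n%:R ^+ 2).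
rewrite -ltNge => wt.
have t0 : 0 < t by exact: lt_le_trans ta.
have [mB BE] := lebesgue_measure_reflect t (mA n).
set B := _ @^-1` _ in mB BE.
have sub : `]0, t[%classic `<=` A n `|` B.
  move=> s /=; rewrite in_itv/= => /andP[s0 st].
  have [ns|sn] := leP n%:R (w s).
    by left; split => //=; rewrite in_itv/= s0 (le_trans (ltW st)).
  right; split => /=; first by rewrite in_itv/= subr_gt0 st lerBlDr (le_trans tb)// lerDl ltW.
  have ts : 0 < t - s by rewrite subr_gt0.
  rewrite leNgt; apply/negP => tsn.
  have := lt_le_trans wt _; rewrite -{1}(subrK s t) addrC => /(_ _ (wM _ _ s0 ts)).
  apply/negP; rewrite -leNgt expr2 ler_pM ?w0//; exact: ltW.
have : (mu `]0%R, t[ <= mu (A n) + mu B)%E.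
  apply: (le_trans _ (measureU2 _ _ _)) => //.
  by apply: le_measure; rewrite ?inE//; exact: measurableU.
rewrite BE lebesgue_measure_itv/= lte_fin t0 oppr0 adde0 -(fineK HN2) -EFinD lee_fin.
move: HN1; rewrite /= sub0r normrN => /(le_lt_trans (ler_norm _)).
set m := fine _; lra.
Qed.

(** Divide s by t0 with remainder r: each of the n full steps costs a factor w t0. The offset a
    keeps the remaining argument r + a in [a, a + t0], away from 0, near which w may be
    unbounded. *)
Lemma weight_exp_bound w l t0 : weight w -> 0 < t0 -> w t0 <= expR (l * t0) ->
  forall a, 0 < a -> exists2 C, 0 <= C & forall s, 0 <= s -> w (s + a) <= C * expR (l * s).
Proof.
move=> ww t00 wt0 a a0.
have [M wa] := weight_locally_bounded ww (a + t0) a0.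
have [mw w0 wM] := ww.
have K n r : 0 <= r <= t0 -> w (n%:R * t0 + (r + a)) <= expR (l * (n%:R * t0)) * `|M|.
  move=> /andP[r0 rt]; elim: n => [|n IH].
    rewrite mul0r add0r mulr0 expR0 mul1r (le_trans (wa _ _)) ?ler_norm//.
    by rewrite lerDr r0 addrC lerD2l.
  have p : 0 < n%:R * t0 + (r + a).
    by apply: ltr_wpDl; [apply: mulr_ge0 => //; exact: ltW|exact: ltr_wpDl].
  rewrite -natr1 mulrDl mul1r addrAC addrC (le_trans (wM _ _ _ _))//.
  by rewrite mulrDr expRD mulrAC mulrC ler_pM ?w0.
(* The first factor bounds the remainder; the second pays for replacing n * t0 by s, which differs
   from it by at most t0, whatever the sign of l. *)
exists (`|M| * expR (`|l| * t0)); first by rewrite mulr_ge0// expR_ge0.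
move=> s s0; have st0 : 0 <= s / t0 by rewrite divr_ge0// ltW.
have /andP[n1 n2] := truncn_itv st0; set n := Num.truncn _ in n1 n2.
have r0 : 0 <= s - n%:R * t0 by rewrite subr_ge0 -ler_pdivlMr.
have rt : s - n%:R * t0 <= t0.
  by rewrite lerBlDr; move: n2; rewrite ltr_pdivrMr// -natr1 mulrDl mul1r addrC => /ltW.
have := K n _ (introT andP (conj r0 rt)).
rewrite addrA addrCA subrr addr0 => /le_trans; apply.
rewrite mulrC -mulrA ler_wpM2l// -expRD ler_expR.
have : l * (n%:R * t0 - s) <= `|l| * t0.
  rewrite (le_trans (ler_norm _))// normrM ler_wpM2l// distrC ger0_norm//.
by rewrite mulrBr; lra.
Qed.

(** Fekete's argument, by contraposition: if w t exceeds exp(l t) for every t > 0, then w is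
    positive and ln(w t) / t converges to its infimum, which is at least l. Convergence has to be
    proved here, since [lim] has no meaning before it. *)
Lemma weight_radius w l : weight w ->
  (lne (lim (w t `^ t^-1 @[t --> +oo]))%:E < l%:E)%E ->
  exists2 t0, 0 < t0 & w t0 <= expR (l * t0).
Proof.
move=> ww; apply: contraPP => /forall2NP nt.
have wl t : 0 < t -> expR (l * t) < w t.
  by move=> t0; case: (nt t) => // /negP; rewrite -ltNge.
have w_gt0 t : 0 < t -> 0 < w t by move=> /wl; apply: lt_trans; exact: expR_gt0.
pose h t := t^-1 * ln (w t).
have hl t : 0 < t -> l <= h t.
  move=> t0; rewrite /h ler_pdivlMl// mulrC -ler_expR lnK ?posrE ?w_gt0//.
  exact/ltW/wl.
pose S := [set h t | t in D].
have hS : has_inf S.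
  split; first by exists (h 1), 1 => //=; rewrite in_itv/= ltr01.
  by exists l => _ [t + <-]; rewrite halflineE; exact: hl.
have lS : l <= inf S.
  by apply: lb_le_inf => [|_ [t + <-]]; [case: hS|rewrite halflineE; exact: hl].
have hcvg : h t @[t --> +oo] --> inf S.
  apply/cvgrPdist_le => e e0.
  have e2 : 0 < e / 2 by rewrite divr_gt0.
  have [_ [t0 + <-] ht0] := inf_adherent e2 hS; rewrite halflineE => t00.
  have wt0 : w t0 <= expR ((inf S + e / 2) * t0).
    by rewrite -[leLHS]lnK ?posrE ?w_gt0// ler_expR mulrC -ler_pdivrMl// ltW.
  have [C C0 wC] := weight_exp_bound ww t00 wt0 ltr01.
  set m := inf S + e / 2 in ht0 wt0 wC.
  (* Will bound w t by K * expR (m * t): the exponential undoes the unit offset in t = (t - 1) + 1,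
     and [C + 1] is positive, so that its logarithm is meaningful. *)
  pose K := (C + 1) * expR (- m).
  have K0 : 0 < K by rewrite mulr_gt0 ?expR_gt0// ltr_wpDl.
  near=> t.
  have t1 : 1 <= t by near: t; exact: nbhs_pinfty_ge.
  have tp : 0 < t by exact: lt_le_trans t1.
  have infh : inf S <= h t by apply: ge_inf; [case: hS|exists t => //; rewrite halflineE].
  rewrite distrC ger0_norm ?subr_ge0// lerBlDl.
  rewrite /h ler_pdivrMl//.
  have : ln (w t) <= ln K + m * t.
    rewrite -ler_expR lnK ?posrE ?w_gt0// expRD lnK ?posrE// /K -mulrA -expRD.
    have := wC (t - 1); rewrite subr_ge0 subrK => /(_ t1) /le_trans; apply.
    by rewrite mulrBr mulr1 [- m + _]addrC ler_wpM2r ?expR_ge0// lerDl.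
  move=> /le_trans; apply; rewrite addrC -lerBrDl.
  have Kt : ln K <= t * (e / 2).
    rewrite -ler_pdivrMr//; near: t; exact: nbhs_pinfty_ge.
  by rewrite (le_trans Kt)// /m; lra.
have gcvg : w t `^ t^-1 @[t --> +oo] --> expR (inf S).
  have : expR (h t) @[t --> +oo] --> expR (inf S).
    by apply: continuous_cvg => //; exact: continuous_expR.
  apply: cvg_trans; apply: near_eq_cvg; near=> t.
  have tp : 0 < t by near: t; exact: nbhs_pinfty_gt.
  by rewrite /powR gt_eqF ?w_gt0.
rewrite (cvg_lim _ gcvg)// lne_EFin ?expR_gt0// expRK lte_fin.
by move/lt_geF; rewrite lS.
Unshelve. all: by end_near. Qed.

End weights.

(** * Integrals of derivatives over the half-line *)

Section boundary_terms.
Context {R : realType}.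
Local Notation mu := (@lebesgue_measure R).
Local Notation RM := (measurableTypeR R).
Local Notation D := (halfline R).

Definition window (n : nat) (t : R) := n.+1%:R^-1 <= t <= n.+1%:R.

Lemma window_near (t : R) : 0 < t -> exists N, forall n, (N <= n)%N -> window n t.
Proof.
move=> t0; exists (maxn (Num.truncn t^-1).+1 (Num.truncn t).+1) => n.
rewrite geq_max => /andP[n1 n2]; apply/andP; split.
  rewrite invf_ple ?posrE//; apply/ltW/(lt_le_trans (truncnS_gt _)).
  by rewrite ler_nat (leq_trans n1).
by apply/ltW/(lt_le_trans (truncnS_gt _)); rewrite ler_nat (leq_trans n2).
Qed.

Lemma window_gt0 n (t : R) : window n t -> 0 < t.
Proof. by move=> /andP[+ _]; apply: lt_le_trans; rewrite invr_gt0. Qed.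

Lemma measurable_window n : measurable [set t : RM | window n t].
Proof.
exact: (measurable_itv `[n.+1%:R^-1, n.+1%:R]).
Qed.

Lemma tail_integral (g : R -> R) : mu.-integrable D (EFin \o g) ->
  forall e, 0 < e -> exists N, forall n, (N <= n)%N ->
    \int[mu]_(t in D) `|if window n t then 0 else g t| < e.
Proof.
move=> ig; have [/measurable_EFinP mg _] := integrableP _ _ _ ig.
apply: (@Rintegral_dominated_cvg0 R (fun n t => if window n t then 0 else g t) (fun t => `|g t|)).
- move=> n; apply: measurable_fun_if => //.
    by apply: (measurable_fun_bool true); apply: measurableI => //; exact: measurable_window.
  by apply: measurable_funS mg.
- by move=> n t _; case: ifP => // _; rewrite normr0.
- by have := integrable_norm ig; apply: eq_integrable.
- by move=> t /window_near[N HN]; exists N => n /HN ->.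
Qed.

Lemma tail_integral_lt (g : R -> R) : mu.-integrable D (EFin \o g) ->
  forall e, 0 < e -> exists N, forall n, (N <= n)%N -> forall A : set RM, measurable A ->
    A `<=` D -> [set t : R | window n t] `&` A = set0 ->
    \int[mu]_(t in A) `|g t| < e.
Proof.
move=> ig e e0; have [N HN] := tail_integral ig e0; exists N => n Nn A mA AD wA.
apply: le_lt_trans (HN n Nn).
have iD : mu.-integrable D (EFin \o (fun t => if window n t then 0 else g t)).
  have [/measurable_EFinP mg _] := integrableP _ _ _ ig.
  apply: le_integrable ig => //.
    apply/measurable_EFinP; apply: measurable_fun_if => //.
      by apply: (measurable_fun_bool true); apply: measurableI => //; exact: measurable_window.
    by apply: measurable_funS mg.
  by move=> t _ /=; case: ifP => // _; rewrite lee_fin normr0.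
rewrite (_ : \int[mu]_(t in A) `|g t| =
    \int[mu]_(t in A) `|if window n t then 0 else g t|); last first.
  apply: eq_Rintegral => t; rewrite inE => At; case: ifP => // wt.
  by have : set0 t by rewrite -wA.
apply: fine_le.
- by apply: integrable_fin_num => //; apply: (integrableS _ _ AD) => //; exact: integrable_norm iD.
- by apply: integrable_fin_num => //; exact: integrable_norm iD.
- apply: ge0_subset_integral => //.
  by have /integrableP[] := integrable_norm iD.
Qed.

Lemma FTC_pos (q q' : R -> R) :
  (forall t : R, 0 < t -> is_derive t 1 q (q' t)) ->
  (forall t : R, 0 < t -> {for t, continuous q'}) ->
  forall a b, 0 < a -> a < b -> \int[mu]_(t in `[a, b]) q' t = q b - q a.
Proof.
move=> dq cq' a b a0 ab; rewrite /Rintegral (continuous_FTC2 (F := q) ab)//.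
- apply: continuous_in_subspaceT => t; rewrite inE/= in_itv/= => /andP[ta _].
  by apply: cq'; exact: lt_le_trans ta.
- have cq t : 0 < t -> {for t, continuous q}.
    move=> t0; have dt := dq t t0.
    by apply: differentiable_continuous; apply/derivable1_diffP; exact: ex_derive.
  split.
  + move=> t; rewrite in_itv/= => /andP[ta _].
    by have dt := dq t (lt_trans a0 ta); exact: ex_derive.
  + by apply: cvg_at_right_filter; exact: cq.
  + by apply: cvg_at_left_filter; apply: cq; exact: lt_trans ab.
- move=> t; rewrite in_itv/= => /andP[ta _].
  have dt := dq t (lt_trans a0 ta).
  by rewrite derive1E derive_val.
Qed.

(** No limit at infinity is assumed: integrability of q yields arbitrarily large points where q is
    small, and these serve as right endpoints in the fundamental theorem. *)
Lemma integral_derive_eq0 (q q' : R -> R) :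
  (forall t : R, 0 < t -> is_derive t 1 q (q' t)) ->
  (forall t : R, 0 < t -> {for t, continuous q'}) ->
  mu.-integrable D (EFin \o q') -> mu.-integrable D (EFin \o q) ->
  q t @[t --> 0^'+] --> 0 -> \int[mu]_(t in D) q' t = 0.
Proof.
move=> dq cq' iq' iq q0; set L := \int[mu]_(t in D) q' t.
apply/eqP; rewrite -normr_le0; apply/ler_addgt0Pr => e e0; rewrite add0r.
(* Four errors of this size occur: two tails of the integral of q' and two boundary values of q. *)
have e5 : 0 < e / 5 by rewrite divr_gt0.
have [N1 HN1] := tail_integral_lt iq' e5.
have [N2 HN2] := tail_integral_lt iq e5.
pose n := maxn N1 N2; have {}HN1 := HN1 n (leq_maxl _ _); have {}HN2 := HN2 n (leq_maxr _ _).
have n0 : 0 < n.+1%:R^-1 :> R by rewrite invr_gt0.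
have Lq s t : 0 < s < n.+1%:R^-1 -> n.+1%:R < t -> `|L - (q t - q s)| <= e / 5 + e / 5.
  move=> /andP[s0 sn] tn.
  have st : s < t by rewrite (lt_trans sn)// (le_lt_trans _ tn)// (@le_trans _ _ 1)// ?invf_le1// ler1n.
  have t0 : 0 < t by exact: lt_trans st.
  have iS (i : interval R) : [set` i] `<=` D -> mu.-integrable [set` i] (EFin \o q').
    by move=> iD; apply: integrableS iq'.
  have sub0 x : `]0, x]%classic `<=` D by move=> y /=; rewrite !in_itv/= => /andP[->].
  have subt : `]t, +oo[%classic `<=` D.
    by move=> y /=; rewrite !in_itv/= !andbT; exact: lt_trans.
  have -> : L - (q t - q s) =
      \int[mu]_(x in `]t, +oo[) q' x + \int[mu]_(x in `]0, s]) q' x.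
    rewrite -(FTC_pos dq cq' s0 st) -Rintegral_itv_obnd_cbnd; last first.
      by apply: iS => y /=; rewrite !in_itv/= andbT => /andP[/(lt_trans s0)].
    rewrite -(@Rintegral_itvB _ q' (BRight 0) (BRight t) s)//; last 3 first.
    - exact: (iS `]0, t]).
    - by rewrite bnd_simp ltW.
    - by rewrite bnd_simp ltW.
    rewrite -(@Rintegral_itvB _ q' (BRight 0) +oo%O t)//; last by rewrite bnd_simp ltW.
    by rewrite -/L; ring.
  rewrite (le_trans (ler_normD _ _))// lerD//.
    rewrite (le_trans (le_normr_Rintegral _ _))//; first exact: (iS `]t, +oo[).
    apply/ltW/HN1 => //; apply/seteqP; split => // y /= [/andP[_ yn]].
    by rewrite in_itv/= andbT => /(lt_trans tn); rewrite ltNge yn.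
  rewrite (le_trans (le_normr_Rintegral _ _))//; first exact: (iS `]0, s]).
  apply/ltW/HN1 => //; apply/seteqP; split => // y /= [/andP[yn _]].
  by rewrite in_itv/= => /andP[_ ys]; move: (le_lt_trans ys sn); rewrite ltNge yn.
have [s [s0 sn qs]] : exists s, [/\ 0 < s, s < n.+1%:R^-1 & `|q s| <= e / 5].
  have /cvgrPdist_le/(_ _ e5) q0' := q0.
  near (0 : R)^'+ => s; exists s; split; near: s.
  - exact: nbhs_right_gt.
  - exact: nbhs_right_lt.
  - by move: q0'; apply: filterS => s; rewrite sub0r normrN.
(* Otherwise q exceeds e / 5 in modulus on an interval of length 1 outside the window, against the
   tail estimate for q. *)
have [t tn qt] : exists2 t, n.+1%:R < t & `|q t| <= e / 5.
  apply: contrapT => /forall2NP nt.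
  pose A : set RM := `]n.+1%:R, n.+2%:R]%classic.
  have AD : A `<=` D.
    by move=> y /=; rewrite !in_itv/= andbT => /andP[+ _]; apply: lt_trans.
  have := HN2 A (measurable_itv _) AD.
  rewrite ltNge => /(_ _)/negP; apply.
    apply/seteqP; split => // y /= [/andP[_ yn]].
    by rewrite /A/= in_itv/= => /andP[]; rewrite ltNge yn.
  have muA : fine (mu A) = 1.
    rewrite lebesgue_measure_itv/= lte_fin ltr_nat ltnSn/=.
    by rewrite -natrB// subSnn.
  rewrite -[leLHS]mulr1 -[X in _ * X]muA -Rintegral_cst; last exact: measurable_itv.
  apply: le_Rintegral; first exact: measurable_itv.
  - apply: measurable_bounded_integrable => //.
    + exact: measurable_itv.
    + rewrite [X in (X < _)%E](_ : _ = mu A)//.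
      by rewrite /A lebesgue_measure_itv/=; case: ifP => _; rewrite -?EFinB ltry.
    + exists (e / 5); split => [|x /ltW ex y _ /=]; first exact: num_real.
      by rewrite ger0_norm// ltW.
  - have iA : mu.-integrable A (EFin \o q) by apply: integrableS iq => //; exact: measurable_itv.
    by have := integrable_norm iA; apply: eq_integrable => //; exact: measurable_itv.
  - move=> y; rewrite /A/= in_itv/= => /andP[ny _].
    by case: (nt y) => // /negP; rewrite -ltNge => /ltW.
have := Lq s t; rewrite s0 sn tn => /(_ isT isT).
have -> : `|L| = `|L - (q t - q s) + (q t - q s)| by rewrite subrK.
move=> LL; rewrite (le_trans (ler_normD _ _))// (le_trans (lerD LL (ler_normB _ _)))//.
by move: qt qs; lra.
Unshelve. all: by end_near. Qed.


End boundary_terms.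

(** * Seminormed spaces and bounded operators *)

Section seminormed_spaces.
Context {R : realType}.

(** Definiteness is a separate hypothesis wherever it matters, because elements of [L1] are not
    identified almost everywhere. *)
Definition seminormed (E : nspace R) :=
  [/\ car (0 : amb E),
      forall a (x y : amb E), car x -> car y -> car (a *: x + y),
      forall x : amb E, car x -> 0 <= nrm x,
      forall x y : amb E, car x -> car y -> nrm (x + y) <= nrm x + nrm y
    & forall a (x : amb E), car x -> nrm (a *: x) = cabs a * nrm x].

(** In contrast with [bounded_op], nothing is imposed outside [car], so a raw map such as [T t]
    qualifies; [restr] then turns it into an element of [Bop]. *)
Definition bounded_linear (E F : nspace R) (S : amb E -> amb F) :=
  [/\ forall x, car x -> car (S x),
      forall a x y, car x -> car y -> S (a *: x + y) = a *: S x + S y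
    & exists M : R, forall x, car x -> nrm (S x) <= M * nrm x].

Definition linear_subset (V : lmodType R[i]) (P : set V) :=
  P 0 /\ forall a x y, P x -> P y -> P (a *: x + y).

Lemma linear_subsetZ (V : lmodType R[i]) (P : set V) a x :
  linear_subset P -> P x -> P (a *: x).
Proof. by move=> [P0 PL] Px; rewrite -[_ *: _]addr0; exact: PL. Qed.

Lemma linear_subsetD (V : lmodType R[i]) (P : set V) x y :
  linear_subset P -> P x -> P y -> P (x + y).
Proof. by move=> [P0 PL] Px Py; rewrite -[x]scale1r; exact: PL. Qed.

Lemma linear_subsetN (V : lmodType R[i]) (P : set V) x :
  linear_subset P -> P x -> P (- x).
Proof. by move=> PL Px; rewrite -scaleN1r; exact: linear_subsetZ. Qed.

Lemma linear_subsetB (V : lmodType R[i]) (P : set V) x y :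
  linear_subset P -> P x -> P y -> P (x - y).
Proof. by move=> PL Px Py; apply: linear_subsetD => //; exact: linear_subsetN. Qed.

Section theory.
Context (E : nspace R) (sE : seminormed E).
Implicit Types x y z : amb E.

Lemma seminormed_linear : linear_subset (@car R E).
Proof. by case: sE. Qed.

Lemma nrm_ge0 x : car x -> 0 <= nrm x. Proof. by case: sE => _ _ + _ _; exact. Qed.

Lemma nrmD x y : car x -> car y -> nrm (x + y) <= nrm x + nrm y.
Proof. by case: sE => _ _ _ + _; exact. Qed.

Lemma nrmZ a x : car x -> nrm (a *: x) = cabs a * nrm x.
Proof. by case: sE => _ _ _ _; exact. Qed.

Lemma nrmN x : car x -> nrm (- x) = nrm x.
Proof.
by move=> cx; rewrite -scaleN1r nrmZ// cabsN (_ : 1 = 1%:C)// cabs_real normr1 mul1r.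
Qed.

Lemma nrm0 : nrm (0 : amb E) = 0.
Proof.
have [c0 _] := seminormed_linear.
by rewrite -(scale0r (0 : amb E)) nrmZ// cabs0 mul0r.
Qed.

Lemma nrmB x y : car x -> car y -> nrm (x - y) <= nrm x + nrm y.
Proof.
move=> cx cy; rewrite -(nrmN cy) nrmD//.
exact: linear_subsetN seminormed_linear _.
Qed.

Lemma nrmBC x y : car x -> car y -> nrm (x - y) = nrm (y - x).
Proof.
move=> cx cy; rewrite -nrmN ?opprB//.
exact: linear_subsetB seminormed_linear _ _.
Qed.

Lemma nrm_trans y x z : car x -> car y -> car z ->
  nrm (x - z) <= nrm (x - y) + nrm (y - z).
Proof.
move=> cx cy cz; have := nrmD (linear_subsetB seminormed_linear cx cy)
  (linear_subsetB seminormed_linear cy cz).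
by rewrite addrA subrK.
Qed.

Lemma seminormed_sub (C : set (amb E)) : C `<=` @car R E -> linear_subset C ->
  seminormed (@NSpace R (amb E) C (@nrm R E)).
Proof.
move=> CE [C0 CL]; split => //=.
- by move=> x /CE; exact: nrm_ge0.
- by move=> x y /CE cx /CE cy; exact: nrmD.
- by move=> a x /CE; exact: nrmZ.
Qed.

Lemma nclosure_linear (P : set (amb E)) : P `<=` @car R E -> linear_subset P ->
  linear_subset (nclosure P).
Proof.
move=> PE PL; have [P0 PL'] := PL; have [c0 cL] := seminormed_linear; split.
  by split => // e e0; exists 0 => //; rewrite subr0 nrm0.
move=> a x y [cx ax] [cy ay]; split; first exact: cL.
move=> e e0.
have e2 : 0 < e / 2 by rewrite divr_gt0.
have ca : 0 < cabs a + 1 by rewrite ltr_wpDl ?cabs_ge0.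
have [x' Px' xx'] := ax _ (divr_gt0 e2 ca); have [y' Py' yy'] := ay _ e2.
exists (a *: x' + y'); first exact: PL'.
have cdx := linear_subsetB seminormed_linear cx (PE _ Px').
have cdy := linear_subsetB seminormed_linear cy (PE _ Py').
rewrite opprD addrACA -scalerBr.
rewrite (le_lt_trans (nrmD (linear_subsetZ a seminormed_linear cdx) cdy))//.
rewrite nrmZ// [e]splitr ltr_leD//; last exact: ltW.
rewrite (@le_lt_trans _ _ ((cabs a + 1) * nrm (x - x')))//.
  by rewrite ler_wpM2r ?nrm_ge0// lerDl.
by rewrite -ltr_pdivlMl// mulrC.
Qed.

Lemma sub_nclosure (P : set (amb E)) : P `<=` @car R E -> P `<=` nclosure P.
Proof. by move=> PE x Px; split; [exact: PE|move=> e e0; exists x => //; rewrite subrr nrm0]. Qed.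

Lemma nclosure_idem (P : set (amb E)) x : P `<=` @car R E -> car x ->
  (forall e : R, 0 < e -> exists2 a, nclosure P a & nrm (x - a) < e) -> nclosure P x.
Proof.
move=> PE cx ax; split => // e e0; have e2 : 0 < e / 2 by rewrite divr_gt0.
have [a [ca aa] xa] := ax _ e2; have [b Pb ab] := aa _ e2.
exists b => //; rewrite (le_lt_trans (nrm_trans cx ca (PE _ Pb)))//.
by rewrite [e]splitr ltrD.
Qed.

Lemma nrm_eq0_approx x : car x -> (forall e : R, 0 < e -> nrm x <= e) -> nrm x = 0.
Proof.
by move=> cx xe; apply/eqP; rewrite eq_le nrm_ge0// andbT; apply/ler_addgt0Pr => e /xe;
  rewrite add0r.
Qed.

End theory.

Section operators.
Context (E F : nspace R) (sE : seminormed E) (sF : seminormed F).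
Implicit Types S : amb E -> amb F.

Lemma bounded_linear0 S : bounded_linear S -> S 0 = 0.
Proof.
move=> [_ SL _]; have [c0 _] := seminormed_linear sE.
have := SL (-1) 0 0 c0 c0; rewrite scaler0 addr0 => S0.
by rewrite [LHS]S0 scaleN1r addNr.
Qed.

Lemma bounded_linearZ S a x : bounded_linear S -> car x -> S (a *: x) = a *: S x.
Proof.
move=> bS cx; have [_ SL _] := bS; have [c0 _] := seminormed_linear sE.
by rewrite -[a *: x]addr0 SL// (bounded_linear0 bS) addr0.
Qed.

Lemma bounded_linearD S x y : bounded_linear S -> car x -> car y -> S (x + y) = S x + S y.
Proof. by move=> [_ SL _] cx cy; rewrite -{1}[x]scale1r SL// scale1r. Qed.

Lemma bounded_linearN S x : bounded_linear S -> car x -> S (- x) = - S x.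
Proof. by move=> bS cx; rewrite -scaleN1r bounded_linearZ// scaleN1r. Qed.

Lemma bounded_linearB S x y : bounded_linear S -> car x -> car y -> S (x - y) = S x - S y.
Proof.
move=> bS cx cy; rewrite bounded_linearD// ?bounded_linearN//.
exact: linear_subsetN (seminormed_linear sE) _.
Qed.

Let opset S := [set nrm (S x) | x in [set x | car x /\ nrm x <= 1]].

Let opset_sup S : bounded_linear S -> has_sup (opset S).
Proof.
move=> [cS _ [M SM]]; have [c0 _] := seminormed_linear sE; split.
  by exists (nrm (S 0)), 0 => //; split => //; rewrite (nrm0 sE).
exists `|M| => _ [x [cx x1] <-]; rewrite (le_trans (SM _ cx))//.
rewrite (@le_trans _ _ (`|M| * nrm x))// ?ler_wpM2r ?ler_norm ?nrm_ge0//.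
by rewrite ler_piMr.
Qed.

Lemma opnorm_bound S x : bounded_linear S -> car x -> nrm (S x) <= opnorm S * nrm x.
Proof.
move=> bS cx; have [cS SL [M SM]] := bS.
(* Under a seminorm x cannot be normalized when its norm is 0; there boundedness of [S] gives the
   claim directly. *)
have [x0|x0] := eqVneq (nrm x) 0.
  by have := SM _ cx; rewrite x0 !mulr0.
have xgt0 : 0 < nrm x by rewrite lt_neqAle eq_sym x0 nrm_ge0.
rewrite -ler_pdivrMr// mulrC -[X in X * _](ger0_norm (ltW (_ : 0 < (nrm x)^-1)))?invr_gt0//.
have cy : car ((nrm x)^-1%:C *: x) by exact: linear_subsetZ (seminormed_linear sE) _.
rewrite -cabs_real -(nrmZ sF _ (cS _ cx)) -bounded_linearZ//.
apply: ub_le_sup; first by case: (opset_sup bS).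
exists ((nrm x)^-1%:C *: x) => //; split => //.
by rewrite (nrmZ sE)// cabs_real ger0_norm ?invr_ge0 ?(ltW xgt0)// mulVf// lexx.
Qed.

Lemma opnorm_ge0 S : bounded_linear S -> 0 <= opnorm S.
Proof.
move=> bS; have [c0 _] := seminormed_linear sE.
apply: ub_le_sup; first by case: (opset_sup bS).
by exists 0; [rewrite /= (nrm0 sE)|rewrite (bounded_linear0 bS) (nrm0 sF)].
Qed.

Lemma opnorm_le S c : bounded_linear S -> 0 <= c ->
  (forall x, car x -> nrm (S x) <= c * nrm x) -> opnorm S <= c.
Proof.
move=> bS c0 Sc; apply: ge_sup; first by case: (opset_sup bS).
by move=> _ [x [cx x1] <-]; rewrite (le_trans (Sc _ cx))// ler_piMr.
Qed.

End operators.

Section operator_algebra.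
Context (E : nspace R) (sE : seminormed E).

Lemma bounded_op_linear S : bounded_op (E := E) S -> bounded_linear (E := E) (F := E) S.
Proof. by case. Qed.

Lemma bounded_op_subset : linear_subset (@bounded_op R E).
Proof.
have [c0 cL] := seminormed_linear sE; split.
  split => //=; first by move=> a x y; rewrite scaler0 addr0.
  by exists 0 => x cx; rewrite (nrm0 sE) mul0r.
move=> a S1 S2 [c1 L1 [M1 B1] z1] [c2 L2 [M2 B2] z2]; split.
- by move=> x cx; apply: cL; [exact: c1|exact: c2].
- move=> b x y cx cy; rewrite !fctE L1// L2//.
  by rewrite !scalerDr !scalerA [b * a]mulrC addrACA.
- exists (cabs a * M1 + M2) => x cx.
  rewrite (le_trans (nrmD sE (linear_subsetZ a (seminormed_linear sE) (c1 _ cx)) (c2 _ cx)))//.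
  rewrite (nrmZ sE _ (c1 _ cx)) mulrDl -mulrA lerD ?B2//.
  by rewrite ler_wpM2l ?cabs_ge0 ?B1.
- by move=> x nx; rewrite !fctE z1// z2// scaler0 addr0.
Qed.

Lemma seminormed_Bop : seminormed (Bop E).
Proof.
have [c0 cL] := bounded_op_subset.
split => //.
- by move=> S /bounded_op_linear; exact: opnorm_ge0.
- move=> S1 S2 b1 b2; have l1 := bounded_op_linear b1; have l2 := bounded_op_linear b2.
  have b12 := linear_subsetD bounded_op_subset b1 b2.
  change (opnorm (E := E) (F := E) (S1 + S2) <=
    opnorm (E := E) (F := E) S1 + opnorm (E := E) (F := E) S2).
  apply: (opnorm_le sE (bounded_op_linear b12)).
    by rewrite addr_ge0 ?(opnorm_ge0 sE sE).
  move=> x cx; have [cS1 _ _] := l1; have [cS2 _ _] := l2.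
  by rewrite (le_trans (nrmD sE (cS1 _ cx) (cS2 _ cx)))// mulrDl lerD ?(opnorm_bound sE sE).
- move=> a S b; have l := bounded_op_linear b; have [cS _ _] := l.
  (* One inequality for all scalars: applied to a and to its inverse it yields equality. *)
  have H a' S' : bounded_op (E := E) S' ->
      opnorm (E := E) (F := E) (a' *: S' : amb (Bop E)) <=
      cabs a' * opnorm (E := E) (F := E) S'.
    move=> b'; have l' := bounded_op_linear b'; have [cS' _ _] := l'.
    apply: (opnorm_le sE (bounded_op_linear (linear_subsetZ a' bounded_op_subset b'))).
      by rewrite mulr_ge0 ?cabs_ge0 ?(opnorm_ge0 sE sE).
    move=> x cx; rewrite (nrmZ sE a' (cS' _ cx)) -mulrA ler_wpM2l ?cabs_ge0//.
    exact: opnorm_bound.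
  apply/eqP; rewrite eq_le H//=.
  have [->|a0] := eqVneq a 0.
    rewrite cabs0 mul0r (opnorm_ge0 sE sE)//; apply: bounded_op_linear.
    by rewrite scale0r; have [] := bounded_op_subset.
  have ca : 0 < cabs a.
    by rewrite lt_neqAle cabs_ge0 andbT eq_sym; apply: contra_neq a0; exact: cabs0_eq0.
  rewrite -ler_pdivlMl//.
  have -> : (cabs a)^-1 = cabs a^-1.
    by apply: (mulfI (lt0r_neq0 ca)); rewrite divff ?gt_eqF// -cabsM divff// (_ : 1 = 1%:C)// cabs_real normr1.
  rewrite -{1}[S](scalerK a0).
  by apply: H; apply: linear_subsetZ => //; exact: bounded_op_subset.
Qed.

Lemma bounded_op_comp S1 S2 : bounded_op (E := E) S1 -> bounded_op (E := E) S2 ->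
  bounded_op (E := E) (S1 \o S2).
Proof.
move=> b1 b2; have [c1 L1 [M1 B1] z1] := b1; have [c2 L2 [M2 B2] z2] := b2; split => /=.
- by move=> x cx; exact/c1/c2.
- by move=> a x y cx cy; rewrite L2// L1//; exact: c2.
- exists (`|M1| * M2) => x cx; rewrite (le_trans (B1 _ (c2 _ cx)))//.
  rewrite (@le_trans _ _ (`|M1| * nrm (S2 x)))//.
    by rewrite ler_wpM2r ?ler_norm// (nrm_ge0 sE)//; exact: c2.
  by rewrite -mulrA ler_wpM2l ?B2.
- by move=> x nx; rewrite z2// (bounded_linear0 sE (bounded_op_linear b1)).
Qed.

Lemma opnorm_comp S1 S2 : bounded_op (E := E) S1 -> bounded_op (E := E) S2 ->
  opnorm (E := E) (F := E) (S1 \o S2) <=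
    opnorm (E := E) (F := E) S1 * opnorm (E := E) (F := E) S2.
Proof.
move=> b1 b2; have l1 := bounded_op_linear b1; have l2 := bounded_op_linear b2.
apply: (opnorm_le sE (bounded_op_linear (bounded_op_comp b1 b2))).
  by rewrite mulr_ge0 ?(opnorm_ge0 sE sE).
move=> x cx; have [c2 _ _] := l2.
rewrite (le_trans (opnorm_bound sE sE l1 (c2 _ cx)))// -mulrA ler_wpM2l ?(opnorm_ge0 sE sE)//.
exact: opnorm_bound.
Qed.

End operator_algebra.

End seminormed_spaces.

(** * Dual pairings and weak integrals *)

Section norms.
Context {R : realType}.

Lemma normE_Re (V : normedModType R[i]) (x : V) : `|x| = (complex.Re `|x|)%:C.
Proof. by have := normr_ge0 x; case: `|x| => a b; rewrite lecE/= => /andP[/eqP -> _]. Qed.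

Lemma rnorm_ge0 (V : normedModType R[i]) (x : V) : 0 <= complex.Re `|x|.
Proof. by have := normr_ge0 x; rewrite {1}normE_Re lecR. Qed.

Lemma rnormD (V : normedModType R[i]) (x y : V) :
  complex.Re `|x + y| <= complex.Re `|x| + complex.Re `|y|.
Proof. by have := ler_normD x y; rewrite (normE_Re (x + y)) (normE_Re x) (normE_Re y) -rmorphD lecR. Qed.

Lemma rnormZ (V : normedModType R[i]) a (x : V) :
  complex.Re `|a *: x| = cabs a * complex.Re `|x|.
Proof. by rewrite normrZ normE_cabs [in LHS]normE_Re -rmorphM. Qed.

Lemma rnorm_eq0 (V : normedModType R[i]) (x : V) : complex.Re `|x| = 0 -> x = 0.
Proof. by move=> x0; apply/normr0_eq0; rewrite normE_Re x0. Qed.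

Lemma seminormed_banach (X : completeNormedModType R[i]) : seminormed (banach X).
Proof.
split => //=.
- by move=> x _; exact: rnorm_ge0.
- by move=> x y _ _; exact: rnormD.
- by move=> a x _; exact: rnormZ.
Qed.

Lemma seminormed_scalars : seminormed (scalars R).
Proof.
split => //=.
- by move=> x _; exact: cabs_ge0.
- by move=> x y _ _; exact: cabsD.
- by move=> a x _; exact: cabsM.
Qed.

Lemma continuous_linear_bounded (V W : normedModType R[i]) (f : V -> W) :
  linear f -> continuous f ->
  exists2 M, 0 <= M & forall x, complex.Re `|f x| <= M * complex.Re `|x|.
Proof.
move=> lf cf.
have f0 : f 0 = 0.
  by have := lf (-1) 0 0; rewrite scaler0 addr0 scaleN1r addNr.
have fZ a x : f (a *: x) = a *: f x by have := lf a x 0; rewrite f0 !addr0.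
have /cvgrPdist_lt/(_ 1 ltr01) := cf 0.
move=> /nbhs_ballP[d /= d0 dB].
have dE : d = (complex.Re d)%:C.
  by move: d0; case: d {dB} => a b; rewrite ltcE/= => /andP[/eqP ->].
have rd : 0 < complex.Re d by move: d0; rewrite dE ltcR.
set r := complex.Re d in dE rd.
exists (2 / r) => [|x]; first by rewrite divr_ge0// ltW.
have [x0|x0] := eqVneq (complex.Re `|x|) 0.
  by rewrite (rnorm_eq0 x0) f0 !normr0 mulr0.
have xp : 0 < complex.Re `|x| by rewrite lt_neqAle eq_sym x0 rnorm_ge0.
pose c := r / 2 / complex.Re `|x|.
have cp : 0 < c by rewrite !divr_gt0.
have := dB (c%:C *: x); rewrite -ball_normE/= sub0r normrN (normE_Re (c%:C *: x)) rnormZ cabs_real.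
rewrite (ger0_norm (ltW cp)) /c divfK// dE ltcR ltr_pdivrMr// ltr_pMr// ltr1n => /(_ isT).
rewrite f0 sub0r normrN fZ (normE_Re (c%:C *: f x)) rnormZ cabs_real (ger0_norm (ltW cp)).
rewrite (_ : 1 = 1%:C)// ltcR => /ltW; rewrite mulrC -ler_pdivlMr// div1r => /le_trans; apply.
by rewrite /c !invf_div mulrC.
Qed.

Lemma banach_complete (X : completeNormedModType R[i]) (u : nat -> X) :
  (forall e, 0 < e -> exists N, forall n m, (N <= n)%N -> (N <= m)%N ->
     complex.Re `|u n - u m| < e) ->
  exists y, forall e, 0 < e -> exists N, forall n, (N <= n)%N ->
     complex.Re `|u n - y| < e.
Proof.
move=> ucauchy.
have posC (e : R[i]) : 0 < e -> e = (complex.Re e)%:C /\ 0 < complex.Re e.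
  by case: e => a b; rewrite ltcE/= => /andP[/eqP -> a0].
have : cvg (u n @[n --> \oo]).
  apply: cauchy_cvg; apply: cauchy_exP => e /posC[-> e0].
  have [N HN] := ucauchy _ e0; exists (u N); exists N => // n Nn /=.
  by rewrite -ball_normE/= normE_Re ltcR; exact: HN.
move=> /cvgrPdist_lt ucvg; exists (lim (u n @[n --> \oo])) => e e0.
have [|N _ HN] := ucvg e%:C; first by rewrite ltcR.
by exists N => n Nn; have := HN n Nn; rewrite /= distrC normE_Re ltcR.
Qed.

(** Only s is confined to [a, b], while t may leave it: translates of a function on [a, b] are
    compared across its endpoints. *)
Lemma heine (k : R -> R) a b : (forall t, a <= t <= b -> {for t, continuous k}) ->
  forall e, 0 < e -> exists2 d, 0 < d &
    forall s t, a <= s <= b -> `|t - s| < d -> `|k t - k s| < e.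
Proof.
move=> ck e e0.
have /compact_near_coveringP := @segment_compact R a b.
move=> /(_ R (0^'+) (fun d s => forall t, `|t - s| < d -> `|k t - k s| < e)) H.
have : \forall d \near 0^'+, `[a, b] `<=` (fun s => forall t, `|t - s| < d -> `|k t - k s| < e).
  apply: H => x /=; rewrite in_itv/= => xab.
  have e2 : 0 < e / 2 by rewrite divr_gt0.
  have /cvgrPdist_lt/(_ _ e2)/nbhs_ballP[d /= d0 dB] := ck x xab.
  have d2 : 0 < d / 2 by rewrite divr_gt0.
  exists (ball x (d / 2), [set d' | d' < d / 2]) => /=.
    by split; [exact: nbhsx_ballx|exact: nbhs_right_lt].
  move=> [x' d'] /= [xx' dd'] t tx'.
  rewrite -[k t - k x'](subrKA (k x)) (le_lt_trans (ler_normD _ _))// [e]splitr ltrD//.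
    rewrite distrC; apply: dB; rewrite -ball_normE/=.
    rewrite -(subrKA x') (le_lt_trans (ler_normD _ _))// [d]splitr ltrD//.
    by rewrite distrC (lt_trans tx').
  by apply: dB; move: xx'; rewrite -!ball_normE/= => /lt_trans; apply; rewrite ltr_pdivrMr// ltr_pMr// ltr1n.
move=> HH; have [d [d0 Hd]] := filter_ex (filterI (nbhs_right_gt (0 : R)) HH).
by exists d => // s t sab; apply: Hd; rewrite /= in_itv.
Qed.

End norms.

(** * Functionals of a dual pairing and the weak topology *)

Section dual_pairing_theory.
Context {R : realType} (X : completeNormedModType R[i]) (Xs : set (X -> R[i]^o)).
Hypothesis dp : dual_pairing Xs.
Local Notation N := (@nrm R (banach X)).

Lemma dualZ a l : Xs l -> Xs (fun x => a * l x).
Proof.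
case: dp => _ [X0 XL] _ _ Xl.
rewrite (_ : (fun _ => _) = a *: l + 0); first exact: XL.
by apply/funext => x; rewrite addr0.
Qed.

Lemma dual_linear l : Xs l -> linear l. Proof. by case: dp => + _ _ _ => /[apply] -[]. Qed.

Lemma dualB l x y : Xs l -> l (x - y) = l x - l y.
Proof. by move=> Xl; rewrite addrC -scaleN1r (dual_linear Xl) scaleN1r addrC. Qed.

Lemma dualD l x y : Xs l -> l (x + y) = l x + l y.
Proof. by move=> Xl; have := dual_linear Xl 1 x y; rewrite !scale1r. Qed.

Lemma dual0 l : Xs l -> l 0 = 0.
Proof. by move=> Xl; rewrite -(subrr 0) dualB// subrr. Qed.

Lemma dualM l a x : Xs l -> l (a *: x) = a * l x.
Proof. by move=> Xl; have := dual_linear Xl a x 0; rewrite dual0// !addr0. Qed.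

Lemma dual_bounded l : Xs l -> exists2 M, 0 <= M & forall x, cabs (l x) <= M * N x.
Proof.
by case: dp => + _ _ _ => /[apply] -[ll cl]; exact: (continuous_linear_bounded ll cl).
Qed.

Definition dual_ball l := Xs l /\ forall x, cabs (l x) <= N x.

(** The dual ball is stable under unimodular factors, so by [cabs_rotate] the supremum of the moduli
    is already reached through real parts. *)
Lemma norm_le_dual x c : (forall l, dual_ball l -> complex.Re (l x) <= c) -> N x <= c.
Proof.
case: (dp) => _ [X0 _] nx _ xc; change (complex.Re `|x| <= c); rewrite nx; apply: ge_sup.
  exists (cabs (0 : R[i])), 0 => //; split => //.
  rewrite /opnorm (_ : [set _ | _ in _] = [set 0]) ?sup1//.
  apply/seteqP; split => [_ [y _ <-]/=|_ ->]; first by rewrite cabs0.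
  by exists 0; rewrite /= ?cabs0// normr0.
move=> _ [l [Xl l1] <-]; have [c' c'1 <-] := cabs_rotate (l x).
apply: (xc (fun x => c' * l x)); split; first exact: dualZ.
move=> y; rewrite cabsM c'1 mul1r.
have bl : bounded_linear (E := banach X) (F := scalars R) l.
  split => //; first by move=> a u v _ _; rewrite (dual_linear Xl).
  by have [M _ lM] := dual_bounded Xl; exists M => u _; exact: lM.
have := opnorm_bound (seminormed_banach X) seminormed_scalars bl (x := y) I.
move=> /le_trans; apply; rewrite ler_piMl//; exact: rnorm_ge0.
Qed.

Lemma dual_separates x : (forall l, Xs l -> complex.Re (l x) = 0) -> x = 0.
Proof.
move=> x0; apply: rnorm_eq0; apply/eqP; rewrite eq_le rnorm_ge0 andbT.
by apply: norm_le_dual => l [Xl _]; rewrite x0.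
Qed.

Lemma sigma_continuous l : Xs l -> continuous (l : sigma_top Xs -> R[i]^o).
Proof.
move=> Xl x U Ul.
have /cvg_sup /(_ (exist _ l Xl)) H := @cvg_id _ (nbhs ((fun l => sval l x) :
  prod_topology (fun _ : {l | Xs l} => R[i]^o))).
have := @initial_continuous _ _ (fun x : X =>
    (fun l => sval l x) : prod_topology (fun _ : {l | Xs l} => R[i]^o)) x.
move=> /(_ ((fun f => f (exist _ l Xl)) @^-1` U)); apply.
suff : @nbhs _ (initial_topology (fun f : prod_topology (fun _ : {l | Xs l} => R[i]^o) =>
    f (exist _ l Xl))) (fun l => sval l x) ((fun f => f (exist _ l Xl)) @^-1` U) by exact: H.
move: Ul; rewrite nbhsE => -[V [oV Vx] VU].
rewrite nbhsE; exists ((fun f => f (exist _ l Xl)) @^-1` V); first by split => //; exists V.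
by move=> f /= /VU.
Qed.

Lemma sigma_continuous_to (z : R -> X) : (forall l, Xs l -> continuous (l \o z : R -> R[i]^o)) ->
  continuous (z : R -> sigma_top Xs).
Proof.
move=> cz; apply: continuous_comp_initial => t; apply/cvg_sup => -[l Xl].
move: t; apply/(@continuousP _ (initial_topology
  (fun f : prod_topology (fun _ : {l | Xs l} => R[i]^o) => f (exist _ l Xl)))) => A [B oB <-].
have /continuousP/(_ _ oB) := cz l Xl; exact.
Qed.

End dual_pairing_theory.

(** * Riemann sums weighted by an integrable density *)

Section partitions.
Context {R : realType}.
Local Notation mu := (@lebesgue_measure R).
Local Notation RM := (measurableTypeR R).

Lemma real_integrableD (A : set RM) (f g : RM -> R) : measurable A ->
  mu.-integrable A (EFin \o f) -> mu.-integrable A (EFin \o g) ->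
  mu.-integrable A (EFin \o (fun t => f t + g t)).
Proof. by move=> mA i1 i2; have := integrableD mA i1 i2; apply: eq_integrable. Qed.

Lemma real_integrableZ (A : set RM) c (f : RM -> R) : measurable A ->
  mu.-integrable A (EFin \o f) -> mu.-integrable A (EFin \o (fun t => c * f t)).
Proof. by move=> mA i1; have := integrableZl mA c i1; apply: eq_integrable. Qed.

Lemma mu_itv_lty (a b : R) : (mu `[a, b] < +oo)%E.
Proof. by rewrite lebesgue_measure_itv/=; case: ifP => _; rewrite -?EFinB ltry. Qed.

Definition pt (a b : R) (n k : nat) : R := a + (b - a) * (k%:R / n.+1%:R).

Lemma pt0 a b n : pt a b n 0 = a.
Proof. by rewrite /pt mul0r mulr0 addr0. Qed.

Lemma ptn a b n : pt a b n n.+1 = b.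
Proof. by rewrite /pt divff ?pnatr_eq0// mulr1 subrKC. Qed.

Lemma ptS a b n k : pt a b n k.+1 = pt a b n k + (b - a) / n.+1%:R.
Proof. by rewrite /pt -natr1; field; rewrite addrC natr1 pnatr_eq0. Qed.

Lemma pt_le a b n k m : a <= b -> (k <= m)%N -> pt a b n k <= pt a b n m.
Proof.
move=> ab km; rewrite lerD2l ler_wpM2l ?subr_ge0//.
by rewrite ler_wpM2r ?invr_ge0// ler_nat.
Qed.

Lemma pt_itv a b n k : a <= b -> (k <= n.+1)%N -> a <= pt a b n k <= b.
Proof.
move=> ab kn; rewrite -{1}(pt0 a b n) pt_le//=.
by rewrite -{2}(ptn a b n) pt_le.
Qed.

Lemma partition_integral a b n m (h : R -> R) : a <= b ->
  mu.-integrable `[a, b] (EFin \o h) -> (m <= n.+1)%N ->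
  \int[mu]_(t in `[a, pt a b n m[) h t =
  \sum_(k < m) \int[mu]_(t in `[pt a b n k, pt a b n k.+1[) h t.
Proof.
move=> ab ih; elim: m => [|m IH] mn.
  by rewrite big_ord0 pt0 set_itvco0 Rintegral_set0.
have /andP[am mb] := pt_itv ab (ltnW mn).
have /andP[_ m1b] := pt_itv ab mn.
have mm : pt a b n m <= pt a b n m.+1 by exact: pt_le.
rewrite big_ord_recr/= -(IH (ltnW mn)).
have E : `[a, pt a b n m.+1[%classic =
    `[a, pt a b n m[%classic `|` `[pt a b n m, pt a b n m.+1[%classic.
  by rewrite -itv_bndbnd_setU// bnd_simp.
rewrite E Rintegral_setU//.
  rewrite -E; apply: integrableS ih => // t /=.
  by rewrite !in_itv/= => /andP[-> /ltW /le_trans]; exact.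
apply/disj_setPS => t /= []; rewrite !in_itv/= => /andP[_ tm] /andP[mt _].
by move: tm; rewrite ltNge mt.
Qed.

Lemma mesh_small (a b d : R) : 0 < d -> exists N, forall n, (N <= n)%N -> (b - a) / n.+1%:R < d.
Proof.
move=> d0; exists (Num.truncn ((b - a) / d)) => n Nn.
rewrite ltr_pdivrMr// mulrC -ltr_pdivrMr// (lt_le_trans (truncnS_gt _))//.
by rewrite ler_nat.
Qed.

Lemma integrable_mul_continuous (a b : R) (g F : RM -> R) :
  mu.-integrable `[a, b] (EFin \o g) ->
  (forall t, a <= t <= b -> {for t, continuous F}) ->
  mu.-integrable `[a, b] (EFin \o (fun t => g t * F t)).
Proof.
move=> ig cF.
have cFs : {within `[a, b], continuous F}.
  by apply: continuous_in_subspaceT => t; rewrite inE/= in_itv/=; exact: cF.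
have /compact_bounded bF := continuous_compact cFs (segment_compact (a:=a) (b:=b)).
have mF : measurable_fun `[a, b] F by exact: subspace_continuous_measurable_fun.
have := @integrableMl _ RM R mu `[a, b] _ (EFin \o g) F ig mF; apply => //.
by case: bF => M [Mr HM]; exists M; split => // x Mx t tab; apply: HM => //; exists t.
Qed.

(** On a small cell F oscillates by less than e. Weighting each cell by its mass under g rather than
    by its length lets g be merely integrable, and makes the weights nonnegative with total mass the
    integral of g, as a convex combination requires. *)
Lemma riemann_sum (a b : R) (g F : RM -> R) : a <= b ->
  measurable_fun `[a, b] g -> (forall t, a <= t <= b -> 0 <= g t) ->
  mu.-integrable `[a, b] (EFin \o g) ->
  (forall t, a <= t <= b -> {for t, continuous F}) ->
  forall e, 0 < e -> exists N, forall n, (N <= n)%N ->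
  `|\int[mu]_(t in `[a, b[) (g t * F t) -
    \sum_(k < n.+1) (\int[mu]_(t in `[pt a b n k, pt a b n k.+1[) g t) * F (pt a b n k)|
    <= e * \int[mu]_(t in `[a, b[) g t.
Proof.
move=> ab mg g0 ig cF e e0.
have [d d0 Fd] := heine cF e0; have [N HN] := mesh_small a b d0.
exists N => n Nn.
have igF := integrable_mul_continuous ig cF.
rewrite -{1 5}(ptn a b n) !partition_integral// -sumrB mulr_sumr.
rewrite (le_trans (ler_norm_sum _ _ _))//; apply: ler_sum => -[k kn] _ /=.
have /andP[ak kb] := pt_itv ab (ltnW kn).
have /andP[_ k1b] := pt_itv ab kn.
set I : set RM := `[_, _[%classic.
have mI : measurable I by exact: measurable_itv.
have Iab : I `<=` `[a, b].
  move=> t /=; rewrite !in_itv/= => /andP[kt tk].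
  by rewrite (le_trans ak)//= (le_trans (ltW tk)).
have igI : mu.-integrable I (EFin \o g) by apply: integrableS ig.
have igFI : mu.-integrable I (EFin \o (fun t => g t * F t)) by apply: integrableS igF.
have igk c : mu.-integrable I (EFin \o (fun t => g t * c)).
  by have := integrableZr mI c igI; apply: eq_integrable.
rewrite -RintegralZr// -RintegralB//.
rewrite (le_trans (le_normr_Rintegral _ _))//.
  by have := integrableB mI igFI (igk (F (pt a b n k))); apply: eq_integrable.
rewrite -RintegralZl//; apply: le_Rintegral => //.
- have := integrableB mI igFI (igk (F (pt a b n k))).
  by move=> /(integrable_norm); apply: eq_integrable.
- by have := integrableZl mI e igI; apply: eq_integrable.
- move=> t It; have := Iab t It; rewrite /= in_itv/= => tab.
  rewrite -mulrBr normrM ger0_norm ?g0// mulrC ler_wpM2r ?g0//.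
  apply/ltW/Fd; first by rewrite ak.
  move: It; rewrite /I/= in_itv/= => /andP[kt tk].
  rewrite ger0_norm ?subr_ge0// ltrBlDl (lt_trans tk)// ptS ltrD2l; exact: HN.
Qed.

End partitions.

(** * Closed convex hulls in the weak topology *)

Section hull.
Context {R : realType} (X : completeNormedModType R[i]) (Xs : set (X -> R[i]^o)).
Hypothesis dp : dual_pairing Xs.

Definition hull (K : set (sigma_top Xs)) : set (sigma_top Xs) :=
  smallest [set C : set (sigma_top Xs) | closed C /\ @convex_set _ X C] K.

Lemma hull_convex K (c : R) (x y : X) : 0 <= c <= 1 ->
  hull K x -> hull K y -> hull K (c%:C *: x + (1 - c)%:C *: y).
Proof.
move=> /andP[c0 c1] Hx Hy C [[cC vC] KC].
have c0' : 0 <= c%:C by rewrite lecR.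
have c1' : c%:C <= 1 by rewrite (_ : 1 = 1%:C)// lecR.
have := vC x y (Itv01 c0' c1'); rewrite !inE.
move=> /(_ (Hx C (conj (conj cC vC) KC)) (Hy C (conj (conj cC vC) KC))).
have E : (1 - c)%:C = 1 - c%:C :> R[i] by apply: complex_eqP; rewrite /= ?subr0.
rewrite E; exact.
Qed.

(** Because 0 lies in the hull, it absorbs whatever mass the coefficients lack to reach s; this
    keeps the induction on two-point combinations free of exact sums. *)
Lemma hull_sum K n (c : nat -> R) (p : nat -> X) s : hull K 0 ->
  (forall k, 0 <= c k) -> \sum_(k < n) c k <= s -> (forall k, hull K (p k)) ->
  exists2 h, hull K h & \sum_(k < n) (c k)%:C *: p k = s%:C *: h.
Proof.
move=> H0 c0 + Hp; elim: n s => [|n IH] s.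
  by move=> _; exists 0 => //; rewrite big_ord0 scaler0.
rewrite big_ord_recr/= -lerBrDr => cs.
have [h' Hh' eqh'] := IH _ cs.
have s'0 : 0 <= s - c n by apply: le_trans cs; apply: sumr_ge0.
rewrite big_ord_recr/= eqh'.
have [s0|s0] := eqVneq s 0.
  have cn0 : c n = 0.
    by apply/eqP; rewrite eq_le c0 andbT; move: s'0; rewrite s0 sub0r oppr_ge0.
  by exists 0 => //; rewrite s0 cn0 subrr !scale0r addr0.
have sp : 0 < s.
  by rewrite lt_neqAle eq_sym s0 (le_trans s'0)// gerBl.
exists ((1 - c n / s)%:C *: h' + (c n / s)%:C *: p n).
  rewrite addrC; apply: hull_convex => //.
  by rewrite divr_ge0 ?(ltW sp)//= ler_pdivrMr// mul1r -subr_ge0.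
rewrite scalerDr !scalerA -!rmorphM/=; congr (_%:C *: _ + _%:C *: _); field => //.
Qed.

End hull.

(** * Truncation to bounded functions of compact support *)

Section truncation.
Context {R : realType}.
Local Notation mu := (@lebesgue_measure R).
Local Notation RM := (measurableTypeR R).
Local Notation D := (halfline R).
Implicit Types (f : R -> R[i]) (b : RM -> R).

(** Cutting both the domain and the size produces bounded functions supported in a compact part of
    ]0, oo[, where weak integrals come from compactness and weights are bounded. *)
Definition trunc n f (t : R) : R[i] :=
  if window n t && (cabs (f t) <= n%:R) then f t else 0.

Lemma trunc_cmeasurable n f : cmeasurable D f -> cmeasurable D (trunc n f).
Proof.
move=> mf; have [mr mi] := mf.
have mgood : measurable_fun D (fun t => window n t && (cabs (f t) <= n%:R)).
  apply: measurable_and.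
    by apply: (measurable_fun_bool true); apply: measurableI => //; exact: measurable_window.
  by apply: measurable_fun_ler => //; exact: measurable_cabs.
have mcase (h : R -> R) : measurable_fun D h ->
    measurable_fun D (fun t => if window n t && (cabs (f t) <= n%:R) then h t else 0).
  by move=> m1; apply: measurable_fun_if => //; exact: measurable_funS m1.
split.
  rewrite (_ : (fun _ => _) =
    (fun t => if window n t && (cabs (f t) <= n%:R) then complex.Re (f t) else 0)).
    exact: mcase.
  by apply/funext => t; rewrite /trunc; case: ifP.
rewrite (_ : (fun _ => _) =
  (fun t => if window n t && (cabs (f t) <= n%:R) then complex.Im (f t) else 0)).
  exact: mcase.
by apply/funext => t; rewrite /trunc; case: ifP.
Qed.

Lemma trunc_le n f t : cabs (trunc n f t) <= cabs (f t).
Proof. by rewrite /trunc; case: ifP => // _; rewrite cabs0 cabs_ge0. Qed.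

Lemma truncB_le n f t : cabs (f t - trunc n f t) <= cabs (f t).
Proof. by rewrite /trunc; case: ifP => _; rewrite ?subrr ?subr0// cabs0 cabs_ge0. Qed.

Lemma trunc_bounded n f t : cabs (trunc n f t) <= n%:R.
Proof. by rewrite /trunc; case: ifP => [/andP[]//|_]; rewrite cabs0. Qed.

Lemma trunc_support n f t : ~~ window n t -> trunc n f t = 0.
Proof. by move=> wt; rewrite /trunc (negbTE wt). Qed.

Lemma cmeasurableB A f g : cmeasurable A f -> cmeasurable A g ->
  cmeasurable A (fun t => f t - g t).
Proof.
move=> [fr fi] [gr gi]; split.
  by under eq_fun do rewrite ReD ReN; exact: measurable_funB.
by under eq_fun do rewrite ImD ImN; exact: measurable_funB.
Qed.

Lemma integrable_cabs_le b f g : measurable_fun D b -> (forall t, 0 < t -> 0 <= b t) ->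
  cmeasurable D g -> (forall t, 0 < t -> cabs (g t) <= cabs (f t)) ->
  mu.-integrable D (EFin \o (fun t => cabs (f t) * b t)) ->
  mu.-integrable D (EFin \o (fun t => cabs (g t) * b t)).
Proof.
move=> mb b0 mg gf; apply: le_integrable => //.
  by apply/measurable_EFinP/measurable_funM => //; exact: measurable_cabs.
move=> t; rewrite halflineE => t0 /=.
by rewrite lee_fin !ger0_norm ?mulr_ge0 ?cabs_ge0 ?b0// ler_wpM2r ?b0 ?gf.
Qed.

Lemma trunc_approx b f : measurable_fun D b -> (forall t, 0 < t -> 0 <= b t) ->
  cmeasurable D f -> mu.-integrable D (EFin \o (fun t => cabs (f t) * b t)) ->
  forall e, 0 < e -> exists n0, forall n, (n0 <= n)%N ->
    \int[mu]_(t in D) (cabs (f t - trunc n f t) * b t) < e.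
Proof.
move=> mb b0 mf ifb e e0.
have [||t t0|n0 Hn0] := @Rintegral_dominated_cvg0 R
  (fun n t => cabs (f t - trunc n f t) * b t)
  (fun t => cabs (f t) * b t) _ _ ifb _ e e0.
- move=> n; apply: measurable_funM => //; apply: measurable_cabs.
  by apply: cmeasurableB => //; exact: trunc_cmeasurable.
- by move=> n t t0; rewrite ger0_norm ?mulr_ge0 ?cabs_ge0 ?b0// ler_wpM2r ?b0 ?truncB_le.
- have [n1 Hn1] := window_near t0.
  exists (maxn n1 (Num.truncn (cabs (f t))).+1) => n; rewrite geq_max => /andP[/Hn1 wn n2].
  rewrite /trunc wn/= (le_trans (ltW (truncnS_gt _))) ?ler_nat//.
  by rewrite subrr cabs0 mul0r.
exists n0 => n /Hn0; apply: le_lt_trans; rewrite le_eqVlt; apply/predU1P; left.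
apply: eq_Rintegral => t; rewrite inE halflineE => t0.
by rewrite ger0_norm ?mulr_ge0 ?cabs_ge0 ?b0.
Qed.

End truncation.

(** * Weak integrals of vector-valued functions *)

Section weak_integral.
Context {R : realType} (X : completeNormedModType R[i]) (Xs : set (X -> R[i]^o)).
Hypothesis dp : dual_pairing Xs.
Local Notation N := (@nrm R (banach X)).
Local Notation mu := (@lebesgue_measure R).
Local Notation RM := (measurableTypeR R).
Local Notation D := (halfline R).

Lemma complex_continuous_at (F : R -> R[i]^o) t :
  {for t, continuous (fun t => complex.Re (F t))} ->
  {for t, continuous (fun t => complex.Im (F t))} -> {for t, continuous F}.
Proof.
move=> cr ci; apply/cvgrPdist_lt => e e0.
have [eE er] : e = (complex.Re e)%:C /\ 0 < complex.Re e.
  by move: e0; case: e => a b; rewrite ltcE/= => /andP[/eqP -> a0].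
have e2 : 0 < complex.Re e / 2 by rewrite divr_gt0.
have /cvgrPdist_lt/(_ _ e2) Hr := cr; have /cvgrPdist_lt/(_ _ e2) Hi := ci.
apply: filterS2 Hr Hi => s Hr Hi; rewrite normE_cabs eE ltcR.
rewrite (le_lt_trans (cabs_le_ReIm _))// ReD ImD ReN ImN [ltRHS]splitr.
exact: ltrD.
Qed.

(** Freezing the function before a yields continuity on the whole line, including at arguments t <=
    0, where nothing is known of F. *)
Lemma pos_continuous_clamp (F : R -> R[i]^o) (a : R) : 0 < a -> pos_continuous F ->
  continuous (fun t : R => F (Num.max t a)).
Proof.
move=> a0 [cr ci] t.
have p : 0 < Num.max t a by rewrite lt_max a0 orbT.
have cm : {for t, continuous (fun t : R => Num.max t a)}.
  by apply: (@continuous_max _ _ id (cst a)) => //; exact: cst_continuous.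
apply: (@complex_continuous_at (fun t : R => F (Num.max t a))).
  exact: (continuous_comp cm (cr _ p)).
exact: (continuous_comp cm (ci _ p)).
Qed.

(** This is where the compactness axiom of the dual pairing enters: the weighted Riemann sums of z
    stay in one compact hull, and a cluster point of them is the integral, as every functional
    shows. *)
Let pettis_pos (z : R -> X) (a b : R) (g : RM -> R) :
  (forall l, Xs l -> pos_continuous (l \o z)) -> 0 < a -> a <= b ->
  measurable_fun `[a, b] g -> (forall t, a <= t <= b -> 0 <= g t) ->
  mu.-integrable `[a, b] (EFin \o g) ->
  exists y, forall l, Xs l -> complex.Re (l y) =
    \int[mu]_(t in `[a, b[) (g t * complex.Re (l (z t))).
Proof.
move=> cz a0 ab mg g0 ig.
pose G := \int[mu]_(t in `[a, b[) g t.
have G0 : 0 <= G.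
  by apply: Rintegral_ge0 => t /=; rewrite in_itv/= => /andP[ta /ltW tb]; rewrite g0// ta.
(* Scaling z by M makes the coefficients [c n k / M] sum to at most 1; the summand 1 keeps M
   positive when g has mass 0. *)
pose M := 1 + G.
have M0 : 0 < M by rewrite ltr_pwDl.
pose zz t : sigma_top Xs := M%:C *: z (Num.max t a).
have czz : continuous (zz : R -> sigma_top Xs).
  apply: sigma_continuous_to => l Xl.
  have := pos_continuous_clamp a0 (cz _ (dualZ dp M%:C Xl)).
  rewrite (_ : (fun t => _) = l \o zz)//.
  by apply/funext => t; rewrite /= (dualM dp).
pose K : set (sigma_top Xs) := (zz @` `[a, b]) `|` [set (0 : X)].
have cK : compact K.
  apply: compactU; last exact: compact_set1.
  apply: continuous_compact; last exact: segment_compact.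
  exact: continuous_subspaceT.
have cH : compact (hull K) by case: dp => _ _ _; exact.
have H0 : hull K (0 : X) by apply: sub_gen_smallest; right.
have Hz t : a <= t <= b -> hull K (zz t).
  by move=> tab; apply: sub_gen_smallest; left; exists t => //=; rewrite in_itv.
pose c n k : R := if (k <= n)%N then \int[mu]_(t in `[pt a b n k, pt a b n k.+1[) g t else 0.
have c0 n k : 0 <= c n k.
  rewrite /c; case: ifP => // kn; apply: Rintegral_ge0 => t /=; rewrite in_itv/= => /andP[tk1 tk2].
  have kn' : (k < n.+1)%N by [].
  have /andP[p1 _] := pt_itv ab (ltnW kn'); have /andP[_ p2] := pt_itv ab kn'.
  by rewrite g0// (le_trans p1)//= (le_trans (ltW tk2)).
pose p n k : X := if (k <= n)%N then zz (pt a b n k) else 0.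
have Hp n k : hull K (p n k).
  rewrite /p; case: ifP => // kn; apply: Hz; apply: pt_itv => //; exact: leqW.
have csum n : \sum_(k < n.+1) c n k = G.
  rewrite /G -[in RHS](ptn a b n) partition_integral//.
  by apply: eq_bigr => -[k kn] _; rewrite /c/= -ltnS kn.
have c1 n : \sum_(k < n.+1) c n k / M <= 1.
  by rewrite -mulr_suml csum ler_pdivrMr// mul1r /M lerDr.
have cM0 n k : 0 <= c n k / M by rewrite divr_ge0// ltW.
pose y n : X := \sum_(k < n.+1) (c n k / M)%:C *: p n k.
have Hy n : hull K (y n).
  by have [h Hh] := hull_sum H0 (cM0 n) (c1 n) (Hp n); rewrite /y => ->; rewrite scale1r.
have ly n l : Xs l -> complex.Re (l (y n)) =
    \sum_(k < n.+1) (\int[mu]_(t in `[pt a b n k, pt a b n k.+1[) g t) *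
      complex.Re (l (z (pt a b n k))).
  move=> Xl; rewrite /y.
  have Rsum (q : nat -> X) m : complex.Re (l (\sum_(k < m) q k)) = \sum_(k < m) complex.Re (l (q k)).
    elim: m => [|m IH]; first by rewrite !big_ord0 (dual0 dp).
    by rewrite !big_ord_recr/= (dualD dp)// ReD IH.
  rewrite (Rsum (fun k => (c n k / M)%:C *: p n k)); apply: eq_bigr => -[k kn] _ /=.
  rewrite (dualM dp)// ReZ /c /p -ltnS kn /zz (dualM dp)// ReZ.
  have /andP[p1 _] := pt_itv ab (ltnW kn).
  by rewrite max_l// mulrA divfK// gt_eqF.
have HF : (y n @[n --> \oo]) (hull K) by exists 0%N => // n _ /=; exact: Hy.
(* Compactness provides only a cluster point. That suffices: the scalar sums converge, and the value
   of each functional at a cluster point must be their limit. *)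
have [w [Hw cw]] := cH _ _ HF.
exists w => l Xl; set L := \int[mu]_(t in _) _.
apply/eqP; rewrite -subr_eq0 -normr_le0; apply/ler_addgt0Pr => e e0; rewrite add0r.
have e2 : 0 < e / 2 by rewrite divr_gt0.
have eM : 0 < e / 2 / M by rewrite divr_gt0.
have cF t : a <= t <= b -> {for t, continuous (fun t => complex.Re (l (z t)))}.
  by move=> /andP[ta _]; have [+ _] := cz l Xl; apply; exact: lt_le_trans ta.
have [n0 Hn0] := riemann_sum ab mg g0 ig cF eM.
have near_w : nbhs w [set x : X | `|complex.Re (l w) - complex.Re (l x)| < e / 2].
  have e2C : 0 < (e / 2)%:C by rewrite ltcR.
  have /cvgrPdist_lt/(_ _ e2C) := sigma_continuous Xl (x := w).
  apply: filterS => x; rewrite normE_cabs ltcR; apply: le_lt_trans.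
  by rewrite -ReN -ReD Re_le_cabs.
have FB : (y n @[n --> \oo]) [set y n | n in [set n | (n0 <= n)%N]].
  by exists n0 => // n /= n0n; exists n.
have [_ [[n n0n <-] /= Hn]] := cw _ _ FB near_w.
rewrite -(subrKA (complex.Re (l (y n)))) (le_trans (ler_normD _ _))// [e]splitr lerD//.
  exact: ltW.
rewrite distrC ly// (le_trans (Hn0 n n0n))// -/G mulrAC ler_pdivrMr//.
by rewrite ler_wpM2l ?(ltW e2)// /M lerDr.
Qed.

(** Real parts determine the complex identity, because [Xs] is stable under multiplication by -i;
    see [weak_integralE]. *)
Definition weak_integral (f : R -> R[i]) (z : R -> X) (y : X) :=
  forall l, Xs l -> complex.Re (l y) = \int[mu]_(t in D) complex.Re (f t * l (z t)).

Lemma weak_integral_unique f z y y' : weak_integral f z y -> weak_integral f z y' -> y = y'.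
Proof.
move=> wy wy'; apply/eqP; rewrite -subr_eq0; apply/eqP; apply: (dual_separates dp) => l Xl.
by rewrite (dualB dp)// ReD ReN wy// wy'// subrr.
Qed.

Lemma weak_integralE f z y : weak_integral f z y <->
  (forall l, Xs l -> l y = cintegral D (fun t => f t * l (z t))).
Proof.
split=> [wy l Xl|wy l Xl]; last by rewrite wy.
apply: complex_eqP; first by rewrite wy.
have := wy _ (dualZ dp (- 'i%C) Xl); rewrite ReMi => ->.
by apply: eq_Rintegral => t _; rewrite mulrCA ReMi.
Qed.

Let pettis_bounded (z : R -> X) (a b m : R) (f : R -> R[i]) :
  (forall l, Xs l -> pos_continuous (l \o z)) -> 0 < a -> a <= b ->
  cmeasurable D f -> (forall t, cabs (f t) <= m) ->
  (forall t, ~~ (a <= t <= b) -> f t = 0) ->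
  exists y, weak_integral f z y.
Proof.
move=> cz a0 ab [mr mi] fm fab.
have sub : `[a, b] `<=` D.
  by move=> t /=; rewrite !in_itv/= andbT => /andP[ta _]; exact: lt_le_trans ta.
have sub' : (`[a, b[ : set R) `<=` `[a, b] by move=> t /=; rewrite !in_itv/= => /andP[-> /ltW].
have ibd (h : RM -> R) : measurable_fun `[a, b] h -> (forall t, `|h t| <= m) ->
    mu.-integrable `[a, b] (EFin \o h).
  move=> mh hm; apply: measurable_bounded_integrable => //.
    exact: mu_itv_lty.
  exists m; split => [|x /ltW mx t _ /=]; [exact: num_real|exact: le_trans mx].
have m0 : 0 <= m by apply: le_trans (fm 0); exact: cabs_ge0.
have iMc (h : RM -> R) l : Xs l -> mu.-integrable `[a, b] (EFin \o h) ->
    mu.-integrable `[a, b] (EFin \o (fun t => h t * complex.Re (l (z t)))).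
  move=> Xl ih; have cF t : a <= t <= b -> {for t, continuous (fun t => complex.Re (l (z t)))}.
    by move=> /andP[ta _]; have [+ _] := cz l Xl; apply; exact: lt_le_trans ta.
  exact: (integrable_mul_continuous ih cF).
have iM (h : RM -> R) l : Xs l -> mu.-integrable `[a, b] (EFin \o h) ->
    mu.-integrable `[a, b[ (EFin \o (fun t => h t * complex.Re (l (z t)))).
  by move=> Xl ih; apply: integrableS (iMc _ _ Xl ih).
(* A real function bounded by m is the difference of the nonnegative functions h + m and m, to which
   [pettis_pos] applies. *)
have Hreal (h : RM -> R) : measurable_fun D h -> (forall t, `|h t| <= m) ->
   exists y, forall l, Xs l -> complex.Re (l y) =
    \int[mu]_(t in `[a, b[) (h t * complex.Re (l (z t))).
  move=> mh' hm; have mh : measurable_fun `[a, b] h by exact: measurable_funS mh'.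
  have ih := ibd h mh hm.
  have im : mu.-integrable `[a, b] (EFin \o cst m).
    by apply: ibd => // t; rewrite ger0_norm.
  have ihm : mu.-integrable `[a, b] (EFin \o (fun t => h t + m)).
    by apply: real_integrableD.
  have hm0 t : a <= t <= b -> 0 <= h t + m.
    by move=> _; rewrite -lerBlDr sub0r; have := hm t; rewrite ler_norml => /andP[].
  have mhm : measurable_fun `[a, b] (fun t => h t + m) by exact: measurable_funD.
  have [y1 Hy1] := pettis_pos cz a0 ab mhm hm0 ihm.
  have [y2 Hy2] := pettis_pos cz a0 ab (measurable_cst m) (fun _ _ => m0) im.
  exists (y1 - y2) => l Xl; rewrite (dualB dp)// ReD ReN Hy1// Hy2//.
  rewrite -RintegralB//; [|exact: iM|exact: iM].
  by apply: eq_Rintegral => t _; rewrite -mulrBl addrK.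
have [|y1 Hy1] := Hreal _ mr; first by move=> t; exact: le_trans (Re_le_cabs _) (fm t).
have [|y2 Hy2] := Hreal _ mi; first by move=> t; exact: le_trans (Im_le_cabs _) (fm t).
exists (y1 + 'i%C *: y2) => l Xl; rewrite (dualD dp)// (dualM dp)// ReD Hy1//.
have ir : mu.-integrable `[a, b] (EFin \o (fun t => complex.Re (f t))).
  by apply: ibd => [|t]; [exact: measurable_funS mr|exact: le_trans (Re_le_cabs _) (fm t)].
have ii : mu.-integrable `[a, b] (EFin \o (fun t => complex.Im (f t))).
  by apply: ibd => [|t]; [exact: measurable_funS mi|exact: le_trans (Im_le_cabs _) (fm t)].
have Xil := dualZ dp 'i%C Xl.
have mI : measurable (`[a, b[%classic : set RM) by exact: measurable_itv.
have := RintegralD mI (iM _ _ Xl ir) (iM _ _ Xil ii); rewrite (Hy2 _ Xil)/= => <-.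
rewrite Rintegral_itv_bndo_bndc; last first.
  exact: (real_integrableD mI (iM _ _ Xl ir) (iM _ _ Xil ii)).
rewrite (@eq_Rintegral _ _ _ mu `[a, b] (fun t => complex.Re (f t * l (z t)))); last first.
  by move=> t _; rewrite !ReM /=; ring.
rewrite (_ : `[a, b]%classic = D `&` `[a, b]); last by rewrite setIidr.
rewrite Rintegral_mkcondr; apply: eq_Rintegral => t _.
rewrite patchE; case: ifPn => //; rewrite notin_setE/= in_itv/= => /negP tab.
by rewrite fab ?mul0r.
Qed.

Lemma dominated_pairing (b : RM -> R) (f F : R -> R[i]) C :
  measurable_fun D b -> cmeasurable D f -> cmeasurable D F ->
  (forall t, 0 < t -> cabs (F t) <= C * b t) ->
  mu.-integrable D (EFin \o (fun t => cabs (f t) * b t)) ->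
  mu.-integrable D (EFin \o (fun t => complex.Re (f t * F t))) /\
  `|\int[mu]_(t in D) complex.Re (f t * F t)| <= C * \int[mu]_(t in D) (cabs (f t) * b t).
Proof.
move=> mb mf mF FC ifb.
have mD : measurable (D : set RM) by exact: measurable_itv.
have iC : mu.-integrable D (EFin \o (fun t => C * (cabs (f t) * b t))).
  exact: real_integrableZ.
have le t : 0 < t -> `|complex.Re (f t * F t)| <= C * (cabs (f t) * b t).
  move=> t0; rewrite (le_trans (Re_le_cabs _))// cabsM mulrCA.
  by rewrite ler_wpM2l ?cabs_ge0// FC.
have ifF : mu.-integrable D (EFin \o (fun t => complex.Re (f t * F t))).
  apply: le_integrable iC => //.
    apply/measurable_EFinP; have [] // : cmeasurable D (fun t => f t * F t).
    by apply: cmeasurableM.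
  move=> t; rewrite halflineE => t0 /=; rewrite lee_fin.
  by rewrite (le_trans (le _ t0))// ler_norm.
split => //; rewrite -RintegralZl//.
rewrite (le_trans (le_normr_Rintegral _ _))//; apply: le_Rintegral => //.
- by have := integrable_norm ifF; apply: eq_integrable.
- by move=> t; rewrite halflineE; exact: le.
Qed.

Lemma weak_integral_norm_le (z : R -> X) (b : RM -> R) f y :
  (forall l, Xs l -> pos_continuous (l \o z)) ->
  measurable_fun D b -> (forall t, 0 < t -> N (z t) <= b t) ->
  cmeasurable D f -> mu.-integrable D (EFin \o (fun t => cabs (f t) * b t)) ->
  weak_integral f z y -> N y <= \int[mu]_(t in D) (cabs (f t) * b t).
Proof.
move=> cz mb zb mf ifb wy; apply: (norm_le_dual dp) => l [Xl l1]; rewrite wy//.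
have lC t : 0 < t -> cabs (l (z t)) <= 1 * b t.
  by move=> t0; rewrite mul1r (le_trans (l1 _))// zb.
have [_] := dominated_pairing mb mf (pos_continuous_measurable (cz l Xl)) lC ifb.
by rewrite mul1r; apply: le_trans; exact: ler_norm.
Qed.

(* Truncating [f] to compactly supported bounded functions reduces the existence
   of the integral to the completeness of [X]. *)
Lemma weak_integral_exists (z : R -> X) (b : RM -> R) (f : R -> R[i]) :
  (forall l, Xs l -> pos_continuous (l \o z)) ->
  measurable_fun D b -> (forall t, 0 < t -> N (z t) <= b t) ->
  cmeasurable D f -> mu.-integrable D (EFin \o (fun t => cabs (f t) * b t)) ->
  exists y, weak_integral f z y.
Proof.
move=> cz mb zb mf ifb; have [mr mi] := mf.
have b0 t : 0 < t -> 0 <= b t by move=> /zb; apply: le_trans; exact: rnorm_ge0.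
pose fn n := trunc n f.
have mfn n : cmeasurable D (fn n) by exact: trunc_cmeasurable.
have mgn n : cmeasurable D (fun t => f t - fn n t) by exact: cmeasurableB.
have ign n := integrable_cabs_le mb b0 (mgn n) (fun t _ => truncB_le n f t) ifb.
have ifn n := integrable_cabs_le mb b0 (mfn n) (fun t _ => trunc_le n f t) ifb.
pose d n := \int[mu]_(t in D) (cabs (f t - fn n t) * b t).
have d_small e : 0 < e -> exists n0, forall n, (n0 <= n)%N -> d n < e.
  exact: (trunc_approx mb b0 mf ifb).
have yn n : exists y, weak_integral (fn n) z y.
  apply: (@pettis_bounded z n.+1%:R^-1 n.+1%:R n%:R) => //.
  - by rewrite (@le_trans _ _ 1)// ?invf_le1// ler1n.
  - exact: trunc_bounded.
  - by move=> t wt; exact: trunc_support.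
pose y n := projT1 (cid (yn n)).
have Hy n : weak_integral (fn n) z (y n) := projT2 (cid (yn n)).
(* Used twice: with C = 1 on the dual ball it shows that the sequence [y] is Cauchy, and with a
   general C it identifies its limit. *)
have est l C n : Xs l -> (forall x, cabs (l x) <= C * N x) -> 0 <= C ->
    `|\int[mu]_(t in D) complex.Re (f t * l (z t)) - complex.Re (l (y n))| <= C * d n.
  move=> Xl lC C0.
  have lzC t : 0 < t -> cabs (l (z t)) <= C * b t.
    by move=> t0; rewrite (le_trans (lC _))// ler_wpM2l// zb.
  have mlz := pos_continuous_measurable (cz l Xl).
  have [ig le] := dominated_pairing mb (mgn n) mlz lzC (ign n).
  have [iF _] := dominated_pairing mb (mfn n) mlz lzC (ifn n).
  rewrite Hy// (_ : \int[mu]_(t in D) complex.Re (f t * l (z t)) =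
    \int[mu]_(t in D) complex.Re (fn n t * l (z t)) +
    \int[mu]_(t in D) complex.Re ((f t - fn n t) * l (z t))).
    by rewrite addrAC subrr add0r.
  rewrite -RintegralD//; apply: eq_Rintegral => t _.
  by rewrite -ReD -mulrDl subrKC.
have [w Hw] : exists w, forall e, 0 < e -> exists n0, forall n, (n0 <= n)%N -> N (y n - w) < e.
  apply: banach_complete => e e0; have e3 : 0 < e / 3 by rewrite divr_gt0.
  have [n0 Hn0] := d_small _ e3; exists n0 => n m /Hn0 dn /Hn0 dm.
  apply: (@le_lt_trans _ _ (e / 3 + e / 3)); last by lra.
  apply: (norm_le_dual dp) => l [Xl l1].
  have l1' x : cabs (l x) <= 1 * N x by rewrite mul1r.
  have := est l 1 n Xl l1' ler01; have := est l 1 m Xl l1' ler01.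
  rewrite !mul1r (dualB dp)// ReD ReN !ler_norml => /andP[_ em] /andP[en _].
  by lra.
exists w => l Xl; have [C C0 lC] := dual_bounded dp Xl.
apply/eqP; rewrite -subr_eq0 -normr_le0; apply/ler_addgt0Pr => e e0; rewrite add0r.
have e2 : 0 < e / 2 / (C + 1) by rewrite !divr_gt0// ltr_wpDl.
have [n1 Hn1] := Hw _ e2; have [n2 Hn2] := d_small _ e2.
pose n := maxn n1 n2.
have {}Hn1 := Hn1 n (leq_maxl _ _); have {}Hn2 := Hn2 n (leq_maxr _ _).
have C1 : 0 < C + 1 by rewrite ltr_wpDl.
have mulC x : 0 <= x -> x < e / 2 / (C + 1) -> C * x <= e / 2.
  move=> x0; rewrite ltr_pdivlMr// => /ltW; apply: le_trans.
  by rewrite mulrC ler_wpM2l// lerDl.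
rewrite -(subrKA (complex.Re (l (y n)))) (le_trans (ler_normD _ _))// [e]splitr lerD//.
  rewrite distrC -ReN -ReD -(dualB dp)// (le_trans (Re_le_cabs _))//.
  by rewrite (le_trans (lC _))// mulC//; exact: rnorm_ge0.
rewrite distrC (le_trans (est l C n Xl lC C0))// mulC//.
by apply: Rintegral_ge0 => t; rewrite halflineE => t0; rewrite mulr_ge0 ?cabs_ge0 ?b0.
Qed.

End weak_integral.

(** * The semigroup and its functional calculus *)

Section semigroup_weight.
Context {R : realType} (X : completeNormedModType R[i]) (Xs : set (X -> R[i]^o)).
Hypothesis dp : dual_pairing Xs.
Context (T : R -> X -> X).
Hypothesis sg : weakly_continuous_semigroup Xs T.
Local Notation N := (@nrm R (banach X)).
Local Notation mu := (@lebesgue_measure R).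
Local Notation RM := (measurableTypeR R).
Local Notation D := (halfline R).
Local Notation w := (omegaT T).

(** Giving the value -oo off the half-line keeps the extension lower semicontinuous on the whole
    line, because the half-line is open. *)
Lemma lsc_measurable (h : R -> R) :
  (forall c t, 0 < t -> c < h t -> \forall s \near t, c < h s) -> measurable_fun D h.
Proof.
move=> hl; pose k t := if 0 < t then (h t)%:E else -oo%E.
have kl : lower_semicontinuous k.
  move=> t a; rewrite /k; case: ifPn => // t0; rewrite lte_fin => aht.
  exists [set s | 0 < s /\ a < h s].
    apply: filterI; last exact: hl.
    by apply: (@cvgr_gt _ _ (nbhs t) _ id t) => //; exact: cvg_id.
  by move=> s [s0 ahs]; rewrite s0 lte_fin.
have /(measurable_funTS (D := D)) mk := lower_semicontinuous_measurable kl.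
apply/measurable_EFinP; apply: eq_measurable_fun mk => t.
by rewrite inE halflineE /k => ->.
Qed.

Lemma semigroup_dual t l : 0 < t -> Xs l -> Xs (l \o T t).
Proof. by case: sg => + _ _ t0 Xl => /(_ t t0)[_ _]; exact. Qed.

Lemma semigroup_bounded_linear t : 0 < t ->
  bounded_linear (E := banach X) (F := banach X) (T t).
Proof.
case: sg => + _ _ => /[apply] -[lT cT _]; split => //; first by move=> a x y _ _; exact: lT.
by have [M _ TM] := continuous_linear_bounded lT cT; exists M => x _; exact: TM.
Qed.

Lemma semigroup_linear t a x y : 0 < t -> T t (a *: x + y) = a *: T t x + T t y.
Proof. by case: sg => + _ _ => /[apply] -[+ _ _]; exact. Qed.

Lemma semigroup0 t : 0 < t -> T t 0 = 0.
Proof. by move=> /semigroup_bounded_linear/(bounded_linear0 (seminormed_banach X)). Qed.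

Lemma semigroupB t x y : 0 < t -> T t (x - y) = T t x - T t y.
Proof.
by move=> /semigroup_bounded_linear b; rewrite (bounded_linearB (seminormed_banach X) b).
Qed.

Lemma semigroupM t s x : 0 < t -> 0 < s -> T t (T s x) = T (t + s) x.
Proof. by case: sg => _ TD _ t0 s0; rewrite TD. Qed.

Lemma semigroup_norm_le t x : 0 < t -> N (T t x) <= w t * N x.
Proof.
move=> /semigroup_bounded_linear b.
exact: (opnorm_bound (seminormed_banach X) (seminormed_banach X) b (x := x) I).
Qed.

Lemma omegaT_ge0 t : 0 < t -> 0 <= w t.
Proof.
move=> /semigroup_bounded_linear b.
exact: (opnorm_ge0 (seminormed_banach X) (seminormed_banach X) b).
Qed.

Lemma orbit_continuous x l : Xs l -> pos_continuous (l \o (fun t => T t x)).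
Proof.
case: sg => _ _ + Xl => /(_ x l Xl).
rewrite continuous_open_subspace; last exact: interval_open.
move=> cT; split => t t0.
  have /cvgrPdist_lt ct : {for t, continuous (fun t => l (T t x))}.
    by apply: cT; rewrite inE halflineE.
  apply/cvgrPdist_lt => e e0; have e0C : 0 < e%:C by rewrite ltcR.
  have := ct _ e0C; apply: filterS => s; rewrite normE_cabs ltcR; apply: le_lt_trans.
  by rewrite /= -ReN -ReD Re_le_cabs.
have /cvgrPdist_lt ct : {for t, continuous (fun t => l (T t x))}.
  by apply: cT; rewrite inE halflineE.
apply/cvgrPdist_lt => e e0; have e0C : 0 < e%:C by rewrite ltcR.
have := ct _ e0C; apply: filterS => s; rewrite normE_cabs ltcR; apply: le_lt_trans.
by rewrite /= -ImN -ImD Im_le_cabs.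
Qed.

(** For the measurability: the norm of T(t) is a supremum of the continuous functions Re l(T(t) x),
    with x in the unit ball and l in the dual ball, hence lower semicontinuous. *)
Lemma omegaT_weight : weight w.
Proof.
split.
- apply: lsc_measurable => c t t0 ct.
  have b := semigroup_bounded_linear t0.
  have [x Nx] : exists2 x, N x <= 1 & c < N (T t x).
    apply: contrapT => /forall2NP nx.
    have : w t <= c.
      apply: ge_sup.
        by exists (N (T t 0)), 0 => //; split => //=; rewrite normr0.
      by move=> _ [x [_ x1] <-]; case: (nx x) => // /negP; rewrite -leNgt.
    by rewrite leNgt ct.
  move=> cx; have [l [[Xl l1] cl]] : exists l, dual_ball Xs l /\ c < complex.Re (l (T t x)).
    apply: contrapT => /forallNP nl; move: cx; rewrite ltNge => /negP; apply.
    apply: (norm_le_dual dp) => l lb; rewrite leNgt; apply/negP => cl.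
    by apply: (nl l).
  have [+ _] := orbit_continuous x Xl => /(_ t t0) H.
  have : \forall s \near t, c < complex.Re (l (T s x)).
    exact: (cvgr_gt _ H _ cl).
  have : \forall s \near t, 0 < s by apply: (@cvgr_gt _ _ (nbhs t) _ id t) => //; exact: cvg_id.
  apply: filterS2 => s s0 cs; apply: (lt_le_trans cs).
  rewrite (le_trans (ler_norm _))// (le_trans (Re_le_cabs _))// (le_trans (l1 _))//.
  rewrite (le_trans (semigroup_norm_le _ s0))// ler_piMr ?omegaT_ge0//.
- exact: omegaT_ge0.
- move=> s t s0 t0; have st0 := addr_gt0 s0 t0.
  apply: (opnorm_le (seminormed_banach X) (semigroup_bounded_linear st0)).
    by rewrite mulr_ge0 ?omegaT_ge0.
  move=> x _; rewrite -semigroupM//.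
  rewrite (le_trans (semigroup_norm_le _ s0))// -mulrA ler_wpM2l ?omegaT_ge0//.
  exact: semigroup_norm_le.
Qed.

Local Notation L1w := (@car R (L1 w)).
Local Notation nL := (@nrm R (L1 w)).

Lemma L1_orbit_integrable f x : L1w f ->
  mu.-integrable D (EFin \o (fun t => cabs (f t) * (w t * N x))).
Proof.
move=> fL; have := real_integrableZ (N x) (measurable_itv _) (L1_integrable omegaT_weight fL).
by apply: eq_integrable => // t _ /=; congr EFin; ring.
Qed.

Let measurable_orbit_bound x : measurable_fun D (fun t => w t * N x).
Proof. by apply: measurable_funM => //; case: omegaT_weight. Qed.

(** Certifies that the choice made in [phiX] is a genuine integral and not the default value 0. *)
Lemma phiX_weak_integral f x : L1w f -> weak_integral Xs f (fun t => T t x) (phiX Xs T f x).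
Proof.
move=> fL; apply/(weak_integralE dp).
have [y Hy] : exists y, weak_integral Xs f (fun t => T t x) y.
  apply: (weak_integral_exists dp (b := fun t => w t * N x)).
  - by move=> l; exact: orbit_continuous.
  - exact: measurable_orbit_bound.
  - by move=> t; exact: semigroup_norm_le.
  - by case: fL.
  - exact: L1_orbit_integrable.
have := @xgetPex _ 0 [set y | forall l, Xs l ->
    l y = cintegral (halfline R) (fun t => f t * l (T t x))].
by apply; exists y; apply/(weak_integralE dp).
Qed.

Lemma phiX_eq f x y : L1w f -> weak_integral Xs f (fun t => T t x) y -> phiX Xs T f x = y.
Proof. by move=> fL; apply: (weak_integral_unique dp); exact: phiX_weak_integral. Qed.

Lemma phiX_norm_le f x : L1w f -> N (phiX Xs T f x) <= nL f * N x.
Proof.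
move=> fL; have [mr mi _] := fL.
have := weak_integral_norm_le dp (fun l Xl => orbit_continuous x Xl) (measurable_orbit_bound x)
  (fun t t0 => semigroup_norm_le x t0) (conj mr mi) (L1_orbit_integrable x fL)
  (phiX_weak_integral x fL).
move=> /le_trans; apply; rewrite /nrm/= -RintegralZr//; last exact: L1_integrable omegaT_weight _.
by rewrite le_eqVlt; apply/predU1P; left; apply: eq_Rintegral => t _; rewrite mulrA.
Qed.

Lemma pairing_orbit_integrable f x l : L1w f -> Xs l ->
  mu.-integrable D (EFin \o (fun t => complex.Re (f t * l (T t x)))).
Proof.
move=> fL Xl; have [C C0 lC] := dual_bounded dp Xl.
apply: (pairing_integrable (C := C * N x) omegaT_weight fL).
  exact: pos_continuous_measurable (orbit_continuous x Xl).
move=> t t0; rewrite (le_trans (lC _))// -mulrA ler_wpM2l// mulrC; exact: semigroup_norm_le.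
Qed.

Lemma phiX_linear f a x y : L1w f ->
  phiX Xs T f (a *: x + y) = a *: phiX Xs T f x + phiX Xs T f y.
Proof.
move=> fL; apply: phiX_eq => // l Xl.
rewrite (dual_linear dp Xl) ReD.
have := phiX_weak_integral x fL (dualZ dp a Xl) => /= ->.
rewrite (phiX_weak_integral y fL Xl) -RintegralD//; last 2 first.
- exact: (pairing_orbit_integrable x fL (dualZ dp a Xl)).
- exact: pairing_orbit_integrable.
apply: eq_Rintegral => t; rewrite inE halflineE => t0.
by rewrite semigroup_linear// (dual_linear dp Xl) -ReD -mulrDr.
Qed.

Lemma phiX_comm f s x : L1w f -> 0 < s -> phiX Xs T f (T s x) = T s (phiX Xs T f x).
Proof.
move=> fL s0; apply: phiX_eq => // l Xl.
have := phiX_weak_integral x fL (semigroup_dual s0 Xl) => /= ->.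
apply: eq_Rintegral => t; rewrite inE halflineE => t0.
by rewrite !semigroupM// addrC.
Qed.

Lemma phiX_conv f g x : L1w f -> L1w g ->
  phiX Xs T (Defs.conv f g) x = phiX Xs T f (phiX Xs T g x).
Proof.
move=> fL gL; apply: phiX_eq; first exact: conv_L1 omegaT_weight fL gL.
move=> l Xl; rewrite (phiX_weak_integral _ fL Xl).
have [C C0 lC] := dual_bounded dp Xl.
rewrite (conv_integral_l (C := C * N x) omegaT_weight fL gL); last 2 first.
- exact: pos_continuous_measurable (orbit_continuous x Xl).
- by move=> t t0; rewrite (le_trans (lC _))// -mulrA ler_wpM2l// mulrC; exact: semigroup_norm_le.
apply: eq_Rintegral => s; rewrite inE halflineE => s0.
have := phiX_weak_integral x gL (dualZ dp (f s) (semigroup_dual s0 Xl)) => /= ->.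
apply: eq_Rintegral => t; rewrite inE halflineE => t0.
by rewrite semigroupM//; congr complex.Re; ring.
Qed.

End semigroup_weight.

(** * Translation in weighted L1 spaces *)

Section shifts.
Context {R : realType}.
Local Notation mu := (@lebesgue_measure R).
Local Notation RM := (measurableTypeR R).
Local Notation D := (halfline R).
Implicit Types (w : R -> R) (f : R -> R[i]).

(** Convolution with the point mass at s; under the functional calculus it becomes multiplication by
    T(s). *)
Definition translate (s : R) f (t : R) : R[i] := zero_ext f (t - s).

Lemma integral_zero_ext_translate (v : R -> R) s : 0 <= s -> measurable_fun D v ->
  (\int[mu]_(t in D) (zero_ext v (t - s))%:E = \int[mu]_(t in D) (v t)%:E)%E.
Proof.
move=> s0 mv; have mz := measurable_zero_ext mv.
rewrite [LHS]integral_mkcond [RHS]integral_mkcond.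
transitivity (\int[mu]_t (zero_ext v t)%:E)%E; last first.
  by rewrite zero_ext_patch; apply: eq_integral => t _; rewrite !patchE; case: ifP.
rewrite -(@integral_shift R (fun t => (zero_ext v t)%:E) (- s)); last exact/measurable_EFinP.
apply: eq_integral => t _; rewrite patchE; case: ifPn => //.
rewrite notin_setE halflineE => /negP; rewrite -leNgt => t0.
by rewrite zero_ext_npos// subr_le0 (le_trans t0).
Qed.

Lemma translate_cmeasurable s f : cmeasurable D f -> cmeasurable D (translate s f).
Proof.
move=> /cmeasurable_zero_ext mf.
have [mr mi] : cmeasurable [set: RM] (translate s f).
  by apply: (cmeasurable_comp mf (g := fun t : RM => (t - s : RM)%R)); exact: measurable_funB.
by split; exact: measurable_funTS.
Qed.

Lemma translate_pairing s f (F : R -> R[i]) : 0 <= s -> cmeasurable D f -> cmeasurable D F ->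
  \int[mu]_(t in D) complex.Re (translate s f t * F t) =
  \int[mu]_(t in D) complex.Re (f t * F (t + s)).
Proof.
move=> s0 mf mF; congr fine.
have mFs : cmeasurable D (fun t => F (t + s)).
  have [mr mi] : cmeasurable [set: RM] (fun t : RM => zero_ext F (t + s)).
    apply: (cmeasurable_comp (cmeasurable_zero_ext mF) (g := fun t : RM => (t + s : RM)%R)).
    exact: measurable_funD.
  split; [apply: eq_measurable_fun (measurable_funTS mr)|apply: eq_measurable_fun (measurable_funTS mi)];
    by move=> t; rewrite inE halflineE => t0; rewrite zero_ext_pos// ltr_wpDr.
rewrite -(integral_zero_ext_translate s0 (v := fun t => complex.Re (f t * F (t + s)))).
  apply: eq_integral => t _; congr EFin; rewrite /translate /zero_ext.
  by case: ifP => _; rewrite ?mul0r// subrK.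
by have [] : cmeasurable D (fun t => f t * F (t + s)) by exact: cmeasurableM.
Qed.

Lemma translate_L1 w s f : weight w -> 0 < s -> car (n := L1 w) f -> car (n := L1 w) (translate s f).
Proof.
move=> ww s0 fL; have [mr mi _] := fL; have [mw w0 wM] := ww.
have [mr' mi'] := translate_cmeasurable s (conj mr mi).
split => //.
pose v t := cabs (f t) * w (t + s).
have mws : measurable_fun D (fun t => w (t + s)).
  have mz : measurable_fun [set: RM] (fun t : RM => zero_ext w (t + s)).
    apply: (measurableT_comp (measurable_zero_ext mw) (g := fun t : RM => (t + s : RM)%R)).
    exact: measurable_funD.
  apply: eq_measurable_fun (measurable_funTS mz) => t; rewrite inE halflineE => t0.
  by rewrite zero_ext_pos// addr_gt0.
have mv : measurable_fun D v by apply: measurable_funM => //; exact: measurable_cabs.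
rewrite (_ : (\int[mu]_(t in D) _ = \int[mu]_(t in D) (zero_ext v (t - s))%:E)%E); last first.
  apply: eq_integral => t _; congr EFin; rewrite /v /translate /zero_ext.
  by case: ifP => _; rewrite ?subrK// cabs0 mul0r.
rewrite (integral_zero_ext_translate (ltW s0) mv).
have mD : measurable (D : set RM) by exact: measurable_itv.
have := integrable_lty mD (real_integrableZ (w s) mD (L1_integrable ww fL)).
apply: le_lt_trans; apply: ge0_le_integral => //.
- by move=> t; rewrite halflineE => t0; rewrite lee_fin mulr_ge0 ?cabs_ge0 ?w0 ?addr_gt0.
- exact/measurable_EFinP.
- by apply/measurable_EFinP/measurable_funM => //; apply: measurable_funM => //; exact: measurable_cabs.
- move=> t; rewrite halflineE => t0 /=; rewrite lee_fin mulrCA ler_wpM2l ?cabs_ge0//.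
  by rewrite mulrC wM.
Qed.

Lemma L1_linear w : weight w -> linear_subset (@car R (L1 w)).
Proof.
move=> ww; have [mw w0 wM] := ww; split.
  split; [exact: measurable_cst|exact: measurable_cst|].
  rewrite (_ : (\int[mu]_(t in D) _ = 0)%E) ?ltry//.
  by apply: integral0_eq => t _; rewrite [cabs _]cabs0 mul0r.
move=> a f g fL gL; have [fr fi _] := fL; have [gr gi _] := gL.
have [mr mi] : cmeasurable D (fun t => a * f t + g t).
  have [hr hi] : cmeasurable D (fun t => a * f t).
    by apply: cmeasurableM => //; split; exact: measurable_cst.
  split.
    rewrite (_ : (fun t => _) = (fun t => complex.Re (a * f t) + complex.Re (g t))).
      exact: measurable_funD.
    by apply/funext => t; exact: ReD.
  rewrite (_ : (fun t => _) = (fun t => complex.Im (a * f t) + complex.Im (g t))).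
    exact: measurable_funD.
  by apply/funext => t; exact: ImD.
split => //.
have mD : measurable (D : set RM) by exact: measurable_itv.
have i1 := real_integrableZ (cabs a) mD (L1_integrable ww fL).
have := integrable_lty mD (real_integrableD mD i1 (L1_integrable ww gL)).
apply: le_lt_trans; apply: ge0_le_integral => //.
- by move=> t; rewrite halflineE => t0; rewrite lee_fin mulr_ge0 ?cabs_ge0 ?w0.
- by apply/measurable_EFinP/measurable_funM => //; exact: measurable_cabs.
- apply/measurable_EFinP/measurable_funD; last by apply: measurable_funM => //; exact: measurable_cabs.
  by apply: measurable_funM => //; apply: measurable_funM => //; exact: measurable_cabs.
- move=> t; rewrite halflineE => t0 /=; rewrite lee_fin mulrA -mulrDl ler_wpM2r ?w0//.
  by rewrite (le_trans (cabsD _ _))// cabsM.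
Qed.

Lemma trunc_L1 w n f : weight w -> car (n := L1 w) f -> car (n := L1 w) (trunc n f).
Proof.
move=> ww [mr mi _]; have [mr' mi'] := trunc_cmeasurable n (conj mr mi).
apply: (L1_bounded (a := n.+1%:R^-1) (b := n.+1%:R) (M := n%:R)) => //.
- exact: weight_locally_bounded.
- by move=> t _; exact: trunc_bounded.
- by move=> t; exact: trunc_support.
Qed.

(** A truncation vanishes before 1 / (n + 1), so it can be moved left by half of that and still be
    supported away from 0. Its image under the functional calculus therefore carries a factor
    T(a). *)
Lemma trunc_translate w n f : weight w -> car (n := L1 w) f -> exists a g,
  [/\ 0 < a, car (n := L1 w) g & trunc n f = translate a g].
Proof.
move=> ww fL; have [mr mi _] := trunc_L1 n ww fL.
pose a : R := n.+1%:R^-1 / 2; have a0 : 0 < a by rewrite divr_gt0.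
have aa : a + a = n.+1%:R^-1 by rewrite -splitr.
pose g t := trunc n f (t + a); exists a, g; split => //.
  apply: (L1_bounded (a := a) (b := n.+1%:R) (M := n%:R)) => //.
  - exact: weight_locally_bounded.
  - have [mr' mi'] : cmeasurable [set: RM] (fun t : RM => zero_ext (trunc n f) (t + a)).
      apply: (cmeasurable_comp (cmeasurable_zero_ext (conj mr mi)) (g := fun t : RM => (t + a : RM)%R)).
      exact: measurable_funD.
    split; [apply: eq_measurable_fun (measurable_funTS mr')|apply: eq_measurable_fun (measurable_funTS mi')];
      by move=> t; rewrite inE halflineE => t0; rewrite zero_ext_pos// addr_gt0.
  - by move=> t _; exact: trunc_bounded.
  - move=> t tb; apply: trunc_support; apply: contra tb => /andP[t1 t2].
    by apply/andP; split; [rewrite -(lerD2r a) aa|rewrite (le_trans _ t2)// lerDl ltW].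
apply/funext => t; rewrite /translate /zero_ext subr_gt0; case: ltP => ta; first by rewrite /g subrK.
by apply: trunc_support; rewrite negb_and -!ltNge -aa (le_lt_trans ta)// ltrDl.
Qed.

End shifts.

(** * Norm closures of sets of operators *)

Section operator_closures.
Context {R : realType} (E : nspace R) (sE : seminormed E).
Implicit Types C P : set (amb (Bop E)).
Local Notation O := (@nrm R (Bop E)).
Local Notation sub C := (@NSpace R (amb (Bop E)) C (@nrm R (Bop E))).

Lemma comp_approx S1 S2 S1' S2' : bounded_op (E := E) S1 -> bounded_op (E := E) S2 ->
  bounded_op (E := E) S1' -> bounded_op (E := E) S2' ->
  O ((S1 \o S2) - (S1' \o S2')) <= O S1 * O (S2 - S2') + O (S1 - S1') * O S2'.
Proof.
move=> b1 b2 b1' b2'; have sB := seminormed_Bop sE.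
have d1 : bounded_op (E := E) (S1 - S1') := linear_subsetB (bounded_op_subset sE) b1 b1'.
have d2 : bounded_op (E := E) (S2 - S2') := linear_subsetB (bounded_op_subset sE) b2 b2'.
have -> : (S1 \o S2) - (S1' \o S2') = (S1 \o (S2 - S2')) + ((S1 - S1') \o S2').
  apply/funext => x; rewrite !fctE.
  have [c2 _ _ z2] := b2; have [c2' _ _ z2'] := b2'.
  have [cx|cx] := pselect (car x); last first.
    have l1 := bounded_op_linear b1.
    by rewrite z2// z2'// subr0 (bounded_linear0 sE l1) !add0r.
  rewrite (bounded_linearB sE (bounded_op_linear b1) (c2 _ cx) (c2' _ cx)).
  by rewrite addrA subrK.
rewrite (le_trans (nrmD sB (bounded_op_comp sE b1 d2) (bounded_op_comp sE d1 b2')))//.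
by rewrite lerD// opnorm_comp.
Qed.

Lemma nclosure_comp C P : C `<=` @car R (Bop E) ->
  (forall S1 S2, C S1 -> C S2 -> C (S1 \o S2)) -> P `<=` C ->
  (forall S1 S2, P S1 -> P S2 -> P (S1 \o S2)) ->
  forall S1 S2, nclosure (E := sub C) P S1 -> nclosure (E := sub C) P S2 ->
    nclosure (E := sub C) P (S1 \o S2).
Proof.
move=> CB CC PC PP S1 S2 [c1 a1] [c2 a2]; split; first exact: CC.
move=> e e0; have e2 : 0 < e / 2 by rewrite divr_gt0.
have O1 : 0 < O S1 + 1 by rewrite ltr_wpDl// (nrm_ge0 (seminormed_Bop sE) (CB _ c1)).
(* The second factor is approximated first, because the tolerance for the first one depends on the
   norm of this approximant. *)
have [S2' P2' d2] := a2 _ (divr_gt0 e2 O1).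
have O2 : 0 < O S2' + 1.
  by rewrite ltr_wpDl// (nrm_ge0 (seminormed_Bop sE) (CB _ (PC _ P2'))).
have [S1' P1' d1] := a1 _ (divr_gt0 e2 O2).
exists (S1' \o S2'); first exact: PP.
have := comp_approx (CB _ c1) (CB _ c2) (CB _ (PC _ P1')) (CB _ (PC _ P2')).
move=> /le_lt_trans; apply.
have n2 : 0 <= O (S2 - S2').
  apply: (nrm_ge0 (seminormed_Bop sE)).
  exact: linear_subsetB (bounded_op_subset sE) (CB _ c2) (CB _ (PC _ P2')).
have n1 : 0 <= O (S1 - S1').
  apply: (nrm_ge0 (seminormed_Bop sE)).
  exact: linear_subsetB (bounded_op_subset sE) (CB _ c1) (CB _ (PC _ P1')).
rewrite [e]splitr ler_ltD//.
  rewrite (@le_trans _ _ ((O S1 + 1) * O (S2 - S2')))//.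
    by rewrite ler_wpM2r// lerDl.
  by rewrite -ler_pdivlMl// mulrC ltW.
rewrite (@le_lt_trans _ _ (O (S1 - S1') * (O S2' + 1)))//.
  by rewrite ler_wpM2l// lerDl.
by rewrite -ltr_pdivlMr.
Qed.

Lemma nclosure_lcomp C P S0 : C `<=` @car R (Bop E) -> linear_subset C -> P `<=` C ->
  bounded_op (E := E) S0 -> (forall S, C S -> C (S0 \o S)) ->
  (forall S, P S -> nclosure (E := sub C) P (S0 \o S)) ->
  forall S, nclosure (E := sub C) P S -> nclosure (E := sub C) P (S0 \o S).
Proof.
move=> CB CL PC b0 C0 P0 S [cS aS].
have sC := seminormed_sub (seminormed_Bop sE) CB CL.
apply: (nclosure_idem (E := sub C) sC) => //; first exact: C0.
move=> e e0.
have O0 : 0 < O S0 + 1 by rewrite ltr_wpDl// (nrm_ge0 (seminormed_Bop sE) b0).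
have [S' PS' dS] := aS _ (divr_gt0 e0 O0); exists (S0 \o S'); first exact: P0.
have := comp_approx b0 (CB _ cS) b0 (CB _ (PC _ PS')).
rewrite subrr (nrm0 (seminormed_Bop sE)) mul0r addr0 => /le_lt_trans; apply.
rewrite (@le_lt_trans _ _ ((O S0 + 1) * O (S - S')))//.
  rewrite ler_wpM2r ?lerDl//; apply: (nrm_ge0 (seminormed_Bop sE)).
  exact: linear_subsetB (bounded_op_subset sE) (CB _ cS) (CB _ (PC _ PS')).
by rewrite -ltr_pdivlMl// mulrC.
Qed.

Lemma nclosure_comm C P S0 : C `<=` @car R (Bop E) -> P `<=` C ->
  (forall x : amb E, car x -> nrm x = 0 -> x = 0) ->
  bounded_op (E := E) S0 -> (forall S, P S -> S0 \o S = S \o S0) ->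
  forall S, nclosure (E := sub C) P S -> S0 \o S = S \o S0.
Proof.
move=> CB PC E0 b0 P0 S [cS aS].
have bS := CB _ cS.
have b1 := bounded_op_comp sE b0 bS; have b2 := bounded_op_comp sE bS b0.
apply/funext => x; have [cx|cx] := pselect (car x); last first.
  have [_ _ _ z1] := b1; have [_ _ _ z2] := b2.
  by rewrite z1// z2.
apply/eqP; rewrite -subr_eq0; apply/eqP.
have d12 := linear_subsetB (bounded_op_subset sE) b1 b2.
have [c12 _ _ _] := d12.
apply: (E0 _ (c12 _ cx)); apply: (nrm_eq0_approx sE (c12 _ cx)) => e e0.
rewrite (le_trans (opnorm_bound sE sE (bounded_op_linear d12) cx))//.
pose K := (O S0 + O S0 + 1) * (nrm x + 1).
have O0 := nrm_ge0 (seminormed_Bop sE) b0.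
have x0 := nrm_ge0 sE cx.
have K0 : 0 < K by rewrite mulr_gt0// ltr_wpDl ?addr_ge0.
have [S' PS' dS] := aS _ (divr_gt0 e0 K0).
have bS' := CB _ (PC _ PS').
have dd := linear_subsetB (bounded_op_subset sE) bS bS'.
have dd0 := nrm_ge0 (seminormed_Bop sE) dd.
have le : O ((S0 \o S) - (S \o S0)) <= (O S0 + O S0) * O (S - S').
  have -> : (S0 \o S) - (S \o S0) = ((S0 \o S) - (S0 \o S')) - ((S \o S0) - (S' \o S0)).
    by rewrite -(P0 _ PS') opprB addrA subrK.
  have := nrmB (seminormed_Bop sE)
    (linear_subsetB (bounded_op_subset sE) b1 (bounded_op_comp sE b0 bS'))
    (linear_subsetB (bounded_op_subset sE) b2 (bounded_op_comp sE bS' b0)).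
  move=> /le_trans; apply.
  have := comp_approx b0 bS b0 bS'; have := comp_approx bS b0 bS' b0.
  rewrite !subrr (nrm0 (seminormed_Bop sE)) mulr0 mul0r add0r addr0 mulrC.
  by move=> h1 h2; rewrite mulrDl lerD.
rewrite (@le_trans _ _ ((O S0 + O S0 + 1) * O (S - S') * (nrm x + 1)))//.
  apply: ler_pM => //; [exact: (nrm_ge0 (seminormed_Bop sE) d12)| |by rewrite lerDl].
  by rewrite (le_trans le)// ler_wpM2r// lerDl.
by rewrite mulrAC -/K -ler_pdivlMl// mulrC ltW.
Qed.

End operator_closures.

(** * Continuity of translation in weighted L1 spaces *)

Section translation.
Context {R : realType}.
Local Notation mu := (@lebesgue_measure R).
Local Notation RM := (measurableTypeR R).
Local Notation D := (halfline R).
Implicit Types (w : R -> R) (f : R -> R[i]).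

Lemma seminormed_L1 w : weight w -> seminormed (L1 w).
Proof.
move=> ww; have [mw w0 wM] := ww; have [L0 LL] := L1_linear ww.
have mD : measurable (D : set RM) by exact: measurable_itv.
split => //.
- move=> f _; apply: Rintegral_ge0 => t; rewrite halflineE => t0.
  by rewrite mulr_ge0 ?cabs_ge0 ?w0.
- move=> f g fL gL; have fgL := linear_subsetD (L1_linear ww) fL gL.
  rewrite /nrm/= -RintegralD//; try exact: L1_integrable.
  apply: le_Rintegral => //; try exact: L1_integrable.
    by apply: real_integrableD => //; exact: L1_integrable.
  move=> t; rewrite halflineE => t0.
  by rewrite -mulrDl ler_wpM2r ?w0//; exact: cabsD.
- move=> a f fL; rewrite /nrm/= -RintegralZl//; last exact: L1_integrable.
  by apply: eq_Rintegral => t _; rewrite mulrA; congr (_ * _); exact: cabsM.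
Qed.

Lemma indic_itv (a b : R) : a <= b ->
  mu.-integrable D (EFin \o \1_(`[a, b]%classic : set RM)) /\
  \int[mu]_(t in D) \1_(`[a, b]%classic : set RM) t <= b - a.
Proof.
move=> ab; have mD : measurable (D : set RM) by exact: measurable_itv.
have mI : measurable (`[a, b]%classic : set RM) by exact: measurable_itv.
have muI : (mu (`[a, b]%classic `&` D) <= (b - a)%:E)%E.
  rewrite (@le_trans _ _ (mu `[a, b]))//.
    by apply: le_measure; rewrite ?inE//; apply: measurableI.
  by rewrite lebesgue_measure_itv/= lte_fin; case: ltP => _; rewrite ?lee_fin ?subr_ge0.
have E : (\int[mu]_(t in D) (\1_(`[a, b]%classic : set RM) t)%:E = mu (`[a, b]%classic `&` D))%E.
  by rewrite integral_indic.
split.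
  apply/integrableP; split; first exact/measurable_EFinP/measurable_indic.
  rewrite (_ : (\int[mu]_(t in D) _ = mu (`[a, b]%classic `&` D))%E).
    by rewrite (le_lt_trans muI)// ltry.
  by rewrite -E; apply: eq_integral => t _ /=; rewrite ger0_norm.
by rewrite /Rintegral/= E -lee_fin fineK// ge0_fin_numE// (le_lt_trans muI)// ltry.
Qed.

Definition cut (a b : R) (g : R -> R) (t : R) : R[i] := if a <= t <= b then (g t)%:C else 0.

Lemma cut_bounded a b (g : R -> R) : a <= b -> continuous g ->
  exists2 G, 0 <= G & forall t, cabs (cut a b g t) <= G.
Proof.
move=> ab cg.
have [c cab cmax] : exists2 c, c \in `[a, b] & forall t, t \in `[a, b] -> `|g t| <= `|g c|.
  apply: (@EVT_max _ (fun t => `|g t|)) => //.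
  by apply: continuous_subspaceT => t; apply: cvg_norm; exact: cg.
exists `|g c| => // t; rewrite /cut; case: ifPn => tab; last by rewrite cabs0.
by rewrite cabs_real; apply: cmax; rewrite in_itv.
Qed.

Lemma cut_cmeasurable a b (g : R -> R) : measurable_fun [set: RM] g -> cmeasurable D (cut a b g).
Proof.
move=> mg; have mab : measurable_fun [set: RM] (fun t : RM => a <= t <= b).
  apply: (measurable_fun_bool true).
  rewrite setTI (_ : _ @^-1` _ = `[a, b]%classic); first exact: measurable_itv.
  by apply/seteqP; split=> t /=; rewrite in_itv.
split; apply: measurable_funTS.
  rewrite (_ : (fun t => _) = (fun t => if a <= t <= b then g t else 0)).
    exact: measurable_fun_ifT.
  by apply/funext => t; rewrite /cut; case: ifP.
rewrite (_ : (fun t => _) = cst 0); first exact: measurable_cst.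
by apply/funext => t; rewrite /cut; case: ifP.
Qed.

Lemma cut_L1 w a b (g : R -> R) : weight w -> 0 < a -> a <= b -> continuous g ->
  car (n := L1 w) (cut a b g).
Proof.
move=> ww a0 ab cg; have [G _ gG] := cut_bounded ab cg.
apply: (L1_bounded (a := a) (b := b) (M := G) ww) => //.
- exact: weight_locally_bounded.
- by apply: cut_cmeasurable; exact: continuous_measurable_fun.
- by move=> t /negbTE tab; rewrite /cut tab.
Qed.

Lemma cut_translation_support (a b h t : R) (g : R -> R) : 0 < h -> ~~ (a <= t <= b + h) ->
  (translate h (cut a b g) - cut a b g) t = 0.
Proof.
move=> h0 tab; rewrite !fctE /translate /zero_ext /cut.
have -> : (a <= t <= b) = false.
  by apply: contraNF tab => /andP[-> tb] /=; rewrite (le_trans tb)// lerDl ltW.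
case: ifPn; rewrite ?subr0// => _.
rewrite (_ : (_ && _) = false) ?subr0//; apply: contraNF tab => /andP[h2 h3].
by apply/andP; split; lra.
Qed.

(** Three zones: in the interior both copies are present and differ by the oscillation of g; on an
    edge zone of length h at either end only one of them is, and its size G is the best available
    bound. *)
Lemma cut_translation_pointwise (a b h t G e : R) (g : R -> R) : 0 < a -> 0 < h -> 0 <= G ->
  0 <= e -> (forall s, a <= s <= b -> `|g s| <= G) ->
  (forall s, a <= s <= b -> `|g (s - h) - g s| <= e) ->
  cabs ((translate h (cut a b g) - cut a b g) t) <=
  e * (a <= t <= b)%R%:R + (G * (a <= t <= a + h)%R%:R + G * (b <= t <= b + h)%R%:R).
Proof.
move=> a0 h0 G0 e0 gG ge.
have [tab|tab] := boolP (a <= t <= b + h); last first.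
  by rewrite (cut_translation_support _ h0 tab) cabs0 !addr_ge0 ?mulr_ge0.
rewrite !fctE /translate /zero_ext subr_gt0 /cut.
have [h1 h2] := andP tab.
have [tb|tb] := leP t b; last first.
  rewrite andbF subr0.
  case: ifPn => [ht|_]; last by rewrite cabs0 !addr_ge0 ?mulr_ge0.
  case: ifPn => [/andP[h3 h4]|_]; last by rewrite cabs0 !addr_ge0 ?mulr_ge0.
  rewrite cabs_real (le_trans (gG _ _)) ?h3//.
  have -> : (b <= t <= b + h) by rewrite h2 ltW.
  by rewrite mulr0 add0r mulr1n mulr1 lerDr mulr_ge0.
rewrite h1 [andb true true]/= mulr1n mulr1.
have [tt|tt] := leP a (t - h).
  have -> : h < t by lra.
  have -> : t - h <= b by lra.
  rewrite /= -rmorphB cabs_real (le_trans (y := e))//; last by rewrite lerDl addr_ge0// mulr_ge0.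
  by apply: ge; rewrite h1 tb.
have -> : t <= a + h by lra.
rewrite [andb true true]/= mulr1n mulr1 (_ : (if _ then _ else _) = 0); last by case: ifP.
rewrite sub0r cabsN cabs_real (le_trans (gG _ _)) ?h1//.
by rewrite addrCA lerDl addr_ge0// mulr_ge0.
Qed.

Lemma cut_translation w a b (g : R -> R) : weight w -> 0 < a -> a <= b -> continuous g ->
  forall e, 0 < e -> exists2 d, 0 < d & forall h, 0 < h -> h < d ->
    nrm (n := L1 w) (translate h (cut a b g) - cut a b g) <= e.
Proof.
move=> ww a0 ab cg e e0; have [mw w0 _] := ww.
have mD : measurable (D : set RM) by exact: measurable_itv.
have [G G0 gG] := cut_bounded ab cg.
(* With h < 1 everything is supported in [a, b + 1], where the weight is bounded. *)
have [M' M'w] := weight_locally_bounded ww (b + 1) a0.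
pose M := `|M'| + 1; have M0 : 0 < M by rewrite ltr_wpDl.
have Mw t : a <= t <= b + 1 -> w t <= M.
  by move=> /M'w /le_trans; apply; rewrite (le_trans (ler_norm _))// lerDl.
have ba0 : 0 < b - a + 1 by rewrite ltr_wpDl// subr_ge0.
(* [e1] is the oscillation allowed in the interior zone, whose contribution is then at most e /
   2. *)
have [e1 e10 e1E] : exists2 e1, 0 < e1 & M * e1 * (b - a + 1) = e / 2.
  exists (e / (M * (b - a + 1) * 2)); first by rewrite divr_gt0// !mulr_gt0.
  by field; rewrite !gt_eqF.
have [d d0 gd] := heine (k := g) (a := a) (b := b) (fun t _ => cg t) e10.
have G1 : 0 < G + 1 by rewrite ltr_wpDl.
(* [d'] limits the length of the two edge zones, so that each contributes at most e / 4. *)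
have [d' d'0 d'E] : exists2 d', 0 < d' & M * (G + 1) * d' = e / 4.
  exists (e / (M * (G + 1) * 4)); first by rewrite divr_gt0// !mulr_gt0.
  by field; rewrite !gt_eqF.
exists (Num.min d (Num.min d' 1)) => [|h h0]; first by rewrite !lt_min d0 d'0 ltr01.
rewrite !lt_min => /and3P[hd hd' h1].
have gG' s : a <= s <= b -> `|g s| <= G by move=> sab; have := gG s; rewrite /cut sab cabs_real.
have ge s : a <= s <= b -> `|g (s - h) - g s| <= e1.
  by move=> sab; apply/ltW; apply: gd => //; rewrite addrAC subrr sub0r normrN gtr0_norm.
pose i1 : RM -> R := \1_(`[a, b]%classic : set RM).
pose i2 : RM -> R := \1_(`[a, a + h]%classic : set RM).
pose i3 : RM -> R := \1_(`[b, b + h]%classic : set RM).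
have [I1 le1] := indic_itv ab.
have [I2 le2] := indic_itv (a := a) (b := a + h) (ltW (ltr_pwDr h0 (lexx _))).
have [I3 le3] := indic_itv (a := b) (b := b + h) (ltW (ltr_pwDr h0 (lexx _))).
pose psi t := M * e1 * i1 t + (M * G * i2 t + M * G * i3 t).
have J1 : mu.-integrable D (EFin \o (fun t => M * e1 * i1 t)) by exact: real_integrableZ.
have J2 : mu.-integrable D (EFin \o (fun t => M * G * i2 t)) by exact: real_integrableZ.
have J3 : mu.-integrable D (EFin \o (fun t => M * G * i3 t)) by exact: real_integrableZ.
have J23 := real_integrableD mD J2 J3.
have J : mu.-integrable D (EFin \o psi) by exact: real_integrableD.
have cL := cut_L1 ww a0 ab cg.
have sL := translate_L1 ww h0 cL.
have key (t : R) : 0 < t -> cabs ((translate h (cut a b g) - cut a b g) t) * w t <= psi t.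
  move=> t0; rewrite (_ : psi t = M * (e1 * i1 t + (G * i2 t + G * i3 t))); last by rewrite /psi; ring.
  set k := cabs _.
  have i1E : i1 t = (a <= t <= b)%R%:R.
    by rewrite /i1 indicE; congr (_ %:R); rewrite mem_setE/= in_itv.
  have i2E : i2 t = (a <= t <= a + h)%R%:R.
    by rewrite /i2 indicE; congr (_ %:R); rewrite mem_setE/= in_itv.
  have i3E : i3 t = (b <= t <= b + h)%R%:R.
    by rewrite /i3 indicE; congr (_ %:R); rewrite mem_setE/= in_itv.
  have bound := cut_translation_pointwise t a0 h0 G0 (ltW e10) gG' ge.
  rewrite -i1E -i2E -i3E in bound.
  have [tab|tab] := boolP (a <= t <= b + h); last first.
    rewrite /k (cut_translation_support _ h0 tab) cabs0 mul0r mulr_ge0 ?(ltW M0)//.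
    exact: le_trans (cabs_ge0 _) bound.
  rewrite (@le_trans _ _ (k * M))//; last by rewrite mulrC ler_wpM2l ?(ltW M0).
  rewrite ler_wpM2l ?cabs_ge0// Mw//; have /andP[-> tb] := tab.
  by rewrite (le_trans tb)// lerD2l ltW.
rewrite /nrm/= (@le_trans _ _ (\int[mu]_(t in D) psi t))//.
  apply: le_Rintegral => //; first exact: (L1_integrable ww (L1B ww sL cL)).
  by move=> t; rewrite halflineE; exact: key.
rewrite /psi RintegralD// RintegralD// !RintegralZl//.
have B1 : M * e1 * (\int[mu]_(x in D) i1 x) <= e / 2.
  rewrite (@le_trans _ _ (M * e1 * (b - a + 1)))//.
    by rewrite ler_wpM2l ?mulr_ge0 ?(ltW M0) ?(ltW e10)// (le_trans le1)// lerDl.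
  by rewrite e1E.
have Bh : M * G * h <= e / 4.
  rewrite (@le_trans _ _ (M * (G + 1) * d'))//.
    by rewrite ler_pM ?mulr_ge0 ?(ltW M0) ?(ltW h0) ?(ltW hd')// ler_wpM2l ?(ltW M0)// lerDl.
  by rewrite d'E.
have B2 : M * G * (\int[mu]_(x in D) i2 x) <= e / 4.
  apply: le_trans Bh; rewrite ler_wpM2l ?mulr_ge0 ?(ltW M0)//.
  by rewrite (le_trans le2)// addrAC subrr add0r.
have B3 : M * G * (\int[mu]_(x in D) i3 x) <= e / 4.
  apply: le_trans Bh; rewrite ler_wpM2l ?mulr_ge0 ?(ltW M0)//.
  by rewrite (le_trans le3)// addrAC subrr add0r.
move: B1 B2 B3; clear; lra.
Qed.

Definition translatable w f := forall e, 0 < e -> exists2 d, 0 < d &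
  forall h, 0 < h -> h < d -> nrm (n := L1 w) (translate h f - f) <= e.

Lemma translate_linear s a (f g : R -> R[i]^o) : translate s (a *: f + g) = a *: (translate s f : R -> R[i]^o) + translate s g.
Proof.
apply/funext => t; rewrite /translate /zero_ext !fctE.
by case: ifP => // _; rewrite scaler0 addr0.
Qed.

Lemma translatable_linear w a (f g : R -> R[i]^o) : weight w ->
  car (n := L1 w) f -> car (n := L1 w) g ->
  translatable w f -> translatable w g -> translatable w (a *: f + g).
Proof.
move=> ww fL gL tf tg e e0; have sL := seminormed_L1 ww.
have a1 : 0 < cabs a + 1 by rewrite ltr_wpDl// cabs_ge0.
have e2 : 0 < e / 2 by rewrite divr_gt0.
have [d1 d10 H1] := tf _ (divr_gt0 e2 a1); have [d2 d20 H2] := tg _ e2.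
exists (Num.min d1 d2) => [|h h0]; first by rewrite lt_min d10.
rewrite lt_min => /andP[h1 h2].
have dfL := L1B ww (translate_L1 ww h0 fL) fL; have dgL := L1B ww (translate_L1 ww h0 gL) gL.
rewrite translate_linear.
have -> : a *: (translate h f : R -> R[i]^o) + translate h g - (a *: f + g) =
  a *: (translate h f - f : R -> R[i]^o) + (translate h g - g).
  by rewrite scalerBr opprD addrACA.
rewrite (le_trans (nrmD sL (linear_subsetZ a (L1_linear ww) dfL) dgL))//.
rewrite (nrmZ sL a dfL) [e]splitr lerD//; last exact: H2.
rewrite (@le_trans _ _ ((cabs a + 1) * nrm (n := L1 w) (translate h f - f)))//.
  by rewrite ler_wpM2r ?(nrm_ge0 sL)// lerDl.
by rewrite -ler_pdivlMl// mulrC H1.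
Qed.

(** Continuous functions are dense in the unweighted L1 space of [a, b], and there the weight is at
    most K. *)
Lemma bounded_translatable_approx w a b M (r : RM -> R) : weight w -> 0 < a -> a <= b ->
  measurable_fun setT r -> (forall t, `|r t| <= M) -> (forall t, ~~ (a <= t <= b) -> r t = 0) ->
  forall e, 0 < e -> exists f,
  [/\ car (n := L1 w) f, translatable w f & nrm (n := L1 w) ((fun t => (r t)%:C) - f) <= e].
Proof.
move=> ww a0 ab mr rM rab e e0; have [mw w0 _] := ww.
have mD : measurable (D : set RM) by exact: measurable_itv.
have mI : measurable (`[a, b]%classic : set RM) by exact: measurable_itv.
have rL : car (n := L1 w) (fun t => (r t)%:C).
  apply: (L1_bounded (a := a) (b := b) (M := M) ww) => //.
  - exact: weight_locally_bounded.
  - by split => /=; [exact: measurable_funTS|exact: measurable_cst].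
  - by move=> t _; rewrite cabs_real.
  - by move=> t /rab ->.
have ri : mu.-integrable (`[a, b]%classic : set RM) (EFin \o r).
  apply: (@le_integrable _ _ _ mu _ mI _ (cst M%:E)).
  - exact/measurable_EFinP/measurable_funTS.
  - by move=> t _ /=; rewrite lee_fin (le_trans (rM t))// ler_norm.
  - apply/integrableP; split; first exact: measurable_cst.
    rewrite integral_cst//= lte_mul_pinfty//; first exact: mu_itv_lty.
have [g [cg gi gcv]] := approximation_continuous_integrable mI (mu_itv_lty a b) ri.
have [M' M'w] := weight_locally_bounded ww b a0.
pose K := `|M'| + 1; have K0 : 0 < K by rewrite ltr_wpDl.
have Kw t : a <= t <= b -> w t <= K.
  by move=> /M'w /le_trans; apply; rewrite (le_trans (ler_norm _))// lerDl.
have eK : 0 < e / K by rewrite divr_gt0.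
have [n gn] : exists n, (\int[mu]_(z in `[a, b]) `|(r z - g n z)%:E| < (e / K)%:E)%E.
  have eK' : (0%:E < (e / K)%:E)%E by rewrite lte_fin.
  by have [n _ /(_ n (leqnn n)) h] := gcv _ (open_ereal_lt' eK'); exists n.
have cL := cut_L1 ww a0 ab (cg n).
exists (cut a b (g n)); split => //; first exact: cut_translation.
have dL := L1B ww rL cL.
have mif : measurable_fun D (fun t : RM => if a <= t <= b then `|r t - g n t| else 0).
  have mg : measurable_fun [set: RM] (fun t : RM => `|r t - g n t|).
    apply: measurableT_comp => //; apply: measurable_funB => //.
    exact: continuous_measurable_fun.
  have [+ _] := @cut_cmeasurable a b _ mg; congr (measurable_fun _ _).
  by apply/funext => t; rewrite /cut; case: ifP.
rewrite -lee_fin /nrm/= /Rintegral fineK; last exact/integrable_fin_num/(L1_integrable ww dL).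
rewrite (@le_trans _ _ (\int[mu]_(t in D) (K * (if a <= t <= b then `|r t - g n t| else 0))%:E)%E)//.
  have [md1 md2 _] := dL.
  apply: ge0_le_integral => //.
  - by move=> t; rewrite halflineE => t0; rewrite lee_fin mulr_ge0 ?cabs_ge0 ?w0.
  - apply/measurable_EFinP/measurable_funM => //; exact: (measurable_cabs (conj md1 md2)).
  - exact/measurable_EFinP/measurable_funM.
  - move=> t; rewrite halflineE => t0; rewrite lee_fin mulrC !fctE /cut.
    case: ifPn => tab; last by rewrite rab// subrr cabs0 !mulr0.
    by rewrite -rmorphB cabs_real ler_wpM2r// Kw.
apply/ltW.
under eq_integral do rewrite EFinM.
rewrite ge0_integralZl//; last 3 first.
- exact/measurable_EFinP.
- by move=> t _; rewrite lee_fin; case: ifP.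
- by rewrite lee_fin ltW.
rewrite -lte_pdivlMl// -EFinM mulrC; apply: le_lt_trans gn.
rewrite [leLHS]integral_mkcond [leRHS]integral_mkcond le_eqVlt; apply/predU1P; left.
apply: eq_integral => t _; rewrite !patchE !mem_setE /= !in_itv/= andbT.
have [tab|tab] := boolP (a <= t <= b); last by case: ifP.
by have [tt _] := andP tab; rewrite (lt_le_trans a0 tt).
Qed.

(** Density is the right statement: translation by h is controlled on [L1 w] only by the factor w h,
    which may blow up as h tends to 0, so continuity does not pass to limits. *)
Lemma translatable_dense w f : weight w -> car (n := L1 w) f -> forall e, 0 < e -> exists g,
  [/\ car (n := L1 w) g, translatable w g & nrm (n := L1 w) (f - g) < e].
Proof.
move=> ww fL e e0; have [mw w0 _] := ww; have [mr mi _] := fL; have sL := seminormed_L1 ww.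
have e4 : 0 < e / 4 by rewrite divr_gt0.
have [n Hn] := trunc_approx mw w0 (conj mr mi) (L1_integrable ww fL) e4.
have {}Hn := Hn n (leqnn _).
have tL := trunc_L1 n ww fL; have [tr ti _] := tL.
pose u t := complex.Re (zero_ext (trunc n f) t); pose v t := complex.Im (zero_ext (trunc n f) t).
have [mu' mv] : cmeasurable [set: RM] (zero_ext (trunc n f)) := cmeasurable_zero_ext (conj tr ti).
have a0 : 0 < n.+1%:R^-1 :> R by rewrite invr_gt0.
have ab : n.+1%:R^-1 <= n.+1%:R :> R.
  by rewrite (@le_trans _ _ 1)// ?invf_le1// ler1n.
have zs t : ~~ (n.+1%:R^-1 <= t <= n.+1%:R) -> zero_ext (trunc n f) t = 0.
  by move=> tab; rewrite /zero_ext; case: ifP => // _; exact: trunc_support.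
have zb t : cabs (zero_ext (trunc n f) t) <= n%:R.
  by rewrite /zero_ext; case: ifP => _; [exact: trunc_bounded|rewrite cabs0].
have [g1 [g1L t1 d1]] := bounded_translatable_approx ww a0 ab mu'
  (fun t => le_trans (Re_le_cabs _) (zb t)) (fun t tab => congr1 (@complex.Re R) (zs t tab)) e4.
have [g2 [g2L t2 d2]] := bounded_translatable_approx ww a0 ab mv
  (fun t => le_trans (Im_le_cabs _) (zb t)) (fun t tab => congr1 (@complex.Im R) (zs t tab)) e4.
exists ('i%C *: (g2 : R -> R[i]^o) + g1); split.
- by case: (L1_linear ww) => _; exact.
- exact: translatable_linear.
have uL : car (n := L1 w) (fun t => (u t)%:C).
  apply: (L1_bounded ww (weight_locally_bounded ww) a0 (b := n.+1%:R) (M := n%:R)).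
  - by split => /=; [exact: measurable_funTS|exact: measurable_cst].
  - by move=> t _; rewrite cabs_real (le_trans (Re_le_cabs _)).
  - by move=> t /zs; rewrite /u => ->.
have vL : car (n := L1 w) (fun t => (v t)%:C).
  apply: (L1_bounded ww (weight_locally_bounded ww) a0 (b := n.+1%:R) (M := n%:R)).
  - by split => /=; [exact: measurable_funTS|exact: measurable_cst].
  - by move=> t _; rewrite cabs_real (le_trans (Im_le_cabs _)).
  - by move=> t /zs; rewrite /v => ->.
have D1 := L1B ww uL g1L; have D2 := L1B ww vL g2L; have D0 := L1B ww fL tL.
have D2' := linear_subsetZ 'i%C (L1_linear ww) D2.
have D12 := linear_subsetD (L1_linear ww) D2' D1.
have tE : trunc n f = 'i%C *: ((fun t => (v t)%:C) : R -> R[i]^o) + (fun t => (u t)%:C).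
  apply/funext => t; rewrite !fctE /u /v /zero_ext.
  have -> : (if 0 < t then trunc n f t else 0) = trunc n f t.
    case: ltP => // t0; rewrite trunc_support//; apply/negP => /window_gt0.
    by rewrite ltNge t0.
  by rewrite {1}[trunc n f t]complexE addrC.
have -> : f - ('i%C *: (g2 : R -> R[i]^o) + g1) =
   (f - trunc n f) + ('i%C *: ((fun t => (v t)%:C) - g2 : R -> R[i]^o) + ((fun t => (u t)%:C) - g1)).
  rewrite [in RHS]tE scalerBr opprD; apply/funext => t; rewrite !fctE.
  by rewrite /GRing.scale/=; ring.
rewrite (le_lt_trans (nrmD sL D0 D12))//.
have := nrmD sL D2' D1; rewrite (nrmZ sL 'i%C D2) (_ : cabs 'i%C = 1); last first.
  by rewrite cabsE/= expr0n expr1n add0r sqrtr1.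
have d1' : nrm (n := L1 w) ((fun t => (u t)%:C) - g1) <= e / 4 by exact: d1.
have d2' : nrm (n := L1 w) ((fun t => (v t)%:C) - g2) <= e / 4 by exact: d2.
have Hn' : nrm (n := L1 w) (f - trunc n f) < e / 4 by exact: Hn.
move=> d3; lra.
Qed.

End translation.

(** * The Arveson ideal *)

Section arveson.
Context {R : realType} (X : completeNormedModType R[i]) (Xs : set (X -> R[i]^o)).
Hypothesis dp : dual_pairing Xs.
Context (T : R -> X -> X).
Hypothesis sg : weakly_continuous_semigroup Xs T.
Local Notation N := (@nrm R (banach X)).
Local Notation mu := (@lebesgue_measure R).
Local Notation RM := (measurableTypeR R).
Local Notation D := (halfline R).
Local Notation w := (omegaT T).
Local Notation L1w := (@car R (L1 w)).
Local Notation nL := (@nrm R (L1 w)).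
Local Notation cX := (@car R (X1 T)).
Local Notation O := (@nrm R (Bop (X1 T))).
Local Notation I := (@car R (Arveson Xs T)).
Local Notation phi := (phiX Xs T).
Local Notation phiA := (phiI Xs T).

Let ww : weight w := omegaT_weight dp sg.

Lemma restr_in (E : nspace R) (S : amb E -> amb E) x : car x -> restr S x = S x.
Proof. by move=> cx; rewrite /restr asboolT. Qed.

Lemma restr_out (E : nspace R) (S : amb E -> amb E) x : ~ car x -> restr S x = 0.
Proof. by move=> cx; rewrite /restr asboolF. Qed.

Lemma restr_op (E : nspace R) (S : amb E -> amb E) : seminormed E ->
  bounded_linear (E := E) (F := E) S -> bounded_op (E := E) (restr S).
Proof.
move=> sE [SE SL [M SM]]; split.
- by move=> x cx; rewrite restr_in//; exact: SE.
- move=> a x y cx cy; have [_ EL] := seminormed_linear sE.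
  by rewrite !restr_in//; [exact: SL|exact: EL].
- by exists M => x cx; rewrite restr_in//; exact: SM.
- by move=> x; exact: restr_out.
Qed.

Let ranges : set X := \bigcup_(t in D) range (T t).

Lemma ranges_linear : linear_subset ranges.
Proof.
split; first by exists 1; [rewrite halflineE ltr01|exists 0 => //; rewrite (semigroup0 sg)].
move=> a _ _ [t1 + [x1 _ <-]] [t2 + [x2 _ <-]]; rewrite !halflineE => t10 t20.
(* Both vectors factor through T(m) when m is below both times; halving the minimum makes the
   remaining times strictly positive. *)
pose m := Num.min t1 t2 / 2.
have m0 : 0 < m by rewrite divr_gt0// lt_min t10.
have m2 : m + m = Num.min t1 t2 by rewrite -splitr.
have m1 : m < t1 by rewrite (@lt_le_trans _ _ (m + m)) ?ltrDl// m2 ge_min lexx.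
have m3 : m < t2 by rewrite (@lt_le_trans _ _ (m + m)) ?ltrDl// m2 ge_min lexx orbT.
exists m; first by rewrite halflineE.
exists (a *: T (t1 - m) x1 + T (t2 - m) x2) => //.
rewrite (semigroup_linear sg)// !(semigroupM sg) ?subr_gt0//.
by rewrite ![m + _]addrC !subrK.
Qed.

Lemma X1_nclosure : cX = nclosure (E := banach X) ranges.
Proof.
apply/seteqP; split=> x /=.
  move=> cx; split => // e e0.
  have e0C : 0 < e%:C by rewrite ltcR.
  have [y [ry]] := cx _ (nbhsx_ballx x _ e0C).
  by rewrite -ball_normE /= normE_Re ltcR => xy; exists y.
move=> [_ ax] B /nbhs_ballP[e /= e0 eB].
have eE : e = (complex.Re e)%:C.
  by move: e0; rewrite ltcE /= => /andP[/eqP + _]; case: e {eB} => ? ? /= ->.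
have re0 : 0 < complex.Re e by move: e0; rewrite eE ltcR.
have [y ry xy] := ax _ re0; exists y; split => //; apply: eB.
by rewrite -ball_normE /= normE_Re eE ltcR.
Qed.

Lemma X1_linear : linear_subset cX.
Proof.
rewrite X1_nclosure; apply: (nclosure_linear (seminormed_banach X)) => //.
exact: ranges_linear.
Qed.

Lemma seminormed_X1 : seminormed (X1 T).
Proof. by apply: (seminormed_sub (seminormed_banach X)) => //; exact: X1_linear. Qed.

Lemma X1_range t x : 0 < t -> cX (T t x).
Proof.
move=> t0; rewrite X1_nclosure; apply: (sub_nclosure (seminormed_banach X)) => //.
by exists t; [rewrite halflineE|exists x].
Qed.

Lemma X1_closed x : (forall e, 0 < e -> exists2 y, cX y & N (x - y) < e) -> cX x.
Proof.
move=> ax; rewrite X1_nclosure; apply: (nclosure_idem (seminormed_banach X)) => // e /ax.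
by rewrite X1_nclosure.
Qed.

Lemma X1_separated (x : amb (X1 T)) : cX x -> nrm x = 0 -> x = 0.
Proof. by move=> _; exact: rnorm_eq0. Qed.

Let sX := seminormed_X1.
Let sB := seminormed_Bop sX.

Lemma phiX_linearf (f g : R -> R[i]^o) a x : L1w f -> L1w g ->
  phi (a *: f + g) x = a *: phi f x + phi g x.
Proof.
move=> fL gL; have [_ LL] := L1_linear ww; apply: (phiX_eq dp sg); first exact: LL.
move=> l Xl; rewrite (dual_linear dp Xl) ReD.
have := phiX_weak_integral dp sg x fL (dualZ dp a Xl) => /= ->.
rewrite (phiX_weak_integral dp sg x gL Xl) -RintegralD//; last 2 first.
- exact: (pairing_orbit_integrable dp sg x fL (dualZ dp a Xl)).
- exact: (pairing_orbit_integrable dp sg).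
apply: eq_Rintegral => t _; rewrite -ReD; congr complex.Re.
by rewrite !fctE /GRing.scale/= /GRing.scale/=; ring.
Qed.

Lemma phiX_translate a f x : 0 < a -> L1w f -> phi (translate a f) x = T a (phi f x).
Proof.
move=> a0 fL; apply: (phiX_eq dp sg); first exact: translate_L1.
move=> l Xl; have := phiX_weak_integral dp sg x fL (semigroup_dual sg a0 Xl) => /= ->.
have [mr mi _] := fL.
rewrite (translate_pairing (F := fun t => l (T t x)) (ltW a0) (conj mr mi)); last first.
  exact: pos_continuous_measurable (orbit_continuous sg x Xl).
apply: eq_Rintegral => t; rewrite inE halflineE => t0.
by rewrite (semigroupM sg)// addrC.
Qed.

Lemma phiXB f g x : L1w f -> L1w g -> phi (f - g) x = phi f x - phi g x.
Proof.
move=> fL gL; have -> : f - g = (-1) *: (g : R -> R[i]^o) + f by rewrite scaleN1r addrC.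
by rewrite phiX_linearf// scaleN1r addrC.
Qed.

Lemma L1_trunc_approx f e : L1w f -> 0 < e -> exists n, nL (f - trunc n f) < e.
Proof.
move=> fL e0; have [mw w0 _] := ww; have [mr mi _] := fL.
have [n Hn] := trunc_approx mw w0 (conj mr mi) (L1_integrable ww fL) e0.
by exists n; exact: Hn.
Qed.

(** A truncation of f is a translate, so its image lies in the range of some T(a); these images
    approximate phi f x, and [X1] is closed. *)
Lemma phiX_X1 f x : L1w f -> cX (phi f x).
Proof.
move=> fL; apply: X1_closed => e e0.
have x1 : 0 < N x + 1 by rewrite ltr_wpDl// (nrm_ge0 (seminormed_banach X)).
have [n Hn] := L1_trunc_approx fL (divr_gt0 e0 x1).
have tL := trunc_L1 n ww fL.
exists (phi (trunc n f) x).
  have [a [g [a0 gL ->]]] := trunc_translate n ww fL.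
  by rewrite phiX_translate//; exact: X1_range.
have nd := nrm_ge0 (seminormed_L1 ww) (L1B ww fL tL).
rewrite -phiXB// (le_lt_trans (phiX_norm_le dp sg x (L1B ww fL tL)))//.
rewrite (@le_lt_trans _ _ (nL (f - trunc n f) * (N x + 1)))//.
  by rewrite ler_wpM2l// lerDl.
by rewrite -ltr_pdivlMr.
Qed.

(** Fubini in the other order replaces the symmetry of the convolution; compared with [phiX_conv] it
    gives commutation of phi f and phi g. *)
Lemma phiX_conv_r f g x : L1w f -> L1w g -> phi (Defs.conv f g) x = phi g (phi f x).
Proof.
move=> fL gL; apply: (phiX_eq dp sg); first exact: conv_L1.
move=> l Xl; rewrite (phiX_weak_integral dp sg _ gL Xl).
have [C C0 lC] := dual_bounded dp Xl.
rewrite (conv_integral_r (C := C * N x) ww fL gL); last 2 first.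
- exact: pos_continuous_measurable (orbit_continuous sg x Xl).
- by move=> t t0; rewrite (le_trans (lC _))// -mulrA ler_wpM2l// mulrC; exact: (semigroup_norm_le sg).
apply: eq_Rintegral => r; rewrite inE halflineE => r0.
have := phiX_weak_integral dp sg x fL (dualZ dp (g r) (semigroup_dual sg r0 Xl)) => /= ->.
apply: eq_Rintegral => s; rewrite inE halflineE => s0.
by rewrite (semigroupM sg)// addrC; congr complex.Re; ring.
Qed.

Lemma phiX_op f : L1w f -> bounded_linear (E := X1 T) (F := X1 T) (phi f).
Proof.
move=> fL; split; first by move=> x _; exact: phiX_X1.
- by move=> a x y _ _; exact: (phiX_linear dp sg).
- by exists (nL f) => x _; exact: (phiX_norm_le dp sg).
Qed.

Lemma phiI_op f : L1w f -> bounded_op (E := X1 T) (phiA f).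
Proof. by move=> fL; apply: restr_op => //; exact: phiX_op. Qed.

Lemma phiIE f x : cX x -> phiA f x = phi f x. Proof. exact: restr_in. Qed.

Lemma phiI_out f x : ~ cX x -> phiA f x = 0. Proof. exact: restr_out. Qed.

Lemma phiI_norm f : L1w f -> O (phiA f) <= nL f.
Proof.
move=> fL; apply: (opnorm_le sX (bounded_op_linear (phiI_op fL))).
  exact: (nrm_ge0 (seminormed_L1 ww)).
by move=> x cx; rewrite phiIE//; exact: (phiX_norm_le dp sg).
Qed.

Lemma phiI_linearf (f g : R -> R[i]^o) a : L1w f -> L1w g ->
  phiA (a *: f + g) = a *: (phiA f : amb (Bop (X1 T))) + phiA g.
Proof.
move=> fL gL; apply/funext => x; rewrite !fctE.
have [cx|cx] := pselect (cX x); first by rewrite !phiIE// phiX_linearf.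
by rewrite !phiI_out// scaler0 addr0.
Qed.

Lemma phiIB f g : L1w f -> L1w g -> phiA (f - g) = (phiA f : amb (Bop (X1 T))) - phiA g.
Proof.
move=> fL gL; have -> : f - g = (-1) *: (g : R -> R[i]^o) + f by rewrite scaleN1r addrC.
by rewrite phiI_linearf// scaleN1r addrC.
Qed.

Lemma phiI_conv f g : L1w f -> L1w g -> phiA f \o phiA g = phiA (Defs.conv f g).
Proof.
move=> fL gL; apply/funext => x /=; have [cx|cx] := pselect (cX x).
  by rewrite (phiIE _ cx) phiIE ?(phiIE _ cx)//; [rewrite (phiX_conv dp sg)|exact: phiX_X1].
have [_ _ _ z] := phiI_op fL; rewrite (phiI_out g cx) (phiI_out (Defs.conv f g) cx).
exact: (bounded_linear0 sX (bounded_op_linear (phiI_op fL))).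
Qed.

Lemma phiI_comm f g : L1w f -> L1w g -> phiA f \o phiA g = phiA g \o phiA f.
Proof.
move=> fL gL; rewrite phiI_conv//; apply/funext => x /=; have [cx|cx] := pselect (cX x).
  by rewrite (phiIE _ cx) phiIE ?(phiIE _ cx)//; [rewrite phiX_conv_r|exact: phiX_X1].
rewrite (phiI_out f cx) (phiI_out (Defs.conv f g) cx).
by rewrite (bounded_linear0 sX (bounded_op_linear (phiI_op gL))).
Qed.

Lemma semigroup_X1 t : 0 < t -> bounded_linear (E := X1 T) (F := X1 T) (T t).
Proof.
move=> t0; split; first by move=> x _; exact: X1_range.
- by move=> a x y _ _; exact: (semigroup_linear sg).
- by exists (w t) => x _; exact: (semigroup_norm_le sg).
Qed.

Let P := [set phiA f | f in L1w].

Let P_op : P `<=` @car R (Bop (X1 T)).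
Proof. by move=> _ [f fL <-]; exact: phiI_op. Qed.

Let P_linear : linear_subset (V := amb (Bop (X1 T))) P.
Proof.
have [L0 LL] := L1_linear ww; split.
  exists 0 => //; apply/funext => x; have [cx|cx] := pselect (cX x); last by rewrite phiI_out.
  rewrite phiIE//; apply: (phiX_eq dp sg) => // l Xl.
  rewrite (dual0 dp Xl) /Rintegral integral0_eq// => t _.
  by congr EFin; rewrite [X in complex.Re X](_ : _ = 0)//; exact: mul0r.
by move=> a _ _ [f fL <-] [g gL <-]; exists (a *: (f : R -> R[i]^o) + g); [exact: LL|exact: phiI_linearf].
Qed.

Lemma Arveson_op u : I u -> bounded_op (E := X1 T) u. Proof. by case. Qed.

Lemma phiI_Arveson f : L1w f -> I (phiA f).
Proof. by move=> fL; apply: (sub_nclosure sB) => //; exists f. Qed.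

Lemma Arveson_linear : linear_subset (V := amb (Bop (X1 T))) I.
Proof. by apply: (nclosure_linear sB). Qed.

Lemma Arveson_closed u : bounded_op (E := X1 T) u ->
  (forall e, 0 < e -> exists2 v, I v & O (u - v) < e) -> I u.
Proof. by move=> bu au; apply: (nclosure_idem sB). Qed.

Lemma Arveson_mul u v : I u -> I v -> I (u \o v).
Proof.
apply: (nclosure_comp sX (C := @bounded_op R (X1 T))) => //.
- by move=> S1 S2; exact: bounded_op_comp.
- move=> _ _ [f fL <-] [g gL <-]; rewrite phiI_conv//.
  by exists (Defs.conv f g) => //; exact: conv_L1.
Qed.

Lemma Arveson_comm u v : I u -> I v -> u \o v = v \o u.
Proof.
move=> Iu Iv; apply: (nclosure_comm sX (C := @bounded_op R (X1 T)) (P := P)) => //.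
- exact: X1_separated.
- exact: Arveson_op.
move=> _ [f fL <-]; apply/esym.
apply: (nclosure_comm sX (C := @bounded_op R (X1 T)) (P := P)) => //.
- exact: X1_separated.
- exact: phiI_op.
by move=> _ [g gL <-]; exact: phiI_comm.
Qed.

Lemma Arveson_orbit_comm u s x : I u -> 0 < s -> cX x -> T s (u x) = u (T s x).
Proof.
move=> Iu s0 cx; have bu := Arveson_op Iu; have [uX _ _ _] := bu.
have H : restr (E := X1 T) (T s) \o u = u \o restr (E := X1 T) (T s).
  apply: (nclosure_comm sX (C := @bounded_op R (X1 T)) (P := P)) => //.
  - exact: X1_separated.
  - by apply: restr_op => //; exact: semigroup_X1.
  move=> _ [f fL <-]; apply/funext => y /=; have [cy|cy] := pselect (cX y).
    rewrite (phiIE _ cy) !restr_in//; last 2 first.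
    - by rewrite phiIE ?(phiX_comm dp sg)//; exact: X1_range.
    - exact: phiX_X1.
  have -> : restr (E := X1 T) (T s) y = 0 by exact: restr_out.
  rewrite phiI_out// restr_in; last by case: X1_linear.
  by rewrite (semigroup0 sg)// (bounded_linear0 sX (bounded_op_linear (phiI_op fL))).
by have := congr1 (fun S => S x) H; rewrite /= !restr_in//; exact: uX.
Qed.

Let restrT_comp s (u : X -> X) : 0 < s -> bounded_op (E := X1 T) u ->
  restr (E := X1 T) (T s) \o u = T s \o u.
Proof.
move=> s0 [uX _ _ u0]; apply/funext => x /=; have [cx|cx] := pselect (cX x).
  by rewrite restr_in//; exact: uX.
by rewrite u0// restr_in ?(semigroup0 sg)//; case: X1_linear.
Qed.

Lemma restrT_norm s : 0 < s -> O (restr (E := X1 T) (T s)) <= w s.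
Proof.
move=> s0; have b := restr_op sX (semigroup_X1 s0).
apply: (opnorm_le sX (bounded_op_linear b)); first exact: (omegaT_ge0 sg).
by move=> x cx; rewrite restr_in//; exact: (semigroup_norm_le sg).
Qed.

Lemma orbit_op s (u : X -> X) : 0 < s -> bounded_op (E := X1 T) u -> bounded_op (E := X1 T) (T s \o u).
Proof.
move=> s0 bu; rewrite -(restrT_comp s0 bu); apply: (bounded_op_comp sX) => //.
by apply: restr_op => //; exact: semigroup_X1.
Qed.

Lemma orbit_norm_le s (u : X -> X) : 0 < s -> bounded_op (E := X1 T) u -> O (T s \o u) <= w s * O u.
Proof.
move=> s0 bu; rewrite -(restrT_comp s0 bu).
have b := restr_op sX (semigroup_X1 s0).
rewrite (le_trans (opnorm_comp sX b bu))// ler_wpM2r ?restrT_norm//.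
exact: (nrm_ge0 sB).
Qed.

Lemma phiI_translate a f : 0 < a -> L1w f -> T a \o phiA f = phiA (translate a f).
Proof.
move=> a0 fL; apply/funext => x /=; have [cx|cx] := pselect (cX x).
  by rewrite !phiIE// phiX_translate.
by rewrite !phiI_out// (semigroup0 sg).
Qed.

Lemma Arveson_orbit s u : 0 < s -> I u -> I (T s \o u).
Proof.
move=> s0 Iu; rewrite -(restrT_comp s0 (Arveson_op Iu)).
apply: (nclosure_lcomp sX (C := @bounded_op R (X1 T)) (P := P)) => //.
- exact: bounded_op_subset.
- by apply: restr_op => //; exact: semigroup_X1.
- move=> S bS; apply: (bounded_op_comp sX) => //.
  by apply: restr_op => //; exact: semigroup_X1.
- move=> _ [f fL <-]; rewrite (restrT_comp s0 (phiI_op fL)) phiI_translate//.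
  exact/phiI_Arveson/translate_L1.
Qed.

Lemma Arveson_dense u e : I u -> 0 < e -> exists a v, [/\ 0 < a, I v & O (u - (T a \o v)) < e].
Proof.
move=> [bu au] e0; have e2 : 0 < e / 2 by rewrite divr_gt0.
have [_ [f fL <-] uf] := au _ e2.
have [n fn] := L1_trunc_approx fL e2; have tL := trunc_L1 n ww fL.
have [a [g [a0 gL tE]]] := trunc_translate n ww fL.
exists a, (phiA g); split => //; first exact: phiI_Arveson.
rewrite phiI_translate// -tE (le_lt_trans (nrm_trans sB (y := phiA f) _ _ _))//; try exact: phiI_op.
rewrite [e]splitr; apply: ltrD; first exact: uf.
by have <- := phiIB fL tL; exact: le_lt_trans (phiI_norm (L1B ww fL tL)) fn.
Qed.

Lemma Arveson_translatable_dense u e : I u -> 0 < e -> exists v,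
  [/\ I v, O (u - v) < e & forall e', 0 < e' -> exists2 d, 0 < d &
    forall h, 0 < h -> h < d -> O ((T h \o v) - v) <= e'].
Proof.
move=> [bu au] e0; have e2 : 0 < e / 2 by rewrite divr_gt0.
have [_ [f fL <-] uf] := au _ e2.
have [g [gL tg fg]] := translatable_dense ww fL e2.
exists (phiA g); split; first exact: phiI_Arveson.
  rewrite (le_lt_trans (nrm_trans sB (y := phiA f) _ _ _))//; try exact: phiI_op.
  rewrite [e]splitr; apply: ltrD; first exact: uf.
  by have <- := phiIB fL gL; exact: le_lt_trans (phiI_norm (L1B ww fL gL)) fg.
move=> e' e'0; have [d d0 Hd] := tg _ e'0; exists d => // h h0 hd.
have sL := translate_L1 ww h0 gL.
rewrite phiI_translate//; have <- := phiIB sL gL.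
exact: le_trans (phiI_norm (L1B ww sL gL)) (Hd _ h0 hd).
Qed.

Lemma orbitB s (u v : X -> X) : 0 < s -> T s \o (u - v) = (T s \o u) - (T s \o v).
Proof. by move=> s0; apply/funext => x; rewrite !fctE (semigroupB sg). Qed.

Lemma orbit_comp s t (u : X -> X) : 0 < s -> 0 < t -> T s \o (T t \o u) = T (s + t) \o u.
Proof. by move=> s0 t0; apply/funext => x; rewrite /= (semigroupM sg). Qed.

(** The times a and a + h stay in [a, a + 1], where the weight is bounded, so approximation of u by
    an element with continuous orbit costs uniformly little. At a = 0 this argument would fail. *)
Lemma orbit_right_continuous a u e : 0 < a -> I u -> 0 < e -> exists2 d, 0 < d &
  forall h, 0 < h -> h < d -> O ((T (a + h) \o u) - (T a \o u)) <= e.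
Proof.
move=> a0 Iu e0; have [M' Mw] := weight_locally_bounded ww (a + 1) a0.
pose M := `|M'| + 1; have M0 : 0 < M by rewrite ltr_wpDl.
have {Mw}Mw t : a <= t <= a + 1 -> w t <= M.
  by move=> /Mw/le_trans; apply; rewrite (le_trans (ler_norm _))// lerDl.
have e3 : 0 < e / 3 / M by rewrite !divr_gt0.
have [v [Iv uv tv]] := Arveson_translatable_dense Iu e3.
have [d d0 Hd] := tv _ e3.
exists (Num.min d 1) => [|h h0]; first by rewrite lt_min d0 ltr01.
rewrite lt_min => /andP[hd h1].
have ah0 : 0 < a + h by rewrite addr_gt0.
have [bu bv] := (Arveson_op Iu, Arveson_op Iv).
have bB : forall x y, bounded_op (E := X1 T) x -> bounded_op (E := X1 T) y -> bounded_op (E := X1 T) (x - y).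
  by move=> x y bx by'; exact: linear_subsetB (bounded_op_subset sX) bx by'.
have est t y : a <= t <= a + 1 -> bounded_op (E := X1 T) y -> O y <= e / 3 / M -> O (T t \o y) <= e / 3.
  move=> ta by' ye; have t0 : 0 < t by case/andP: ta => /(lt_le_trans a0).
  rewrite (le_trans (orbit_norm_le t0 by'))// (@le_trans _ _ (M * (e / 3 / M)))//; last first.
    by rewrite mulrC divfK// gt_eqF.
  by rewrite ler_pM ?(omegaT_ge0 sg) ?Mw//; exact: (nrm_ge0 sB).
have duv := bB _ _ bu bv.
have dvu : O (v - u) <= e / 3 / M by rewrite (nrmBC sB bv bu) ltW.
have i1 : a <= a + h <= a + 1 by apply/andP; split; lra.
have i2 : a <= a <= a + 1 by apply/andP; split; lra.
have := est _ _ i1 duv (ltW uv); rewrite orbitB// => B1.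
have := est _ _ i2 (bB _ _ bv bu) dvu; rewrite orbitB// => B2.
have := est _ _ i2 (bB _ _ (orbit_op h0 bv) bv) (Hd _ h0 hd); rewrite orbitB// orbit_comp// => B3.
have o t y : 0 < t -> bounded_op (E := X1 T) y -> bounded_op (E := X1 T) (T t \o y) by exact: orbit_op.
have t1 := nrm_trans sB (o _ _ ah0 bu) (o _ _ ah0 bv) (o _ _ a0 bu).
have t2 := nrm_trans sB (o _ _ ah0 bv) (o _ _ a0 bv) (o _ _ a0 bu).
move: B1 B2 B3 t1 t2; lra.
Qed.

End arveson.

(** * Right derivatives and integration by parts *)

Section derivatives.
Context {R : realType}.
Local Notation mu := (@lebesgue_measure R).
Local Notation RM := (measurableTypeR R).
Local Notation D := (halfline R).

Lemma cvg0_at_right (k : R -> R) : k t @[t --> 0^'+] --> 0 <->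
  forall e, 0 < e -> exists2 d, 0 < d & forall t, 0 < t -> t < d -> `|k t| < e.
Proof.
split=> [/cvgrPdist_lt kc e e0|kc].
  have [d /= d0 Hd] := kc _ e0; exists d => // t t0 td.
  by have := Hd t; rewrite /ball/= sub0r normrN gtr0_norm// sub0r normrN; exact.
apply/cvgrPdist_lt => e e0; have [d d0 Hd] := kc _ e0.
exists d => //= t td t0; rewrite sub0r normrN Hd//.
by rewrite (le_lt_trans (ler_norm _))// -normrN -sub0r.
Qed.

(* The right difference quotients at s = t - h, uniformly controlled, are the left ones at t. *)
Lemma uniform_right_derivative (F G : R -> R) t : 0 < t -> {for t, continuous G} ->
  (forall e, 0 < e -> exists2 d, 0 < d & forall s h, t / 2 <= s <= t -> 0 < h -> h < d ->
     `|h^-1 * (F (s + h) - F s) - G s| <= e) -> is_derive t 1 F (G t).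
Proof.
move=> t0 cG HF.
have H : h^-1 *: ((F \o shift t) (h *: 1) - F t) @[h --> 0^'] --> G t.
  apply/cvgrPdist_le => e e0; have e2 : 0 < e / 2 by rewrite divr_gt0.
  have [d d0 Hd] := HF _ e2.
  have /cvgrPdist_lt/(_ _ e2)[d1 /= d10 Hd1] := cG.
  pose d2 := Num.min d (Num.min d1 (t / 2)).
  have d20 : 0 < d2 by rewrite !lt_min d0 d10 divr_gt0.
  exists d2 => //= h; rewrite /ball_/= sub0r normrN !lt_min => /and3P[hd hd1 ht] hn0.
  rewrite /shift/= [h *: 1]mulr1 [_ *: _]/GRing.scale/= distrC [h + t]addrC.
  have [h0|h0] := ltP 0 h.
    rewrite (gtr0_norm h0) in hd; rewrite (le_trans (Hd t h _ h0 hd))//; last by lra.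
    by rewrite lexx andbT ler_pdivrMr// ler_pMr// ler1n.
  have h0' : 0 < - h by rewrite oppr_gt0 lt_neqAle hn0.
  have hE : `|h| = - h by rewrite ltr0_norm// -oppr_gt0.
  rewrite hE in hd hd1 ht.
  have B1 : `|(- h)^-1 * (F (t + h + - h) - F (t + h)) - G (t + h)| <= e / 2.
    by apply: Hd => //; apply/andP; split; lra.
  have B2 : `|G t - G (t + h)| < e / 2.
    by apply: Hd1; rewrite /ball/= opprD addrA subrr sub0r normrN hE.
  have -> : h^-1 * (F (t + h) - F t) - G t =
     ((- h)^-1 * (F (t + h + - h) - F (t + h)) - G (t + h)) - (G t - G (t + h)).
    by rewrite addrK invrN; ring.
  by rewrite (le_trans (ler_normB _ _))// [e]splitr lerD// ltW.
split; first by apply/cvg_ex; exists (G t); exact: H.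
exact: cvg_lim H.
Qed.

Section C1.
Context (f f' : R -> R[i]^o) (Cf : C1_halfline f f').

(** Needed at t = 0, where it makes the boundary term of the integration by parts vanish. *)
Lemma C1_right_continuous t : 0 <= t -> forall e, 0 < e -> exists2 d, 0 < d &
  forall s, t < s -> s < t + d -> cabs (f s - f t) <= e.
Proof.
move=> t0 e e0; have [/(_ t t0)/cvgrPdist_lt df _] := Cf.
have [d /= d0 Hd] := df _ ltr01.
pose K := cabs (f' t) + 1.
have K0 : 0 < K by rewrite ltr_wpDl// cabs_ge0.
exists (Num.min d (e / K)) => [|s ts]; first by rewrite lt_min d0 divr_gt0.
rewrite -ltrBlDl lt_min => /andP[sd se].
have st0 : 0 < s - t by rewrite subr_gt0.
have := Hd (s - t); rewrite /ball/= sub0r normrN gtr0_norm// => /(_ sd).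
rewrite gt_eqF//= addrC subrK => /(_ isT).
have -> : (0 <= s) by rewrite (le_trans t0)// ltW.
move=> /(_ isT); set q := _ *: _; rewrite normE_cabs ltcR => H.
have qE : f s - f t = (s - t)%:C *: q.
  by rewrite /q scalerA -rmorphM divff ?gt_eqF// scale1r.
have qK : cabs q <= K.
  have -> : q = f' t - (f' t - q) by rewrite subKr.
  by rewrite (le_trans (cabsD _ _))// cabsN lerD// ltW.
rewrite qE cabsM cabs_real gtr0_norm// (@le_trans _ _ ((s - t) * K))//.
  by rewrite ler_wpM2l// ltW.
by rewrite -ler_pdivlMr// ltW.
Qed.

(** An abstract real-linear contraction p treats the real and imaginary parts at once. *)
Let derive_proj (p : R[i] -> R) : (forall x y, p (x - y) = p x - p y) ->
  (forall (a : R) x, p (a%:C * x) = a * p x) -> (forall x, `|p x| <= cabs x) ->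
  forall t : R, 0 < t -> is_derive t 1 (fun t => p (f t)) (p (f' t)).
Proof.
move=> pB pZ pn t t0; have [/(_ t (ltW t0))/cvgrPdist_lt df _] := Cf.
have H : h^-1 *: (((fun t => p (f t)) \o shift t) (h *: 1) - p (f t)) @[h --> 0^'] --> p (f' t).
  apply/cvgrPdist_lt => e e0; have e0C : 0 < e%:C by rewrite ltcR.
  have [d /= d0 Hd] := df _ e0C.
  (* Staying within t of the point keeps t + h >= 0, the range in which [C1_halfline] controls the
     quotient. *)
  exists (Num.min d t) => /=; first by rewrite lt_min d0.
  move=> h; rewrite /ball_/= sub0r normrN lt_min => /andP[hd ht] hn0.
  have th0 : 0 <= t + h.
    by have := ler_norm (- h); rewrite normrN; lra.
  have := Hd h; rewrite /ball/= sub0r normrN => /(_ hd hn0 th0).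
  rewrite normE_cabs ltcR; apply: le_lt_trans.
  by rewrite /shift/= [h *: 1]mulr1 [h + t]addrC [_ *: _]/GRing.scale/= -pB -pZ -pB.
split; first by apply/cvg_ex; exists (p (f' t)); exact: H.
exact: cvg_lim H.
Qed.

Lemma C1_derive_Re (t : R) : 0 < t -> is_derive t 1 (fun t => complex.Re (f t)) (complex.Re (f' t)).
Proof.
apply: derive_proj; first by move=> x y; rewrite ReD ReN.
- by move=> a x; rewrite ReZ.
- exact: Re_le_cabs.
Qed.

Lemma C1_derive_Im (t : R) : 0 < t -> is_derive t 1 (fun t => complex.Im (f t)) (complex.Im (f' t)).
Proof.
apply: derive_proj; first by move=> x y; rewrite ImD ImN.
- by move=> a x; rewrite ImZ.
- exact: Im_le_cabs.
Qed.

Lemma C1_derivative_continuous : pos_continuous f'.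
Proof.
have [_ cf] := Cf.
have c t : 0 < t -> {for t, continuous f'}.
  move=> t0.
  have E := continuous_open_subspace f' (interval_open _ _ : open (`]0, +oo[%classic : set R)).
  have : {within `]0, +oo[, continuous f'}.
    apply: continuous_subspaceW cf => s /=; rewrite !in_itv/= !andbT; exact: ltW.
  by rewrite (E isT isT) => /(_ t); apply; rewrite inE halflineE.
by split => t t0; apply/cvgrPdist_lt => e e0;
  have /cvgrPdist_lt/(_ e%:C) := c t t0; rewrite ltcR => /(_ e0);
  apply: filterS => s; rewrite normE_cabs ltcR; apply: le_lt_trans;
  rewrite -?ReN -?ReD -?ImN -?ImD; [exact: Re_le_cabs|exact: Im_le_cabs].
Qed.

Lemma C1_continuous : pos_continuous f.
Proof.
by split => t t0; apply: differentiable_continuous; apply/derivable1_diffP;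
  [case: (C1_derive_Re t0)|case: (C1_derive_Im t0)].
Qed.

End C1.

(** The bound K near 0 is a separate datum because C * w t may be unbounded there; it is what makes
    f0 F tend to 0 at 0. The end at infinity is handled by [integral_derive_eq0]. *)
Lemma generating_parts w f0 f0' F G C K d : weight w -> generating w f0 f0' ->
  pos_continuous F -> pos_continuous G ->
  (forall t : R, 0 < t -> is_derive t 1 (fun t => complex.Re (F t)) (complex.Re (G t))) ->
  (forall t : R, 0 < t -> is_derive t 1 (fun t => complex.Im (F t)) (complex.Im (G t))) ->
  (forall t, 0 < t -> cabs (F t) <= C * w t) -> (forall t, 0 < t -> cabs (G t) <= C * w t) ->
  0 < d -> (forall t, 0 < t -> t < d -> cabs (F t) <= K) ->
  \int[mu]_(t in D) complex.Re (f0 t * G t) = - \int[mu]_(t in D) complex.Re (f0' t * F t).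
Proof.
move=> ww [Cf [f0L _] f00 f0'L] cF cG dFr dFi FC GC d0 FK.
have mD : measurable (D : set RM) by exact: measurable_itv.
have iG := pairing_integrable ww f0L (pos_continuous_measurable cG) GC.
have iF' := pairing_integrable ww f0'L (pos_continuous_measurable cF) FC.
have iF := pairing_integrable ww f0L (pos_continuous_measurable cF) FC.
apply/eqP; rewrite -subr_eq0 opprK; apply/eqP; rewrite -RintegralD//.
have [cfr cfi] := C1_continuous Cf.
have [cf'r cf'i] := C1_derivative_continuous Cf.
have [cFr cFi] := cF; have [cGr cGi] := cG.
apply: (@integral_derive_eq0 _ (fun t => complex.Re (f0 t * F t))
  (fun t => complex.Re (f0 t * G t) + complex.Re (f0' t * F t))) => //.
- move=> t t0.
  have -> : (fun t => complex.Re (f0 t * F t)) =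
    (fun t => complex.Re (f0 t)) * (fun t => complex.Re (F t)) -
    (fun t => complex.Im (f0 t)) * (fun t => complex.Im (F t)).
    by apply/funext => s; rewrite !fctE ReM.
  have := C1_derive_Re Cf t0; have := C1_derive_Im Cf t0; have := dFr t t0; have := dFi t t0.
  move=> h1 h2 h3 h4; apply: is_derive_eq.
  by rewrite !ReM /GRing.scale/=; ring.
- move=> t t0; rewrite (_ : (fun t => _) = (fun t =>
    complex.Re (f0 t) * complex.Re (G t) - complex.Im (f0 t) * complex.Im (G t) +
    (complex.Re (f0' t) * complex.Re (F t) - complex.Im (f0' t) * complex.Im (F t)))); last first.
    by apply/funext => s; rewrite !ReM.
  apply: continuousD; apply: continuousB; apply: continuousM; auto.
- exact: real_integrableD.
- apply/cvg0_at_right => e e0.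
  have K1 : 0 < `|K| + 1 by rewrite ltr_wpDl.
  have [d1 d10 Hd1] := C1_right_continuous Cf (lexx 0) (divr_gt0 e0 K1).
  have e2 : 0 < e / (`|K| + 1) / 2 by rewrite !divr_gt0.
  have [d2 d20 Hd2] := C1_right_continuous Cf (lexx 0) e2.
  exists (Num.min d d2) => [|t t0]; first by rewrite lt_min d0.
  rewrite lt_min => /andP[td td2].
  rewrite (le_lt_trans (Re_le_cabs _))// cabsM.
  have := Hd2 t t0; rewrite add0r f00 subr0 => /(_ td2) h.
  rewrite (@le_lt_trans _ _ (e / (`|K| + 1) / 2 * (`|K| + 1)))//.
    apply: ler_pM; rewrite ?cabs_ge0//.
    by rewrite (le_trans (FK _ t0 td))// (le_trans (ler_norm _))// lerDl.
  by rewrite mulrAC divfK ?gt_eqF// ltr_pdivrMr// ltr_pMr// ltr1n.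
Qed.

End derivatives.

(** * The generator on the Arveson ideal *)

Section arveson_generator.
Context {R : realType} (X : completeNormedModType R[i]) (Xs : set (X -> R[i]^o)).
Hypothesis dp : dual_pairing Xs.
Context (T : R -> X -> X).
Hypothesis sg : weakly_continuous_semigroup Xs T.
Local Notation N := (@nrm R (banach X)).
Local Notation mu := (@lebesgue_measure R).
Local Notation RM := (measurableTypeR R).
Local Notation D := (halfline R).
Local Notation w := (omegaT T).
Local Notation L1w := (@car R (L1 w)).
Local Notation cX := (@car R (X1 T)).
Local Notation O := (@nrm R (Bop (X1 T))).
Local Notation I := (@car R (Arveson Xs T)).
Local Notation phi := (phiX Xs T).

Let ww : weight w := omegaT_weight dp sg.
Let sX : seminormed (X1 T) := seminormed_X1 sg.
Let sB := seminormed_Bop sX.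

Lemma orbit_pairing_le l y : Xs l -> exists2 C, 0 <= C & forall t, 0 < t -> cabs (l (T t y)) <= C * w t.
Proof.
move=> Xl; have [C C0 lC] := dual_bounded dp Xl; exists (C * N y).
  by rewrite mulr_ge0// (nrm_ge0 (seminormed_banach X)).
move=> t t0; rewrite (le_trans (lC _))// -mulrA ler_wpM2l// mulrC.
exact: (semigroup_norm_le sg).
Qed.

(** Testing phi f z = 0 against c l(T(r) .) shifts the orbit by r and gives exactly the hypothesis
    of [Omega_cancel]. The conclusion concerns positive times, the only ones that the integral
    sees. *)
Lemma phiX_Omega_inj f z : Omega (U := L1 w) f -> phi f z = 0 -> forall t, 0 < t -> T t z = 0.
Proof.
move=> fO fz t t0; apply: (dual_separates dp) => l Xl; have [fL _] := fO.
have [C _ lC] := orbit_pairing_le z Xl.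
rewrite (@Omega_cancel _ w f (fun t => l (T t z)) C ww (weight_locally_bounded ww) fO _ lC)//.
  exact: (orbit_continuous sg).
move=> c r r0.
have := phiX_weak_integral dp sg z fL (dualZ dp c (semigroup_dual sg r0 Xl)).
rewrite /= fz (semigroup0 sg r0) (dual0 dp Xl) mulr0 /= => E; apply/esym.
rewrite [LHS]E; apply: eq_Rintegral => s; rewrite inE halflineE => s0.
by rewrite (semigroupM sg)// mulrA [r + s]addrC.
Qed.

Lemma limI_bound u v e : limI Xs T u v -> 0 < e -> exists2 d, 0 < d &
  forall h, 0 < h -> h < d -> O ((h^-1)%:C *: ((T h \o u) - u) - v) < e.
Proof.
move=> /cvg0_at_right/[apply] -[d d0 Hd]; exists d => // h h0 hd.
have := Hd h h0 hd; rewrite /actI gt_eqF//; apply: le_lt_trans.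
exact: ler_norm.
Qed.

(** The difference quotient at time s is the one at 0 followed by T(s), and T(s) is uniformly
    bounded for s in [t / 2, t]; the norm limit at 0 thus gives the uniform control that
    [uniform_right_derivative] asks for. *)
Lemma limI_weak_derivative u v l x (t : R) : I u -> I v -> limI Xs T u v -> Xs l -> cX x -> 0 < t ->
  is_derive t 1 (fun t => complex.Re (l (T t (u x)))) (complex.Re (l (T t (v x)))).
Proof.
move=> Iu Iv uv Xl cx t0; have [cG _] := orbit_continuous sg (v x) Xl.
apply: (uniform_right_derivative t0 (cG t t0)) => e e0.
have [M' Mw] := weight_locally_bounded ww t (divr_gt0 t0 (ltr0Sn _ 1)).
pose M := `|M'| + 1; have M0 : 0 < M by rewrite ltr_wpDl.
have {Mw}Mw s : t / 2 <= s <= t -> w s <= M.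
  by move=> /Mw/le_trans; apply; rewrite (le_trans (ler_norm _))// lerDl.
have [C C0 lC] := dual_bounded dp Xl.
have x1 : 0 < N x + 1 by rewrite ltr_wpDl// (nrm_ge0 (seminormed_banach X)).
have K0 : 0 < (C + 1) * M * (N x + 1) by rewrite !mulr_gt0// ltr_wpDl.
have [d d0 Hd] := limI_bound uv (divr_gt0 e0 K0).
exists d => // s h st h0 hd.
have s0 : 0 < s by case/andP: st => /(lt_le_trans _) + _; apply; rewrite divr_gt0.
set r := ((h^-1)%:C *: ((T h \o u) - u) - v : amb (Bop (X1 T))).
have Ir : I r.
  have IL := Arveson_linear dp sg; apply: (linear_subsetB IL) => //.
  by apply: (linear_subsetZ _ IL); apply: (linear_subsetB IL) => //; exact: Arveson_orbit.
have -> : h^-1 * (complex.Re (l (T (s + h) (u x))) - complex.Re (l (T s (u x)))) -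
   complex.Re (l (T s (v x))) = complex.Re (l (T s (r x))).
  rewrite /r !fctE /= (semigroupB sg)// (dualB dp _ _ Xl).
  rewrite -[_ *: _]addr0 (semigroup_linear sg)// (semigroup0 sg)// addr0.
  rewrite (dualM dp)// (semigroupB sg)// (dualB dp _ _ Xl) (semigroupM sg)//.
  by rewrite ReD ReN ReZ ReD ReN.
rewrite (le_trans (Re_le_cabs _))// (le_trans (lC _))//.
have bl := bounded_op_linear (Arveson_op Ir).
have rx : N (r x) <= O r * N x := opnorm_bound sX sX bl cx.
have or : O r <= e / ((C + 1) * M * (N x + 1)) by exact/ltW/Hd.
have Nx : 0 <= N x := nrm_ge0 (seminormed_banach X) (x := x) Logic.I.
rewrite (@le_trans _ _ ((C + 1) * (M * (e / ((C + 1) * M * (N x + 1)) * (N x + 1)))))//; last first.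
  rewrite le_eqVlt; apply/predU1P; left; field.
  by rewrite !gt_eqF// ltr_wpDl.
apply: ler_pM => //; [exact: (nrm_ge0 (seminormed_banach X))|by rewrite lerDl|].
rewrite (le_trans (semigroup_norm_le sg _ s0))//.
apply: ler_pM; [exact: (omegaT_ge0 sg)|exact: (nrm_ge0 (seminormed_banach X))|exact: Mw|].
rewrite (le_trans rx)//; apply: ler_pM => //; last by rewrite lerDl.
exact: (nrm_ge0 sB (Arveson_op Ir)).
Qed.

Lemma limI_generator f0 f0' u v : generating w f0 f0' -> I u -> I v -> limI Xs T u v ->
  (- phiI Xs T f0' : amb (Bop (X1 T))) \o u = phiI Xs T f0 \o v.
Proof.
move=> gf Iu Iv uv; have [_ [f0L _] _ f0'L] := gf.
have [uX _ _ u0] := Arveson_op Iu; have [vX _ _ v0] := Arveson_op Iv.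
apply/funext => x; rewrite [LHS]/= fctE /=; have [cx|cx] := pselect (cX x); last first.
  rewrite u0// v0//.
  rewrite (bounded_linear0 sX (bounded_op_linear (phiI_op dp sg f0'L))) oppr0.
  by rewrite (bounded_linear0 sX (bounded_op_linear (phiI_op dp sg f0L))).
rewrite (phiIE _ _ (uX _ cx)) (phiIE _ _ (vX _ cx)); apply/esym.
apply: (phiX_eq dp sg) => // l Xl.
have -> : l (- phi f0' (u x)) = - l (phi f0' (u x)) by rewrite -sub0r (dualB dp _ _ Xl) (dual0 dp Xl) sub0r.
rewrite ReN (phiX_weak_integral dp sg _ f0'L Xl).
have [C1 C10 lC1] := orbit_pairing_le (u x) Xl.
have [C2 C20 lC2] := orbit_pairing_le (v x) Xl.
have w0 t : 0 < t -> 0 <= w t by exact: (omegaT_ge0 sg).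
have [d d0 Hd] := limI_bound uv ltr01.
have [C C0 lC] := dual_bounded dp Xl.
have Nx : 0 <= N x := nrm_ge0 (seminormed_banach X) (x := x) Logic.I.
(* Bound for the orbit on ]0, d[: T(t) u = u + t (r + v), where the error r of the difference
   quotient has norm at most 1 for t < d. *)
pose K := C * (N (u x) + d * (N x + N (v x))).
apply/esym; apply: (generating_parts (C := C1 + C2) (K := K) ww gf _ _ _ _ _ _ d0).
- exact: (orbit_continuous sg).
- exact: (orbit_continuous sg).
- by move=> t t0; exact: (limI_weak_derivative Iu Iv uv Xl cx t0).
(* The imaginary part for l is the real part for -i l. *)
- move=> t t0; have := limI_weak_derivative Iu Iv uv (dualZ dp (-'i%C) Xl) cx t0.
  by under eq_fun do rewrite ReMi; rewrite ReMi.
- by move=> t t0; rewrite (le_trans (lC1 t t0))// ler_wpM2r ?w0// lerDl.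
- by move=> t t0; rewrite (le_trans (lC2 t t0))// ler_wpM2r ?w0// lerDr.
move=> t t0 td; rewrite (le_trans (lC _))// ler_wpM2l//.
set r := ((t^-1)%:C *: ((T t \o u) - u) - v : amb (Bop (X1 T))).
have Ir : I r.
  have IL := Arveson_linear dp sg; apply: (linear_subsetB IL) => //.
  by apply: (linear_subsetZ _ IL); apply: (linear_subsetB IL) => //; exact: Arveson_orbit.
have rE : T t (u x) = u x + t%:C *: (r x + v x).
  rewrite /r !fctE /= subrK scalerA -rmorphM divff ?gt_eqF// scale1r.
  have aE (a b : X) : a = b + (a - b) by rewrite addrC subrK.
  exact: aE.
have rx : N (r x) <= O r * N x := opnorm_bound sX sX (bounded_op_linear (Arveson_op Ir)) cx.
have or : O r <= 1 by exact/ltW/Hd.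
rewrite rE (le_trans (rnormD _ _))// lerD// rnormZ cabs_real gtr0_norm//.
apply: ler_pM; [exact: ltW|exact: rnorm_ge0|exact: ltW|].
rewrite (le_trans (rnormD _ _))// lerD// (le_trans rx)// -[leRHS]mul1r.
by rewrite ler_wpM2r.
Qed.

(** The orbits of y x vanish, and y commutes with the semigroup, so y kills the ranges of all T(t),
    which are dense in [X1]. *)
Lemma Arveson_Omega_inj f y : Omega (U := L1 w) f -> I y ->
  (forall x, cX x -> phi f (y x) = 0) -> y = 0.
Proof.
move=> fO Iy fy; have [yX _ _ y0] := Arveson_op Iy.
have bl := bounded_op_linear (Arveson_op Iy).
have yT t x : 0 < t -> cX x -> y (T t x) = 0.
  move=> t0 cx; rewrite -(Arveson_orbit_comm dp sg)//.
  by apply: (phiX_Omega_inj fO _ t0); exact: fy.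
(* An arbitrary vector x need not lie in [X1], but T(t / 2) x does, and the other half of the time
   is still available. *)
have yT' t (x : X) : 0 < t -> y (T t x) = 0.
  move=> t0; have t2 : 0 < t / 2 by rewrite divr_gt0.
  have -> : T t x = T (t / 2) (T (t / 2) x) by rewrite (semigroupM sg)// -splitr.
  have c2 : cX (T (t / 2) x) by exact: X1_range.
  exact: (yT _ _ t2 c2).
apply/funext => x; have [cx|] := pselect (cX x); last exact: y0.
apply: (X1_separated (yX _ cx)); apply: (nrm_eq0_approx sX (yX _ cx)) => e e0.
have Oy : 0 < O y + 1 by rewrite ltr_wpDl// (nrm_ge0 sB (Arveson_op Iy)).
have := cx; rewrite X1_nclosure => -[_ /(_ _ (divr_gt0 e0 Oy))] [_ [t + [z _ <-]] xz].
rewrite halflineE => t0.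
have cz : cX (T t z) by exact: X1_range.
have dxz := linear_subsetB (X1_linear sg) cx cz.
have -> : y x = y (x - T t z) by rewrite (bounded_linearB sX bl)// yT' ?subr0.
rewrite (le_trans (opnorm_bound sX sX bl dxz))//.
rewrite (@le_trans _ _ ((O y + 1) * N (x - T t z)))//.
  by rewrite ler_wpM2r ?lerDl//; exact: (nrm_ge0 (seminormed_banach X)).
by rewrite -ler_pdivlMl// mulrC ltW.
Qed.

Lemma limI_genI lambda f0 f0' u v : generating w f0 f0' ->
  I u -> car (n := UT Xs T lambda) v -> limI Xs T u v ->
  genI_dom Xs T f0 f0' u /\ genI_val Xs T f0 f0' u = v.
Proof.
move=> gf Iu [[Iv _] _] uv; have [_ f0O _ f0'L] := gf; have [f0L _] := f0O.
have E := limI_generator gf Iu Iv uv.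
split; first by split => //; exists v.
rewrite /genI_val /qm_val; case: xgetP => [y _ [Iy Ey]|/(_ v)]; last by case.
have Iyv : I (y - v) := linear_subsetB (Arveson_linear dp sg) Iy Iv.
have [yX _ _ y0] := Arveson_op Iy; have [vX _ _ v0] := Arveson_op Iv.
apply/eqP; rewrite -subr_eq0; apply/eqP; apply: (Arveson_Omega_inj f0O Iyv) => x cx.
have cd : cX ((y - v) x) by have [+ _ _ _] := Arveson_op Iyv; exact.
rewrite -(phiIE _ _ cd) !fctE.
rewrite (bounded_linearB sX (bounded_op_linear (phiI_op dp sg f0L)) (yX _ cx) (vX _ cx)).
apply/eqP; rewrite subr_eq0; apply/eqP.
have := congr1 (fun S => S x) (etrans (esym Ey) E); exact.
Qed.

End arveson_generator.

(** * The algebra UT *)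

Section normalized_ideal.
Context {R : realType} (X : completeNormedModType R[i]) (Xs : set (X -> R[i]^o)).
Hypothesis dp : dual_pairing Xs.
Context (T : R -> X -> X).
Hypothesis sg : weakly_continuous_semigroup Xs T.
Context (lambda : R).
Hypothesis rhoL : (lne (rhoT T)%:E < lambda%:E)%E.
Local Notation N := (@nrm R (banach X)).
Local Notation w := (omegaT T).
Local Notation cX := (@car R (X1 T)).
Local Notation O := (@nrm R (Bop (X1 T))).
Local Notation I := (@car R (Arveson Xs T)).
Local Notation L := (@car R (LT Xs T lambda)).
Local Notation U := (@car R (UT Xs T lambda)).
Local Notation nU := (@nrm R (LT Xs T lambda)).
Local Notation act := (@actI R X T).
Implicit Types u v : X -> X.

Let ww : weight w := omegaT_weight dp sg.
Let sX : seminormed (X1 T) := seminormed_X1 sg.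
Let sB := seminormed_Bop sX.
Let IL : linear_subset (V := amb (Bop (X1 T))) I := Arveson_linear dp sg.

Lemma actI_pos t u : 0 < t -> act t u = T t \o u.
Proof. by move=> t0; rewrite /actI gt_eqF. Qed.

Lemma actI0 u : act 0 u = u. Proof. by rewrite /actI eqxx. Qed.

Lemma actI_Arveson t u : 0 <= t -> I u -> I (act t u).
Proof.
rewrite le_eqVlt => /predU1P[<-|t0] Iu; first by rewrite actI0.
by rewrite actI_pos//; exact: Arveson_orbit.
Qed.

Lemma actI_linear t a u v : 0 <= t -> act t (a *: (u : X -> X) + v) = a *: (act t u : X -> X) + act t v.
Proof.
rewrite le_eqVlt => /predU1P[<-|t0]; first by rewrite !actI0.
by rewrite !actI_pos//; apply/funext => x; rewrite !fctE /= (semigroup_linear sg).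
Qed.

Lemma actIB t u v : 0 <= t -> act t (u - v) = act t u - act t v.
Proof.
move=> t0; have -> : u - v = (-1) *: (v : X -> X) + u by rewrite scaleN1r addrC.
by rewrite actI_linear// scaleN1r addrC.
Qed.

Lemma actI_0 t : 0 <= t -> act t (0 : X -> X) = 0.
Proof. by move=> t0; rewrite -{1}(subrr (0 : X -> X)) actIB// subrr. Qed.

Lemma actI_comp s t u : 0 <= s -> 0 <= t -> act s (act t u) = act (s + t) u.
Proof.
rewrite le_eqVlt => /predU1P[<-|s0]; first by rewrite actI0 add0r.
rewrite le_eqVlt => /predU1P[<-|t0]; first by rewrite actI0 addr0.
by rewrite !actI_pos ?addr_gt0// (orbit_comp sg).
Qed.

Lemma exp_bound a : 0 < a -> exists2 C, 0 <= C & forall s, 0 <= s -> w (s + a) <= C * expR (lambda * s).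
Proof.
move=> a0; have [t0 t00 wt0] := weight_radius ww rhoL.
exact: (weight_exp_bound ww t00 wt0 a0).
Qed.

(** The norm of [LT] is the least such K ([LT_grows], [nU_le]); reasoning with this bound avoids its
    supremum. *)
Definition grows u K := forall s, 0 <= s -> O (act s u) <= K * expR (lambda * s).

(** A finite upper limit at 0 bounds the orbit on some ]0, d[; from d on the exponential bound on
    the weight takes over. Hence the supremum defining the norm is finite on all of [LT]. *)
Lemma LTP u : L u <-> I u /\ exists K, grows u K.
Proof.
split=> [[Iu /ereal_inf_lt[_ [V V0 <-] VM]]|[Iu [K uK]]].
  split => //; set M := ereal_sup _ in VM.
  have [d /= d0 dV] : exists2 d, 0 < d & forall t, 0 < t -> t < d -> V t.
    have [d /= d0 dV] := V0; exists d => // t t0 td; apply: dV => //.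
    by rewrite /ball_/= sub0r normrN gtr0_norm.
  have [K1 HK1] : exists K1, forall t, 0 < t -> t < d -> O (T t \o u) <= K1.
    exists (fine M) => t t0 td.
    have tM : ((O (act t u))%:E <= M)%E by apply: ereal_sup_ubound; exists t => //; exact: dV.
    rewrite -actI_pos// -lee_fin fineK//.
    by rewrite fin_numElt VM andbT (lt_le_trans _ tM)// ltNyr.
  have d2 : 0 < d / 2 by rewrite divr_gt0.
  (* The offset d / 2 is admissible because for s >= d the bound is taken at s - d / 2 >= 0. *)
  have [C C0 HC] := exp_bound d2.
  have O0 := nrm_ge0 sB (Arveson_op Iu).
  pose K2 := `|K1| * expR (`|lambda| * d).
  (* The three terms serve s = 0, 0 < s < d and s >= d. The exponential factors allow for lambda of
     either sign: on ]0, d[ they offset a small value of [expR (lambda * s)], beyond d the shift by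
     d / 2. *)
  exists (O u + K2 + C * expR (`|lambda| * d) * O u) => s; rewrite le_eqVlt => /predU1P[<-|s0].
    rewrite actI0 mulr0 expR0 mulr1 -addrA lerDl addr_ge0 ?mulr_ge0 ?expR_ge0//.
  rewrite actI_pos//; have [sd|sd] := ltP s d.
    rewrite (le_trans (HK1 _ s0 sd))// (@le_trans _ _ (K2 * expR (lambda * s)))//; last first.
      by rewrite ler_wpM2r ?expR_ge0// -addrA addrCA lerDl addr_ge0// !mulr_ge0 ?expR_ge0.
    rewrite /K2 -mulrA -expRD (le_trans (ler_norm _))// ler_peMr// -expR0 ler_expR.
    rewrite -lerBlDr sub0r (le_trans (ler_norm _))// normrN normrM ler_wpM2l//.
    by rewrite gtr0_norm// ltW.
  have sd2 : 0 <= s - d / 2 by lra.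
  have := HC _ sd2; rewrite subrK => ws.
  rewrite (le_trans (orbit_norm_le sg s0 (Arveson_op Iu)))//.
  rewrite (@le_trans _ _ (C * expR (`|lambda| * d) * O u * expR (lambda * s)))//; last first.
    by rewrite ler_wpM2r ?expR_ge0// lerDr addr_ge0// mulr_ge0 ?expR_ge0.
  rewrite [leRHS]mulrAC ler_wpM2r// (le_trans ws)// -mulrA ler_wpM2l// -expRD ler_expR.
  rewrite mulrBr addrC lerD2r (le_trans (ler_norm _))// normrN normrM ler_wpM2l//.
  by rewrite gtr0_norm//; lra.
split => //; apply: (@le_lt_trans _ _ (`|K| * expR `|lambda|)%:E); last exact: ltry.
apply: (@le_trans _ _ (ereal_sup [set (O (act t u))%:E | t in `]0, 1[%classic])).
  apply: ereal_inf_lbound; exists `]0, 1[%classic => //.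
  exists 1 => //= t; rewrite /ball_/= sub0r normrN => t1 t0.
  by rewrite in_itv/= t0 (le_lt_trans (ler_norm _) t1).
apply: ub_ereal_sup => _ [t + <-]; rewrite /= in_itv/= => /andP[t0 t1]; rewrite lee_fin.
rewrite (le_trans (uK _ (ltW t0)))// ler_pM ?expR_ge0 ?ler_norm//; last first.
  by rewrite ler_expR (le_trans (ler_norm _))// normrM ler_piMr// gtr0_norm// ltW.
have := uK _ (ltW t0); rewrite leNgt; apply: contraNT; rewrite -ltNge => K0.
rewrite (@lt_le_trans _ _ 0)//; first by rewrite nmulr_rlt0// expR_gt0.
exact: (nrm_ge0 sB (Arveson_op (actI_Arveson (ltW t0) Iu))).
Qed.

Lemma LT_Arveson u : L u -> I u. Proof. by case/LTP. Qed.

Let lamsetE s (x : R) : expR (- lambda * s) * x = x / expR (lambda * s).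
Proof. by rewrite mulNr expRN mulrC. Qed.

Lemma LT_grows u : L u -> grows u (nU u).
Proof.
move=> /LTP[Iu [K uK]] s s0; rewrite -ler_pdivrMr ?expR_gt0// -lamsetE.
apply: ub_le_sup; last by exists s.
exists K => _ [t t0 <-]; rewrite lamsetE ler_pdivrMr ?expR_gt0//; exact: uK.
Qed.

Lemma nU_le u K : grows u K -> nU u <= K.
Proof.
move=> uK; apply: ge_sup.
  by exists (expR (- lambda * 0) * O (act 0 u)); exists 0 => //=.
by move=> _ [t t0 <-]; rewrite lamsetE ler_pdivrMr ?expR_gt0//; exact: uK.
Qed.

Lemma nI_le_nU u : L u -> O u <= nU u.
Proof. by move=> /LT_grows/(_ 0 (lexx 0)); rewrite actI0 mulr0 expR0 mulr1. Qed.

Lemma LT_linear : linear_subset (V := amb (Bop (X1 T))) L.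
Proof.
split.
  apply/LTP; split; first by case: IL.
  exists 0 => s s0; rewrite mul0r.
  by rewrite actI_0// (nrm0 sB).
move=> a u v Lu Lv; apply/LTP; split.
  by case: IL => _; apply; exact: LT_Arveson.
exists (cabs a * nU u + nU v) => s s0; rewrite actI_linear//.
have Is := actI_Arveson s0 (LT_Arveson Lu); have It := actI_Arveson s0 (LT_Arveson Lv).
have bs := linear_subsetZ a (bounded_op_subset sX) (Arveson_op Is).
rewrite (le_trans (nrmD sB bs (Arveson_op It)))// mulrDl (nrmZ sB a (Arveson_op Is)).
by rewrite lerD ?(LT_grows Lv)// -mulrA ler_wpM2l ?cabs_ge0//; exact: LT_grows.
Qed.

Lemma seminormed_LT : seminormed (LT Xs T lambda).
Proof.
have LL := LT_linear; have [L0 LD] := LL.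
split => //.
- move=> u Lu; rewrite (le_trans _ (nI_le_nU Lu))//.
  exact: (nrm_ge0 sB (Arveson_op (LT_Arveson Lu))).
- move=> u v Lu Lv; apply: nU_le => s s0.
  have Is := actI_Arveson s0 (LT_Arveson Lu); have It := actI_Arveson s0 (LT_Arveson Lv).
  have := actI_linear 1 u v s0; rewrite !scale1r => ->.
  rewrite (le_trans (nrmD sB (Arveson_op Is) (Arveson_op It)))// mulrDl.
  by rewrite lerD//; exact: LT_grows.
have nZ a u : L u -> nU (a *: (u : amb (Bop (X1 T)))) <= cabs a * nU u.
  move=> Lu; apply: nU_le => s s0.
  have := actI_linear a u 0 s0; rewrite addr0 => ->.
  rewrite actI_0// addr0 (nrmZ sB a (Arveson_op (actI_Arveson s0 (LT_Arveson Lu)))).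
  by rewrite -mulrA ler_wpM2l ?cabs_ge0//; exact: LT_grows.
move=> a u Lu; apply/eqP; rewrite eq_le nZ//=.
have [->|a0] := eqVneq a 0.
  rewrite cabs0 mul0r scale0r (le_trans _ (nI_le_nU L0))//.
  exact: (nrm_ge0 sB (Arveson_op (LT_Arveson L0))).
have ca0 : 0 < cabs a.
  by rewrite lt_neqAle cabs_ge0 andbT eq_sym; apply: contra a0 => /eqP/cabs0_eq0/eqP.
have := nZ a^-1 _ (linear_subsetZ a LL Lu); rewrite scalerA mulVf// scale1r.
have -> : cabs a^-1 = (cabs a)^-1.
  apply: (mulfI (lt0r_neq0 ca0)).
  by rewrite -cabsM divff// divff ?gt_eqF// cabs_real normr1.
by rewrite ler_pdivlMl.
Qed.

Let sL := seminormed_LT.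

Lemma LT_separated u : L u -> nU u = 0 -> u = 0.
Proof.
move=> Lu u0; have [uX _ _ uo] := Arveson_op (LT_Arveson Lu).
have Ou : O u <= 0 by rewrite -u0; exact: nI_le_nU.
apply/funext => x; have [cx|] := pselect (cX x); last exact: uo.
apply: (X1_separated (uX _ cx)); apply/eqP; rewrite eq_le (nrm_ge0 sX (uX _ cx)) andbT.
rewrite (le_trans (opnorm_bound sX sX (bounded_op_linear (Arveson_op (LT_Arveson Lu))) cx))//.
by rewrite mulr_le0_ge0//; exact: (nrm_ge0 sX).
Qed.

Lemma LT_actI t u : 0 <= t -> L u -> L (act t u) /\ nU (act t u) <= expR (lambda * t) * nU u.
Proof.
move=> t0 Lu; have g : grows (act t u) (expR (lambda * t) * nU u).
  move=> s s0; rewrite actI_comp// (le_trans (LT_grows Lu (addr_ge0 s0 t0)))//.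
  by rewrite mulrDr expRD le_eqVlt; apply/predU1P; left; ring.
split; last exact: nU_le.
by apply/LTP; split; [exact: actI_Arveson (LT_Arveson Lu)|exists (expR (lambda * t) * nU u)].
Qed.

(** T(a) regularizes: the exponential bound with offset a controls the stronger norm of [LT] by the
    operator norm. *)
Lemma LT_orbit a : 0 < a -> exists2 C, 0 <= C & forall u, I u ->
  L (T a \o u) /\ nU (T a \o u) <= C * O u.
Proof.
move=> a0; have [C C0 HC] := exp_bound a0; exists C => // u Iu.
have g : grows (T a \o u) (C * O u).
  move=> s s0; rewrite -(actI_pos _ a0) actI_comp ?(ltW a0)// actI_pos ?ltr_wpDl//.
  rewrite (le_trans (orbit_norm_le sg (ltr_wpDl s0 a0) (Arveson_op Iu)))//.
  by rewrite mulrAC ler_wpM2r ?HC// (nrm_ge0 sB (Arveson_op Iu)).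
split; last exact: nU_le.
by apply/LTP; split; [exact: Arveson_orbit|exists (C * O u)].
Qed.

Lemma Arveson_actI_comm t u v : 0 <= t -> I u -> I v -> act t (u \o v) = u \o act t v.
Proof.
rewrite le_eqVlt => /predU1P[<-|t0] Iu Iv; first by rewrite !actI0.
rewrite !actI_pos//; have [vX _ _ v0] := Arveson_op Iv; have [_ _ _ u0] := Arveson_op Iu.
apply/funext => x /=; have [cx|cx] := pselect (cX x).
  exact: (Arveson_orbit_comm dp sg Iu t0 (vX _ cx)).
rewrite v0// (semigroup0 sg)// (bounded_linear0 sX (bounded_op_linear (Arveson_op Iu))).
by rewrite (semigroup0 sg).
Qed.

(** The action can be moved past u onto v, so only the growth of v matters. This is what makes every
    u of the Arveson ideal a bounded multiplier. *)
Lemma LT_mul u v : I u -> L v -> L (u \o v) /\ nU (u \o v) <= O u * nU v.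
Proof.
move=> Iu Lv; have Iv := LT_Arveson Lv.
have g : grows (u \o v) (O u * nU v).
  move=> s s0; rewrite Arveson_actI_comm//.
  have b := Arveson_op (actI_Arveson s0 Iv).
  rewrite (le_trans (opnorm_comp sX (Arveson_op Iu) b))// -mulrA ler_wpM2l//.
    exact: (nrm_ge0 sB (Arveson_op Iu)).
  exact: LT_grows.
split; last exact: nU_le.
by apply/LTP; split; [exact: Arveson_mul|exists (O u * nU v)].
Qed.

Let P := \bigcup_(t in halfline R) [set act t u | u in I].

Let PP u : P u <-> exists a v, [/\ 0 < a, I v & u = T a \o v].
Proof.
split=> [[a + [v Iv <-]]|[a [v [a0 Iv ->]]]].
  by rewrite halflineE => a0; exists a, v; rewrite actI_pos.
by exists a; [rewrite halflineE|exists v => //; rewrite actI_pos].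
Qed.

Let P_L : P `<=` L.
Proof. by move=> _ /PP[a [v [a0 Iv ->]]]; have [C _ /(_ v Iv)[]] := LT_orbit a0. Qed.

Let P_linear : linear_subset (V := amb (Bop (X1 T))) P.
Proof.
split.
  apply/PP; exists 1, 0; split => //; first by case: IL.
  by apply/funext => x; rewrite /= (semigroup0 sg).
move=> a _ _ /PP[t1 [u1 [t10 I1 ->]]] /PP[t2 [u2 [t20 I2 ->]]]; apply/PP.
pose m := Num.min t1 t2 / 2.
have m0 : 0 < m by rewrite divr_gt0// lt_min t10.
have m2 : m + m = Num.min t1 t2 by rewrite -splitr.
have m1 : m < t1 by rewrite (@lt_le_trans _ _ (m + m)) ?ltrDl// m2 ge_min lexx.
have m3 : m < t2 by rewrite (@lt_le_trans _ _ (m + m)) ?ltrDl// m2 ge_min lexx orbT.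
exists m, (a *: ((T (t1 - m) \o u1) : amb (Bop (X1 T))) + (T (t2 - m) \o u2)); split => //.
  by case: IL => _; apply; apply: Arveson_orbit => //; rewrite subr_gt0.
apply/funext => x; rewrite !fctE /= (semigroup_linear sg)// !(semigroupM sg) ?subr_gt0//.
by rewrite ![m + _]addrC !subrK.
Qed.

Lemma UT_LT u : U u -> L u. Proof. by case. Qed.

Lemma UT_Arveson u : U u -> I u. Proof. by move=> /UT_LT/LT_Arveson. Qed.

Lemma UT_linear : linear_subset (V := amb (Bop (X1 T))) U.
Proof. by apply: (nclosure_linear sL). Qed.

Lemma seminormed_UT : seminormed (UT Xs T lambda).
Proof. by apply: (seminormed_sub sL) => [u /UT_LT//|]; exact: UT_linear. Qed.

Lemma UT_closed u : L u -> (forall e, 0 < e -> exists2 v, U v & nU (u - v) < e) -> U u.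
Proof. by move=> Lu au; apply: (nclosure_idem sL). Qed.

Lemma UT_orbit a u : 0 < a -> I u -> U (T a \o u).
Proof.
by move=> a0 Iu; apply: (sub_nclosure sL) => //; apply/PP; exists a, u.
Qed.

Lemma UT_actI t u : 0 <= t -> U u -> U (act t u).
Proof.
rewrite le_eqVlt => /predU1P[<-|t0] Uu; first by rewrite actI0.
have Iu := UT_Arveson Uu; rewrite (actI_pos _ t0).
by apply: UT_orbit t0 Iu.
Qed.

Lemma UT_mul u v : I u -> U v -> U (u \o v).
Proof.
move=> Iu Uv; have [Luv _] := LT_mul Iu (UT_LT Uv); apply: UT_closed => // e e0.
have O1 : 0 < O u + 1 by rewrite ltr_wpDl// (nrm_ge0 sB (Arveson_op Iu)).
have [_ /(_ _ (divr_gt0 e0 O1))[p Pp vp]] := Uv.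
have /PP[a [p' [a0 Ip' pE]]] := Pp.
exists (u \o p).
  have := Arveson_actI_comm (ltW a0) Iu Ip'; rewrite !(actI_pos _ a0) pE => <-.
  exact: (UT_orbit a0 (Arveson_mul dp sg Iu Ip')).
have [vX _ _ v0] := Arveson_op (UT_Arveson Uv); have [pX _ _ p0] := Arveson_op (LT_Arveson (P_L Pp)).
have -> : (u \o v) - (u \o p) = u \o (v - p).
  apply/funext => x; rewrite !fctE /=; have [cx|cx] := pselect (cX x).
    by rewrite (bounded_linearB sX (bounded_op_linear (Arveson_op Iu)) (vX _ cx) (pX _ cx)).
  by rewrite v0// p0// subr0 subrr (bounded_linear0 sX (bounded_op_linear (Arveson_op Iu))).
have Lvp : L (v - p) := linear_subsetB LT_linear (UT_LT Uv) (P_L Pp).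
have [_ le] := LT_mul Iu Lvp; rewrite (le_lt_trans le)//.
rewrite (@le_lt_trans _ _ ((O u + 1) * nU (v - p)))//.
  by rewrite ler_wpM2r ?lerDl//; exact: (nrm_ge0 sL).
by rewrite -ltr_pdivlMl// mulrC.
Qed.

(** For the dense elements T(a) v, one half of the time a gives operator norm continuity of the
    orbit at a / 2, and the other half, through [LT_orbit], converts the operator norm into that of
    [LT]. Density suffices here because the action is uniformly bounded for h < 1. *)
Lemma UT_strongly_continuous u e : U u -> 0 < e -> exists2 d, 0 < d &
  forall h, 0 < h -> h < d -> nU (act h u - u) <= e.
Proof.
move=> Uu e0; pose K := expR `|lambda| + 1.
have K0 : 0 < K by rewrite ltr_wpDl// expR_ge0.
have [_ /(_ (e / 2 / K))[|p Pp up]] := Uu; first by rewrite !divr_gt0.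
have /PP[a [v [a0 Iv pE]]] := Pp.
have a2 : 0 < a / 2 by rewrite divr_gt0.
have [C C0 HC] := LT_orbit a2.
have C1 : 0 < C + 1 by rewrite ltr_wpDl.
have ec : 0 < e / 2 / (C + 1) by rewrite !divr_gt0.
have [d d0 Hd] := orbit_right_continuous dp sg a2 Iv ec.
exists (Num.min d 1) => [|h h0]; first by rewrite lt_min d0 ltr01.
rewrite lt_min => /andP[hd h1].
have Lu := UT_LT Uu; have Lp := P_L Pp.
have [Lhu _] := LT_actI (ltW h0) Lu; have [Lhp _] := LT_actI (ltW h0) Lp.
have LB x y : L x -> L y -> L (x - y) by move=> Lx Ly; exact: linear_subsetB LT_linear Lx Ly.
have Lup := LB _ _ Lu Lp.
have [Lhup le1] := LT_actI (ltW h0) Lup.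
have hp : nU (act h p - p) <= e / 2.
  have Iq : I ((T (a / 2 + h) \o v) - (T (a / 2) \o v)).
    by apply: (linear_subsetB IL); apply: Arveson_orbit => //; rewrite addr_gt0.
  have -> : act h p - p = T (a / 2) \o ((T (a / 2 + h) \o v) - (T (a / 2) \o v)).
    rewrite actI_pos// pE (orbitB sg)// !(orbit_comp sg) ?addr_gt0// -splitr.
    by rewrite addrA -splitr addrC.
  have [_ le] := HC _ Iq; rewrite (le_trans le)//.
  rewrite (@le_trans _ _ ((C + 1) * (e / 2 / (C + 1))))//; last by rewrite mulrC divfK// gt_eqF.
  by rewrite ler_pM ?lerDl ?Hd//; exact: (nrm_ge0 sB (Arveson_op Iq)).
have -> : act h u - u = act h (u - p) + (act h p - p) - (u - p).
  have alg (V : zmodType) (x y z t : V) : x - t = (x - y) + (y - z) - (t - z).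
    by rewrite addrA subrK opprB addrA subrK.
  by rewrite actIB ?(ltW h0)//; exact: alg.
have Lhpp := LB _ _ Lhp Lp.
rewrite (le_trans (nrmB sL (linear_subsetD LT_linear Lhup Lhpp) Lup))//.
have := nrmD sL Lhup Lhpp.
have el : expR (lambda * h) <= expR `|lambda|.
  by rewrite ler_expR (le_trans (ler_norm _))// normrM ler_piMr// gtr0_norm// ltW.
have le2 : expR (lambda * h) * nU (u - p) <= expR `|lambda| * nU (u - p).
  by rewrite ler_wpM2r//; exact: (nrm_ge0 sL Lup).
have : K * nU (u - p) <= e / 2 by rewrite -ler_pdivlMl// mulrC ltW.
rewrite /K mulrDl mul1r; move: le1 le2 hp; lra.
Qed.

End normalized_ideal.

(** * Multiplier algebras with a semigroup action *)

Section completeness.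
Context {R : realType}.

Definition complete_nspace (E : nspace R) := forall u : nat -> amb E, (forall n, car (u n)) ->
  (forall e, 0 < e -> exists n0, forall n m, (n0 <= n)%N -> (n0 <= m)%N -> nrm (u n - u m) < e) ->
  exists2 y, car y & forall e, 0 < e -> exists n0, forall n, (n0 <= n)%N -> nrm (u n - y) < e.

Lemma complete_closed (E : nspace R) (C : set (amb E)) : seminormed E -> complete_nspace E ->
  C `<=` @car R E ->
  (forall y, car y -> (forall e, 0 < e -> exists2 c, C c & nrm (y - c) < e) -> C y) ->
  complete_nspace (@NSpace R (amb E) C (@nrm R E)).
Proof.
move=> sE cE CE Cc u Cu ucauchy.
have [y cy uy] := cE u (fun n => CE _ (Cu n)) ucauchy.
exists y => //; apply: Cc => // e e0; have [n0 /(_ n0 (leqnn _)) Hn] := uy e e0.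
by exists (u n0); [exact: Cu|have <- := nrmBC sE (CE _ (Cu n0)) cy].
Qed.

Lemma limit_unique (E : nspace R) (u : nat -> amb E) y y' : seminormed E ->
  (forall x : amb E, car x -> nrm x = 0 -> x = 0) -> (forall n, car (u n)) -> car y -> car y' ->
  (forall e, 0 < e -> exists n0, forall n, (n0 <= n)%N -> nrm (u n - y) < e) ->
  (forall e, 0 < e -> exists n0, forall n, (n0 <= n)%N -> nrm (u n - y') < e) -> y = y'.
Proof.
move=> sE E0 cu cy cy' uy uy'; apply/eqP; rewrite -subr_eq0; apply/eqP.
have cd := linear_subsetB (seminormed_linear sE) cy cy'.
apply: E0 => //; apply: nrm_eq0_approx => // e e0; have e2 : 0 < e / 2 by rewrite divr_gt0.
have [n1 H1] := uy _ e2; have [n2 H2] := uy' _ e2; pose n := maxn n1 n2.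
rewrite (le_trans (nrm_trans sE cy (cu n) cy'))// [e]splitr lerD// ltW//.
  by rewrite (nrmBC sE cy (cu n)) H1// leq_maxl.
by rewrite H2// leq_maxr.
Qed.

Lemma complete_Bop (E : nspace R) : seminormed E ->
  (forall x : amb E, car x -> nrm x = 0 -> x = 0) -> complete_nspace E -> complete_nspace (Bop E).
Proof.
move=> sE E0 cE u bu ucauchy; have EL := seminormed_linear sE.
have sB := seminormed_Bop sE.
have unx n m x : car x -> nrm (u n x - u m x) <= nrm (n := Bop E) (u n - u m) * nrm x.
  move=> cx; have b : bounded_op (E := E) (u n - u m).
    exact: linear_subsetB (bounded_op_subset sE) (bu n) (bu m).
  exact: (opnorm_bound sE sE (bounded_op_linear b) cx).
have ucar n x : car x -> car (u n x) by have [+ _ _ _] := bu n; exact.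
have nB n m : 0 <= nrm (n := Bop E) (u n - u m).
  apply: (nrm_ge0 sB); exact: (linear_subsetB (bounded_op_subset sE) (bu n) (bu m)).
pose lim x y := car y /\ forall e, 0 < e -> exists n0, forall n, (n0 <= n)%N -> nrm (u n x - y) < e.
have limE x : car x -> exists y, lim x y.
  move=> cx; have x1 : 0 < nrm x + 1 by rewrite ltr_wpDl// (nrm_ge0 sE).
  have [|y cy uy] := cE (fun n => u n x) (fun n => ucar n x cx); last by exists y.
  move=> e e0; have [n0 Hn] := ucauchy _ (divr_gt0 e0 x1); exists n0 => n m n0n n0m.
  rewrite (le_lt_trans (unx _ _ _ cx))//.
  rewrite (@le_lt_trans _ _ (nrm (n := Bop E) (u n - u m) * (nrm x + 1)))//.
    by rewrite ler_wpM2l// lerDl.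
  by rewrite -ltr_pdivlMr// Hn.
pose S x := if `[< car x >] then xget 0 (lim x) else 0.
have SE x : car x -> lim x (S x).
  move=> cx; rewrite /S asboolT//; case: xgetP => // nl.
  by have [y ly] := limE x cx; case: (nl y).
have Slim e : 0 < e -> exists n0, forall n, (n0 <= n)%N -> forall x, car x -> nrm (u n x - S x) <= e * nrm x.
  move=> e0; have [n0 Hn] := ucauchy _ e0; exists n0 => n n0n x cx.
  have [cS uS] := SE x cx.
  apply/ler_addgt0Pr => d d0; have [n1 H1] := uS _ d0; pose m := maxn n0 n1.
  rewrite (le_trans (nrm_trans sE (ucar n _ cx) (ucar m _ cx) cS))// lerD//.
    by rewrite (le_trans (unx _ _ _ cx))// ler_wpM2r ?(nrm_ge0 sE)// ltW// Hn// leq_maxl.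
  by rewrite ltW// H1// leq_maxr.
have bS : bounded_op (E := E) S.
  split.
  - by move=> x /SE[].
  - move=> a x y cx cy.
    have [EL0 ELL] := EL.
    have [cSx Sx] := SE x cx; have [cSy Sy] := SE y cy; have [cS Sa] := SE _ (ELL a x y cx cy).
    apply: (limit_unique sE E0 (fun n => ucar n _ (ELL a x y cx cy)) cS _ Sa); first exact: ELL.
    move=> e e0; have a1 : 0 < cabs a + 1 by rewrite ltr_wpDl// cabs_ge0.
    have e2 : 0 < e / 2 by rewrite divr_gt0.
    have [n1 H1] := Sx _ (divr_gt0 e2 a1); have [n2 H2] := Sy _ e2.
    exists (maxn n1 n2) => n; rewrite geq_max => /andP[n1n n2n].
    have [_ uL _ _] := bu n; rewrite uL//.
    have -> : a *: u n x + u n y - (a *: S x + S y) = a *: (u n x - S x) + (u n y - S y).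
      by rewrite scalerBr opprD addrACA.
    have d1 := linear_subsetB EL (ucar n _ cx) cSx; have d2 := linear_subsetB EL (ucar n _ cy) cSy.
    rewrite (le_lt_trans (nrmD sE (linear_subsetZ a EL d1) d2))// (nrmZ sE a d1).
    rewrite [e]splitr ler_ltD ?H2//.
    rewrite (@le_trans _ _ ((cabs a + 1) * nrm (u n x - S x)))//.
      by rewrite ler_wpM2r ?(nrm_ge0 sE)// lerDl.
    by rewrite -ler_pdivlMl// mulrC ltW// H1.
  - have [n0 Hn] := Slim _ ltr01; exists (nrm (n := Bop E) (u n0) + 1) => x cx.
    have [cS _] := SE x cx; have cu := ucar n0 _ cx.
    have -> : S x = u n0 x - (u n0 x - S x) by rewrite subKr.
    rewrite (le_trans (nrmB sE cu (linear_subsetB EL cu cS)))// mulrDl lerD ?Hn//.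
    exact: (opnorm_bound sE sE (bounded_op_linear (bu n0)) cx).
  - by move=> x ncx; rewrite /S asboolF.
exists S => // e e0; have e2 : 0 < e / 2 by rewrite divr_gt0.
have [n0 Hn] := Slim _ e2; exists n0 => n n0n.
have b : bounded_op (E := E) (u n - S) := linear_subsetB (bounded_op_subset sE) (bu n) bS.
rewrite (@le_lt_trans _ _ (e / 2))//; last by rewrite ltr_pdivrMr// ltr_pMr// ltr1n.
by apply: (opnorm_le sE (bounded_op_linear b)); [exact: ltW|exact: Hn].
Qed.

End completeness.

(** For r < r' the increment of the orbit is a(r) applied to a(r' - r) x - x, so continuity at 0 and
    the exponential bound give continuity from both sides. *)
Lemma semigroup_orbit_continuous {R : realType} (E : nspace R) (a : R -> amb E -> amb E) lambda :
  seminormed E -> (forall t x, 0 < t -> car x -> car (a t x)) ->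
  (forall t x y, 0 < t -> a t (x - y) = a t x - a t y) ->
  (forall t x, 0 < t -> car x -> nrm (a t x) <= expR (lambda * t) * nrm x) ->
  (forall s t x, 0 < s -> 0 < t -> a s (a t x) = a (s + t) x) ->
  forall x, car x -> (forall e, 0 < e -> exists2 d, 0 < d &
    forall h, 0 < h -> h < d -> nrm (a h x - x) <= e) ->
  forall t e, 0 < t -> 0 < e -> exists2 d, 0 < d &
    forall s, 0 < s -> `|s - t| < d -> nrm (a s x - a t x) <= e.
Proof.
move=> sE aE aB an ac x cx xc t e t0 e0; pose K := expR (`|lambda| * (t + 1)).
have K0 : 0 < K by exact: expR_gt0.
have [d d0 Hd] := xc _ (divr_gt0 e0 K0).
exists (Num.min d 1) => [|s s0]; first by rewrite lt_min d0 ltr01.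
rewrite lt_min => /andP[sd s1].
have key r r' : 0 < r -> r < r' -> r' <= t + 1 -> `|r' - r| < d -> nrm (a r' x - a r x) <= e.
  move=> r0 rr' rt rd; have rr'0 : 0 < r' - r by rewrite subr_gt0.
  have -> : a r' x - a r x = a r (a (r' - r) x - x).
    by rewrite aB// ac// [r + _]addrC subrK.
  have cd := linear_subsetB (seminormed_linear sE) (aE _ _ rr'0 cx) cx.
  rewrite (le_trans (an _ _ r0 cd))//.
  rewrite (@le_trans _ _ (K * (e / K)))//; last by rewrite mulrC divfK// gt_eqF.
  apply: ler_pM; [exact: expR_ge0|exact: (nrm_ge0 sE cd)| |].
    rewrite ler_expR (le_trans (ler_norm _))// normrM ler_wpM2l// gtr0_norm//.
    by rewrite ltW// (lt_le_trans rr').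
  by apply: Hd => //; rewrite (le_lt_trans (ler_norm _)).
have [st|st|->] := ltgtP s t.
- rewrite (nrmBC sE (aE _ _ s0 cx) (aE _ _ t0 cx)).
  by apply: key => //; [rewrite lerDl|rewrite distrC].
- by apply: key => //; move: s1; rewrite gtr0_norm ?subr_gt0//; lra.
- by rewrite subrr (nrm0 sE) ltW.
Qed.

(** * Closures of multiplier algebras under an abstract action *)

Section multiplier_semigroup.
Context {R : realType}.
Local Notation mu := (@lebesgue_measure R).
Local Notation RM := (measurableTypeR R).
Local Notation D := (halfline R).

Definition act_mult (A : nalg R) (act : R -> amb A -> amb A) (t : R) (S : amb A -> amb A) :
  amb A -> amb A := fun v => act t (S v).

(* The situation of [UT] acted upon by [T], by the Arveson ideal [P], and tested against the
   functionals [Phi], here v |-> l (v x). *)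
Record multiplier_semigroup (A : nalg R) (P : set (amb A -> amb A)) (act : R -> amb A -> amb A)
    (lambda : R) (Phi : set (amb A -> R[i]^o)) : Prop := MultiplierSemigroup {
  ms_seminormed : seminormed A;
  ms_separated : forall v : amb A, car v -> nrm v = 0 -> v = 0;
  ms_complete : complete_nspace A;
  ms_mul : forall u v : amb A, car u -> car v ->
    car (Defs.mul u v) /\ nrm (Defs.mul u v) <= nrm u * nrm v;
  ms_mulD : forall a (u u' v : amb A), car u -> car u' -> car v ->
    Defs.mul (a *: u + u') v = a *: Defs.mul u v + Defs.mul u' v;
  ms_sub : P `<=` @car R (Mult A);
  ms_linear : linear_subset (V := amb (Bop A)) P;
  ms_comp : forall S1 S2, P S1 -> P S2 -> P (S1 \o S2);
  ms_comm : forall S1 S2, P S1 -> P S2 -> S1 \o S2 = S2 \o S1;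
  ms_act_car : forall t v, 0 < t -> car v -> car (act t v);
  ms_act_linear : forall t a x y, 0 < t -> act t (a *: x + y) = a *: act t x + act t y;
  ms_act_norm : forall t v, 0 < t -> car v -> nrm (act t v) <= expR (lambda * t) * nrm v;
  ms_act_comp : forall s t v, 0 < s -> 0 < t -> act s (act t v) = act (s + t) v;
  ms_act_mul : forall t u v, 0 < t -> car u -> car v -> act t (Defs.mul u v) = Defs.mul (act t u) v;
  ms_act_P : forall t S, 0 < t -> P S -> P (act_mult act t S);
  ms_act_continuous : forall v e, car v -> 0 < e -> exists2 d, 0 < d &
    forall h, 0 < h -> h < d -> nrm (act h v - v) <= e;
  ms_P_continuous : forall S e, P S -> 0 < e -> exists S',
    [/\ P S', nrm (n := Mult A) (S - S') < e &
        forall e', 0 < e' -> exists2 d, 0 < d & forall h, 0 < h -> h < d ->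
          nrm (n := Mult A) (act_mult act h S' - S') <= e'];
  ms_Phi_linear : forall p a x y, Phi p -> p (a *: x + y) = a * p x + p y;
  ms_Phi_bounded : forall p, Phi p -> exists2 C, 0 <= C & forall v, car v -> cabs (p v) <= C * nrm v;
  ms_Phi_scale : forall p a, Phi p -> Phi (fun v => a * p v);
  ms_Phi_act : forall p t, Phi p -> 0 < t -> Phi (p \o act t);
  ms_norming : forall v c, car v -> 0 <= c ->
    (forall p, Phi p -> (forall u, car u -> cabs (p u) <= nrm u) -> complex.Re (p v) <= c) ->
    nrm v <= c;
  ms_integral : forall f a b M, 0 < a -> cmeasurable D f -> (forall t, cabs (f t) <= M) ->
    (forall t, ~~ (a <= t <= b) -> f t = 0) -> exists2 S, P S & forall v p, car v -> Phi p ->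
      complex.Re (p (S v)) = \int[mu]_(t in D) complex.Re (f t * p (act t v)) }.

Context (A : nalg R) (P : set (amb A -> amb A)) (act : R -> amb A -> amb A) (lambda : R).
Context (Phi : set (amb A -> R[i]^o)) (H : multiplier_semigroup P act lambda Phi).

(** For [UT] and the left multiplications by the Arveson ideal this is [JT] by conversion, and
    [act_weight] is then [omegaJ]. *)
Definition mclosure : nalg R := @subnalg R (Mult A) (@nclosure R (Mult A) P).
Definition act_weight (t : R) : R := @opnorm R mclosure mclosure (act_mult act t).

Local Notation V := (amb A).
Local Notation U := (@car R A).
Local Notation nU := (@nrm R A).
Local Notation Mu := (@car R (Mult A)).
Local Notation J := (@car R mclosure).
Local Notation nJ := (@nrm R mclosure).
Local Notation wJ := act_weight.
Local Notation actj := (act_mult act).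
Implicit Types (u v : V) (S : V -> V).

Let sA : seminormed A := ms_seminormed H.
Let UL : linear_subset U := seminormed_linear sA.
Let sB := seminormed_Bop sA.

Lemma act0 t : 0 < t -> act t 0 = 0.
Proof.
by move=> t0; have := ms_act_linear H (-1) 0 0 t0; rewrite !scaler0 addr0 scaleN1r addNr.
Qed.

Lemma actB t u v : 0 < t -> act t (u - v) = act t u - act t v.
Proof.
move=> t0; have -> : u - v = (-1) *: v + u by rewrite scaleN1r addrC.
by rewrite (ms_act_linear H)// scaleN1r addrC.
Qed.

Lemma Phi0 p : Phi p -> p 0 = 0.
Proof.
by move=> Pp; have := ms_Phi_linear H (-1) 0 0 Pp; rewrite !scaler0 addr0 mulN1r addNr.
Qed.

Lemma PhiZ p a v : Phi p -> p (a *: v) = a * p v.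
Proof. by move=> Pp; rewrite -[_ *: _]addr0 (ms_Phi_linear H)// Phi0// addr0. Qed.

Lemma PhiD p u v : Phi p -> p (u + v) = p u + p v.
Proof. by move=> Pp; rewrite -[u]scale1r (ms_Phi_linear H)// mul1r scale1r. Qed.

Lemma PhiB p u v : Phi p -> p (u - v) = p u - p v.
Proof. by move=> Pp; rewrite PhiD// -scaleN1r PhiZ// mulN1r. Qed.

Lemma Phi_separates v : U v -> (forall p, Phi p -> complex.Re (p v) = 0) -> nU v = 0.
Proof.
move=> Uv pv; apply/eqP; rewrite eq_le (nrm_ge0 sA Uv) andbT.
by apply: (ms_norming H) => // p Pp _; rewrite pv.
Qed.

Lemma Mult_op S : Mu S -> bounded_op (E := A) S. Proof. by case. Qed.

Lemma Mult_linear : linear_subset (V := amb (Bop A)) Mu.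
Proof.
have [B0 BL] := bounded_op_subset sA; split.
  split => // u v Uu Uv.
  have [U0 _] := UL; rewrite -[LHS]/(0 : V) -[X in Defs.mul X v]/(0 : V); have := ms_mulD H (-1) U0 U0 Uv.
  by rewrite !scaler0 addr0 scaleN1r addNr.
move=> a S1 S2 [b1 m1] [b2 m2]; split; first exact: BL.
move=> u v Uu Uv; have [c1 _ _ _] := b1; have [c2 _ _ _] := b2.
by rewrite !fctE m1// m2// (ms_mulD H) //; [exact: c1|exact: c2].
Qed.

Lemma Mult_comp S1 S2 : Mu S1 -> Mu S2 -> Mu (S1 \o S2).
Proof.
move=> [b1 m1] [b2 m2]; split; first exact: bounded_op_comp.
by move=> u v Uu Uv; have [c2 _ _ _] := b2; rewrite /= m2// m1//; exact: c2.
Qed.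

Let sM : seminormed (Mult A).
Proof. by apply: (seminormed_sub sB) => [S /Mult_op//|]; exact: Mult_linear. Qed.

Lemma mclosure_Mult S : J S -> Mu S. Proof. by case. Qed.

Lemma mclosure_op S : J S -> bounded_op (E := A) S. Proof. by move=> /mclosure_Mult/Mult_op. Qed.

Lemma sub_mclosure S : P S -> J S.
Proof. by move=> PS; apply: (sub_nclosure sM) => //; exact: (ms_sub H). Qed.

Lemma mclosure_linear : linear_subset (V := amb (Bop A)) J.
Proof. by apply: (nclosure_linear sM); [exact: (ms_sub H)|exact: (ms_linear H)]. Qed.

Lemma seminormed_mclosure : seminormed mclosure.
Proof. by apply: (seminormed_sub sM) => [S /mclosure_Mult//|]; exact: mclosure_linear. Qed.

Let sJ := seminormed_mclosure.

Lemma mclosure_closed S : Mu S -> (forall e, 0 < e -> exists2 S', J S' & nJ (S - S') < e) -> J S.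
Proof. by move=> MS aS; apply: (nclosure_idem sM) => //; exact: (ms_sub H). Qed.

Lemma mclosure_mul S1 S2 : J S1 -> J S2 -> J (S1 \o S2).
Proof.
apply: (nclosure_comp sA (C := Mu)).
- by move=> S /Mult_op.
- exact: Mult_comp.
- exact: (ms_sub H).
- exact: (ms_comp H).
Qed.


Lemma mclosure_comm S1 S2 : J S1 -> J S2 -> S1 \o S2 = S2 \o S1.
Proof.
have CB : Mu `<=` @car R (Bop A) by move=> S /Mult_op.
move=> J1 J2; apply: (nclosure_comm sA CB (ms_sub H) (ms_separated H) (mclosure_op J1) _ J2).
move=> S PS; apply/esym.
apply: (nclosure_comm sA CB (ms_sub H) (ms_separated H) (Mult_op (ms_sub H PS)) _ J1).
by move=> S' PS'; exact: (ms_comm H).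
Qed.

Lemma mclosure_val S v : J S -> U v -> U (S v) /\ nU (S v) <= nJ S * nU v.
Proof.
move=> JS Uv; have [SU _ _ _] := mclosure_op JS; split; first exact: SU.
exact: (opnorm_bound sA sA (bounded_op_linear (mclosure_op JS)) Uv).
Qed.

Lemma Mult_norm_le S c : Mu S -> 0 <= c -> (forall v, U v -> nU (S v) <= c * nU v) -> nJ S <= c.
Proof. by move=> [b _] c0 Sc; apply: (opnorm_le sA (bounded_op_linear b)). Qed.

Lemma mulBl u u' v : U u -> U u' -> U v -> Defs.mul (u - u') v = Defs.mul u v - Defs.mul u' v.
Proof.
move=> Uu Uu' Uv; have -> : u - u' = (-1) *: u' + u by rewrite scaleN1r addrC.
by rewrite (ms_mulD H)// scaleN1r addrC.
Qed.

(** The identity S(uv) = (Su)v survives norm limits, so [Mult A] is closed among the bounded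
    operators, which are complete; the closure of [P] is closed in it. *)
Lemma complete_mclosure : complete_nspace mclosure.
Proof.
have cM : complete_nspace (Mult A).
  apply: (complete_closed sB (complete_Bop sA (ms_separated H) (ms_complete H))).
    by move=> S /Mult_op.
  move=> S bS aS; split => // u v Uu Uv.
  have [SU _ _ _] := bS; have [Uuv nuv] := ms_mul H Uu Uv.
  have [USv _] := ms_mul H (SU _ Uu) Uv.
  have Ud := linear_subsetB UL (SU _ Uuv) USv.
  apply/eqP; rewrite -subr_eq0; apply/eqP; apply: (ms_separated H Ud).
  apply: (nrm_eq0_approx sA Ud) => e e0.
  have K0 : 0 < (nU u * nU v + 1) * 2.
    by rewrite mulr_gt0// ltr_wpDl// mulr_ge0//; exact: (nrm_ge0 sA).
  have [S' [bS' mS'] SS'] := aS _ (divr_gt0 e0 K0).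
  have [SU' _ _ _] := bS'; have [US'v _] := ms_mul H (SU' _ Uu) Uv.
  have bd := linear_subsetB (bounded_op_subset sA) bS bS'.
  have b1 := opnorm_bound sA sA (bounded_op_linear bd) Uuv.
  have b2 := opnorm_bound sA sA (bounded_op_linear bd) Uu.
  have Ud1 := linear_subsetB UL (SU _ Uuv) (SU' _ Uuv).
  have Ud2 := linear_subsetB UL (SU _ Uu) (SU' _ Uu).
  have [Ud2v nd2v] := ms_mul H Ud2 Uv.
  have -> : S (Defs.mul u v) - Defs.mul (S u) v =
      (S - S') (Defs.mul u v) - Defs.mul ((S - S') u) v.
    rewrite !fctE mulBl//; [|exact: SU|exact: SU'].
    by rewrite mS'// opprB addrA subrK.
  rewrite (le_trans (nrmB sA Ud1 Ud2v))//.
  have v0 := nrm_ge0 sA Uv; have u0 := nrm_ge0 sA Uu.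
  have uv0 : 0 <= nU u * nU v by exact: mulr_ge0.
  have n0 : 0 <= nrm (n := Bop A) (S - S') := nrm_ge0 sB bd.
  have B1 : nrm ((S - S') (Defs.mul u v)) <= nrm (n := Bop A) (S - S') * (nU u * nU v).
    by rewrite (le_trans b1)// ler_wpM2l.
  have B2 : nrm (Defs.mul ((S - S') u) v) <= nrm (n := Bop A) (S - S') * (nU u * nU v).
    by rewrite (le_trans nd2v)// mulrA ler_wpM2r.
  have B3 : nrm (n := Bop A) (S - S') * ((nU u * nU v + 1) * 2) <= e.
    by rewrite -ler_pdivlMr// ltW.
  move: B1 B2 B3 n0; lra.
apply: (complete_closed sM cM) => [S /mclosure_Mult//|S MS aS].
exact: mclosure_closed.
Qed.

Lemma act_bounded_linear t : 0 < t -> bounded_linear (E := A) (F := A) (act t).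
Proof.
move=> t0; split.
- by move=> v Uv; exact: (ms_act_car H).
- by move=> a v1 v2 _ _; exact: (ms_act_linear H).
- by exists (expR (lambda * t)) => v Uv; exact: (ms_act_norm H).
Qed.

Let ract t := restr (E := A) (act t).

Let ract_op t : 0 < t -> bounded_op (E := A) (ract t).
Proof. by move=> t0; apply: (restr_op sA); exact: act_bounded_linear. Qed.

Let ract_comp t S : 0 < t -> bounded_op (E := A) S -> ract t \o S = actj t S.
Proof.
move=> t0 [SU _ _ S0]; apply/funext => v; rewrite /= /act_mult.
have [Uv|Uv] := pselect (U v); first by rewrite /ract restr_in//; exact: SU.
by rewrite S0// act0// (bounded_linear0 sA (bounded_op_linear (ract_op t0))).
Qed.

Lemma act_mult_Mult t S : 0 < t -> Mu S -> Mu (actj t S).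
Proof.
move=> t0 [b m]; split.
  by rewrite -(ract_comp t0 b); exact: (bounded_op_comp sA (ract_op t0) b).
move=> u v Uu Uv; rewrite /act_mult m//; have [SU _ _ _] := b.
by rewrite (ms_act_mul H)//; exact: SU.
Qed.

Lemma act_mult_norm t S : 0 < t -> Mu S -> nJ (actj t S) <= expR (lambda * t) * nJ S.
Proof.
move=> t0 MS; have MtS := act_mult_Mult t0 MS; have [bS _] := MS.
apply: Mult_norm_le => //; first by rewrite mulr_ge0 ?expR_ge0//; exact: (nrm_ge0 sM MS).
move=> v Uv; have [SU _ _ _] := bS.
rewrite (le_trans (ms_act_norm H t0 (SU _ Uv)))// -mulrA ler_wpM2l ?expR_ge0//.
exact: (opnorm_bound sA sA (bounded_op_linear bS) Uv).
Qed.

Lemma act_mult_car t S : 0 < t -> J S -> J (actj t S).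
Proof.
move=> t0 JS; rewrite -(ract_comp t0 (mclosure_op JS)).
have CB : Mu `<=` @car R (Bop A) by move=> S' /Mult_op.
apply: (nclosure_lcomp sA CB Mult_linear (ms_sub H) (ract_op t0) _ _ JS).
- by move=> S' MS'; rewrite (ract_comp t0 (Mult_op MS')); exact: act_mult_Mult.
- move=> S' PS'; rewrite (ract_comp t0 (Mult_op (ms_sub H PS'))).
  by apply: sub_mclosure; exact: (ms_act_P H).
Qed.

Lemma act_mult_linear t a S1 S2 : 0 < t ->
  actj t (a *: (S1 : amb (Bop A)) + S2) = a *: (actj t S1 : amb (Bop A)) + actj t S2.
Proof. by move=> t0; apply/funext => v; rewrite /act_mult !fctE (ms_act_linear H). Qed.

Lemma act_multB t S1 S2 : 0 < t -> actj t (S1 - S2) = actj t S1 - actj t S2.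
Proof. by move=> t0; apply/funext => v; rewrite /act_mult !fctE actB. Qed.

Lemma act_mult_comp s t S : 0 < s -> 0 < t -> actj s (actj t S) = actj (s + t) S.
Proof. by move=> s0 t0; apply/funext => v; rewrite /act_mult (ms_act_comp H). Qed.

Lemma mclosureB S1 S2 : J S1 -> J S2 -> J (S1 - S2).
Proof. exact: linear_subsetB mclosure_linear. Qed.

Lemma subr_telescope (W : zmodType) (y z x t : W) : x - t = (x - y) + (y - z) - (t - z).
Proof. by rewrite addrA subrK opprB addrA subrK. Qed.

(** The elements with continuous orbit from [ms_P_continuous] are dense, and the action is bounded
    by [K] - 1 for h < 1. *)
Lemma mclosure_strongly_continuous S e : J S -> 0 < e -> exists2 d, 0 < d &
  forall h, 0 < h -> h < d -> nJ (actj h S - S) <= e.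
Proof.
move=> JS e0; pose K := expR `|lambda| + 1.
have K0 : 0 < K by rewrite ltr_wpDl// expR_ge0.
have eK : 0 < e / 2 / K / 2 by rewrite !divr_gt0.
have [_ /(_ _ eK)[S0 PS0 SS0]] := JS.
have [p [Pp S0p pc]] := ms_P_continuous H PS0 eK.
have Jp := sub_mclosure Pp.
have Sp : nJ (S - p) <= e / 2 / K.
  rewrite (le_trans (nrm_trans sJ JS (sub_mclosure PS0) Jp))//.
  by rewrite [leRHS]splitr lerD// ltW.
have e2 : 0 < e / 2 by rewrite divr_gt0.
have [d d0 Hd] := pc _ e2.
exists (Num.min d 1) => [|h h0]; first by rewrite lt_min d0 ltr01.
rewrite lt_min => /andP[hd h1].
have hp : nJ (actj h p - p) <= e / 2 by exact: Hd.
have -> : actj h S - S = actj h (S - p) + (actj h p - p) - (S - p).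
  by rewrite act_multB//; exact: subr_telescope.
have JSp := mclosureB JS Jp.
have JhSp := act_mult_car h0 JSp.
have Jhp := mclosureB (act_mult_car h0 Jp) Jp.
rewrite (le_trans (nrmB sJ (linear_subsetD mclosure_linear JhSp Jhp) JSp))//.
have t1 := nrmD sJ JhSp Jhp.
have t2 := act_mult_norm h0 (mclosure_Mult JSp).
have el : expR (lambda * h) <= expR `|lambda|.
  by rewrite ler_expR (le_trans (ler_norm _))// normrM ler_piMr// gtr0_norm// ltW.
have le2 : expR (lambda * h) * nJ (S - p) <= expR `|lambda| * nJ (S - p).
  by rewrite ler_wpM2r//; exact: (nrm_ge0 sJ JSp).
have : K * nJ (S - p) <= e / 2 by rewrite -ler_pdivlMl// mulrC.
rewrite /K mulrDl mul1r; move: t1 t2 le2 hp; lra.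
Qed.

Lemma mclosure_orbit_continuous S t e : J S -> 0 < t -> 0 < e -> exists2 d, 0 < d &
  forall s, 0 < s -> `|s - t| < d -> nJ (actj s S - actj t S) <= e.
Proof.
move=> JS; apply: (semigroup_orbit_continuous (E := mclosure) (a := actj) (lambda := lambda) sJ) => //.
- by move=> r S' r0; exact: act_mult_car.
- by move=> r S1 S2 r0; exact: act_multB.
- by move=> r S' r0 JS'; exact: act_mult_norm (mclosure_Mult JS').
- by move=> r r' S' r0 r'0; exact: act_mult_comp.
- by move=> e'; exact: mclosure_strongly_continuous.
Qed.

Lemma act_orbit_continuous v t e : U v -> 0 < t -> 0 < e -> exists2 d, 0 < d &
  forall s, 0 < s -> `|s - t| < d -> nU (act s v - act t v) <= e.
Proof.
move=> Uv; apply: (semigroup_orbit_continuous (E := A) (a := act) (lambda := lambda) sA) => //.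
- by move=> r v' r0; exact: (ms_act_car H).
- by move=> r v1 v2 r0; exact: actB.
- by move=> r v' r0; exact: (ms_act_norm H).
- by move=> r r' v' r0 r'0; exact: (ms_act_comp H).
- by move=> e'; exact: (ms_act_continuous H).
Qed.

Lemma act_mult_bounded_linear t : 0 < t -> bounded_linear (E := mclosure) (F := mclosure) (actj t).
Proof.
move=> t0; split.
- by move=> S; exact: act_mult_car.
- by move=> a S1 S2 _ _; exact: act_mult_linear.
- by exists (expR (lambda * t)) => S JS; exact: act_mult_norm (mclosure_Mult JS).
Qed.

Lemma act_weight_bound t S : 0 < t -> J S -> nJ (actj t S) <= wJ t * nJ S.
Proof. by move=> t0 JS; exact: (opnorm_bound sJ sJ (act_mult_bounded_linear t0) JS). Qed.

Lemma act_weight_ge0 t : 0 < t -> 0 <= wJ t.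
Proof. by move=> t0; exact: (opnorm_ge0 sJ sJ (act_mult_bounded_linear t0)). Qed.

Lemma act_weight_le t : 0 < t -> wJ t <= expR (lambda * t).
Proof.
move=> t0; apply: (opnorm_le sJ (act_mult_bounded_linear t0)); first exact: expR_ge0.
by move=> S JS; exact: act_mult_norm (mclosure_Mult JS).
Qed.

(** Orbits in the closure are norm continuous, so [wJ] is a supremum of continuous functions and
    lower semicontinuous. *)
Lemma act_weight_weight : weight wJ.
Proof.
split.
- apply: lsc_measurable => c t t0 ct.
  have b := act_mult_bounded_linear t0.
  have [S [JS S1] cS] : exists2 S, J S /\ nJ S <= 1 & c < nJ (actj t S).
    apply: contrapT => /forall2NP nx.
    have : wJ t <= c.
      apply: ge_sup.
        exists (nJ (actj t 0)); exists 0 => //; split; first by case: mclosure_linear.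
        by rewrite (nrm0 sJ).
      move=> _ [S [JS S1] <-]; rewrite leNgt; apply/negP => cS.
      by case: (nx S) => [[]//|].
    by rewrite leNgt ct.
  have e0 : 0 < (nJ (actj t S) - c) / 2 by rewrite divr_gt0// subr_gt0.
  have [d d0 Hd] := mclosure_orbit_continuous JS t0 e0.
  exists (Num.min d t) => /=; first by rewrite lt_min d0.
  move=> s; rewrite /ball_/= lt_min => /andP[sd st].
  have s0 : 0 < s by have := ler_norm (t - s); lra.
  rewrite distrC in sd.
  have J1 := act_mult_car s0 JS; have J2 := act_mult_car t0 JS.
  have h1 := Hd _ s0 sd.
  have h2 : nJ (actj t S) <= nJ (actj s S) + nJ (actj s S - actj t S).
    have E : actj t S = actj s S - (actj s S - actj t S) by rewrite subKr.
    by rewrite {1}E; exact: (nrmB sJ J1 (mclosureB J1 J2)).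
  have h3 := act_weight_bound s0 JS.
  have h4 : wJ s * nJ S <= wJ s by rewrite ler_piMr// act_weight_ge0.
  move: h1 h2 h3 h4 cS; lra.
- exact: act_weight_ge0.
- move=> s t s0 t0; apply: (opnorm_le sJ (act_mult_bounded_linear (addr_gt0 s0 t0))).
    by rewrite mulr_ge0 ?act_weight_ge0.
  move=> S JS; rewrite -act_mult_comp//.
  rewrite (le_trans (act_weight_bound s0 (act_mult_car t0 JS)))// -mulrA ler_wpM2l//.
    by rewrite act_weight_ge0.
  by rewrite act_weight_bound.
Qed.

End multiplier_semigroup.

(** * Averages over intervals *)

Section boxes.
Context {R : realType}.
Local Notation mu := (@lebesgue_measure R).
Local Notation RM := (measurableTypeR R).
Local Notation D := (halfline R).

(** Density of the uniform distribution on [a, b]. Taking a = 0 gives the averages used for the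
    converse, and a = h, b = 2h an approximate identity supported away from 0. *)
Definition box (a b t : R) : R := if a <= t <= b then (b - a)^-1 else 0.

Lemma box_ge0 a b t : a < b -> 0 <= box a b t.
Proof. by move=> ab; rewrite /box; case: ifP => // _; rewrite invr_ge0 subr_ge0 ltW. Qed.

Lemma box_cmeasurable a b : cmeasurable D (fun t => (box a b t)%:C).
Proof.
have := @cut_cmeasurable R a b (cst (b - a)^-1) (measurable_cst _).
rewrite (_ : cut _ _ _ = fun t => (box a b t)%:C)//.
by apply/funext => t; rewrite /cut /box; case: ifP.
Qed.

Lemma box_integral a b : 0 <= a -> a < b ->
  mu.-integrable D (EFin \o box a b) /\ \int[mu]_(t in D) box a b t = 1.
Proof.
move=> a0 ab; have mD : measurable (D : set RM) by exact: measurable_itv.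
have [I1 le1] := indic_itv (ltW ab).
have boxE : box a b = fun t => (b - a)^-1 * \1_(`[a, b]%classic : set RM) t.
  apply/funext => t; rewrite /box indicE mem_setE /= in_itv/=.
  by case: ifP => _; rewrite ?mulr1 ?mulr0.
rewrite boxE; split; first exact: real_integrableZ.
rewrite RintegralZl//; have -> : \int[mu]_(t in D) \1_(`[a, b]%classic : set RM) t = b - a.
  apply/eqP; rewrite eq_le le1/=.
  (* For a = 0 the left endpoint lies outside the half-line, so the lower bound goes through ]a,
     b]. *)
  have mI : measurable (`]a, b]%classic : set RM) by exact: measurable_itv.
  have E : (\int[mu]_(t in D) (\1_(`[a, b]%classic : set RM) t)%:E =
      mu (`[a, b]%classic `&` D))%E by rewrite integral_indic//; exact: measurable_itv.
  rewrite -lee_fin /Rintegral fineK; last exact: integrable_fin_num.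
  rewrite E (@le_trans _ _ (mu `]a, b]%classic))//.
    by rewrite lebesgue_measure_itv/= lte_fin ab -EFinB.
  apply: le_measure; rewrite ?inE//; first by apply: measurableI; exact: measurable_itv.
  move=> t /=; rewrite !in_itv/= andbT => /andP[ta tb].
  by rewrite (ltW ta) tb; split => //; exact: le_lt_trans ta.
by rewrite mulVf// gt_eqF// subr_gt0.
Qed.

Lemma box_bounded a b t : a < b -> cabs (box a b t)%:C <= (b - a)^-1.
Proof.
move=> ab; rewrite cabs_real ger0_norm ?box_ge0// /box; case: ifP => // _.
by rewrite invr_ge0 subr_ge0 ltW.
Qed.

Lemma pos_continuousP (F : R -> R[i]) :
  (forall t e, 0 < t -> 0 < e -> exists2 d, 0 < d & forall s, 0 < s -> `|s - t| < d ->
     cabs (F s - F t) <= e) -> pos_continuous F.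
Proof.
move=> Fc; split => t t0; apply/cvgrPdist_le => e e0;
  have [d d0 Hd] := Fc t e t0 e0;
  (exists (Num.min d t) => /=; first by rewrite lt_min d0);
  move=> s; rewrite /ball_/= lt_min => /andP[sd st];
  (have s0 : 0 < s by have := ler_norm (t - s); lra);
  rewrite distrC in sd; rewrite distrC; apply: le_trans (Hd s s0 sd).
- by rewrite -ReN -ReD; exact: Re_le_cabs.
- by rewrite -ImN -ImD; exact: Im_le_cabs.
Qed.

End boxes.

(** * Weak functional calculus on the closure *)

Section functional_calculus.
Context {R : realType} (A : nalg R) (P : set (amb A -> amb A)) (act : R -> amb A -> amb A).
Context (lambda : R) (Phi : set (amb A -> R[i]^o)).
Hypothesis H : multiplier_semigroup P act lambda Phi.
Local Notation mu := (@lebesgue_measure R).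
Local Notation RM := (measurableTypeR R).
Local Notation D := (halfline R).
Local Notation V := (amb A).
Local Notation U := (@car R A).
Local Notation nU := (@nrm R A).
Local Notation B := (mclosure P).
Local Notation Mu := (@car R (Mult A)).
Local Notation J := (@car R B).
Local Notation nJ := (@nrm R B).
Local Notation wJ := (act_weight P act).
Local Notation actj := (act_mult act).
Implicit Types (u v : V) (S : V -> V) (f : R -> R[i]).

Let sA : seminormed A := ms_seminormed H.
Let sJ := seminormed_mclosure H.
Let UL : linear_subset U := seminormed_linear sA.
Let JL := mclosure_linear H.
Let ww := act_weight_weight H.
Let mD : measurable (D : set RM). Proof. exact: measurable_itv. Qed.

Lemma Phi_orbit_continuous v p : U v -> Phi p -> pos_continuous (fun t => p (act t v)).
Proof.
move=> Uv Pp; have [C C0 pC] := ms_Phi_bounded H Pp.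
have C1 : 0 < C + 1 by rewrite ltr_wpDl.
apply: pos_continuousP => t e t0 e0.
have [d d0 Hd] := act_orbit_continuous H Uv t0 (divr_gt0 e0 C1).
exists d => // s s0 sd; rewrite -(PhiB H _ _ Pp).
have Ud := linear_subsetB UL (ms_act_car H s0 Uv) (ms_act_car H t0 Uv).
rewrite (le_trans (pC _ Ud))// (@le_trans _ _ ((C + 1) * (e / (C + 1))))//.
  by rewrite ler_pM ?(nrm_ge0 sA Ud)// ?lerDl ?Hd.
by rewrite mulrC divfK// gt_eqF.
Qed.

(** The norming functionals give weak integrals the usual norm inequality, without any strong
    measurability of k. *)
Lemma norm_le_integral v (k : R -> V) (b : R -> R) : U v -> (forall t, 0 < t -> U (k t)) ->
  mu.-integrable D (EFin \o b) -> (forall t, 0 < t -> nU (k t) <= b t) ->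
  (forall p, Phi p -> mu.-integrable D (EFin \o (fun t => complex.Re (p (k t)))) /\
     complex.Re (p v) = \int[mu]_(t in D) complex.Re (p (k t))) ->
  nU v <= \int[mu]_(t in D) b t.
Proof.
move=> Uv Uk ib kb pv; apply: (ms_norming H) => //.
  apply: Rintegral_ge0 => t; rewrite halflineE => t0.
  by rewrite (le_trans _ (kb t t0))// (nrm_ge0 sA (Uk t t0)).
move=> p Pp p1; have [ip ->] := pv p Pp; apply: le_Rintegral => // t; rewrite halflineE => t0.
rewrite (le_trans (ler_norm _))// (le_trans (Re_le_cabs _))//.
by rewrite (le_trans (p1 _ (Uk t t0)))// kb.
Qed.

(** The box has mass 1, so v can be moved under the integral and only the distance from k t to v on
    [a, b] counts. *)
Lemma box_average a b (k : R -> V) z v c : 0 <= a -> a < b -> U z -> U v ->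
  (forall t, 0 < t -> U (k t)) -> 0 <= c ->
  (forall t, 0 < t -> a <= t <= b -> nU (k t - v) <= c) ->
  (forall p, Phi p -> mu.-integrable D (EFin \o (fun t => complex.Re ((box a b t)%:C * p (k t)))) /\
     complex.Re (p z) = \int[mu]_(t in D) complex.Re ((box a b t)%:C * p (k t))) ->
  nU (z - v) <= c.
Proof.
move=> a0 ab Uz Uv Uk c0 kv pz; have [ib b1] := box_integral a0 ab.
have Ud t : 0 < t -> U (k t - v) by move=> t0; exact: linear_subsetB UL (Uk t t0) Uv.
have -> : c = \int[mu]_(t in D) (c * box a b t) by rewrite RintegralZl// b1 mulr1.
apply: (norm_le_integral (k := fun t => (box a b t)%:C *: (k t - v))).
- exact: linear_subsetB UL Uz Uv.
- by move=> t t0; exact: linear_subsetZ UL (Ud t t0).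
- exact: real_integrableZ.
- move=> t t0; rewrite (nrmZ sA _ (Ud t t0)) cabs_real ger0_norm ?box_ge0// mulrC /box.
  by case: ifPn => tab; rewrite ?mulr0// ler_wpM2r ?kv// invr_ge0 subr_ge0 ltW.
move=> p Pp; have [ip pzE] := pz p Pp.
have ip2 : mu.-integrable D (EFin \o (fun t => - complex.Re (p v) * box a b t)).
  exact: real_integrableZ.
have E : (fun t => complex.Re (p ((box a b t)%:C *: (k t - v)))) =
    (fun t => complex.Re ((box a b t)%:C * p (k t)) + (- complex.Re (p v)) * box a b t).
  apply/funext => t.
  by rewrite (PhiZ H _ _ Pp) (PhiB H _ _ Pp) mulrBr ReD ReN !ReZ; ring.
rewrite E; split; first exact: real_integrableD.
by rewrite RintegralD// RintegralZl// b1 mulr1 (PhiB H _ _ Pp) ReD ReN pzE.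
Qed.

Lemma box_L1 (w : R -> R) a b M : weight w -> 0 <= a -> a < b ->
  (forall t, 0 < t -> a <= t <= b -> w t <= M) -> car (n := L1 w) (fun t => (box a b t)%:C).
Proof.
move=> wt a0 ab wM; have [mw w0 _] := wt; have [mr mi] := box_cmeasurable a b.
have [ib _] := box_integral a0 ab; have iM := real_integrableZ M mD ib.
split => //; have := integrable_lty mD iM; apply: le_lt_trans.
apply: ge0_le_integral => //.
- by move=> t; rewrite halflineE => t0; rewrite lee_fin mulr_ge0 ?cabs_ge0 ?w0.
- apply/measurable_EFinP/measurable_funM => //.
  exact: (measurable_cabs (box_cmeasurable a b)).
- by case/integrableP : iM.
- move=> t; rewrite halflineE => t0; rewrite lee_fin /= cabs_real ger0_norm ?box_ge0// mulrC.
  rewrite /box; case: ifPn => tab; last by rewrite !mulr0.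
  by rewrite ler_wpM2r ?wM// invr_ge0 subr_ge0 ltW.
Qed.

Lemma expR_weight : weight (fun t : R => expR (lambda * t)).
Proof.
split.
- apply: measurable_funTS; apply: continuous_measurable_fun => t.
  by apply: continuous_comp; [exact: mulrl_continuous|exact: continuous_expR].
- by move=> t _; exact: expR_ge0.
- by move=> s t _ _; rewrite mulrDr expRD.
Qed.

Lemma Phi_orbit_le_exp v p : U v -> Phi p ->
  exists2 C, 0 <= C & forall t, 0 < t -> cabs (p (act t v)) <= C * expR (lambda * t).
Proof.
move=> Uv Pp; have [C C0 pC] := ms_Phi_bounded H Pp; exists (C * nU v).
  by rewrite mulr_ge0// (nrm_ge0 sA Uv).
move=> t t0; rewrite (le_trans (pC _ (ms_act_car H t0 Uv)))// -mulrA ler_wpM2l//.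
by rewrite mulrC (ms_act_norm H).
Qed.

Lemma box_exp_bound (b t : R) : 0 < t -> t <= b -> expR (lambda * t) <= expR (`|lambda| * b).
Proof.
move=> t0 tb; rewrite ler_expR (le_trans (ler_norm _))// normrM ler_wpM2l// gtr0_norm//.
Qed.

Lemma box_orbit_integrable a b v p : 0 <= a -> a < b -> U v -> Phi p ->
  mu.-integrable D (EFin \o (fun t => complex.Re ((box a b t)%:C * p (act t v)))).
Proof.
move=> a0 ab Uv Pp; have [C C0 pC] := Phi_orbit_le_exp Uv Pp.
apply: (pairing_integrable expR_weight _ _ pC).
  apply: (box_L1 expR_weight a0 ab (M := expR (`|lambda| * b))) => t t0 /andP[_ tb].
  exact: box_exp_bound.
exact: pos_continuous_measurable (Phi_orbit_continuous Uv Pp).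
Qed.

(* The orbit is controlled by [wJ] since the averages of [act] over [h, 2h] lie in the algebra. *)
Lemma orbit_le_weight : exists2 C, 0 <= C & forall t v, 0 < t -> U v -> nU (act t v) <= C * wJ t * nU v.
Proof.
(* Bounds the action on [h, 2h] for every h <= 1, and hence the norms of the averages independently
   of h. *)
pose K := expR (`|lambda| * 2); exists K; first exact: expR_ge0.
move=> t v t0 Uv; have w0 := act_weight_ge0 H t0; have v0 := nrm_ge0 sA Uv.
apply/ler_addgt0Pr => e e0.
have [d d0 Hd] := ms_act_continuous H Uv (divr_gt0 e0 (expR_gt0 (lambda * t))).
(* A third of d gives 2h < d strictly, so continuity at 0 applies on all of [h, 2h]. *)
pose h := Num.min (d / 3) 1.
have h0 : 0 < h by rewrite lt_min divr_gt0//= ltr01.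
have hd : h <= d / 3 by rewrite ge_min lexx.
have h1 : h <= 1 by rewrite ge_min lexx orbT.
have hh : h < 2 * h by rewrite mulr_natl mulr2n ltrDl.
have [|t' /negbTE tb|S PS Sw] := ms_integral H h0 (box_cmeasurable h (2 * h)) (b := 2 * h)
    (M := (2 * h - h)^-1).
- by move=> t'; exact: box_bounded.
- by rewrite /box tb.
have MS := ms_sub H PS; have JS := sub_mclosure H PS.
have avg u u' c : U u -> U u' -> 0 <= c ->
    (forall t', 0 < t' -> h <= t' <= 2 * h -> nU (act t' u - u') <= c) -> nU (S u - u') <= c.
  move=> Uu Uu' c0 uc; have [SuU _] := mclosure_val H JS Uu.
  apply: (box_average (k := fun t => act t u) (ltW h0) hh SuU Uu' _ c0 uc).
    by move=> t' t'0; exact: (ms_act_car H).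
  move=> p Pp; split; first exact: (box_orbit_integrable (ltW h0) hh).
  exact: Sw.
have [U0 _] := UL.
have nS : nJ S <= K.
  apply: (Mult_norm_le H MS (expR_ge0 _)) => u Uu.
  have u0 := nrm_ge0 sA Uu.
  rewrite -[S u]subr0; apply: avg => //; first by rewrite mulr_ge0 ?expR_ge0.
  move=> t' t'0 /andP[_ th]; rewrite subr0 (le_trans (ms_act_norm H t'0 Uu))// ler_wpM2r//.
  by apply: box_exp_bound => //; lra.
have Sv : nU (S v - v) <= e / expR (lambda * t).
  apply: avg => //; first by rewrite ltW// divr_gt0// expR_gt0.
  by move=> t' t'0 /andP[_ th]; apply: Hd => //; lra.
have [SvU _] := mclosure_val H JS Uv.
have Uvd := linear_subsetB UL SvU Uv.
have UaS := ms_act_car H t0 SvU; have Uad := ms_act_car H t0 Uvd.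
(* The first term is the element [actj t S] of the closure applied to v, of norm at most [wJ t] *
   [K] times that of v; the second is below the arbitrary e. *)
have -> : act t v = act t (S v) - act t (S v - v) by rewrite -(actB H)// subKr.
rewrite (le_trans (nrmB sA UaS Uad))// lerD//.
  have JaS := act_mult_car H t0 JS.
  have [_ h2] := mclosure_val H JaS Uv.
  rewrite (le_trans h2)// ler_wpM2r// (le_trans (act_weight_bound H t0 JS))//.
  by rewrite mulrC ler_wpM2r.
rewrite (le_trans (ms_act_norm H t0 Uvd))// mulrC -ler_pdivlMr ?expR_gt0//.
Qed.

Lemma Phi_orbit_le v p : U v -> Phi p ->
  exists2 C, 0 <= C & forall t, 0 < t -> cabs (p (act t v)) <= C * wJ t.
Proof.
move=> Uv Pp; have [C C0 pC] := ms_Phi_bounded H Pp; have [K K0 aK] := orbit_le_weight.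
have v0 := nrm_ge0 sA Uv.
exists (C * K * nU v); first by rewrite !mulr_ge0.
move=> t t0; rewrite (le_trans (pC _ (ms_act_car H t0 Uv)))//.
have -> : C * K * nU v * wJ t = C * (K * wJ t * nU v) by ring.
by rewrite ler_wpM2l// aK.
Qed.

Lemma L1_Phi_integrable f v p : car (n := L1 wJ) f -> U v -> Phi p ->
  mu.-integrable D (EFin \o (fun t => complex.Re (f t * p (act t v)))).
Proof.
move=> fL Uv Pp; have [C C0 pC] := Phi_orbit_le Uv Pp.
apply: (pairing_integrable ww fL _ pC).
exact: pos_continuous_measurable (Phi_orbit_continuous Uv Pp).
Qed.

Definition weak_symbol f S := forall v p, U v -> Phi p ->
  complex.Re (p (S v)) = \int[mu]_(t in D) complex.Re (f t * p (act t v)).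

Lemma weak_symbolB f g S1 S2 : car (n := L1 wJ) f -> car (n := L1 wJ) g ->
  weak_symbol f S1 -> weak_symbol g S2 -> weak_symbol (f - g) (S1 - S2).
Proof.
move=> fL gL fS gS v p Uv Pp; rewrite fctE (PhiB H _ _ Pp) ReD ReN fS// gS//.
rewrite -RintegralB//; [|exact: L1_Phi_integrable..].
by apply: eq_Rintegral => t _; rewrite -ReN -ReD -mulrBl.
Qed.

Lemma weak_symbol_norm : exists2 C, 0 <= C & forall f S, car (n := L1 wJ) f -> Mu S ->
  weak_symbol f S -> nJ S <= C * nrm (n := L1 wJ) f.
Proof.
have [C C0 aC] := orbit_le_weight; exists C => // f S fL MS fS.
have nf := nrm_ge0 (seminormed_L1 ww) fL.
apply: (Mult_norm_le H MS); first exact: mulr_ge0.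
move=> v Uv; have v0 := nrm_ge0 sA Uv; have [SU _ _ _] := Mult_op MS.
have iL := L1_integrable ww fL.
rewrite mulrAC /nrm/= -RintegralZl//.
apply: (norm_le_integral (k := fun t => f t *: act t v)).
- exact: SU.
- by move=> t t0; apply: (linear_subsetZ _ UL); exact: (ms_act_car H).
- exact: real_integrableZ.
- move=> t t0; rewrite (nrmZ sA _ (ms_act_car H t0 Uv)).
  rewrite mulrCA ler_wpM2l ?cabs_ge0// mulrAC; exact: aC.
- move=> p Pp.
  have E : (fun t => complex.Re (p (f t *: act t v))) = (fun t => complex.Re (f t * p (act t v))).
    by apply/funext => t; rewrite (PhiZ H _ _ Pp).
  by rewrite E; split; [exact: L1_Phi_integrable|exact: fS].
Qed.

(** Truncations of f have symbols in [P] by [ms_integral]; the norm estimate makes them a Cauchy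
    sequence in the complete closure. *)
Lemma weak_symbol_exists f : car (n := L1 wJ) f -> exists2 S, J S & weak_symbol f S.
Proof.
move=> fL; have [mr mi _] := fL; have [mw w0 _] := ww; have sL := seminormed_L1 ww.
have [C C0 nC] := weak_symbol_norm.
have C1 : 0 < C + 1 by rewrite ltr_wpDl.
have tL n := trunc_L1 n ww fL.
have [S HS] : exists S : nat -> V -> V, forall n, P (S n) /\ weak_symbol (trunc n f) (S n).
  suff : forall n, exists S, P S /\ weak_symbol (trunc n f) S by move=> /boolp.choice[S HS]; exists S.
  move=> n.
  have a0 : 0 < n.+1%:R^-1 :> R by rewrite invr_gt0.
  have [S PS Sw] := ms_integral H a0 (trunc_cmeasurable n (conj mr mi)) (trunc_bounded n f)
    (fun t => @trunc_support R n f t).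
  by exists S; split => // v p Uv Pp; exact: Sw.
have JS n := sub_mclosure H (HS n).1.
have apx e : 0 < e -> exists n0, forall n, (n0 <= n)%N -> nrm (n := L1 wJ) (f - trunc n f) < e.
  by move=> e0; exact: (trunc_approx mw w0 (conj mr mi) (L1_integrable ww fL) e0).
have [|Sl JSl SSl] := complete_mclosure H JS.
  move=> e e0; have [n0 Hn] := apx _ (divr_gt0 (divr_gt0 e0 C1) (ltr0Sn R 1)).
  exists n0 => n m n0n n0m.
  have dL := L1B ww (tL n) (tL m).
  have Md := mclosure_Mult (mclosureB H (JS n) (JS m)).
  rewrite (le_lt_trans (nC _ _ dL Md (weak_symbolB (tL n) (tL m) (HS n).2 (HS m).2)))//.
  rewrite (@le_lt_trans _ _ ((C + 1) * nrm (n := L1 wJ) (trunc n f - trunc m f)))//.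
    by rewrite ler_wpM2r ?lerDl//; exact: (nrm_ge0 sL dL).
  rewrite -ltr_pdivlMl// mulrC (le_lt_trans (nrm_trans sL (tL n) fL (tL m)))//.
  rewrite [ltRHS]splitr; apply: ltrD; last exact: Hn.
  by rewrite (nrmBC sL (tL n) fL); exact: Hn.
exists Sl => // v p Uv Pp; apply/eqP; rewrite -subr_eq0 -normr_le0; apply/ler_addgt0Pr => e e0; rewrite add0r.
have [K K0 pK] := ms_Phi_bounded H Pp; have [K' K'0 pK'] := Phi_orbit_le Uv Pp.
have v0 := nrm_ge0 sA Uv.
have Q1 : 0 < (K + 1) * (nU v + 1) by rewrite mulr_gt0// ltr_wpDl.
have Q2 : 0 < K' + 1 by rewrite ltr_wpDl.
have e2 : 0 < e / 2 by rewrite divr_gt0.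
have [n1 H1] := SSl _ (divr_gt0 e2 Q1); have [n2 H2] := apx _ (divr_gt0 e2 Q2).
pose n := maxn n1 n2.
have {}H1 : nJ (S n - Sl) <= e / 2 / ((K + 1) * (nU v + 1)) by rewrite ltW// H1// leq_maxl.
have {}H2 : nrm (n := L1 wJ) (f - trunc n f) <= e / 2 / (K' + 1) by rewrite ltW// H2// leq_maxr.
have [_ Sw] := HS n.
have dL := L1B ww fL (tL n).
have cF := pos_continuous_measurable (Phi_orbit_continuous Uv Pp).
have -> : complex.Re (p (Sl v)) - \int[mu]_(t in D) complex.Re (f t * p (act t v)) =
   - complex.Re (p ((S n - Sl) v)) - \int[mu]_(t in D) complex.Re ((f - trunc n f) t * p (act t v)).
  have -> : \int[mu]_(t in D) complex.Re ((f - trunc n f) t * p (act t v)) =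
     \int[mu]_(t in D) complex.Re (f t * p (act t v)) - complex.Re (p (S n v)).
    rewrite Sw// -RintegralB//; [|exact: L1_Phi_integrable..].
    by apply: eq_Rintegral => t _; rewrite -ReN -ReD -mulrBl.
  by rewrite fctE (PhiB H _ _ Pp) ReD ReN; ring.
rewrite (le_trans (ler_normB _ _))// normrN [e]splitr lerD//.
  have JB := mclosureB H (JS n) JSl; have [Ud nd] := mclosure_val H JB Uv.
  rewrite (le_trans (Re_le_cabs _))// (le_trans (pK _ Ud))//.
  rewrite (@le_trans _ _ ((K + 1) * (e / 2 / ((K + 1) * (nU v + 1)) * (nU v + 1))))//.
    apply: ler_pM => //; [exact: (nrm_ge0 sA Ud)|by rewrite lerDl|].
    rewrite (le_trans nd)// ler_pM ?lerDl//; exact: (nrm_ge0 sJ JB).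
  by rewrite le_eqVlt; apply/predU1P; left; field; rewrite !gt_eqF// ltr_wpDl.
have iL := L1_integrable ww dL; have [mr' mi' _] := dL.
have [_ le] := dominated_pairing mw (conj mr' mi') cF pK' iL.
rewrite (le_trans le)// (@le_trans _ _ ((K' + 1) * (e / 2 / (K' + 1))))//; last first.
  by rewrite mulrC divfK// gt_eqF.
by rewrite ler_pM ?lerDl//; exact: (nrm_ge0 sL dL).
Qed.

End functional_calculus.

(** * Bochner integrals *)

Section bochner.
Context {R : realType} (E : nspace R) (sE : seminormed E).
Local Notation mu := (@lebesgue_measure R).
Local Notation RM := (measurableTypeR R).
Local Notation D := (halfline R).
Local Notation V := (amb E).
Local Notation U := (@car R E).
Local Notation nU := (@nrm R E).
Implicit Types (s : seq (set R * V)) (g : R -> V).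

Let EL := seminormed_linear sE.
Let mD : measurable (D : set RM). Proof. exact: measurable_itv. Qed.

Lemma is_simple_cons p s : is_simple (E := E) (p :: s) ->
  [/\ measurable (p.1 : set RM), p.1 `<=` D, (mu p.1 < +oo)%E & U p.2] /\ is_simple (E := E) s.
Proof. by move=> ps; split; [exact: (ps 0)|move=> i si; exact: (ps i.+1)]. Qed.

Lemma simple_val_cons p s t :
  simple_val (p :: s) t = (if t \in p.1 then p.2 else 0) + simple_val s t.
Proof. by rewrite /simple_val big_cons; case: ifP; rewrite ?add0r. Qed.

Lemma simple_int_cons p s :
  simple_int (p :: s) = (fine (mu p.1))%:C *: p.2 + simple_int s.
Proof. by rewrite /simple_int big_cons. Qed.

Lemma simple_car s t : is_simple (E := E) s -> U (simple_val s t) /\ U (simple_int s).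
Proof.
have [E0 _] := EL.
elim: s => [_|p s IH /is_simple_cons[[_ _ _ cp] /IH[c1 c2]]].
  by rewrite /simple_val /simple_int !big_nil.
rewrite simple_val_cons simple_int_cons; split; apply: (linear_subsetD EL) => //.
  by case: ifP.
exact: linear_subsetZ EL cp.
Qed.

Lemma simple_functional (q : V -> R[i]) s : (forall a x y, q (a *: x + y) = a * q x + q y) ->
  is_simple (E := E) s ->
  mu.-integrable D (EFin \o (fun t => complex.Re (q (simple_val s t)))) /\
  \int[mu]_(t in D) complex.Re (q (simple_val s t)) = complex.Re (q (simple_int s)).
Proof.
move=> qL.
have q0 : q 0 = 0 by have := qL (-1) 0 0; rewrite !scaler0 addr0 mulN1r addNr.
elim: s => [_|p s IH /is_simple_cons[[mp pD fp cp] /IH[i1 e1]]].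
  have -> : (fun t => complex.Re (q (simple_val [::] t))) = cst 0.
    by apply/funext => t; rewrite /simple_val big_nil q0.
  split; first by have := @integrable0 _ _ _ mu D; apply: eq_integrable.
  by rewrite /simple_int big_nil q0 /Rintegral integral0_eq.
have ei : (\int[mu]_(t in D) (\1_(p.1 : set RM) t)%:E = mu p.1)%E.
  by rewrite integral_indic// (_ : p.1 `&` D = p.1)//; exact: setIidl.
have ii : mu.-integrable D (EFin \o \1_(p.1 : set RM)).
  apply/integrableP; split; first exact/measurable_EFinP/measurable_indic.
  under eq_integral do rewrite /= ger0_norm//.
  by rewrite ei.
have ip := real_integrableZ (complex.Re (q p.2)) mD ii.
have vE : (fun t => complex.Re (q (simple_val (p :: s) t))) =
    (fun t => complex.Re (q p.2) * \1_(p.1 : set RM) t + complex.Re (q (simple_val s t))).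
  apply/funext => t; rewrite simple_val_cons indicE.
  have [_|_] := boolP (t \in p.1); last by rewrite add0r mulr0 add0r.
  by rewrite -[p.2]scale1r qL mul1r ReD mulr1 scale1r.
rewrite vE; split; first exact: real_integrableD.
rewrite RintegralD// RintegralZl// e1 simple_int_cons qL ReD ReZ mulrC; congr (_ * _ + _).
by rewrite /Rintegral ei.
Qed.

Lemma nrm_dist x y : U x -> U y -> `|nU x - nU y| <= nU (x - y).
Proof.
move=> cx cy; have cd := linear_subsetB EL cx cy.
have h1 := nrmD sE cd cy; rewrite subrK in h1.
have h2 := nrmD sE (linear_subsetB EL cy cx) cx; rewrite subrK (nrmBC sE cy cx) in h2.
by rewrite ler_norml; apply/andP; split; move: h1 h2; lra.
Qed.

Definition pos_norm_continuous g := (forall t, 0 < t -> U (g t)) /\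
  forall t e, 0 < t -> 0 < e -> exists2 d, 0 < d & forall r : R, 0 < r -> `|r - t| < d -> nU (g r - g t) <= e.

Lemma uniformly_norm_continuous g a b : pos_norm_continuous g -> 0 < a ->
  forall e, 0 < e -> exists2 d, 0 < d &
    forall r t : R, a <= r <= b -> 0 < t -> `|t - r| < d -> nU (g t - g r) <= e.
Proof.
move=> [gc gg] a0 e e0.
have /compact_near_coveringP := @segment_compact R a b.
pose Q := fun (d s : R) => forall t, 0 < t -> `|t - s| < d -> nU (g t - g s) <= e.
move=> /(_ R (0^'+) Q) HQ.
have : \forall d \near 0^'+, `[a, b] `<=` Q d.
  apply: HQ => x /=; rewrite in_itv/= => /andP[xa _]; have x0 := lt_le_trans a0 xa.
  have e2 : 0 < e / 2 by rewrite divr_gt0.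
  have [d d0 dB] := gg x _ x0 e2.
  have d2 : 0 < Num.min d x / 2 by rewrite divr_gt0// lt_min d0.
  exists (ball x (Num.min d x / 2), [set d' | d' < d / 2]) => /=.
    by split; [exact: nbhsx_ballx|apply: nbhs_right_lt; rewrite divr_gt0].
  move=> [x' d'] /= [xx' dd'] t t0 tx'.
  move: xx'; rewrite -ball_normE/= => xx'.
  have [mx md] : Num.min d x <= x /\ Num.min d x <= d by rewrite !ge_min !lexx orbT.
  have x'0 : 0 < x' by have := ler_norm (x - x'); lra.
  rewrite (le_trans (nrm_trans sE (gc _ t0) (gc _ x0) (gc _ x'0)))// [e]splitr lerD//.
    apply: dB => //; rewrite -(subrKA x') (le_lt_trans (ler_normD _ _))//.
    by rewrite [X in _ + X]distrC; lra.
  by rewrite (nrmBC sE (gc _ x0) (gc _ x'0)); apply: dB => //; rewrite distrC; lra.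
move=> HH; have [d [d0 Hd]] := filter_ex (filterI (nbhs_right_gt (0 : R)) HH).
by exists d => // s t sab; apply: Hd; rewrite /= in_itv.
Qed.

(** Induction with an accumulated constant c: the half-line splits along p.1, and there the value
    p.2 joins c. The base case is continuous in t. *)
Lemma simple_diff_measurable g s : pos_norm_continuous g -> is_simple (E := E) s ->
  measurable_fun D (fun t => nU (g t - simple_val s t)).
Proof.
move=> [gc gg]; have [E0 _] := EL.
suff : forall c, U c -> is_simple (E := E) s ->
    measurable_fun D (fun t : RM => nU (g t - (c + simple_val s t))).
  move=> /(_ 0 E0)/[apply]; congr (measurable_fun _ _).
  by apply/funext => t; rewrite add0r.
elim: s => [|p s IH] c cc.
  move=> _; rewrite (_ : (fun t => _) = fun t => nU (g t - c)); last first.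
    by apply/funext => t; rewrite /simple_val big_nil addr0.
  have : pos_continuous (fun t => (nU (g t - c))%:C).
    apply: pos_continuousP => t e t0 e0; have [d d0 Hd] := gg t e t0 e0; exists d => // r r0 rd.
    rewrite -rmorphB cabs_real.
    have c1 := linear_subsetB EL (gc _ r0) cc; have c2 := linear_subsetB EL (gc _ t0) cc.
    by rewrite (le_trans (nrm_dist c1 c2))// opprB addrA subrK Hd.
  by move=> /pos_continuous_measurable[].
move=> /is_simple_cons[[mp pD _ cp] ss].
have IH1 := IH _ (linear_subsetD EL cc cp) ss; have IH2 := IH c cc ss.
rewrite (_ : (fun t => _) = fun t : RM => if t \in (p.1 : set RM) then
    nU (g t - (c + p.2 + simple_val s t)) else nU (g t - (c + simple_val s t))).
  apply: measurable_fun_if => //.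
  - apply: (measurable_fun_bool true); apply: measurableI => //.
    rewrite (_ : _ @^-1` _ = p.1)//; apply/seteqP; split => t /=; first by move=> /set_mem.
    exact: mem_set.
  - by apply: measurable_funS IH1 => //; exact: subIsetl.
  - by apply: measurable_funS IH2 => //; exact: subIsetl.
by apply/funext => t; rewrite simple_val_cons; case: ifP => _; rewrite ?add0r// addrA.
Qed.

Lemma bochner_functional g y (q : V -> R[i]) K : 0 <= K ->
  (forall a x z, q (a *: x + z) = a * q x + q z) -> (forall x, U x -> cabs (q x) <= K * nU x) ->
  (forall t, 0 < t -> U (g t)) -> mu.-integrable D (EFin \o (fun t => complex.Re (q (g t)))) ->
  is_bochner (E := E) g y -> complex.Re (q y) = \int[mu]_(t in D) complex.Re (q (g t)).
Proof.
move=> K0 qL qK gc iq [cy [s [ss ms is_ ys]]].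
have qB x z : q (x - z) = q x - q z.
  by rewrite addrC -scaleN1r qL mulN1r addrC.
have K1 : 0 < K + 1 by rewrite ltr_wpDl.
apply/eqP; rewrite -subr_eq0 -normr_le0; apply/ler_addgt0Pr => e e0; rewrite add0r.
have eK : 0 < e / 2 / (K + 1) by rewrite !divr_gt0.
have eKE : (0%:E < (e / 2 / (K + 1))%:E)%E by rewrite lte_fin.
have [n1 _ H1] := is_ _ (open_ereal_lt' eKE).
have /cvgrPdist_lt/(_ _ eK)[n2 _ H2] := ys.
pose n := maxn n1 n2.
have {H1}H1 := H1 n (leq_maxl _ _); have {H2}H2 := H2 n (leq_maxr _ _).
rewrite /= in H1 H2; rewrite sub0r normrN in H2.
have [iS eS] := simple_functional qL (ss n).
have [_ cSi] := simple_car 0 (ss n).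
have cS t : U (simple_val (s n) t) by have [] := simple_car t (ss n).
have nd t : 0 < t -> 0 <= nU (g t - simple_val (s n) t).
  by move=> t0; apply: (nrm_ge0 sE); exact: (linear_subsetB EL (gc t t0) (cS t)).
have inrm : mu.-integrable D (EFin \o (fun t => nU (g t - simple_val (s n) t))).
  apply/integrableP; split; first by apply/measurable_EFinP; exact: ms.
  rewrite (_ : (\int[mu]_(t in D) _ = \int[mu]_(t in D) (nU (g t - simple_val (s n) t))%:E)%E).
    by rewrite (lt_trans H1)// ltry.
  apply: eq_integral => t; rewrite inE halflineE => t0 /=.
  by rewrite ger0_norm// nd.
have dE : (fun t => complex.Re (q (g t)) - complex.Re (q (simple_val (s n) t))) =
    (fun t => complex.Re (q (g t - simple_val (s n) t))).
  by apply/funext => t; rewrite qB ReD ReN.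
have id : mu.-integrable D (EFin \o (fun t => complex.Re (q (g t - simple_val (s n) t)))).
  rewrite -dE; have := real_integrableD mD iq (real_integrableZ (-1) mD iS).
  by apply: eq_integrable => // t _ /=; rewrite mulN1r.
have -> : complex.Re (q y) - \int[mu]_(t in D) complex.Re (q (g t)) =
    - complex.Re (q (simple_int (s n) - y)) -
    \int[mu]_(t in D) complex.Re (q (g t - simple_val (s n) t)).
  by rewrite -dE RintegralB// eS qB ReD ReN; ring.
rewrite (le_trans (ler_normB _ _))// normrN [e]splitr lerD//.
  have cd := linear_subsetB EL cSi cy.
  rewrite (le_trans (Re_le_cabs _))// (le_trans (qK _ cd))//.
  rewrite (@le_trans _ _ ((K + 1) * (e / 2 / (K + 1))))//; last by rewrite mulrC divfK// gt_eqF.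
  rewrite ler_pM ?lerDl//; first exact: (nrm_ge0 sE cd).
  by rewrite ltW// (le_lt_trans (ler_norm _)).
rewrite (le_trans (le_normr_Rintegral mD id))//.
rewrite (@le_trans _ _ (\int[mu]_(t in D) (K * nU (g t - simple_val (s n) t))))//.
  apply: le_Rintegral => //.
  - have /integrable_abse := id; apply: eq_integrable => //.
  - exact: real_integrableZ.
  - move=> t; rewrite halflineE => t0; rewrite (le_trans (Re_le_cabs _))// qK//.
    exact: linear_subsetB EL (gc t t0) (cS t).
rewrite RintegralZl// (@le_trans _ _ ((K + 1) * (e / 2 / (K + 1))))//; last first.
  by rewrite mulrC divfK// gt_eqF.
rewrite ler_pM ?lerDl//.
  by apply: Rintegral_ge0 => t; rewrite halflineE; exact: nd.
by rewrite -lee_fin /Rintegral fineK ?ltW//; exact: integrable_fin_num.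
Qed.

(** The cells are half-open and hence disjoint, so that the sum in [simple_val] keeps a single
    sample of g. *)
Fixpoint steps g (a b : R) (n m : nat) : seq (set R * V) :=
  if m is k.+1 then
    (`[pt a b n k, pt a b n k.+1[%classic, g (pt a b n k)) :: steps g a b n k
  else [::].

Lemma steps_simple g a b n m : 0 < a -> a <= b -> (m <= n.+1)%N ->
  (forall t, 0 < t -> U (g t)) -> is_simple (E := E) (steps g a b n m).
Proof.
move=> a0 ab mn gc; elim: m mn => [//|m IH mn] [|i] /=; last exact: IH (ltnW mn) i.
have /andP[ap _] := pt_itv ab (ltnW mn).
move=> _; split.
- exact: measurable_itv.
- by move=> t /=; rewrite !in_itv/= andbT => /andP[+ _]; apply: lt_le_trans; exact: lt_le_trans ap.
- by rewrite lebesgue_measure_itv/=; case: ifP => _; rewrite -?EFinB ltry.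
- by apply: gc; exact: lt_le_trans ap.
Qed.

Lemma steps_val g a b n m t : a <= b -> (m <= n.+1)%N ->
  if a <= t < pt a b n m then
    exists k, [/\ (k < m)%N, pt a b n k <= t < pt a b n k.+1 & simple_val (steps g a b n m) t = g (pt a b n k)]
  else simple_val (steps g a b n m) t = 0.
Proof.
move=> ab; elim: m => [_|m IH mn].
  rewrite pt0 (_ : (a <= t < a) = false) ?/simple_val ?big_nil//.
  by apply/negbTE/negP => /andP[/le_lt_trans/[apply]]; rewrite ltxx.
have pm : pt a b n m <= pt a b n m.+1 by exact: pt_le.
have /andP[apm _] := pt_itv ab (ltnW mn).
move: (IH (ltnW mn)) => {}IH /=; rewrite simple_val_cons /=.
have -> : (t \in `[pt a b n m, pt a b n m.+1[%classic) = (pt a b n m <= t < pt a b n m.+1).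
  by rewrite mem_setE/= in_itv.
case: (leP (pt a b n m) t) => ptm /=; last first.
  rewrite add0r; move: IH; rewrite ptm andbT (lt_le_trans ptm pm) andbT.
  by case: ifP => // _ [k [km kt ->]]; exists k; split => //; exact: ltnW.
have -> : (a <= t) by exact: le_trans ptm.
move: IH; rewrite (_ : (a <= t < pt a b n m) = false); last first.
  by rewrite ltNge ptm andbF.
move=> ->; rewrite addr0 /=; case: ifP => tm; last by rewrite tm.
by exists m; rewrite ptm tm.
Qed.

(** On a compact window uniform continuity makes step functions close; outside it the error is at
    most the tail of the majorant b. *)
Lemma simple_approx g (b : R -> R) : pos_norm_continuous g ->
  mu.-integrable D (EFin \o b) -> (forall t, 0 < t -> nU (g t) <= b t) ->
  forall e, 0 < e -> exists2 s, is_simple (E := E) s &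
    (\int[mu]_(t in D) (nU (g t - simple_val s t))%:E <= e%:E)%E.
Proof.
move=> gn ib gb e e0; have [gc _] := gn.
have e2 : 0 < e / 2 by rewrite divr_gt0.
have [n0 Hn] := tail_integral ib e2; have {}Hn := Hn n0 (leqnn _).
(* The cells miss the point c, so c must lie strictly beyond the right end of the closed window. *)
pose a : R := n0.+1%:R^-1; pose c : R := n0.+1%:R + 1.
have a0 : 0 < a by rewrite invr_gt0.
have ac : a <= c.
  rewrite (@le_trans _ _ 1)//; first by rewrite invf_le1// ler1n.
  by rewrite lerDr.
have ca0 : 0 < c - a + 1 by rewrite ltr_wpDl// subr_ge0.
pose eta := e / 2 / (c - a + 1); have eta0 : 0 < eta by rewrite !divr_gt0.
have [d d0 Hd] := uniformly_norm_continuous c gn a0 eta0.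
have [N HN] := mesh_small a c d0; have {}HN := HN N (leqnn _).
exists (steps g a c N N.+1); first exact: steps_simple.
have sS := steps_simple a0 ac (leqnn N.+1) gc.
set s := steps _ _ _ _ _ in sS *.
pose tl t := if window n0 t then 0 else b t.
have itl : mu.-integrable D (EFin \o (fun t => `|tl t|)).
  apply: (@le_integrable _ _ _ mu _ mD _ (EFin \o b)) => //.
    apply/measurable_EFinP; apply: measurableT_comp => //.
    have [+ _] := integrableP _ _ _ ib => /measurable_EFinP mb.
    apply: measurable_fun_if => //; last by apply: measurable_funS mb => //; exact: subIsetl.
    apply: (measurable_fun_bool true); apply: measurableI => //.
    rewrite (_ : _ @^-1` _ = [set t : RM | window n0 t])//; exact: measurable_window.
  move=> t _ /=; rewrite lee_fin normr_id /tl; case: ifP => _; rewrite ?normr0//.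
have [I1 le1] := indic_itv ac.
have Ie := real_integrableZ eta mD I1.
have I2 := real_integrableD mD Ie itl.
have : \int[mu]_(t in D) (eta * \1_(`[a, c]%classic : set RM) t + `|tl t|) <= e.
  rewrite RintegralD// RintegralZl// [leRHS]splitr lerD ?(ltW Hn)//.
  rewrite (@le_trans _ _ (eta * (c - a + 1)))//; last by rewrite /eta divfK// gt_eqF.
  by rewrite ler_wpM2l ?(ltW eta0)// (le_trans le1)// lerDl.
rewrite -lee_fin /Rintegral fineK; last exact: integrable_fin_num.
apply: le_trans; have [+ _] := integrableP _ _ _ I2 => m2.
have ms := simple_diff_measurable gn sS.
apply: ge0_le_integral => //.
- move=> t; rewrite halflineE => t0; rewrite lee_fin; apply: (nrm_ge0 sE).
  by apply: (linear_subsetB EL) (gc t t0) _; have [] := simple_car t sS.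
- exact/measurable_EFinP.
- move=> t; rewrite halflineE => t0; rewrite lee_fin indicE mem_setE/= in_itv/=.
  have := @steps_val g a c N N.+1 t ac (leqnn _); rewrite ptn -/s.
  case: ifPn => [/andP[ta tc] [k [kN /andP[kt tk] ->]]|tac ->].
    rewrite ta (ltW tc) mulr1 (@le_trans _ _ eta)//; last by rewrite lerDl.
    have /andP[ak kc] := pt_itv ac (ltnW kN).
    apply: Hd => //; first by rewrite ak kc.
    by rewrite ger0_norm ?subr_ge0// ltrBlDl (lt_trans tk)// ptS ltrD2l.
  rewrite subr0 (le_trans (gb t t0))// (@le_trans _ _ `|tl t|)//.
    rewrite /tl (_ : window n0 t = false) ?ler_norm//.
    apply: contraNF tac => /andP[-> /= tn].
    by rewrite (le_lt_trans tn)// ltrDl.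
  by rewrite lerDr mulr_ge0 ?(ltW eta0).
Qed.

(** The candidate y is known beforehand, from the weak theory; the last hypothesis compares it with
    simple integrals, so no limit of these has to be constructed. *)
Lemma bochner_exists g (b : R -> R) y : pos_norm_continuous g -> U y ->
  mu.-integrable D (EFin \o b) -> (forall t, 0 < t -> nU (g t) <= b t) ->
  (forall s, is_simple (E := E) s -> mu.-integrable D (EFin \o (fun t => nU (g t - simple_val s t))) ->
     nU (simple_int s - y) <= \int[mu]_(t in D) nU (g t - simple_val s t)) ->
  is_bochner (E := E) g y.
Proof.
move=> gn cy ib gb gy; have [gc _] := gn; split => //.
have : forall n : nat, exists s, is_simple (E := E) s /\
    (\int[mu]_(t in D) (nU (g t - simple_val s t))%:E <= n.+1%:R^-1%:E)%E.
  move=> n; have n0 : 0 < n.+1%:R^-1 :> R by rewrite invr_gt0.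
  by have [s ss sn] := simple_approx gn ib gb n0; exists s.
move=> /boolp.choice[s Hs]; exists s.
have ss n := (Hs n).1; have sn n := (Hs n).2.
have ms n := simple_diff_measurable gn (ss n).
have n0 n t : 0 < t -> 0 <= nU (g t - simple_val (s n) t).
  move=> t0; apply: (nrm_ge0 sE); apply: (linear_subsetB EL (gc t t0)).
  by have [] := simple_car t (ss n).
have I0 n : (0 <= \int[mu]_(t in D) (nU (g t - simple_val (s n) t))%:E)%E.
  by apply: integral_ge0 => t; rewrite halflineE => t0; rewrite lee_fin n0.
have inv0 : n.+1%:R^-1 @[n --> \oo] --> (0 : R) by exact: cvg_harmonic.
have i n : mu.-integrable D (EFin \o (fun t => nU (g t - simple_val (s n) t))).
  apply/integrableP; split; first by apply/measurable_EFinP; exact: ms.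
  rewrite (_ : (\int[mu]_(t in D) _ = \int[mu]_(t in D) (nU (g t - simple_val (s n) t))%:E)%E).
    by rewrite (le_lt_trans (sn n))// ltry.
  apply: eq_integral => t; rewrite inE halflineE => t0 /=.
  by rewrite ger0_norm// n0.
split => //.
  apply/fine_cvgP; split; first by near=> n; exact: (integrable_fin_num mD (i n)).
  apply: (squeeze_cvgr _ (cvg_cst _) inv0); near=> n; rewrite /= -!lee_fin fineK ?I0 ?sn//.
  exact: (integrable_fin_num mD (i n)).
apply: (squeeze_cvgr _ (cvg_cst _) inv0); near=> n.
apply/andP; split.
  by apply: (nrm_ge0 sE); apply: (linear_subsetB EL) cy; have [] := simple_car 0 (ss n).
rewrite (le_trans (gy _ (ss n) (i n)))// -lee_fin /Rintegral fineK ?sn//.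
exact: (integrable_fin_num mD (i n)).
Unshelve. all: by end_near. Qed.

End bochner.

(** * The generator on the closure of the multipliers *)

(** The indicator identity ]d, h + d] minus ]0, h] equals ]h, h + d] minus ]0, d]. Both a strict and
    a weak inequality appear because [translate] contributes the first and [box] the second. *)
Lemma interval_swap {R : realType} (h d t r : R) : 0 < h -> 0 < d ->
  (if [&& d < t, d <= t & t <= h + d] then r else 0) - (if t <= h then r else 0) =
  (if [&& h < t, h <= t & t <= h + d] then r else 0) - (if t <= d then r else 0).
Proof.
move=> h0 d0; have [td|td] := leP t d; have [th|th] := leP t h; have [thd|thd] := leP t (h + d) => /=;
  rewrite ?(ltW td) ?(ltW th) /=; lra.
Qed.

Section multiplier_generator.
Context {R : realType} (A : nalg R) (P : set (amb A -> amb A)) (act : R -> amb A -> amb A).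
Context (lambda : R) (Phi : set (amb A -> R[i]^o)).
Hypothesis H : multiplier_semigroup P act lambda Phi.
Local Notation mu := (@lebesgue_measure R).
Local Notation RM := (measurableTypeR R).
Local Notation D := (halfline R).
Local Notation V := (amb A).
Local Notation U := (@car R A).
Local Notation nU := (@nrm R A).
Local Notation B := (mclosure P).
Local Notation Mu := (@car R (Mult A)).
Local Notation J := (@car R B).
Local Notation nJ := (@nrm R B).
Local Notation wJ := (act_weight P act).
Local Notation actj := (act_mult act).
Implicit Types (u v : V) (S : V -> V) (f : R -> R[i]).

Let sA : seminormed A := ms_seminormed H.
Let sJ := seminormed_mclosure H.
Let UL : linear_subset U := seminormed_linear sA.
Let JL := mclosure_linear H.
Let ww := act_weight_weight H.
Let mD : measurable (D : set RM). Proof. exact: measurable_itv. Qed.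

Lemma pos_continuous_eps (F : R -> R[i]) t e : pos_continuous F -> 0 < t -> 0 < e ->
  exists2 d, 0 < d & forall r, `|r - t| < d -> cabs (F r - F t) <= e.
Proof.
move=> [Fr Fi] t0 e0; have e2 : 0 < e / 2 by rewrite divr_gt0.
have /cvgrPdist_lt/(_ _ e2)[d1 /= d10 H1] := Fr t t0.
have /cvgrPdist_lt/(_ _ e2)[d2 /= d20 H2] := Fi t t0.
exists (Num.min d1 d2) => [|r]; first by rewrite lt_min d10.
rewrite lt_min distrC => /andP[/H1 h1 /H2 h2].
rewrite (le_trans (cabs_le_ReIm _))// [e]splitr lerD//.
  by rewrite ReD ReN distrC ltW.
by rewrite ImD ImN distrC ltW.
Qed.

Definition bochner_symbol f S := J S /\ forall S', J S' ->
  is_bochner (E := B) (fun t => f t *: (actj t S' : amb B)) (S \o S').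

Let evalL v p : Phi p -> forall a (S1 S2 : amb B), p ((a *: S1 + S2) v) = a * p (S1 v) + p (S2 v).
Proof. by move=> Pp a S1 S2; rewrite !fctE (ms_Phi_linear H). Qed.

(** Continuity of f makes t |-> f(t) T(t) S' norm continuous, hence approximable by simple
    functions; the norming functionals then bound the distance of their integrals to the weak symbol
    composed with S'. *)
Lemma bochner_symbol_exists f : pos_continuous f -> car (n := L1 wJ) f -> exists S, bochner_symbol f S.
Proof.
move=> fc fL; have [S JS fS] := weak_symbol_exists H fL; exists S; split => // S' JS'.
have nS' := nrm_ge0 sJ JS'.
have gJ t : 0 < t -> J (f t *: (actj t S' : amb B)).
  by move=> t0; apply: (linear_subsetZ _ JL); exact: (act_mult_car H).
apply: (bochner_exists sJ (b := fun t => nJ S' * (cabs (f t) * wJ t))).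
- split => // t e t0 e0; have JtS := act_mult_car H t0 JS'.
  have e2 : 0 < e / 2 by rewrite divr_gt0.
  have n0 := nrm_ge0 sJ JtS.
  have K1 : 0 < nJ (actj t S') + 1 by rewrite ltr_wpDl.
  have K2 : 0 < cabs (f t) + 1 by rewrite ltr_wpDl// cabs_ge0.
  have [d1 d10 H1] := pos_continuous_eps fc t0 (divr_gt0 e2 K1).
  have [d2 d20 H2] := mclosure_orbit_continuous H JS' t0 (divr_gt0 e2 K2).
  have [d3 d30 H3] := mclosure_orbit_continuous H JS' t0 ltr01.
  exists (Num.min d1 (Num.min d2 d3)) => [|r r0]; first by rewrite !lt_min d10 d20.
  rewrite !lt_min => /and3P[/H1 h1 /(H2 _ r0) h2 /(H3 _ r0) h3].
  have JrS := act_mult_car H r0 JS'.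
  have -> : f r *: (actj r S' : amb B) - f t *: (actj t S' : amb B) =
      (f r - f t) *: (actj r S' : amb B) + f t *: ((actj r S' : amb B) - actj t S').
    by rewrite scalerBl scalerBr addrA subrK.
  have Jd := mclosureB H JrS JtS.
  have nr : nJ (actj r S') <= nJ (actj t S') + 1.
    have E : actj r S' = (actj r S' - actj t S') + actj t S' by rewrite subrK.
    by rewrite {1}E addrC (le_trans (nrmD sJ JtS Jd))// lerD2l.
  rewrite (le_trans (nrmD sJ (linear_subsetZ _ JL JrS) (linear_subsetZ _ JL Jd)))//.
  rewrite (nrmZ sJ _ JrS) (nrmZ sJ _ Jd) [e]splitr lerD//.
    rewrite (@le_trans _ _ (e / 2 / (nJ (actj t S') + 1) * (nJ (actj t S') + 1)))//.
      by rewrite ler_pM ?cabs_ge0//; exact: (nrm_ge0 sJ JrS).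
    by rewrite divfK// gt_eqF.
  rewrite (@le_trans _ _ ((cabs (f t) + 1) * (e / 2 / (cabs (f t) + 1))))//.
    by rewrite ler_pM ?cabs_ge0 ?lerDl//; exact: (nrm_ge0 sJ Jd).
  by rewrite mulrC divfK// gt_eqF.
- exact: (mclosure_mul H JS JS').
- exact: real_integrableZ (L1_integrable ww fL).
- move=> t t0; rewrite (nrmZ sJ _ (act_mult_car H t0 JS')).
  by rewrite mulrCA ler_wpM2l ?cabs_ge0// mulrC (act_weight_bound H).
move=> s ss ig; pose g (t : R) : amb B := f t *: (actj t S' : amb B).
have JSS := mclosure_mul H JS JS'.
have [_ Jint] := simple_car sJ 0 ss.
have Jval t : J (simple_val s t) by have [] := simple_car sJ t ss.
have Jd := mclosureB H Jint JSS.
apply: (Mult_norm_le H (mclosure_Mult Jd)).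
  apply: Rintegral_ge0 => t; rewrite halflineE => t0.
  exact: (nrm_ge0 sJ (mclosureB H (gJ t t0) (Jval t))).
move=> v Uv; have v0 := nrm_ge0 sA Uv.
have [Ud _] := mclosure_val H Jd Uv.
rewrite mulrC -RintegralZl//.
have [US'v _] := mclosure_val H JS' Uv.
apply: (norm_le_integral H (k := fun t => (simple_val s t - g t) v)) => //.
- by move=> t t0; have [] := mclosure_val H (mclosureB H (Jval t) (gJ t t0)) Uv.
- exact: real_integrableZ.
- move=> t t0; have [_ le] := mclosure_val H (mclosureB H (Jval t) (gJ t t0)) Uv.
  by rewrite mulrC (nrmBC sJ (gJ t t0) (Jval t)).
move=> p Pp; have [i1 e1] := simple_functional (evalL v Pp) ss.
have i2 := L1_Phi_integrable H fL US'v Pp.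
have E : (fun t => complex.Re (p ((simple_val s t - g t) v))) =
    (fun t => complex.Re (p (simple_val s t v)) - complex.Re (f t * p (act t (S' v)))).
  by apply/funext => t; rewrite /g !fctE (PhiB H _ _ Pp) (PhiZ H _ _ Pp) ReD ReN.
rewrite E; split.
  have := real_integrableD mD i1 (real_integrableZ (-1) mD i2).
  by apply: eq_integrable => // t _ /=; rewrite mulN1r.
by rewrite RintegralB// e1 -fS// fctE (PhiB H _ _ Pp) ReD ReN.
Qed.

Lemma bochner_symbol_weak f S S' v p : car (n := L1 wJ) f -> bochner_symbol f S -> J S' -> U v ->
  Phi p -> complex.Re (p (S (S' v))) = \int[mu]_(t in D) complex.Re (f t * p (act t (S' v))).
Proof.
move=> fL [JS fS] JS' Uv Pp; have [C C0 pC] := ms_Phi_bounded H Pp.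
have [US'v _] := mclosure_val H JS' Uv; have v0 := nrm_ge0 sA Uv.
have E : (fun t => complex.Re (p ((f t *: (actj t S' : amb B)) v))) =
    (fun t => complex.Re (f t * p (act t (S' v)))).
  by apply/funext => t; rewrite !fctE (PhiZ H _ _ Pp).
have -> : \int[mu]_(t in D) complex.Re (f t * p (act t (S' v))) =
   \int[mu]_(t in D) complex.Re (p ((f t *: (actj t S' : amb B)) v)) by rewrite E.
apply: (bochner_functional sJ (K := C * nU v) (q := fun S => p (S v)) _ _ _ _ _ (fS S' JS')).
- exact: mulr_ge0.
- exact: evalL.
- move=> S1 JS1; have [U1 n1] := mclosure_val H JS1 Uv.
  by rewrite (le_trans (pC _ U1))// -mulrA ler_wpM2l// mulrC.
- by move=> t t0; apply: (linear_subsetZ _ JL); exact: (act_mult_car H).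
- by rewrite E; exact: (L1_Phi_integrable H).
Qed.

(** [Omega_cancel] kills the orbit of S' v at positive times, and strong continuity at 0 then kills
    S' v itself. *)
Lemma bochner_symbol_inj f S S' : Omega (U := L1 wJ) f -> bochner_symbol f S -> J S' ->
  (forall v, U v -> S (S' v) = 0) -> S' = 0.
Proof.
move=> fO fS JS' SS0; have [fL _] := fO; have [_ _ _ S'0] := mclosure_op JS'.
apply/funext => v; have [Uv|] := pselect (U v); last exact: S'0.
have [Ux _] := mclosure_val H JS' Uv; set x := S' v in Ux *.
have ax t : 0 < t -> act t x = 0.
  move=> t0; have Uax := ms_act_car H t0 Ux.
  apply: (ms_separated H Uax); apply: (Phi_separates H Uax) => p Pp.
  have [C _ pC] := Phi_orbit_le H Ux Pp.
  rewrite (@Omega_cancel _ wJ f (fun t => p (act t x)) C ww (weight_locally_bounded ww) fO _ pC)//.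
    exact: (Phi_orbit_continuous H Ux Pp).
  move=> c r r0.
  have := bochner_symbol_weak fL fS JS' Uv (ms_Phi_scale H c (ms_Phi_act H Pp r0)).
  rewrite SS0// /= (act0 H)// (Phi0 H Pp) mulr0 /= => E; apply/esym.
  rewrite [LHS]E; apply: eq_Rintegral => s; rewrite inE halflineE => s0.
  by rewrite (ms_act_comp H)// mulrA [r + s]addrC.
apply: (ms_separated H Ux); apply: (nrm_eq0_approx sA Ux) => e e0.
have [d d0 Hd] := ms_act_continuous H Ux e0.
have d2 : 0 < d / 2 by rewrite divr_gt0.
have := Hd _ d2; rewrite ax// sub0r (nrmN sA Ux); apply.
by rewrite ltr_pdivrMr// ltr_pMr// ltr1n.
Qed.

Definition right_derivative S S' := forall e, 0 < e -> exists2 d, 0 < d &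
  forall h, 0 < h -> h < d -> nJ ((h^-1)%:C *: ((actj h S : amb B) - S) - S') <= e.

Lemma right_derivative_weak S S' v p (t : R) : J S -> J S' -> right_derivative S S' -> U v -> Phi p ->
  0 < t -> is_derive t 1 (fun t => complex.Re (p (act t (S v)))) (complex.Re (p (act t (S' v)))).
Proof.
move=> JS JS' SS' Uv Pp t0.
have [USv _] := mclosure_val H JS Uv; have [US'v _] := mclosure_val H JS' Uv.
have [cG _] := Phi_orbit_continuous H US'v Pp.
apply: (uniform_right_derivative t0 (cG t t0)) => e e0.
have [C C0 pC] := ms_Phi_bounded H Pp; have v0 := nrm_ge0 sA Uv.
pose M := expR (`|lambda| * t); have M0 : 0 < M := expR_gt0 _.
have K0 : 0 < (C + 1) * M * (nU v + 1) by rewrite !mulr_gt0// ltr_wpDl.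
have [d d0 Hd] := SS' _ (divr_gt0 e0 K0).
exists d => // s h /andP[st1 st2] h0 hd.
have s0 : 0 < s by apply: lt_le_trans st1; rewrite divr_gt0.
set r := ((h^-1)%:C *: ((actj h S : amb B) - S) - S' : amb B).
have Jr : J r.
  apply: (mclosureB H) => //; apply: (linear_subsetZ _ JL); apply: (mclosureB H) => //.
  exact: (act_mult_car H).
have [Urv nrv] := mclosure_val H Jr Uv.
have nr : nJ r <= e / ((C + 1) * M * (nU v + 1)) by exact: Hd.
have -> : h^-1 * (complex.Re (p (act (s + h) (S v))) - complex.Re (p (act s (S v)))) -
   complex.Re (p (act s (S' v))) = complex.Re (p (act s (r v))).
  rewrite /r !fctE (actB H)// (PhiB H _ _ Pp) -[(h^-1)%:C *: _]addr0 (ms_act_linear H)//.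
  rewrite (act0 H)// addr0 (PhiZ H _ _ Pp) (actB H)// (PhiB H _ _ Pp) (ms_act_comp H)//.
  by rewrite ReD ReN ReZ ReD ReN.
rewrite (le_trans (Re_le_cabs _))// (le_trans (pC _ (ms_act_car H s0 Urv)))//.
rewrite (@le_trans _ _ ((C + 1) * (M * (e / ((C + 1) * M * (nU v + 1)) * (nU v + 1)))))//; last first.
  rewrite le_eqVlt; apply/predU1P; left; field.
  by rewrite !gt_eqF// ltr_wpDl.
apply: ler_pM => //; [exact: (nrm_ge0 sA (ms_act_car H s0 Urv))|by rewrite lerDl|].
rewrite (le_trans (ms_act_norm H s0 Urv))//.
apply: ler_pM; [exact: expR_ge0|exact: (nrm_ge0 sA Urv)|exact: box_exp_bound|].
rewrite (le_trans nrv)// ler_pM ?lerDl//; exact: (nrm_ge0 sJ Jr).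
Qed.

Lemma right_derivative_generator f f' S0 S1 S S' : generating wJ f f' ->
  bochner_symbol f S0 -> bochner_symbol f' S1 -> J S -> J S' -> right_derivative S S' ->
  forall v, U v -> S0 (S' v) = - S1 (S v).
Proof.
move=> gf fS0 fS1 JS JS' SS' v Uv; have [_ [fL _] _ f'L] := gf.
have [JS0 _] := fS0; have [JS1 _] := fS1.
have [USv _] := mclosure_val H JS Uv; have [US'v _] := mclosure_val H JS' Uv.
have [U0 _] := mclosure_val H JS0 US'v; have [U1 _] := mclosure_val H JS1 USv.
have U01 := linear_subsetD UL U0 U1.
apply/eqP; rewrite -addr_eq0; apply/eqP.
apply: (ms_separated H U01); apply: (Phi_separates H U01) => p Pp.
rewrite (PhiD H _ _ Pp) ReD (bochner_symbol_weak fL fS0 JS' Uv Pp) (bochner_symbol_weak f'L fS1 JS Uv Pp).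
apply/eqP; rewrite addr_eq0; apply/eqP.
have [C1 C10 pC1] := Phi_orbit_le H USv Pp; have [C2 C20 pC2] := Phi_orbit_le H US'v Pp.
have [C C0 pC] := Phi_orbit_le_exp H USv Pp.
have w0 t : 0 < t -> 0 <= wJ t by exact: (act_weight_ge0 H).
apply: (generating_parts (C := C1 + C2) (K := C * expR (`|lambda| * 1)) ww gf _ _ _ _ _ _ ltr01).
- exact: (Phi_orbit_continuous H USv Pp).
- exact: (Phi_orbit_continuous H US'v Pp).
- by move=> t t0; exact: (right_derivative_weak JS JS' SS' Uv Pp t0).
- move=> t t0; have := right_derivative_weak JS JS' SS' Uv (ms_Phi_scale H (-'i%C) Pp) t0.
  by under eq_fun do rewrite ReMi; rewrite ReMi.
- by move=> t t0; rewrite (le_trans (pC1 t t0))// ler_wpM2r ?w0// lerDl.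
- by move=> t t0; rewrite (le_trans (pC2 t t0))// ler_wpM2r ?w0// lerDr.
- move=> t t0 t1; rewrite (le_trans (pC t t0))// ler_wpM2l//.
  by apply: box_exp_bound => //; exact: ltW.
Qed.

(** The normalization pays off here: [wJ] is at most expR (lambda * t), hence bounded near 0, so a
    box reaching down to 0 is in [L1 wJ]. *)
Lemma average_exists h : 0 < h -> exists2 S, J S & weak_symbol act Phi (fun t => (box 0 h t)%:C) S.
Proof.
move=> h0; apply: (weak_symbol_exists H).
apply: (box_L1 ww (lexx 0) h0 (M := expR (`|lambda| * h))) => t t0 /andP[_ th].
by rewrite (le_trans (act_weight_le H t0))// box_exp_bound.
Qed.

Local Notation average h := (weak_symbol act Phi (fun t => (box 0 h t)%:C)).

Lemma average_close S e : J S -> 0 < e -> exists2 d, 0 < d & forall h S', 0 < h -> h < d ->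
  J S' -> average h S' -> nJ ((S' \o S) - S) <= e.
Proof.
move=> JS e0; have [d d0 Hd] := mclosure_strongly_continuous H JS e0.
exists d => // h S' h0 hd JS' aS'.
have JSS := mclosure_mul H JS' JS; have Jd := mclosureB H JSS JS.
apply: (Mult_norm_le H (mclosure_Mult Jd) (ltW e0)) => v Uv; have v0 := nrm_ge0 sA Uv.
have [USv _] := mclosure_val H JS Uv; have [US'v _] := mclosure_val H JSS Uv.
apply: (box_average H (k := fun t => act t (S v)) (lexx 0) h0 US'v USv).
- by move=> t t0; exact: (ms_act_car H).
- by rewrite mulr_ge0// ltW.
- move=> t t0 /andP[_ th].
  have [_ le] := mclosure_val H (mclosureB H (act_mult_car H t0 JS) JS) Uv.
  rewrite (le_trans le)// ler_wpM2r//; apply: Hd => //; exact: le_lt_trans hd.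
- move=> p Pp; split; first exact: (box_orbit_integrable H).
  exact: aS'.
Qed.

(* Both sides integrate the orbit over ]h, h + d] minus ]0, d], up to the factor. *)
Lemma average_swap h d Sh Sd v : 0 < h -> 0 < d -> J Sh -> J Sd -> average h Sh -> average d Sd ->
  U v -> h%:C *: (act d (Sh v) - Sh v) = d%:C *: (act h (Sd v) - Sd v).
Proof.
move=> h0 d0 JSh JSd aSh aSd Uv.
have [Uh _] := mclosure_val H JSh Uv; have [Ud _] := mclosure_val H JSd Uv.
have Uhd := linear_subsetZ h%:C UL (linear_subsetB UL (ms_act_car H d0 Uh) Uh).
have Udh := linear_subsetZ d%:C UL (linear_subsetB UL (ms_act_car H h0 Ud) Ud).
have Udif := linear_subsetB UL Uhd Udh.
apply/eqP; rewrite -subr_eq0; apply/eqP.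
apply: (ms_separated H Udif); apply: (Phi_separates H Udif) => p Pp.
have val a c Sa : 0 < a -> 0 < c -> average a Sa ->
    mu.-integrable D (EFin \o (fun t => a * (complex.Re (translate c (fun t => (box 0 a t)%:C) t * p (act t v)) -
       complex.Re ((box 0 a t)%:C * p (act t v))))) /\
    complex.Re (p (a%:C *: (act c (Sa v) - Sa v))) = \int[mu]_(t in D)
      (a * (complex.Re (translate c (fun t => (box 0 a t)%:C) t * p (act t v)) -
       complex.Re ((box 0 a t)%:C * p (act t v)))).
  move=> a0 c0 aSa.
  have bL : car (n := L1 wJ) (fun t => (box 0 a t)%:C).
    apply: (box_L1 ww (lexx 0) a0 (M := expR (`|lambda| * a))) => t t0 /andP[_ th].
    by rewrite (le_trans (act_weight_le H t0))// box_exp_bound.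
  have i1 := L1_Phi_integrable H bL Uv Pp.
  have i2 := L1_Phi_integrable H (translate_L1 ww c0 bL) Uv Pp.
  have i12 : mu.-integrable D (EFin \o (fun t =>
      complex.Re (translate c (fun t => (box 0 a t)%:C) t * p (act t v)) -
      complex.Re ((box 0 a t)%:C * p (act t v)))).
    have := real_integrableD mD i2 (real_integrableZ (-1) mD i1).
    by apply: eq_integrable => // t _ /=; rewrite mulN1r.
  split; first exact: real_integrableZ.
  rewrite RintegralZl// RintegralB// (PhiZ H _ _ Pp) ReZ (PhiB H _ _ Pp) ReD ReN aSa//.
  rewrite (translate_pairing (ltW c0) (box_cmeasurable 0 a)); last first.
    exact: pos_continuous_measurable (Phi_orbit_continuous H Uv Pp).
  have := aSa v _ Uv (ms_Phi_act H Pp c0) => /= ->; congr (_ * (_ - _)).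
  apply: eq_Rintegral => s; rewrite inE halflineE => s0.
  by rewrite (ms_act_comp H)// addrC.
have [_ e1] := val _ _ _ h0 d0 aSh; have [_ e2] := val _ _ _ d0 h0 aSd.
rewrite (PhiB H _ _ Pp) ReD ReN e1 e2; apply/eqP; rewrite subr_eq0; apply/eqP.
apply: eq_Rintegral => t; rewrite inE halflineE => t0.
rewrite /translate /zero_ext !subr_gt0 /box !subr0 (ltW t0)/=.
set z := p _.
have -> : (0 <= t - d) = (d <= t) by rewrite subr_ge0.
have -> : (0 <= t - h) = (h <= t) by rewrite subr_ge0.
rewrite !lerBlDr [d + h]addrC.
have hn : h != 0 by rewrite gt_eqF. have dn : d != 0 by rewrite gt_eqF.
have bz a (b : bool) : a != 0 -> a * complex.Re ((if b then a^-1 else 0)%:C * z) = if b then complex.Re z else 0.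
  by move=> a0; case: b; rewrite ReZ ?mulVKf// mul0r mulr0.
rewrite !mulrBr !bz//.
have bt a (b b' : bool) : a != 0 ->
    a * complex.Re ((if b then (if b' then a^-1 else 0)%:C else 0) * z) = if b && b' then complex.Re z else 0.
  by move=> a0; case: b => /=; [exact: bz|rewrite mul0r mulr0].
rewrite !bt//.
exact: interval_swap.
Qed.

(** By [average_swap] the quotient with step c of the h-average of S is the quotient with step h of
    its c-average. The roles being exchanged, it only remains that the c-average of S tends to S. *)
Lemma average_derivative S h Sh : J S -> 0 < h -> J Sh -> average h Sh ->
  right_derivative (Sh \o S) ((h^-1)%:C *: ((actj h S : amb B) - S)).
Proof.
move=> JS h0 JSh aSh e e0.
(* Bounds the norm of the operator (T(h) - 1) / h, with h fixed. *)
have K0 : 0 < h^-1 * (expR (lambda * h) + 1).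
  by rewrite mulr_gt0 ?invr_gt0// ltr_wpDl// expR_ge0.
have [d d0 Hd] := average_close JS (divr_gt0 e0 K0).
exists d => // c c0 cd; have [Sc JSc aSc] := average_exists c0.
have JSS := mclosure_mul H JSc JS; have JJ := mclosureB H JSS JS.
have n1 := Hd c Sc c0 cd JSc aSc.
have -> : (c^-1)%:C *: ((actj c (Sh \o S) : amb B) - (Sh \o S)) - (h^-1)%:C *: ((actj h S : amb B) - S) =
    (h^-1)%:C *: ((actj h ((Sc \o S) - S) : amb B) - ((Sc \o S) - S)).
  have -> : (c^-1)%:C *: ((actj c (Sh \o S) : amb B) - (Sh \o S)) =
      (h^-1)%:C *: ((actj h (Sc \o S) : amb B) - (Sc \o S)).
    apply/funext => v; rewrite !fctE /act_mult /=.
    have [Uv|Uv] := pselect (U v); last first.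
      have [_ _ _ z1] := mclosure_op JS; have [_ _ _ _] := mclosure_op JSh.
      rewrite z1// (bounded_linear0 sA (bounded_op_linear (mclosure_op JSh))).
      by rewrite (bounded_linear0 sA (bounded_op_linear (mclosure_op JSc))) !(act0 H)// subrr !scaler0.
    have [USv _] := mclosure_val H JS Uv.
    have E := average_swap h0 c0 JSh JSc aSh aSc USv.
    have -> : act c (Sh (S v)) - Sh (S v) = (h^-1)%:C *: (h%:C *: (act c (Sh (S v)) - Sh (S v))).
      by rewrite scalerA -rmorphM mulVf ?gt_eqF// scale1r.
    by rewrite E !scalerA -!rmorphM; congr (_%:C *: _); field; rewrite !gt_eqF.
  have alg (W : zmodType) (x y z t : W) : x - y - (z - t) = x - z - (y - t).
    by rewrite !opprB addrACA [RHS]addrACA; congr (_ + _); exact: addrC.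
  by rewrite (act_multB H)// -scalerBr; congr (_ *: _); exact: alg.
have JhJ := act_mult_car H h0 JJ.
rewrite (nrmZ sJ _ (mclosureB H JhJ JJ)) cabs_real ger0_norm ?invr_ge0 ?(ltW h0)//.
rewrite (@le_trans _ _ (h^-1 * ((expR (lambda * h) + 1) * nJ ((Sc \o S) - S))))//.
  rewrite ler_wpM2l ?invr_ge0 ?(ltW h0)// (le_trans (nrmB sJ JhJ JJ))// mulrDl mul1r lerD2r.
  exact: (act_mult_norm H h0 (mclosure_Mult JJ)).
by rewrite mulrA -ler_pdivlMl// mulrC.
Qed.

Lemma generator_right_derivative f f' S0 S1 S S' : generating wJ f f' ->
  bochner_symbol f S0 -> bochner_symbol f' S1 -> J S -> J S' ->
  (forall v, U v -> S0 (S' v) = - S1 (S v)) -> right_derivative S S'.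
Proof.
move=> gf fS0 fS1 JS JS' SS' e e0; have [_ fO _ _] := gf.
have [JS0 _] := fS0; have [JS1 _] := fS1.
have [d d0 Hd] := average_close JS' e0; exists d => // h h0 hd.
have [Sh JSh aSh] := average_exists h0.
set W := (h^-1)%:C *: ((actj h S : amb B) - S).
have JW : J W.
  by apply: (linear_subsetZ _ JL); apply: (mclosureB H) => //; exact: (act_mult_car H).
have JSS' := mclosure_mul H JSh JS'.
have WE : W = Sh \o S'.
  apply/eqP; rewrite -subr_eq0; apply/eqP.
  apply: (bochner_symbol_inj fO fS0 (mclosureB H JW JSS')) => v Uv.
  have [UW _] := mclosure_val H JW Uv; have [USS _] := mclosure_val H JSS' Uv.
  rewrite !fctE (bounded_linearB sA (bounded_op_linear (mclosure_op JS0)) UW USS).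
  apply/eqP; rewrite subr_eq0; apply/eqP.
  rewrite (right_derivative_generator gf fS0 fS1 (mclosure_mul H JSh JS) JW
    (average_derivative JS h0 JSh aSh) Uv) /=.
  have [USv _] := mclosure_val H JS Uv; have [US'v _] := mclosure_val H JS' Uv.
  have c1 := congr1 (fun Z => Z (S v)) (mclosure_comm H JS1 JSh).
  have c0 := congr1 (fun Z => Z (S' v)) (mclosure_comm H JS0 JSh).
  rewrite /= in c1 c0; rewrite c1 c0 SS'//.
  have [U1 _] := mclosure_val H JS1 USv.
  by rewrite (bounded_linearN sA (bounded_op_linear (mclosure_op JSh)) U1).
by rewrite WE; exact: (Hd h Sh h0 hd JSh aSh).
Qed.

Lemma right_derivativeP S S' : J S -> J S' -> right_derivative S S' <->
  nJ ((t^-1)%:C *: ((actj t S : amb B) - S) - S') @[t --> 0^'+] --> (0 : R).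
Proof.
move=> JS JS'.
have Jq h : 0 < h -> J ((h^-1)%:C *: ((actj h S : amb B) - S) - S').
  move=> h0; apply: (mclosureB H) => //; apply: (linear_subsetZ _ JL).
  by apply: (mclosureB H) => //; exact: (act_mult_car H).
split=> [SS'|/cvg0_at_right SS'].
  apply/cvg0_at_right => e e0; have e2 : 0 < e / 2 by rewrite divr_gt0.
  have [d d0 Hd] := SS' _ e2; exists d => // h h0 hd.
  rewrite ger0_norm ?(nrm_ge0 sJ (Jq h h0))// (le_lt_trans (Hd h h0 hd))//.
  by rewrite ltr_pdivrMr// ltr_pMr// ltr1n.
move=> e e0; have [d d0 Hd] := SS' _ e0; exists d => // h h0 hd.
by rewrite (le_trans (ler_norm _))// ltW// Hd.
Qed.

(** Shaped so that it unfolds to [phiJ] in the concrete instance. *)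
Definition bochner_mult f : amb B := xget 0 (bochner_symbol f).

Lemma bochner_multP f : pos_continuous f -> car (n := L1 wJ) f -> bochner_symbol f (bochner_mult f).
Proof.
move=> fc fL; rewrite /bochner_mult; case: xgetP => // nS.
by have [S fS] := bochner_symbol_exists fc fL; case: (nS S).
Qed.

Lemma mclosure_eq S1 S2 : J S1 -> J S2 -> (forall v, U v -> S1 v = S2 v) -> S1 = S2.
Proof.
move=> J1 J2 S12; apply/funext => v; have [|Uv] := pselect (U v); first exact: S12.
by have [_ _ _ z1] := mclosure_op J1; have [_ _ _ z2] := mclosure_op J2; rewrite z1// z2.
Qed.

Theorem generator_mclosure f f' S : generating wJ f f' -> J S ->
  (qm_dom (U := B) (- bochner_mult f') (bochner_mult f) S <->
     exists2 S', J S' & nJ ((t^-1)%:C *: ((actj t S : amb B) - S) - S') @[t --> 0^'+] --> (0 : R)) /\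
  (forall S', J S' -> nJ ((t^-1)%:C *: ((actj t S : amb B) - S) - S') @[t --> 0^'+] --> (0 : R) ->
     qm_val (U := B) (- bochner_mult f') (bochner_mult f) S = S').
Proof.
move=> gf JS; have [Cf fO _ f'L] := gf; have [fL _] := fO.
have fS0 := bochner_multP (C1_continuous Cf) fL.
have fS1 := bochner_multP (C1_derivative_continuous Cf) f'L.
set S0 := bochner_mult f in fS0 *; set S1 := bochner_mult f' in fS1 *.
have [JS0 _] := fS0; have [JS1 _] := fS1.
have eqE S' : J S' -> (- S1 : amb B) \o S = S0 \o S' <-> forall v, U v -> S0 (S' v) = - S1 (S v).
  move=> JS'; split=> [E v Uv|E]; first by have := congr1 (fun Z => Z v) E; rewrite /= fctE => <-.
  apply: mclosure_eq; [|exact: (mclosure_mul H JS0 JS')|by move=> v Uv; rewrite /= fctE E].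
  by apply: (mclosure_mul H) => //; exact: linear_subsetN JL JS1.
have der S' : J S' -> nJ ((t^-1)%:C *: ((actj t S : amb B) - S) - S') @[t --> 0^'+] --> (0 : R) ->
    (- S1 : amb B) \o S = S0 \o S'.
  move=> JS' /(right_derivativeP JS JS') SS'; apply/eqE => // v Uv.
  exact: (right_derivative_generator gf fS0 fS1 JS JS' SS').
split; first split.
- move=> [_ [S' JS' /(eqE _ JS') SS']]; exists S' => //; apply/(right_derivativeP JS JS').
  exact: (generator_right_derivative gf fS0 fS1 JS JS').
- by move=> [S' JS' /(der _ JS') SS']; split => //; exists S'.
move=> S' JS' /(der _ JS') SS'; rewrite /qm_val; case: xgetP => [Y _ [JY SY]|/(_ S')]; last by case.
apply/eqP; rewrite -subr_eq0; apply/eqP.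
apply: (bochner_symbol_inj fO fS0 (mclosureB H JY JS')) => v Uv.
have [UY _] := mclosure_val H JY Uv; have [US' _] := mclosure_val H JS' Uv.
rewrite fctE (bounded_linearB sA (bounded_op_linear (mclosure_op JS0)) UY US').
apply/eqP; rewrite subr_eq0; apply/eqP.
exact: (congr1 (fun Z => Z v) (etrans (esym SY) SS')).
Qed.

End multiplier_generator.

(** * The normalized Arveson ideal *)

Section complete_ideals.
Context {R : realType} (X : completeNormedModType R[i]) (Xs : set (X -> R[i]^o)).
Hypothesis dp : dual_pairing Xs.
Context (T : R -> X -> X).
Hypothesis sg : weakly_continuous_semigroup Xs T.
Context (lambda : R).
Hypothesis rhoL : (lne (rhoT T)%:E < lambda%:E)%E.
Local Notation cX := (@car R (X1 T)).
Local Notation O := (@nrm R (Bop (X1 T))).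
Local Notation I := (@car R (Arveson Xs T)).
Local Notation L := (@car R (LT Xs T lambda)).
Local Notation U := (@car R (UT Xs T lambda)).
Local Notation nU := (@nrm R (LT Xs T lambda)).
Local Notation act := (@actI R X T).

Let sX : seminormed (X1 T) := seminormed_X1 sg.
Let sB := seminormed_Bop sX.
Let sL := seminormed_LT dp sg rhoL.

Lemma complete_banach : complete_nspace (banach X).
Proof. by move=> u _ /banach_complete[y uy]; exists y. Qed.

Lemma complete_X1 : complete_nspace (X1 T).
Proof.
apply: (complete_closed (seminormed_banach X) complete_banach) => // y _ ay.
exact: X1_closed.
Qed.

Lemma complete_Arveson : complete_nspace (Arveson Xs T).
Proof.
have cB := complete_Bop sX (@X1_separated _ _ T) complete_X1.
apply: (complete_closed sB cB) => [u /Arveson_op//|u bu au].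
exact: (Arveson_closed dp sg bu au).
Qed.

(** A Cauchy sequence first converges in operator norm. At each fixed s the action is operator
    bounded, so the Cauchy estimates, which are uniform in s, pass to the limit. *)
Lemma complete_LT : complete_nspace (LT Xs T lambda).
Proof.
move=> u Lu ucauchy; have IL := Arveson_linear dp sg.
have Iu n : I (u n) := LT_Arveson dp sg rhoL (Lu n).
have LB n m : L (u n - u m) := linear_subsetB (LT_linear dp sg rhoL) (Lu n) (Lu m).
have [|y Iy uy] := complete_Arveson Iu.
  move=> e e0; have [n0 Hn] := ucauchy e e0; exists n0 => n m n0n n0m.
  exact: le_lt_trans (nI_le_nU dp sg rhoL (LB n m)) (Hn n m n0n n0m).
have key e : 0 < e -> exists n0, forall n, (n0 <= n)%N -> grows T lambda (u n - y) e.
  move=> e0; have [n0 Hn] := ucauchy e e0; exists n0 => n n0n s s0.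
  have Iny := linear_subsetB IL (Iu n) Iy.
  have [C C0 HC] : exists2 C, 0 <= C & forall v, I v -> O (act s v) <= C * O v.
    move: s0; rewrite le_eqVlt => /predU1P[<-|s0].
      by exists 1 => // v _; rewrite actI0 mul1r.
    exists (omegaT T s); first exact: (omegaT_ge0 sg).
    by move=> v Iv; rewrite (actI_pos _ _ s0); exact: (orbit_norm_le sg s0 (Arveson_op Iv)).
  apply/ler_addgt0Pr => d d0.
  have C1 : 0 < C + 1 by rewrite ltr_wpDl.
  have [n1 H1] := uy _ (divr_gt0 d0 C1); pose m := maxn n0 n1.
  have Imy := linear_subsetB IL (Iu m) Iy.
  have Inm := linear_subsetB IL (Iu n) (Iu m).
  have -> : act s (u n - y) = act s (u n - u m) + act s (u m - y).
    have := actI_linear sg 1 (u n - u m) (u m - y) s0; rewrite !scale1r => <-.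
    by rewrite addrA subrK.
  have b1 := Arveson_op (actI_Arveson dp sg s0 Inm).
  have b2 := Arveson_op (actI_Arveson dp sg s0 Imy).
  rewrite (le_trans (nrmD sB b1 b2))//; apply: lerD.
    rewrite (le_trans (LT_grows dp sg rhoL (LB n m) s0))// ler_wpM2r ?expR_ge0//.
    by rewrite ltW//; apply: Hn => //; exact: leq_maxl.
  rewrite (le_trans (HC _ Imy))// (@le_trans _ _ ((C + 1) * O (u m - y)))//.
    by rewrite ler_wpM2r ?lerDl//; exact: (nrm_ge0 sB (Arveson_op Imy)).
  by rewrite -ler_pdivlMl// mulrC ltW// H1// leq_maxr.
have Ly : L y.
  have [n0 Hn] := key 1 ltr01; have gn := Hn n0 (leqnn _).
  have Lny : L (u n0 - y).
    by apply/(LTP dp sg rhoL); split; [exact: linear_subsetB IL (Iu n0) Iy|exists 1].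
  have -> : y = u n0 - (u n0 - y) by rewrite subKr.
  exact: linear_subsetB (LT_linear dp sg rhoL) (Lu n0) Lny.
exists y => // e e0; have e2 : 0 < e / 2 by rewrite divr_gt0.
have [n0 Hn] := key _ e2; exists n0 => n n0n.
by rewrite (le_lt_trans (nU_le Xs (Hn n n0n)))// ltr_pdivrMr// ltr_pMr// ltr1n.
Qed.

Lemma complete_UT : complete_nspace (UT Xs T lambda).
Proof.
apply: (complete_closed sL complete_LT) => [u /UT_LT//|u Lu au].
exact: (UT_closed dp sg rhoL Lu au).
Qed.

End complete_ideals.

(** * The normalized ideal as an instance of the abstract situation *)

Section normalized_arveson.
Context {R : realType} (X : completeNormedModType R[i]) (Xs : set (X -> R[i]^o)).
Hypothesis dp : dual_pairing Xs.
Context (T : R -> X -> X).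
Hypothesis sg : weakly_continuous_semigroup Xs T.
Context (lambda : R).
Hypothesis rhoL : (lne (rhoT T)%:E < lambda%:E)%E.
Local Notation N := (@nrm R (banach X)).
Local Notation mu := (@lebesgue_measure R).
Local Notation D := (halfline R).
Local Notation w := (omegaT T).
Local Notation cX := (@car R (X1 T)).
Local Notation O := (@nrm R (Bop (X1 T))).
Local Notation I := (@car R (Arveson Xs T)).
Local Notation UU := (UT Xs T lambda).
Local Notation U := (@car R (UT Xs T lambda)).
Local Notation nU := (@nrm R (UT Xs T lambda)).
Local Notation Mu := (@car R (Mult (UT Xs T lambda))).
Local Notation nM := (@nrm R (Mult (UT Xs T lambda))).
Local Notation act := (@actI R X T).
Local Notation lm := (@lmult R (UT Xs T lambda)).
Implicit Types (u v : X -> X).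

Let ww : weight w := omegaT_weight dp sg.
Let sX : seminormed (X1 T) := seminormed_X1 sg.
Let sB := seminormed_Bop sX.
Let IL : linear_subset (V := amb (Bop (X1 T))) I := Arveson_linear dp sg.
Let sU : seminormed UU := seminormed_UT dp sg rhoL.
Let UI v : U v -> I v := fun Uv => UT_Arveson dp sg rhoL Uv.

Lemma UT_mul_le u v : I u -> U v -> U (u \o v) /\ nU (u \o v) <= O u * nU v.
Proof.
move=> Iu Uv; split; first exact: (UT_mul dp sg rhoL Iu Uv).
by have [_] := LT_mul dp sg rhoL Iu (UT_LT Uv).
Qed.

Lemma UT_mul_mul u v : U u -> U v -> U (u \o v) /\ nU (u \o v) <= nU u * nU v.
Proof.
move=> Uu Uv; have [Uuv le] := UT_mul_le (UI Uu) Uv; split; first exact: Uuv.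
apply: (le_trans le); apply: ler_wpM2r; first exact: (nrm_ge0 sU Uv).
exact: (nI_le_nU dp sg rhoL (UT_LT Uu)).
Qed.

Lemma lmultE u v : U v -> lm u v = u \o v. Proof. by move=> Uv; rewrite /lmult (restr_in _ Uv). Qed.

Lemma lmult_out u v : ~ U v -> lm u v = 0. Proof. by move=> Uv; rewrite /lmult (restr_out _ Uv). Qed.

Lemma comp_linear_r u v1 v2 a : I u -> U v1 -> U v2 ->
  u \o (a *: (v1 : X -> X) + v2) = a *: (u \o v1 : X -> X) + (u \o v2).
Proof.
move=> Iu U1 U2; have [_ uL _ u0] := Arveson_op Iu.
have [v1X _ _ v10] := Arveson_op (UI U1); have [v2X _ _ v20] := Arveson_op (UI U2).
apply/funext => x; rewrite !fctE /=; have [cx|cx] := pselect (cX x).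
  exact: (uL _ _ _ (v1X _ cx) (v2X _ cx)).
rewrite (v10 _ cx) (v20 _ cx) scaler0 addr0.
by rewrite (bounded_linear0 sX (bounded_op_linear (Arveson_op Iu))) scaler0 addr0.
Qed.

Lemma lmult_bounded_linear u : I u -> bounded_linear (E := UU) (F := UU) (fun v => u \o v).
Proof.
move=> Iu; split.
- by move=> v Uv; have [] := UT_mul_le Iu Uv.
- by move=> a v1 v2 U1 U2; exact: (comp_linear_r a Iu U1 U2).
- by exists (O u) => v Uv; have [] := UT_mul_le Iu Uv.
Qed.

Lemma lmult_op u : I u -> bounded_op (E := UU) (lm u).
Proof. by move=> Iu; apply: (restr_op sU); exact: (lmult_bounded_linear Iu). Qed.

Lemma lmult_Mult u : I u -> Mu (lm u).
Proof.
move=> Iu; split; first exact: (lmult_op Iu).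
move=> v1 v2 U1 U2; have [U12 _] := UT_mul_mul U1 U2.
exact: etrans (lmultE u U12) (esym (congr1 (fun z => z \o v2) (lmultE u U1))).
Qed.

Lemma lmult_norm u : I u -> nM (lm u) <= O u.
Proof.
move=> Iu; apply: (opnorm_le sU (bounded_op_linear (lmult_op Iu)) (nrm_ge0 sB (Arveson_op Iu))).
by move=> v Uv; rewrite (lmultE u Uv); have [] := UT_mul_le Iu Uv.
Qed.

Lemma lmult_linear a u v : lm (a *: (u : X -> X) + v) = a *: (lm u : amb (Bop UU)) + lm v.
Proof.
apply/funext => z.
have -> : (a *: (lm u : amb (Bop UU)) + lm v) z = a *: lm u z + lm v z by [].
have [Uz|Uz] := pselect (U z); first by rewrite !(lmultE _ Uz); exact/funext.
by rewrite !(lmult_out _ Uz) scaler0 addr0.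
Qed.

Lemma lmultB u v : lm (u - v) = (lm u : amb (Bop UU)) - lm v.
Proof.
have -> : u - v = (-1) *: (v : X -> X) + u by rewrite scaleN1r addrC.
by rewrite lmult_linear scaleN1r addrC.
Qed.

Lemma lmult_comp u v : I u -> I v -> lm u \o lm v = lm (u \o v).
Proof.
move=> Iu Iv; apply/funext => z /=; have [Uz|Uz] := pselect (U z).
  have [Uvz _] := UT_mul_le Iv Uz.
  by rewrite (lmultE _ Uz) (lmultE _ Uvz) (lmultE _ Uz).
rewrite !(lmult_out _ Uz).
exact: (bounded_linear0 sU (bounded_op_linear (lmult_op Iu))).
Qed.

Lemma act_lmult t u : 0 < t -> act_mult (A := UU) act t (lm u) = lm (T t \o u).
Proof.
move=> t0; apply/funext => v; rewrite /act_mult; have [Uv|Uv] := pselect (U v).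
  by rewrite !(lmultE _ Uv) (actI_pos _ _ t0).
by rewrite !(lmult_out _ Uv) (actI_0 sg (ltW t0)).
Qed.

(** Stable under the action because [Xs] is stable under composition with T(t); this is where T(t)
    in B_w(X) enters. *)
Definition functionals : set (amb UU -> R[i]^o) :=
  [set p | exists l x, [/\ Xs l, cX x & p = fun v => l (v x)]].

Lemma functional_le l v x t : dual_ball Xs l -> 0 <= t -> U v -> cX x ->
  cabs (l (act t v x)) <= nU v * expR (lambda * t) * N x.
Proof.
move=> [_ l1] t0 Uv cx; apply: (le_trans (l1 _)).
have b := bounded_op_linear (Arveson_op (actI_Arveson dp sg t0 (UI Uv))).
apply: (le_trans (opnorm_bound sX sX b cx)); apply: ler_wpM2r; first exact: rnorm_ge0.
exact: (LT_grows dp sg rhoL (UT_LT Uv) t0).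
Qed.

(** The norm of [UT] is a supremum over s of rescaled operator norms of T(s) v. For fixed s, x and
    l, the functional u |-> l(T(s) u x) divided by expR (lambda * s) and the norm of x is of the
    same family and is bounded by that norm. *)
Lemma functionals_norming v c : U v -> 0 <= c ->
  (forall p, functionals p -> (forall u, U u -> cabs (p u) <= nU u) -> complex.Re (p v) <= c) ->
  nU v <= c.
Proof.
move=> Uv c0 pv; apply: (nU_le Xs) => s s0.
have Isv := Arveson_op (actI_Arveson dp sg s0 (UI Uv)).
apply: (opnorm_le sX (bounded_op_linear Isv)); first by rewrite mulr_ge0 ?expR_ge0.
move=> x cx; apply: (norm_le_dual dp) => l lb.
have Nx : 0 <= N x := rnorm_ge0 _.
(* For x = 0 the normalizing constant [k] below would vanish. *)
have [x0|x0] := eqVneq (N x) 0.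
  have -> : x = 0 by exact: (rnorm_eq0 x0).
  rewrite (bounded_linear0 sX (bounded_op_linear Isv)) (dual0 dp lb.1).
  by rewrite mulr_ge0 ?rnorm_ge0// mulr_ge0 ?expR_ge0.
have N0 : 0 < N x by rewrite lt_neqAle eq_sym x0.
pose k := expR (lambda * s) * N x; have k0 : 0 < k by rewrite mulr_gt0 ?expR_gt0.
have -> : complex.Re (l (act s v x)) = k * complex.Re ((k^-1)%:C * l (act s v x)).
  by rewrite ReZ mulVKf// gt_eqF.
have cE : c * expR (lambda * s) * N x = k * c by rewrite -mulrA mulrC.
apply: (@le_trans _ _ (k * c)); last by rewrite -cE.
rewrite ler_wpM2l ?(ltW k0)//.
have [l' Xl' lE] : exists2 l', Xs l' & forall u, l (act s u x) = l' (u x).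
  move: s0; rewrite le_eqVlt => /predU1P[<-|s0]; first by exists l; [exact: lb.1|move=> u; rewrite actI0].
  exists (l \o T s); first exact: (semigroup_dual sg s0 lb.1).
  by move=> u; rewrite (actI_pos _ _ s0).
rewrite lE; apply: (pv (fun u => (k^-1)%:C * l' (u x))).
  by exists (fun y => (k^-1)%:C * l' y), x; split => //; exact: (dualZ dp).
move=> u Uu; rewrite cabsM cabs_real gtr0_norm ?invr_gt0// ler_pdivrMl// -lE.
by rewrite /k mulrC mulrA; exact: functional_le.
Qed.

(** A bounded function supported in [a, b] lies in [L1 w], so left multiplication by phi(f), already
    built on X, is the required multiplier. *)
Lemma lmult_integral f a b M : 0 < a -> cmeasurable D f -> (forall t, cabs (f t) <= M) ->
  (forall t, ~~ (a <= t <= b) -> f t = 0) -> exists2 S, [set lm u | u in I] S &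
  forall v p, U v -> functionals p ->
    complex.Re (p (S v)) = \int[mu]_(t in D) complex.Re (f t * p (act t v)).
Proof.
move=> a0 mf fM fab.
have fL : car (n := L1 w) f.
  by apply: (L1_bounded ww (weight_locally_bounded ww) a0 mf (fun t _ => fM t) fab).
exists (lm (phiI Xs T f)); first by exists (phiI Xs T f) => //; exact: (phiI_Arveson dp sg fL).
move=> v _ Uv [l [x [Xl cx ->]]].
have [vX _ _ _] := Arveson_op (UI Uv).
rewrite (lmultE _ Uv) /= (phiIE _ _ (vX _ cx)).
rewrite (phiX_weak_integral dp sg _ fL Xl).
apply: eq_Rintegral => t; rewrite inE halflineE => t0.
by rewrite (actI_pos _ _ t0).
Qed.

Lemma UT_multiplier_semigroup :
  multiplier_semigroup (A := UU) [set lm u | u in I] act lambda functionals.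
Proof.
split.
- exact: sU.
- by move=> v Uv; exact: (LT_separated dp sg rhoL (UT_LT Uv)).
- exact: (complete_UT dp sg rhoL).
- by move=> u v Uu Uv; exact: (UT_mul_mul Uu Uv).
- by move=> a u u' v _ _ _; apply/funext.
- by move=> _ [u Iu <-]; exact: (lmult_Mult Iu).
- have [I0 ILL] := IL; split.
    exists 0; first exact: I0.
    apply/funext => z; have [Uz|Uz] := pselect (U z); last exact: (lmult_out _ Uz).
    by rewrite (lmultE _ Uz).
  move=> a _ _ [u Iu <-] [v Iv <-]; exists (a *: (u : X -> X) + v); first exact: (ILL a u v Iu Iv).
  exact: lmult_linear.
- move=> _ _ [u Iu <-] [v Iv <-]; exists (u \o v); first exact: (Arveson_mul dp sg Iu Iv).
  exact/esym/(lmult_comp Iu Iv).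
- move=> _ _ [u Iu <-] [v Iv <-].
  by rewrite (lmult_comp Iu Iv) (lmult_comp Iv Iu) (Arveson_comm dp sg Iu Iv).
- by move=> t v t0 Uv; exact: (UT_actI dp sg rhoL (ltW t0) Uv).
- by move=> t a x y t0; exact: (actI_linear sg a x y (ltW t0)).
- by move=> t v t0 Uv; have [] := LT_actI dp sg rhoL (ltW t0) (UT_LT Uv).
- by move=> s t v s0 t0; exact: (actI_comp sg v (ltW s0) (ltW t0)).
- by move=> t u v t0 _ _; rewrite !(actI_pos _ _ t0).
- move=> t _ t0 [u Iu <-]; exists (T t \o u); first exact: (Arveson_orbit dp sg t0 Iu).
  exact/esym/(act_lmult u t0).
- by move=> v e Uv e0; exact: (UT_strongly_continuous dp sg rhoL Uv e0).
(* Elements T(a) v are dense in the Arveson ideal, and their orbits are continuous because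
   continuity is tested at time a > 0. *)
- move=> _ e [u Iu <-] e0; have [a [v [a0 Iv uv]]] := Arveson_dense dp sg Iu e0.
  have ITv := Arveson_orbit dp sg a0 Iv.
  exists (lm (T a \o v)); split; first by exists (T a \o v).
    rewrite -lmultB; apply: le_lt_trans uv.
    exact: (lmult_norm (linear_subsetB IL Iu ITv)).
  move=> e' e'0; have [d d0 Hd] := orbit_right_continuous dp sg a0 Iv e'0.
  exists d => // h h0 hd.
  have ha0 : 0 < a + h by rewrite addr_gt0.
  rewrite (act_lmult _ h0) (orbit_comp sg _ h0 a0) [h + a]addrC -lmultB.
  apply: le_trans (Hd h h0 hd).
  exact: (lmult_norm (linear_subsetB IL (Arveson_orbit dp sg ha0 Iv) ITv)).
- by move=> _ a u v [l [x [Xl _ ->]]]; exact: (dual_linear dp Xl).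
- move=> _ [l [x [Xl cx ->]]]; have [C C0 lC] := dual_bounded dp Xl.
  exists (C * N x); first by rewrite mulr_ge0// rnorm_ge0.
  move=> v Uv; apply: (le_trans (lC _)); rewrite -mulrA ler_wpM2l// mulrC.
  apply: (le_trans (opnorm_bound sX sX (bounded_op_linear (Arveson_op (UI Uv))) cx)).
  apply: ler_wpM2r; first exact: rnorm_ge0.
  exact: (nI_le_nU dp sg rhoL (UT_LT Uv)).
- move=> _ a [l [x [Xl cx ->]]]; exists (fun y => a * l y), x.
  by split => //; exact: (dualZ dp a Xl).
- move=> _ t [l [x [Xl cx ->]]] t0; exists (l \o T t), x; split => //.
    exact: (semigroup_dual sg t0 Xl).
  by apply/funext => v; rewrite /= (actI_pos _ _ t0).
- exact: functionals_norming.
- exact: lmult_integral.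
Qed.

End normalized_arveson.

(** The concrete algebra, weight, integrals and limits are convertible to the abstract ones, so the
    abstract theorem applies as it stands. *)
Lemma limJ_genJ {R : realType} (X : completeNormedModType R[i]) (Xs : set (X -> R[i]^o))
    (T : R -> X -> X) (lambda : R) : dual_pairing Xs -> weakly_continuous_semigroup Xs T ->
  (lne (rhoT T)%:E < lambda%:E)%E -> forall g0 g0' u,
  generating (omegaJ Xs T lambda) g0 g0' -> car (n := JT Xs T lambda) u ->
  (genJ_dom Xs T lambda g0 g0' u <->
     exists2 v, car (n := JT Xs T lambda) v & limJ Xs T lambda u v) /\
  (forall v, car (n := JT Xs T lambda) v -> limJ Xs T lambda u v ->
     genJ_val Xs T lambda g0 g0' u = v).
Proof.
move=> dp sg rhoL g0 g0' u gf Ju.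
exact: (generator_mclosure (UT_multiplier_semigroup dp sg rhoL) gf Ju).
Qed.

Theorem proposition8p5 (R : realType) (X : completeNormedModType R[i])
    (Xs : set (X -> R[i]^o)) (T : R -> X -> X) (lambda : R) :
  dual_pairing Xs ->
  weakly_continuous_semigroup Xs T ->
  (lne (rhoT T)%:E < lambda%:E)%E ->
  (forall f0 f0' : R -> R[i], generating (omegaT T) f0 f0' ->
     forall u v,
       car (n := Arveson Xs T) u -> car (n := UT Xs T lambda) v ->
       limI Xs T u v ->
       genI_dom Xs T f0 f0' u /\ genI_val Xs T f0 f0' u = v)
  /\
  (forall g0 g0' : R -> R[i], generating (omegaJ Xs T lambda) g0 g0' ->
     forall u, car (n := JT Xs T lambda) u ->
       (genJ_dom Xs T lambda g0 g0' u <->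
          exists2 v, car (n := JT Xs T lambda) v & limJ Xs T lambda u v)
       /\
       (forall v, car (n := JT Xs T lambda) v -> limJ Xs T lambda u v ->
          genJ_val Xs T lambda g0 g0' u = v)).
Proof.
move=> dp sg rhoL; split.
  by move=> f0 f0' gf u v Iu Uv uv; exact: (limI_genI dp sg gf Iu Uv uv).
by move=> g0 g0' gf u Ju; exact: (limJ_genJ dp sg rhoL gf Ju).
Qed.
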